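(* Suppose that the characteristic of $F$ is different from $2$. (1) The isomorphism classes of smooth irreducible representations of $G_S=SL_2(F)$ over $\overline{\mathbb{F}}_p$ admitting a central character are partitioned into four families: (a) the trivial character; (b) the principal series representations; (c) the special series representation(s), i.e. (the class of) $Sp_S$; (d) the supersingular representations. (2) There is no isomorphism between representations coming from different families.
   Context: $p$ is a prime number, $F$ is a complete non-archimedean local field with residue characteristic $p$ and finite residue field $k_F=\mathcal{O}_F/(\varpi_F)$ of cardinality $q=p^f$, where $\mathcal{O}_F$ is the ring of integers and $\varpi_F$ a fixed uniformizer. $\overline{\mathbb{F}}_p$ is an algebraic closure of $\mathbb{F}_p$ containing $k_F$ (a fixed embedding $k_F\hookrightarrow\overline{\mathbb{F}}_p$). All representations are on $\overline{\mathbb{F}}_p$-vector spaces; a representation is smooth if every vector has open stabilizer; it admits a central character if the centre acts by scalars through a character. Put $G=GL_2(F)$, $K=GL_2(\mathcal{O}_F)$, $Z$ the centre of $G$, $G_S=SL_2(F)$, $K_S=SL_2(\mathcal{O}_F)$, $Z_S=\{\pm I_2\}$ the centre of $G_S$ (so $Z_S\subset K_S$), $B_S$ the subgroup of upper triangular matrices of $G_S$, $\alpha=\begin{pmatrix}1&0\\0&\varpi_F\end{pmatrix}$. Principal series. A smooth character $\eta:F^\times\to\overline{\mathbb{F}}_p^\times$ is viewed as the character $\begin{pmatrix}a&b\\0&a^{-1}\end{pmatrix}\mapsto\eta(a)$ of $B_S$. $Ind_{B_S}^{G_S}(\eta)$ is the space of locally constant $f:G_S\to\overline{\mathbb{F}}_p$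 with $f(bg)=\eta(b)f(g)$ for $b\in B_S$, $g\in G_S$, with $G_S$ acting by right translations. A representation $Ind_{B_S}^{G_S}(\eta)$ which is irreducible is called a principal series representation of $G_S$. The special representation is $Sp_S:=Ind_{B_S}^{G_S}(\mathbf 1)/\mathbf 1$, the quotient of $Ind_{B_S}^{G_S}(\mathbf 1)$ by the constant functions. Supersingular representations. For $\vec r=(r_0,\dots,r_{f-1})\in\{0,\dots,p-1\}^f$ let $V_{\vec r}=\bigotimes_{j}Sym^{r_j}(\overline{\mathbb{F}}_p^2)$, where $Sym^r(\overline{\mathbb{F}}_p^2)=\bigoplus_{i=0}^r\overline{\mathbb{F}}_p x^{r-i}y^i$, and let $\sigma_{\vec r}$ be the representation of $KZ$ on $V_{\vec r}$ in which $\varpi_F I_2$ acts trivially and $\begin{pmatrix}a&b\\c&d\end{pmatrix}\in K$ acts by $\bigotimes_j\sigma_{r_j}\begin{pmatrix}a^{p^j}&b^{p^j}\\c^{p^j}&d^{p^j}\end{pmatrix}$, where $\sigma_r\begin{pmatrix}a&b\\c&d\end{pmatrix}(x^{r-i}y^i)=(ax+cy)^{r-i}(bx+dy)^i$ (entries reduced mod $\varpi_F$). $\text{c-ind}_{KZ}^G(\sigma_{\vec r})$ is the space of locally constant functions $f:G\to V_{\vec r}$, compactly supported modulo $Z$, with $f(kg)=\sigma_{\vec r}(k)f(g)$ for $k\in KZ$, with $G$ acting by right translations; it is spanned by the functions $[g,v]$ ($g\in G$, $v\in V_{\vec r}$) with $[g,v](h)=\sigma_{\vec r}(hg)v$ if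 $hg\in KZ$ and $0$ otherwise. Let $U_{\vec r}=\bigotimes_j U_{r_j}$ where $U_r(y^r)=y^r$ and $U_r(x^{r-i}y^i)=0$ for $i<r$; let $\varphi:G\to End(V_{\vec r})$ be the function supported on $KZ\alpha^{-1}KZ$ with $\varphi(k_1\alpha^{-1}k_2)=\sigma_{\vec r}(k_1)U_{\vec r}\,\sigma_{\vec r}(k_2)$. The Hecke operator $T_{\vec r}$ is the $G$-equivariant endomorphism of $\text{c-ind}_{KZ}^G(\sigma_{\vec r})$ with $T_{\vec r}([g,v])=\sum_{g'\in G/KZ}[gg',\varphi(g'^{-1})v]$. The space $\text{c-ind}_{K_SZ_S}^{G_S}(\sigma_{\vec r})$ (defined in the same way from $\sigma_{\vec r}|_{K_SZ_S}$) is identified with the span of the $[g,v]$, $g\in G_S$; it is stable under $T_{\vec r}^2$, and $\tau_{\vec r}$ denotes the $G_S$-endomorphism of it acting on the functions $[g,v]$ as $T_{\vec r}^2$ does. A representation of $G_S$ is supersingular if it is an irreducible quotient of $\text{c-ind}_{K_SZ_S}^{G_S}(\sigma_{\vec r})/\tau_{\vec r}(\text{c-ind}_{K_SZ_S}^{G_S}(\sigma_{\vec r}))$ for some $\vec r$. *)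

(* Defs.v *)
From HB Require Import structures.
From mathcomp Require Import all_boot all_order all_algebra.
From mathcomp Require Import all_classical.
From mathcomp Require Import topology tvs.

Set Implicit Arguments.
Unset Strict Implicit.
Unset Printing Implicit Defensive.

Import Order.TTheory GRing.Theory Num.Theory.

Local Open Scope classical_set_scope.
Local Open Scope ring_scope.
Local Open Scope quotient_scope.

(* Normalized discrete valuation inducing the uniform structure, with a chosen
   uniformizer.  [valuation 0] is junk; [vge] below encodes v(0) = +oo. *)
HB.mixin Record Uniform_isValued F of GRing.Field F & Uniform F := {
  valuation : F -> int;
  uniformizer : F;
  uniformizer_neq0 : uniformizer != 0;
  valuation_uniformizer : valuation uniformizer = 1;
  valuationM : forall x y : F, x != 0 -> y != 0 ->
    valuation (x * y) = valuation x + valuation y;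
  valuationD : forall x y : F, x != 0 -> y != 0 -> x + y != 0 ->
    Num.min (valuation x) (valuation y) <= valuation (x + y);
  valuation_entourage : @entourage F = filter_from [set: int]
    (fun n => [set xy | (xy.1 - xy.2 == 0) || (n <= valuation (xy.1 - xy.2))])
}.

#[short(type="valuedFieldType")]
HB.structure Definition ValuedField :=
  {F of GRing.Field F & Uniform F & Uniform_isValued F}.

#[short(type="completeValuedFieldType")]
HB.structure Definition CompleteValuedField :=
  {F of ValuedField F & Complete F}.

Section ValuationRing.
Variable F : valuedFieldType.

Definition vge (n : int) (x : F) : bool := (x == 0) || (n <= valuation x).

Lemma vge0 n : vge n 0. Proof. by rewrite /vge eqxx. Qed.

Lemma valuation1 : valuation (1 : F) = 0.
Proof.
have := valuationM _ _ (oner_neq0 F) (oner_neq0 F).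
by rewrite mulr1 => /(congr1 (fun z => z - valuation (1 : F))); rewrite subrr addrK.
Qed.

Lemma valuationN1 : valuation (-1 : F) = 0.
Proof.
have N10 : (-1 : F) != 0 by rewrite oppr_eq0 oner_neq0.
have := valuationM _ _ N10 N10; rewrite mulrNN mulr1 valuation1 => /eqP.
by rewrite -mulr2n eq_sym mulrn_eq0 /= => /eqP.
Qed.

Lemma vgeM m n x y : vge m x -> vge n y -> vge (m + n) (x * y).
Proof.
rewrite /vge mulf_eq0; case: eqVneq => //= x0 mx; case: eqVneq => //= y0 ny.
by rewrite valuationM // lerD.
Qed.

Lemma vgeD n x y : vge n x -> vge n y -> vge n (x + y).
Proof.
have [->|x0] := eqVneq x 0; first by rewrite add0r.
have [->|y0] := eqVneq y 0; first by rewrite addr0.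
rewrite /vge (negPf x0) (negPf y0) /=; case: eqVneq => //= xy0 nx ny.
by apply: le_trans (valuationD _ _ x0 y0 xy0); rewrite le_min nx.
Qed.

Lemma vgeN n x : vge n x -> vge n (- x).
Proof.
have vN1 : vge 0 (-1 : F) by rewrite /vge valuationN1 lexx orbT.
by move=> /(vgeM vN1); rewrite add0r mulN1r.
Qed.

Definition is_integral : {pred F} := vge 0.

Lemma is_integral_subring : subring_closed is_integral.
Proof.
split; first by rewrite /is_integral unfold_in /vge valuation1 lexx orbT.
- by move=> x y xi yi; apply: vgeD => //; exact: vgeN.
- by move=> x y xi yi; have := vgeM xi yi; rewrite addr0.
Qed.

HB.instance Definition _ := GRing.isSubringClosed.Build F is_integral is_integral_subring.

Definition integers := {x : F | x \in is_integral}.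
HB.instance Definition _ := [isSub of integers for @sval _ _].
HB.instance Definition _ := [Choice of integers by <:].
HB.instance Definition _ := [SubChoice_isSubComNzRing of integers by <:].

Lemma uniformizer_integral : (uniformizer : F) \in is_integral.
Proof. by rewrite unfold_in /vge valuation_uniformizer orbT. Qed.

Definition uniformizerO : integers := exist _ uniformizer uniformizer_integral.

Definition uniformizer_ideal : {pred integers} :=
  [pred x | `[< exists y, x = uniformizerO * y >]].

Lemma uniformizer_idealr : idealr_closed uniformizer_ideal.
Proof.
split.
- by apply/asboolP; exists 0; rewrite mulr0.
- apply/asboolP => -[y /(congr1 val)]; rewrite /= => /eqP.
  have [->|y0] := eqVneq (sval y) 0; first by rewrite mulr0 oner_eq0.
  apply/negP/eqP => /(congr1 valuation); rewrite valuation1 valuationM //.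
    have := svalP y; rewrite unfold_in /vge (negPf y0) /= => vy.
    by rewrite valuation_uniformizer => e; move: vy; rewrite -(lerD2l 1) -e.
  exact: uniformizer_neq0.
- move=> a u v /asboolP[u' ->] /asboolP[v' ->]; apply/asboolP.
  by exists (a * u' + v'); rewrite mulrDr mulrCA.
Qed.

HB.instance Definition _ :=
  isIdealr.Build integers uniformizer_ideal uniformizer_idealr.

Definition residue_field := {ideal_quot uniformizer_ideal}.
HB.instance Definition _ := GRing.ComNzRing.on residue_field.

Definition residue (x : F) : residue_field := \pi_residue_field (insubd (0 : integers) x).

End ValuationRing.
Arguments is_integral {F}.

(* Continuity of right translations is all that is needed to let G act by
   right translation on locally constant functions on G. *)
HB.mixin Record hasContinuousRightMul G of Group G & Topological G := {
  mulgr_continuous : forall g : G, continuous (fun h : G => (h * g)%g)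
}.

#[short(type="rightTopGroupType")]
HB.structure Definition RightTopGroup :=
  {G of Group G & Topological G & hasContinuousRightMul G}.

(* GL2 and SL2 carry the topology induced from 'M[F]_2.  For GL2 this is also
   the topology that makes inversion continuous, since inversion is
   continuous on F^x. *)
Definition GL2 (F : fieldType) := {A : 'M[F]_2 | A \in unitmx}.
Definition SL2 (F : fieldType) := {A : 'M[F]_2 | \det A == 1}.

Section MatrixGroups.
Variable F : fieldType.

HB.instance Definition _ := [isSub of GL2 F for @sval _ _].
HB.instance Definition _ := [Choice of GL2 F by <:].
HB.instance Definition _ := [isSub of SL2 F for @sval _ _].
HB.instance Definition _ := [Choice of SL2 F by <:].

Definition MkGL2 (A : 'M[F]_2) (A_unit : A \in unitmx) : GL2 F :=
  exist (fun A => A \in unitmx) A A_unit.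
Definition MkSL2 (A : 'M[F]_2) (A_det1 : \det A == 1) : SL2 F :=
  exist (fun A => \det A == 1) A A_det1.

Fact GL2_one_subproof : (1%:M : 'M[F]_2) \in unitmx. Proof. exact: unitmx1. Qed.
Fact GL2_inv_subproof (A : GL2 F) : invmx (val A) \in unitmx.
Proof. by rewrite unitmx_inv (valP A). Qed.
Fact GL2_mul_subproof (A B : GL2 F) : val A *m val B \in unitmx.
Proof. by rewrite unitmx_mul (valP A) (valP B). Qed.

Definition GL2_one : GL2 F := MkGL2 GL2_one_subproof.
Definition GL2_inv (A : GL2 F) : GL2 F := MkGL2 (GL2_inv_subproof A).
Definition GL2_mul (A B : GL2 F) : GL2 F := MkGL2 (GL2_mul_subproof A B).

Fact GL2_mulA : associative GL2_mul.
Proof. by move=> A B C; apply: val_inj; exact: mulmxA. Qed.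
Fact GL2_mul1 : left_id GL2_one GL2_mul.
Proof. by move=> A; apply: val_inj; exact: mul1mx. Qed.
Fact GL2_1mul : right_id GL2_one GL2_mul.
Proof. by move=> A; apply: val_inj; exact: mulmx1. Qed.
Fact GL2_mulV : left_inverse GL2_one GL2_inv GL2_mul.
Proof. by move=> A; apply: val_inj; exact: mulVmx (valP A). Qed.
Fact GL2_Vmul : right_inverse GL2_one GL2_inv GL2_mul.
Proof. by move=> A; apply: val_inj; exact: mulmxV (valP A). Qed.

HB.instance Definition _ :=
  isGroup.Build (GL2 F) GL2_mulA GL2_mul1 GL2_1mul GL2_mulV GL2_Vmul.

Lemma SL2_unitmx (A : SL2 F) : val A \in unitmx.
Proof. by rewrite unitmxE (eqP (valP A)) unitr1. Qed.

Fact SL2_one_subproof : \det (1%:M : 'M[F]_2) == 1. Proof. by rewrite det1. Qed.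
Fact SL2_inv_subproof (A : SL2 F) : \det (invmx (val A)) == 1.
Proof. by rewrite det_inv (eqP (valP A)) invr1. Qed.
Fact SL2_mul_subproof (A B : SL2 F) : \det (val A *m val B) == 1.
Proof. by rewrite det_mulmx (eqP (valP A)) (eqP (valP B)) mulr1. Qed.

Definition SL2_one : SL2 F := MkSL2 SL2_one_subproof.
Definition SL2_inv (A : SL2 F) : SL2 F := MkSL2 (SL2_inv_subproof A).
Definition SL2_mul (A B : SL2 F) : SL2 F := MkSL2 (SL2_mul_subproof A B).

Fact SL2_mulA : associative SL2_mul.
Proof. by move=> A B C; apply: val_inj; exact: mulmxA. Qed.
Fact SL2_mul1 : left_id SL2_one SL2_mul.
Proof. by move=> A; apply: val_inj; exact: mul1mx. Qed.
Fact SL2_1mul : right_id SL2_one SL2_mul.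
Proof. by move=> A; apply: val_inj; exact: mulmx1. Qed.
Fact SL2_mulV : left_inverse SL2_one SL2_inv SL2_mul.
Proof. by move=> A; apply: val_inj; exact: mulVmx (SL2_unitmx A). Qed.
Fact SL2_Vmul : right_inverse SL2_one SL2_inv SL2_mul.
Proof. by move=> A; apply: val_inj; exact: mulmxV (SL2_unitmx A). Qed.

HB.instance Definition _ :=
  isGroup.Build (SL2 F) SL2_mulA SL2_mul1 SL2_1mul SL2_mulV SL2_Vmul.

Definition SL2_GL2 (A : SL2 F) : GL2 F := MkGL2 (SL2_unitmx A).

End MatrixGroups.

Section MatrixGroupTopology.
Variable F : valuedFieldType.

Lemma nbhs_vgeP (x : F) (U : set F) :
  nbhs x U <-> exists n, forall y, vge n (x - y) -> U y.
Proof.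
rewrite -nbhs_entourageE /nbhs_ /= /filter_from /= valuation_entourage; split.
  move=> [E [n _ nE] EU]; exists n => y xy; apply: EU; apply/xsectionP.
  exact: nE.
move=> [n nU]; exists [set xy : F * F | vge n (xy.1 - xy.2)].
  by exists n => // -[y z].
by move=> y /xsectionP; exact: nU.
Qed.

Lemma addF_continuous (x y : F) (U : set F) : nbhs (x + y) U ->
  exists V W, [/\ nbhs x V, nbhs y W & forall a b, V a -> W b -> U (a + b)].
Proof.
move=> /nbhs_vgeP[n nU].
exists [set a | vge n (x - a)], [set b | vge n (y - b)]; split.
- by apply/nbhs_vgeP; exists n.
- by apply/nbhs_vgeP; exists n.
by move=> a b xa yb; apply: nU; rewrite opprD addrACA; exact: vgeD.
Qed.

Lemma mulFr_continuous (c x : F) : {for x, continuous (fun y : F => y * c)}.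
Proof.
move=> U /nbhs_vgeP[n nU]; apply/nbhs_vgeP.
have [c0|c0] := eqVneq c 0.
  exists 0 => y _ /=; apply: nU.
  by rewrite c0 !mulr0 subrr vge0.
exists (n - valuation c) => y xy /=; apply: nU; rewrite -mulrBl.
have vc : vge (valuation c) c by rewrite /vge lexx orbT.
by have := vgeM xy vc; rewrite subrK.
Qed.

Lemma mulmxr_continuous (B : 'M[F]_2) :
  continuous (fun A : 'M[F]_2 => A *m B).
Proof.
move=> A U [P nP PU].
suff : \forall A' \near A, forall i j, P i j ((A' *m B) i j).
  by apply: filterS => A' /PU.
apply: (@filter_forall _ _ (fun i A' => forall j, P i j ((A' *m B) i j)) (nbhs A)) => i.
apply: (@filter_forall _ _ (fun j A' => P i j ((A' *m B) i j)) (nbhs A)) => j.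
have entry k : {for A, continuous (fun A' : 'M[F]_2 => A' i k * B k j)}.
  move=> V /mulFr_continuous nV.
  exists (fun i' k' => if (i' == i) && (k' == k) then (fun y => V (y * B k j)) else setT).
    move=> i' k'; case: andP => [[/eqP-> /eqP->]|_]; first exact: nV.
    exact: filterT.
  by move=> A' /(_ i k); rewrite !eqxx.
have := nP i j; rewrite !mxE big_ord_recl big_ord1 => nPij.
have [V [W [nV nW VW]]] := addF_continuous nPij.
apply: (@filterS _ (nbhs A) _ _ _ _ (@filterI _ (nbhs A) _ _ _ (entry _ _ nV) (entry _ _ nW))).
move=> A' [VA WA].
by rewrite mxE big_ord_recl big_ord1; apply: VW.
Qed.

HB.instance Definition _ :=
  Topological.copy (GL2 F) (initial_topology (@sval 'M[F]_2 (fun A => A \in unitmx))).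
HB.instance Definition _ :=
  Topological.copy (SL2 F) (initial_topology (@sval 'M[F]_2 (fun A => \det A == 1))).

Lemma GL2_mulgr_continuous (g : GL2 F) : continuous (fun h : GL2 F => (h * g)%g).
Proof.
apply/continuousP => _ [V oV <-].
have /continuousP/(_ _ oV) := mulmxr_continuous (B := val g).
by move=> oV'; exists ((fun A : 'M[F]_2 => A *m val g) @^-1` V).
Qed.

Lemma SL2_mulgr_continuous (g : SL2 F) : continuous (fun h : SL2 F => (h * g)%g).
Proof.
apply/continuousP => _ [V oV <-].
have /continuousP/(_ _ oV) := mulmxr_continuous (B := val g).
by move=> oV'; exists ((fun A : 'M[F]_2 => A *m val g) @^-1` V).
Qed.

HB.instance Definition _ :=
  hasContinuousRightMul.Build (GL2 F) GL2_mulgr_continuous.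
HB.instance Definition _ :=
  hasContinuousRightMul.Build (SL2 F) SL2_mulgr_continuous.

End MatrixGroupTopology.

Record rep (C : fieldType) (G : groupType) := Rep {
  rep_space :> lmodType C;
  rep_act : G -> {linear rep_space -> rep_space};
  rep_act1 : forall x, rep_act 1%g x = x;
  rep_actM : forall g h x, rep_act (g * h)%g x = rep_act g (rep_act h x)
}.

Record rep_hom (C : fieldType) (G : groupType) (pi rho : rep C G) := RepHom {
  rep_hom_fun :> {linear pi -> rho};
  rep_homJ : forall g x, rep_hom_fun (rep_act pi g x) = rep_act rho g (rep_hom_fun x)
}.

Record subrep (C : fieldType) (G : groupType) (pi : rep C G) := Subrep {
  subrep_pred :> {pred pi};
  subrep_closed : submod_closed subrep_pred;
  invariant : forall g x, x \in subrep_pred -> rep_act pi g x \in subrep_pred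
}.

HB.instance Definition _ (C : fieldType) (G : groupType) (pi : rep C G)
    (W : subrep pi) :=
  GRing.isSubmodClosed.Build C pi (subrep_pred W)
    (GRing.submod_closed_semi (subrep_closed W)).

Section RepresentationTheory.
Variables (C : fieldType) (G : groupType).
Implicit Types pi rho : rep C G.

Definition rep_iso pi rho := exists phi : rep_hom pi rho, bijective phi.

Definition irreducible pi :=
  (exists x : pi, x != 0) /\
  forall W : subrep pi, (forall x : pi, x \in W -> x = 0) \/ (forall x : pi, x \in W).

Definition is_quotient pi rho :=
  exists phi : rep_hom rho pi, forall y, exists x, phi x = y.

Definition centre : set G := [set z | forall g, commute z g].

Definition has_central_character pi := exists chi : G -> C,
  [/\ forall z, centre z -> chi z != 0,
      forall z t, centre z -> centre t -> chi (z * t)%g = chi z * chi t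
    & forall z x, centre z -> rep_act pi z x = chi z *: x].

Definition trivial_rep : rep C G :=
  @Rep C G C^o (fun=> idfun) (fun=> erefl) (fun _ _ _ => erefl).

Section Sub.
Variables (pi : rep C G) (W : subrep pi).

Definition sub_space := {x : pi | x \in W}.
HB.instance Definition _ := [isSub of sub_space for @sval _ _].
HB.instance Definition _ := [Choice of sub_space by <:].
HB.instance Definition _ := [SubChoice_isSubLmodule of sub_space by <:].

Lemma sub_val_linear : linear (val : sub_space -> pi).
Proof. by []. Qed.

Definition sub_act (g : G) (x : sub_space) : sub_space :=
  exist (fun x => x \in W) (rep_act pi g (val x)) (invariant g (valP x)).

Fact sub_act_linear g : linear (sub_act g).
Proof. by move=> a x y; apply: val_inj; rewrite /= linearP. Qed.
HB.instance Definition _ g := GRing.isLinear.Build C sub_space sub_space _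
  (sub_act g) (sub_act_linear g).

Fact sub_act1 x : sub_act 1%g x = x.
Proof. by apply: val_inj; exact: rep_act1. Qed.
Fact sub_actM g h x : sub_act (g * h)%g x = sub_act g (sub_act h x).
Proof. by apply: val_inj; exact: rep_actM. Qed.

Definition sub_rep : rep C G :=
  @Rep C G sub_space (fun g => sub_act g) sub_act1 sub_actM.

End Sub.

Section Quotient.
Variables (pi : rep C G) (W : subrep pi).

Definition quot_space := Quotient.quot (subrep_pred W).
HB.instance Definition _ := GRing.Zmodule.on quot_space.

Lemma quot_eqP (x y : pi) :
  reflect (\pi_quot_space x = \pi_quot_space y) (x - y \in W).
Proof. by rewrite Quotient.idealrBE; exact: eqP. Qed.

Lemma quot_spaceW (P : quot_space -> Prop) :
  (forall x, P (\pi_quot_space x)) -> forall u, P u.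
Proof. by move=> Ppi u; rewrite -[u]reprK. Qed.

Definition quot_scale (a : C) (u : quot_space) : quot_space :=
  \pi_quot_space (a *: repr u).

Lemma pi_quot_scale a x :
  quot_scale a (\pi_quot_space x) = \pi_quot_space (a *: x).
Proof.
by apply/quot_eqP; rewrite -scalerBr; apply/rpredZ/quot_eqP; rewrite reprK.
Qed.

Fact quot_scaleA a b u : quot_scale a (quot_scale b u) = quot_scale (a * b) u.
Proof. by elim/quot_spaceW: u => x; rewrite !pi_quot_scale scalerA. Qed.
Fact quot_scale1 u : quot_scale 1 u = u.
Proof. by elim/quot_spaceW: u => x; rewrite pi_quot_scale scale1r. Qed.
Fact quot_scaleDr : right_distributive quot_scale +%R.
Proof.
move=> a; elim/quot_spaceW => x; elim/quot_spaceW => y.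
by rewrite -raddfD !pi_quot_scale -raddfD scalerDr.
Qed.
Fact quot_scaleDl u : {morph quot_scale^~ u : a b / a + b}.
Proof. by move=> a b; elim/quot_spaceW: u => x; rewrite !pi_quot_scale -raddfD scalerDl. Qed.

HB.instance Definition _ := GRing.Zmodule_isLmodule.Build C quot_space
  quot_scaleA quot_scale1 quot_scaleDr quot_scaleDl.

Definition quot_act (g : G) (u : quot_space) : quot_space :=
  \pi_quot_space (rep_act pi g (repr u)).

Lemma pi_quot_act g x : quot_act g (\pi_quot_space x) = \pi_quot_space (rep_act pi g x).
Proof.
by apply/quot_eqP; rewrite -linearB; apply/invariant/quot_eqP; rewrite reprK.
Qed.

Fact quot_act_linear g : linear (quot_act g).
Proof.
move=> a; elim/quot_spaceW => x; elim/quot_spaceW => y.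
rewrite [a *: _]pi_quot_scale -raddfD !pi_quot_act [a *: _]pi_quot_scale.
by rewrite -raddfD linearP.
Qed.
HB.instance Definition _ g := GRing.isLinear.Build C quot_space quot_space _
  (quot_act g) (quot_act_linear g).

Fact quot_act1 u : quot_act 1%g u = u.
Proof. by elim/quot_spaceW: u => x; rewrite pi_quot_act rep_act1. Qed.
Fact quot_actM g h u : quot_act (g * h)%g u = quot_act g (quot_act h u).
Proof. by elim/quot_spaceW: u => x; rewrite !pi_quot_act rep_actM. Qed.

Definition quot_rep : rep C G :=
  @Rep C G quot_space (fun g => quot_act g) quot_act1 quot_actM.

End Quotient.

Section Image.
Variables (pi rho : rep C G) (phi : rep_hom pi rho).

Definition rep_image : {pred rho} := [pred y | `[< exists x, y = phi x >]].

Fact rep_image_submod : submod_closed rep_image.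
Proof.
split; first by apply/asboolP; exists 0; rewrite linear0.
move=> a _ _ /asboolP[x ->] /asboolP[y ->]; apply/asboolP.
by exists (a *: x + y); rewrite linearP.
Qed.
Fact rep_image_invariant g y : y \in rep_image -> rep_act rho g y \in rep_image.
Proof.
move=> /asboolP[x ->]; apply/asboolP; exists (rep_act pi g x); by rewrite rep_homJ.
Qed.
Definition image_subrep : subrep rho := Subrep rep_image_submod rep_image_invariant.

End Image.

End RepresentationTheory.

Section FunctionRep.
Variables (C : fieldType) (G : groupType) (V : lmodType C).

Definition fun_act (g : G) (f : G -> V) : G -> V := fun h => f (h * g)%g.

Fact fun_act_linear g : linear (fun_act g). Proof. by []. Qed.
HB.instance Definition _ g := GRing.isLinear.Build C (G -> V) (G -> V) _
  (fun_act g) (fun_act_linear g).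

Fact fun_act1 f : fun_act 1%g f = f.
Proof. by apply/funext => h; rewrite /fun_act mulg1. Qed.
Fact fun_actM g h f : fun_act (g * h)%g f = fun_act g (fun_act h f).
Proof. by apply/funext => k; rewrite /fun_act mulgA. Qed.

Definition fun_rep : rep C G :=
  @Rep C G (G -> V) (fun g => fun_act g) fun_act1 fun_actM.

End FunctionRep.

Definition locally_constant (X : topologicalType) (Y : Type) (f : X -> Y) :=
  forall x, \forall y \near x, f y = f x.

Section Induction.
Variables (C : fieldType) (G : rightTopGroupType) (V : lmodType C).
Variables (H : set G) (sigma : G -> {linear V -> V}).

Definition smooth (pi : rep C G) :=
  forall x : pi, open [set g | rep_act pi g x = x].

Definition equivariant (f : G -> V) :=
  forall h g, H h -> f (h * g)%g = sigma h (f g).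

(* The support of f has compact image modulo the centre: it is contained in
   Z Q for some compact Q. *)
Definition compact_mod_centre (f : G -> V) := exists2 Q : set G, compact Q &
  forall g, f g != 0 -> [set (z * q)%g | z in @centre G & q in Q] g.

Definition Ind_pred : {pred fun_rep G V} :=
  [pred f | `[< locally_constant f /\ equivariant f >]].

Definition cInd_pred : {pred fun_rep G V} :=
  [pred f | `[< [/\ locally_constant f, equivariant f & compact_mod_centre f] >]].

Lemma locally_constant_submod (a : C) (f1 f2 : G -> V) :
  locally_constant f1 -> locally_constant f2 -> locally_constant (a *: f1 + f2).
Proof.
move=> l1 l2 x; apply: filterS2 (l1 x) (l2 x) => y e1 e2.
by rewrite /= !fctE e1 e2.
Qed.

Lemma locally_constant_act g (f : G -> V) :
  locally_constant f -> locally_constant (fun_act g f).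
Proof. by move=> l x; exact: mulgr_continuous g x _ (l _). Qed.

Lemma equivariant_submod (a : C) (f1 f2 : G -> V) :
  equivariant f1 -> equivariant f2 -> equivariant (a *: f1 + f2).
Proof. by move=> e1 e2 h g Hh; rewrite !fctE e1 // e2 // linearP. Qed.

Lemma equivariant_act g (f : G -> V) :
  equivariant f -> equivariant (fun_act g f).
Proof. by move=> e h k Hh; rewrite /fun_act -mulgA e. Qed.

Lemma compact_mod_centre_submod (a : C) (f1 f2 : G -> V) :
  compact_mod_centre f1 -> compact_mod_centre f2 ->
  compact_mod_centre (a *: f1 + f2).
Proof.
move=> [Q1 cQ1 s1] [Q2 cQ2 s2]; exists (Q1 `|` Q2); first exact: compactU.
move=> g; rewrite !fctE.
have [->|f1g _] := eqVneq (f1 g) 0.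
  by rewrite scaler0 add0r => /s2[z Zz [q Qq <-]]; exists z => //; exists q => //; right.
by have [z Zz [q Qq <-]] := s1 _ f1g; exists z => //; exists q => //; left.
Qed.

Lemma compact_mod_centre_act g (f : G -> V) :
  compact_mod_centre f -> compact_mod_centre (fun_act g f).
Proof.
move=> [Q cQ s]; exists ((fun q => (q * g^-1)%g) @` Q).
  apply: continuous_compact => //; apply: continuous_subspaceT.
  exact: mulgr_continuous.
move=> h /s[z Zz [q Qq e]]; exists z => //; exists (q * g^-1)%g; first by exists q.
by rewrite mulgA e mulgK.
Qed.

Fact Ind_submod : submod_closed Ind_pred.
Proof.
split.
  apply/asboolP; split; first by move=> x; exact: nearW.
  by move=> h g _; rewrite linear0.
move=> a f1 f2 /asboolP[l1 e1] /asboolP[l2 e2]; apply/asboolP; split.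
  exact: locally_constant_submod.
exact: equivariant_submod.
Qed.

Fact Ind_invariant g f : f \in Ind_pred -> rep_act (fun_rep G V) g f \in Ind_pred.
Proof.
move=> /asboolP[l e]; apply/asboolP; split; first exact: locally_constant_act.
exact: equivariant_act.
Qed.

Definition Ind : rep C G := sub_rep (Subrep Ind_submod Ind_invariant).

Fact cInd_submod : submod_closed cInd_pred.
Proof.
split.
  apply/asboolP; split; first by move=> x; exact: nearW.
    by move=> h g _; rewrite linear0.
  by exists set0; [exact: compact0 | move=> g; rewrite eqxx].
move=> a f1 f2 /asboolP[l1 e1 c1] /asboolP[l2 e2 c2]; apply/asboolP; split.
- exact: locally_constant_submod.
- exact: equivariant_submod.
- exact: compact_mod_centre_submod.
Qed.

Fact cInd_invariant g f :
  f \in cInd_pred -> rep_act (fun_rep G V) g f \in cInd_pred.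
Proof.
move=> /asboolP[l e c]; apply/asboolP; split.
- exact: locally_constant_act.
- exact: equivariant_act.
- exact: compact_mod_centre_act.
Qed.

Definition cInd : rep C G := sub_rep (Subrep cInd_submod cInd_invariant).

(* The function [g, v] of a compact induction. *)
Definition bracket (g : G) (v : V) : G -> V :=
  fun h => if `[< H (h * g)%g >] then sigma (h * g)%g v else 0.

End Induction.

Section PrincipalSeries.
Variables (F : valuedFieldType) (C : fieldType).

(* Characters of F^x are functions on F whose value at 0 is never used. *)
Definition smooth_character (eta : F -> C) :=
  [/\ forall x, x != 0 -> eta x != 0,
      forall x y, x != 0 -> y != 0 -> eta (x * y) = eta x * eta y
    & open [set x | x != 0 /\ eta x = 1]].

Definition borel : set (SL2 F) := [set b : SL2 F | val b ord_max ord0 = 0].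

Definition borel_character (eta : F -> C) (b : SL2 F) : {linear C^o -> C^o} :=
  *:%R (eta (val b ord0 ord0)).

Definition Ind_B (eta : F -> C) : rep C (SL2 F) :=
  Ind borel (borel_character eta).

Definition principal_series (pi : rep C (SL2 F)) := exists eta : F -> C,
  [/\ smooth_character eta, irreducible (Ind_B eta) & rep_iso pi (Ind_B eta)].

Definition Ind_1 : rep C (SL2 F) := Ind_B (fun=> 1).

Definition constants : {pred Ind_1} :=
  [pred f | `[< exists c : C, forall g, val f g = c >]].

Fact constants_submod : submod_closed constants.
Proof.
split; first by apply/asboolP; exists 0.
move=> a f1 f2 /asboolP[c1 e1] /asboolP[c2 e2]; apply/asboolP.
exists (a * c1 + c2) => g; rewrite -(e1 g) -(e2 g).
exact: (congr1 (fun f : SL2 F -> C^o => f g) (sub_val_linear a f1 f2)).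
Qed.

Fact constants_invariant g f : f \in constants -> rep_act Ind_1 g f \in constants.
Proof. by move=> /asboolP[c e]; apply/asboolP; exists c => h; exact: e. Qed.

Definition special_series : rep C (SL2 F) :=
  quot_rep (Subrep constants_submod constants_invariant).

End PrincipalSeries.

Section Supersingular.
Variables (F : valuedFieldType) (C : fieldType).
Variable iota : {rmorphism residue_field F -> C}.
Variables p f : nat.

(* GL_2(O_F): integral entries and determinant a unit of O_F. *)
Definition K_G : set (GL2 F) := [set k : GL2 F |
  (forall i j, val k i j \in is_integral) /\ valuation (\det (val k)) = 0].

Definition KZ : set (GL2 F) := [set (k * z)%g | k in K_G & z in @centre (GL2 F)].

Definition K_S : set (SL2 F) := [set k : SL2 F | forall i j, val k i j \in is_integral].

Definition KZ_S : set (SL2 F) := [set (k * z)%g | k in K_S & z in @centre (SL2 F)].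

Definition alpha_mx : 'M[F]_2 :=
  diag_mx (\row_j if j == ord0 then 1 else uniformizer).

Fact alpha_unit : alpha_mx \in unitmx.
Proof.
rewrite unitmxE det_diag big_ord_recl big_ord1 !mxE /= mul1r unitfE.
exact: uniformizer_neq0.
Qed.

Definition alpha : GL2 F := MkGL2 alpha_unit.

(* Matrix of sigma_d [[a, b], [c, d']] on Sym^d in the basis x^(d-i) y^i,
   dehomogenized by x := 1, y := 'X: column i holds the coefficients of
   (a x + c y)^(d-i) (b x + d' y)^i. *)
Definition sym_mx (d : nat) (A : 'M[C]_2) : 'M[C]_d.+1 := \matrix_(k, i)
  (((A ord0 ord0)%:P + A ord_max ord0 *: 'X) ^+ (d - i) *
   ((A ord0 ord_max)%:P + A ord_max ord_max *: 'X) ^+ i)`_k.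

Section Weight.
Variable r : 'I_f -> 'I_p.

(* The tensor product of the Sym^(r_j) is given by coordinates in the basis
   indexed by families k, k_j standing for x^(r_j - k_j) y^(k_j); [tensor_op M]
   is then the tensor product of the operators with matrices M j. *)
Local Notation weight_index := {dffun forall j : 'I_f, 'I_(r j).+1}.

Definition weight := {ffun weight_index -> C^o}.

Definition tensor_op (M : forall j : 'I_f, 'M[C]_((r j).+1)) (v : weight) : weight :=
  [ffun k : weight_index => \sum_(i : weight_index) (\prod_j M j (k j) (i j)) * v i].

Fact tensor_op_linear M : linear (tensor_op M).
Proof.
move=> a u v; apply/ffunP => k; rewrite !ffunE scaler_sumr -big_split /=.
by apply: eq_bigr => i _; rewrite !ffunE mulrDr; congr (_ + _); exact: mulrCA.
Qed.
HB.instance Definition _ M := GRing.isLinear.Build C weight weight _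
  (tensor_op M) (tensor_op_linear M).

(* An element g = varpi^n k of KZ, k in K, has valuation (det g) = 2 n, so the
   matrix below is the reduction of k: varpi acts trivially.  Only the values
   on KZ matter. *)
Definition reduce_mx (g : GL2 F) : 'M[C]_2 := \matrix_(i, j)
  iota (residue (uniformizer ^ (- (valuation (\det (val g)) %/ 2)%Z) * val g i j)).

Definition sigma (g : GL2 F) : {linear weight -> weight} :=
  tensor_op (fun j => sym_mx (r j) (map_mx (fun a => a ^+ (p ^ j)) (reduce_mx g))).

Definition sigma_S (g : SL2 F) : {linear weight -> weight} := sigma (SL2_GL2 g).

Definition U_op : {linear weight -> weight} :=
  tensor_op (fun j => delta_mx ord_max ord_max).

Definition cInd_G : rep C (GL2 F) := cInd KZ sigma.
Definition cInd_S : rep C (SL2 F) := cInd KZ_S sigma_S.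

Definition KZalphaKZ : set (GL2 F) :=
  [set (k1 * alpha^-1 * k2)%g | k1 in KZ & k2 in KZ].

Definition is_hecke_function (phi : GL2 F -> {linear weight -> weight}) :=
  (forall k1 k2 v, KZ k1 -> KZ k2 ->
     phi (k1 * alpha^-1 * k2)%g v = sigma k1 (U_op (sigma k2 v))) /\
  (forall g v, ~ KZalphaKZ g -> phi g v = 0).

Definition GmodKZ : set (set (GL2 F)) :=
  [set X | exists g, X = [set (g * k)%g | k in KZ]].

(* The summand below does not depend on the representative of the coset. *)
Definition coset_repr (X : set (GL2 F)) : GL2 F := xget 1%g X.

(* phi and T are characterized, hence unique: the [g, v] all lie in the compact
   induction and span it.  The sum is over finitely many nonzero terms, as phi
   is supported on finitely many cosets. *)
Definition is_hecke_operator (T : rep_hom cInd_G cInd_G) :=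
  exists2 phi, is_hecke_function phi &
    forall g v (x : cInd_G), val x = bracket KZ sigma g v ->
      val (T x) = \sum_(X \in GmodKZ)
        bracket KZ sigma (g * coset_repr X)%g (phi (coset_repr X)^-1%g v).

(* [emb] identifies c-ind for G_S with the span of the [g, v], g in G_S, inside
   c-ind for G; under it tau is T^2. *)
Definition is_tau (T : rep_hom cInd_G cInd_G) (tau : rep_hom cInd_S cInd_S) :=
  exists2 emb : {linear cInd_S -> cInd_G},
    injective emb /\
    (forall g v (x : cInd_S), val x = bracket KZ_S sigma_S g v ->
       val (emb x) = bracket KZ sigma (SL2_GL2 g) v)
  & forall x, emb (tau x) = T (T (emb x)).

End Weight.

Definition supersingular (pi : rep C (SL2 F)) :=
  irreducible pi /\
  exists (r : 'I_f -> 'I_p) (T : rep_hom (cInd_G r) (cInd_G r))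
         (tau : rep_hom (cInd_S r) (cInd_S r)),
    [/\ is_hecke_operator T, is_tau T tau
      & is_quotient pi (quot_rep (image_subrep tau))].

End Supersingular.

Inductive rep_family :=
  TrivialFamily | PrincipalFamily | SpecialFamily | SupersingularFamily.

Definition in_family (F : valuedFieldType) (C : fieldType)
    (iota : {rmorphism residue_field F -> C}) (p f : nat) (c : rep_family)
    (pi : rep C (SL2 F)) : Prop :=
  match c with
  | TrivialFamily => rep_iso pi (trivial_rep C (SL2 F))
  | PrincipalFamily => principal_series pi
  | SpecialFamily => rep_iso pi (special_series F C)
  | SupersingularFamily => supersingular iota p f pi
  end.

Definition is_Fp_closure (p : nat) (C : closedFieldType) :=
  exists h : {rmorphism 'F_p -> C}, forall x, algebraicOver h x.

(* Main.v *)
(** Every nonzero smooth representation [pi] in characteristic p has nonzero vectors fixed by the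
    pro-p Iwahori subgroup I1.  On these act two operators S0 and S1, the sums of the translates
    under [u (lam i) * w] and under their conjugates by [[0, 1], [varpi, 0]], and A = S0 S1.
    An A-eigenvector [v] with nonzero eigenvalue gives a nonzero map from some Ind_B(eta) to [pi]
    (the graph of [fw |-> v] is a functional subrepresentation of Ind_B(eta) x [pi]), so an
    irreducible [pi] is then a principal series or the special representation.

    To find an eigenvector, one shows that [pi] receives a nonzero map from c-ind(sigma_r), r <> 0,
    or contains a nonzero vector fixed by K.  The map sends the generator [e0] to [v].  It is not
    injective, because tau is not surjective: comparing supports along the tree, [e0] is not in its
    image.  The I1-invariants of c-ind(sigma_r) are spanned by the A^n e0 and the S1 A^n e0, so an
    I1-invariant vector of the kernel yields R(A) v = 0 with R <> 0.  Either A has an eigenvector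
    with nonzero eigenvalue or A is nilpotent on [v]; since tau e0 = A e0, in the second case
    [pi] is supersingular.  K-fixed vectors lead to the trivial representation, to the weight
    r = (p-1, ..., p-1), or to tau for r = 0, where tau e0 = A e0 + e0 + S1 e0.

    The families are told apart by the values of S0 and S1 on I1-invariants, and a supersingular
    representation exists because a maximal subrepresentation containing the image of tau but not
    [e0] exists by Zorn's lemma. *)
Require Import Defs.
From HB Require Import structures.
From mathcomp Require Import all_boot all_order all_algebra.
From mathcomp Require Import ring zify.
From mathcomp Require Import cyclic.
From mathcomp Require Import all_classical.
From mathcomp Require Import topology tvs.

Set Implicit Arguments.
Unset Strict Implicit.
Unset Printing Implicit Defensive.

Import Order.TTheory GRing.Theory Num.Theory.

Local Open Scope classical_set_scope.
Local Open Scope ring_scope.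
Local Open Scope quotient_scope.

(** * Linear algebra and representations *)

(** Nothing bounds the I1-invariants of an irreducible [pi], so A is not known to act on a
    finite-dimensional space. This is why a polynomial killing [v] has to be extracted from the
    kernel of a map out of c-ind(sigma_r). I1-fixed vectors exist because the successive quotients
    of the congruence subgroups are abelian of exponent p, and such groups act by commuting
    unipotent operators in characteristic p. Weights are found without classifying the irreducible
    representations of SL2 of the residue field. On the K-span of a vector fixed by the first
    congruence subgroup one takes a functional [l], invariant under integral unipotents and an
    eigenvector of the torus. If l(v) = 0 for an I1-eigenvector [v], the function k -> l(k v) is a
    multiple of a power of the lower left entry of k, which is also a coefficient of a weight with r
    <> 0. The case where this fails produces the K-fixed vectors. SL2 preserves the type of the
    vertices of the tree, so A moves by two steps: digits come in pairs and T enters through its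
    square. Both kinds of maps, out of Ind_B(eta) and out of compact inductions, rest on one device:
    a relation between translates is cut along disjoint supports. *)

Section Subspaces.
Variables (C : fieldType) (V : lmodType C).

(** Subspaces are Prop-valued since those that occur are kernels, fixed vectors, eigenspaces and
    graphs; [prop_subrep] turns a stable one into a [subrep]. *)
Definition subsp (P : V -> Prop) :=
  P 0 /\ forall (a : C) x y, P x -> P y -> P (a *: x + y).

Variables (P : V -> Prop) (sP : subsp P).

Lemma subspD x y : P x -> P y -> P (x + y).
Proof. by move=> Px Py; rewrite -[x]scale1r; exact: sP.2. Qed.

Lemma subspZ a x : P x -> P (a *: x).
Proof. by move=> Px; rewrite -[a *: x]addr0; apply: sP.2 => //; exact: sP.1. Qed.

Lemma subspB x y : P x -> P y -> P (x - y).
Proof. by move=> Px Py; rewrite -scaleN1r; apply: subspD => //; exact: subspZ. Qed.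

Lemma subsp_sum (I : Type) (s : seq I) (Q : pred I) (F : I -> V) :
  (forall i, Q i -> P (F i)) -> P (\sum_(i <- s | Q i) F i).
Proof. by move=> PF; apply: big_ind => //; [exact: sP.1 | exact: subspD]. Qed.

End Subspaces.

(** * Polynomials in one operator and their eigenvectors *)

Section LinearIterate.
Variables (C : fieldType) (V : lmodType C) (L : {linear V -> V}).
Implicit Types (P Q : {poly C}) (x y : V).

Fact iter_is_linear n : linear (iter n L).
Proof.
by elim: n => [|n IHn] a x y //=; rewrite IHn linearP.
Qed.

Lemma iterlB n x y : iter n L (x - y) = iter n L x - iter n L y.
Proof. by rewrite -scaleN1r addrC iter_is_linear scaleN1r addrC. Qed.

Lemma iterl0 n : iter n L 0 = 0.
Proof. by elim: n => //= n ->; rewrite linear0. Qed.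

Lemma iterlZ n a x : iter n L (a *: x) = a *: iter n L x.
Proof. by rewrite -[a *: x]addr0 iter_is_linear iterl0 addr0. Qed.

(** This is P(L) x. The space may be infinite-dimensional, so the operator is never turned into a
    matrix. *)
Definition peval P x : V := \sum_(i < size P) P`_i *: iter i L x.

Lemma peval_widen n P x : (size P <= n)%N ->
  peval P x = \sum_(i < n) P`_i *: iter i L x.
Proof.
move=> le_n; rewrite /peval (big_ord_widen n (fun i => P`_i *: iter i L x)) //.
rewrite big_mkcond; apply: eq_bigr => i _; case: ltnP => // /(nth_default 0) ->.
by rewrite scale0r.
Qed.

Lemma pevalP a P Q x : peval (a *: P + Q) x = a *: peval P x + peval Q x.
Proof.
pose n := maxn (size (a *: P + Q)) (maxn (size P) (size Q)).
rewrite !(@peval_widen n) ?leq_max ?leqnn ?orbT //.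
rewrite scaler_sumr -big_split; apply: eq_bigr => i _ /=.
by rewrite coefD coefZ scalerDl scalerA.
Qed.

Lemma peval0 x : peval 0 x = 0.
Proof. by rewrite /peval size_poly0 big_ord0. Qed.

Lemma pevalZ a P x : peval (a *: P) x = a *: peval P x.
Proof. by rewrite -[a *: P]addr0 pevalP peval0 addr0. Qed.

Lemma pevalD P Q x : peval (P + Q) x = peval P x + peval Q x.
Proof. by rewrite -[P]scale1r pevalP !scale1r. Qed.

Lemma pevalB P Q x : peval (P - Q) x = peval P x - peval Q x.
Proof. by rewrite pevalD -(scaleN1r Q) pevalZ scaleN1r. Qed.

Lemma pevalMX P x : peval (P * 'X) x = peval P (L x).
Proof.
rewrite (@peval_widen (size P).+1); last first.
  by apply: (leq_trans (size_polyMleq _ _)); rewrite size_polyX addn2.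
rewrite big_ord_recl coefMX /= scale0r add0r; apply: eq_bigr => i _.
by rewrite coefMX /= -iterS iterSr.
Qed.

Lemma pevalC c x : peval c%:P x = c *: x.
Proof.
rewrite (@peval_widen 1) ?size_polyC ?leq_b1 //.
by rewrite big_ord_recl big_ord0 coefC addr0.
Qed.

Lemma peval_is_linear P : linear (peval P).
Proof.
move=> a x y; rewrite /peval scaler_sumr -big_split; apply: eq_bigr => i _ /=.
by rewrite iter_is_linear scalerDr !scalerA [_ * a]mulrC.
Qed.

Lemma pevall0 P : peval P 0 = 0.
Proof. by rewrite /peval big1 // => i _; rewrite iterl0 scaler0. Qed.

Lemma pevallB P x y : peval P (x - y) = peval P x - peval P y.
Proof. by rewrite -scaleN1r addrC peval_is_linear scaleN1r addrC. Qed.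

Lemma pevallZ P a x : peval P (a *: x) = a *: peval P x.
Proof. by rewrite -[a *: x]addr0 peval_is_linear pevall0 addr0. Qed.

Lemma peval_comm P x : peval P (L x) = L (peval P x).
Proof.
rewrite /peval linear_sum; apply: eq_bigr => i _.
by rewrite linearZ /= -iterSr.
Qed.

Lemma pevalMXsubC P c x : peval (P * ('X - c%:P)) x = peval P (L x - c *: x).
Proof.
by rewrite mulrBr [P * c%:P]mulrC mul_polyC pevalB pevalMX pevalZ pevallB pevallZ.
Qed.

Lemma pevalXn n x : peval 'X^n x = iter n L x.
Proof.
elim: n x => [|n IHn] x; first by rewrite expr0 pevalC scale1r.
by rewrite exprSr pevalMX IHn iterSr.
Qed.

Lemma peval_prod_XsubC (s : seq C) c x :
  peval (\prod_(z <- c :: s) ('X - z%:P)) x =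
  peval (\prod_(z <- s) ('X - z%:P)) (L x - c *: x).
Proof. by rewrite big_cons mulrC pevalMXsubC. Qed.

Variables (Good : V -> Prop) (sGood : subsp Good).
Hypothesis GoodL : forall x, Good x -> Good (L x).

Lemma Good_peval P x : Good x -> Good (peval P x).
Proof.
move=> Gx; apply: (subsp_sum sGood) => i _; apply: (subspZ sGood).
by elim: (nat_of_ord i) => //= n; exact: GoodL.
Qed.

(** The linear factors are peeled off one at a time: as soon as [L - c] sends the current nonzero
    vector to 0, that vector is an eigenvector. *)
Lemma exists_eigenvector (s : seq C) x : Good x -> x != 0 ->
  peval (\prod_(z <- s) ('X - z%:P)) x = 0 ->
  exists c y, [/\ c \in s, Good y, y != 0 & L y = c *: y].
Proof.
elim: s x => [|c s IHs] x Gx x0.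
  by rewrite big_nil pevalC scale1r => e; rewrite e eqxx in x0.
rewrite peval_prod_XsubC; have [/eqP|y0] := eqVneq (L x - c *: x) 0.
  rewrite subr_eq0 => /eqP e _.
  by exists c, x; split=> //; rewrite mem_head.
have Gy : Good (L x - c *: x).
  by apply: (subspB sGood); [exact: GoodL | exact: subspZ].
move=> /(IHs _ Gy y0)[d [z [ds Gz z0 Lz]]].
by exists d, z; split=> //; rewrite inE ds orbT.
Qed.

(** Induction on the roots, applied to [L x - c *: x]. If L^k kills that vector, then L^k x is an
    eigenvector for [c] or zero; a root c = 0 only lengthens the nilpotency by one. *)
Lemma eigenvector_or_nilpotent (s : seq C) x : Good x ->
  peval (\prod_(z <- s) ('X - z%:P)) x = 0 ->
  (exists c y, [/\ c != 0, Good y, y != 0 & L y = c *: y]) \/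
  (exists k, iter k L x = 0).
Proof.
elim: s x => [|c s IHs] x Gx.
  by rewrite big_nil pevalC scale1r => e; right; exists 0.
rewrite peval_prod_XsubC => /IHs[|[c' [y Py]]|[k]].
- by apply: (subspB sGood); [exact: GoodL | exact: subspZ].
- by left; exists c', y.
rewrite iterlB iterlZ => /eqP; rewrite subr_eq0 => /eqP e.
have [c0|c0] := eqVneq c 0.
  by right; exists k.+1; rewrite iterSr e c0 scale0r.
have [e0|y0] := eqVneq (iter k L x) 0; first by right; exists k.
left; exists c, (iter k L x); split=> //; last by rewrite -iterS iterSr.
by elim: k {e y0} => //= k; exact: GoodL.
Qed.

(** In characteristic p one has (L - 1)^p = L^p - 1 = 0, so 1 is the only possible eigenvalue. *)
Lemma unipotent_fixed p x : p \in [pchar C] -> Good x -> x != 0 ->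
  (forall y, Good y -> iter p L y = y) ->
  exists y, [/\ Good y, y != 0 & L y = y].
Proof.
move=> pC Gx x0 Lp.
have [] := @exists_eigenvector (nseq p 1) x Gx x0; last first.
  move=> c [y [+ Gy y0 Ly]]; rewrite mem_nseq => /andP[_ /eqP c1].
  by exists y; split=> //; rewrite Ly c1 scale1r.
rewrite big_nseq -Monoid.iteropE -/(_ ^+ p).
have -> : ('X - 1%:P) ^+ p = 'X^p - 1 :> {poly C}.
  have pCX : p \in [pchar {poly C}] by rewrite (rmorph_pchar (@polyC C)).
  have := pFrobenius_autB_comm pCX (commr1 'X).
  by rewrite !pFrobenius_autE expr1n.
by rewrite pevalB pevalXn -(polyC1 C) pevalC scale1r Lp // subrr.
Qed.

End LinearIterate.

(** Induction on the list: once a vector fixed by the first operator is found, [Good] is cut down to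
    the fixed space of that operator, which the others preserve by commutation. *)
Lemma commuting_unipotents_fixed (C : fieldType) (V : lmodType C) (p : nat)
    (Ls : seq {linear V -> V}) (Good : V -> Prop) x :
  p \in [pchar C] -> subsp Good -> Good x -> x != 0 ->
  (forall i L, List.nth_error Ls i = Some L -> forall y, Good y ->
     Good (L y) /\ iter p L y = y) ->
  (forall i j L M, List.nth_error Ls i = Some L -> List.nth_error Ls j = Some M ->
     forall y, Good y -> L (M y) = M (L y)) ->
  exists y, [/\ Good y, y != 0 &
     forall i L, List.nth_error Ls i = Some L -> L y = y].
Proof.
move=> pC; elim: Ls Good x => [|L Ls IHLs] Good x sG Gx x0 HL Hc.
  by exists x; split=> // -[].
have [y [Gy y0 Ly]] := unipotent_fixed sG (fun y Gy => (HL 0 L erefl y Gy).1)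
  pC Gx x0 (fun y Gy => (HL 0 L erefl y Gy).2).
have sG' : subsp (fun z => Good z /\ L z = z).
  split; first by split; [exact: sG.1 | rewrite linear0].
  move=> a z z' [Gz Lz] [Gz' Lz']; split; first exact: sG.2.
  by rewrite linearP Lz Lz'.
have [||z [[Gz Lz] z0 Fz]] := IHLs _ y sG' (conj Gy Ly) y0.
- move=> i M Mi z [Gz Lz]; have [GM Mp] := HL i.+1 M Mi z Gz; split=> //.
  by split=> //; rewrite (Hc 0 i.+1 L M erefl Mi z Gz) Lz.
- by move=> i j M N Mi Nj z [Gz _]; exact: (Hc i.+1 j.+1 M N Mi Nj).
by exists z; split=> // -[|i] M /=; [move=> [<-] | exact: Fz].
Qed.

(* Both families are cut into classes by [E]; a vanishing combination of the
   [a i] vanishes class by class, and this forces the one of the [b i] to vanish. *)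
Lemma relation_transfer (C : fieldType) (A B : lmodType C) (I : Type)
    (a : I -> A) (b : I -> B) (E : I -> pred I) :
  (forall i, E i i) ->
  (forall i s, \sum_(j <- s) a j = 0 -> \sum_(j <- s | E i j) a j = 0) ->
  (forall i s, \sum_(j <- s | E i j) a j = 0 -> \sum_(j <- s | E i j) b j = 0) ->
  forall s, \sum_(j <- s) a j = 0 -> \sum_(j <- s) b j = 0.
Proof.
move=> Erefl Hcut Hab s; have [n] := ubnP (size s).
elim: n s => // n IHn [|i s] lts; first by rewrite !big_nil.
move=> sa; have sai := Hcut i _ sa.
rewrite (bigID (E i)) /= (Hab _ _ sai) add0r -big_filter.
apply: IHn; last by rewrite big_filter; move: sa; rewrite (bigID (E i)) /= sai add0r.
rewrite /= Erefl /= -ltnS; apply: leq_ltn_trans lts.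
by rewrite ltnS size_filter count_size.
Qed.

(** * Homomorphisms, products and generated subrepresentations *)

Section Representations.
Variables (C : fieldType) (G : groupType).
Implicit Types (pi rho : rep C G).

Lemma rep_actK pi g : cancel (rep_act pi g) (rep_act pi g^-1%g).
Proof. by move=> x; rewrite -rep_actM mulVg rep_act1. Qed.

Lemma rep_act_eq0 pi g x : (rep_act pi g x == 0) = (x == 0).
Proof.
by apply/eqP/eqP => [/(congr1 (rep_act pi g^-1%g))|->]; rewrite ?linear0 // rep_actK.
Qed.

Lemma rep_ext pi x g h : g = h -> rep_act pi g x = rep_act pi h x.
Proof. by move=> ->. Qed.

Section MkSubrep.
Variables (pi : rep C G) (P : pi -> Prop) (sP : subsp P).
Hypothesis invP : forall g x, P x -> P (rep_act pi g x).

Definition prop_pred : {pred pi} := [pred x | `[< P x >]].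
Fact prop_pred_submod : submod_closed prop_pred.
Proof.
split; first by apply/asboolP; exact: sP.1.
by move=> a x y /asboolP Px /asboolP Py; apply/asboolP; exact: sP.2.
Qed.
Fact prop_pred_inv g x : x \in prop_pred -> rep_act pi g x \in prop_pred.
Proof. by move=> /asboolP Px; apply/asboolP; exact: invP. Qed.
Definition prop_subrep : subrep pi := Subrep prop_pred_submod prop_pred_inv.
Lemma prop_subrepP x : (x \in prop_subrep) <-> P x.
Proof. by split=> [/asboolP|/asboolP]. Qed.
End MkSubrep.

Lemma subrep_subsp pi (W : subrep pi) : subsp (fun x => x \in W).
Proof. split; [exact: rpred0 | move=> a x y Wx Wy; exact: rpredD (rpredZ _ Wx) Wy]. Qed.

Lemma irreducibleP pi (P : pi -> Prop) x : irreducible pi -> subsp P ->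
  (forall g y, P y -> P (rep_act pi g y)) -> P x -> x != 0 -> forall y, P y.
Proof.
move=> [_ /(_ (prop_subrep _ _))-irr] sP iP Px x0 y.
have [W0|WT] := irr P sP iP; last by apply/(prop_subrepP sP iP); exact: WT.
have e := W0 x ((prop_subrepP sP iP x).2 Px).
by rewrite e eqxx in x0.
Qed.

Section Homs.
Variables (pi rho : rep C G) (phi : rep_hom pi rho).

Lemma ker_subsp : subsp (fun x => phi x = 0).
Proof. by split=> [|a x y ex ey]; rewrite ?linear0 // linearP ex ey scaler0 addr0. Qed.
Lemma ker_inv g x : phi x = 0 -> phi (rep_act pi g x) = 0.
Proof. by move=> e; rewrite rep_homJ e linear0. Qed.

Lemma image_subsp : subsp (fun y => exists x, phi x = y).
Proof.
split; first by exists 0; rewrite linear0.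
by move=> a _ _ [z <-] [z' <-]; exists (a *: z + z'); rewrite linearP.
Qed.

Lemma image_inv g y : (exists x, phi x = y) -> exists x, phi x = rep_act rho g y.
Proof. by move=> [z <-]; exists (rep_act pi g z); rewrite rep_homJ. Qed.

Lemma preimage_subsp (Q : rho -> Prop) : subsp Q -> subsp (fun x => Q (phi x)).
Proof. by move=> sQ; split=> [|a x y Qx Qy]; rewrite ?linear0 ?linearP; [exact: sQ.1 | exact: sQ.2]. Qed.

Lemma irreducible_hom_inj x : irreducible pi -> phi x != 0 -> injective phi.
Proof.
move=> irr phix a b ab; apply/eqP; rewrite -subr_eq0; apply: contraT => d0.
have phi_d : phi (a - b) = 0 by rewrite linearB ab subrr.
have phi0 := irreducibleP irr ker_subsp ker_inv phi_d d0 x.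
by rewrite phi0 eqxx in phix.
Qed.

Lemma irreducible_hom_surj x : irreducible rho -> phi x != 0 ->
  forall y, exists z, phi z = y.
Proof.
move=> irr phix y; apply: (irreducibleP irr image_subsp (fun g y => @image_inv g y) _ phix).
by exists x.
Qed.

Lemma bij_iso : injective phi -> (forall y, exists z, phi z = y) -> rep_iso pi rho.
Proof.
move=> inj surj; exists phi.
have [psi psiK] := choice surj.
by exists psi => x //; apply: inj; rewrite psiK.
Qed.

End Homs.

Definition comp_fun (pi rho sigma : rep C G) (psi : rep_hom rho sigma)
  (phi : rep_hom pi rho) : {linear pi -> sigma} := psi \o phi.
Fact comp_homJ (pi rho sigma : rep C G) (psi : rep_hom rho sigma)
    (phi : rep_hom pi rho) g x :
  comp_fun psi phi (rep_act pi g x) = rep_act sigma g (comp_fun psi phi x).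
Proof. by rewrite /= !rep_homJ. Qed.
Definition comp_hom (pi rho sigma : rep C G) (psi : rep_hom rho sigma)
  (phi : rep_hom pi rho) : rep_hom pi sigma := RepHom (comp_homJ psi phi).

Definition id_hom pi : rep_hom pi pi := @RepHom _ _ pi pi idfun (fun _ _ => erefl).

Lemma rep_iso_refl pi : rep_iso pi pi.
Proof. by exists (id_hom pi); exists id. Qed.

Lemma rep_iso_trans pi rho sigma : rep_iso pi rho -> rep_iso rho sigma -> rep_iso pi sigma.
Proof.
move=> [phi bphi] [psi bpsi]; exists (comp_hom psi phi).
exact: bij_comp.
Qed.

Section Inverse.
Variables (pi rho : rep C G) (phi : rep_hom pi rho) (psi : rho -> pi).
Hypotheses (phiK : cancel phi psi) (psiK : cancel psi phi).
Fact inv_linear : linear psi.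
Proof. by move=> a x y; apply: (can_inj phiK); rewrite linearP !psiK. Qed.
HB.instance Definition _ := GRing.isLinear.Build C rho pi _ psi inv_linear.
Fact inv_homJ g x : psi (rep_act rho g x) = rep_act pi g (psi x).
Proof. by apply: (can_inj phiK); rewrite psiK rep_homJ psiK. Qed.
Definition inv_hom : rep_hom rho pi := RepHom inv_homJ.
End Inverse.

Lemma rep_iso_sym pi rho : rep_iso pi rho -> rep_iso rho pi.
Proof.
move=> [phi [psi phiK psiK]]; exists (inv_hom phiK psiK).
by exists phi.
Qed.

Lemma irreducible_iso pi rho : rep_iso pi rho -> irreducible pi -> irreducible rho.
Proof.
move=> [phi [psi phiK psiK]] irr; have [[x x0] _] := irr.
have phix : phi x != 0.
  by apply: contra_neq x0 => e; apply: (can_inj phiK); rewrite linear0.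
split; first by exists (phi x).
move=> W; have [W0|/existsNP[y /not_implyP[Wy y0]]] := pselect (forall x, x \in W -> x = 0).
  by left.
right=> z; rewrite -(psiK z); move: (psi z).
apply: (@irreducibleP _ (fun u => phi u \in W) (psi y) irr); last 2 first.
- by rewrite psiK.
- by apply/eqP => e; apply: y0; rewrite -(psiK y) e linear0.
- split; first by rewrite linear0 rpred0.
  by move=> a u v Wu Wv; rewrite linearP rpredD // rpredZ.
- by move=> g u Wu; rewrite rep_homJ; exact: (Defs.invariant g Wu).
Qed.

Lemma irreducible_quotient_iso pi rho (phi : rep_hom pi rho) x : irreducible pi ->
  irreducible rho -> phi x != 0 -> rep_iso pi rho.
Proof.
move=> irr irr' phix; apply: (@bij_iso _ _ phi).
  exact: irreducible_hom_inj phix.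
exact: irreducible_hom_surj phix.
Qed.

Section Product.
Variables (pi rho : rep C G).
Definition prod_act (g : G) (x : (pi * rho)%type) : (pi * rho)%type :=
  (rep_act pi g x.1, rep_act rho g x.2).
Fact prod_act_linear g : linear (prod_act g).
Proof. by move=> a [x1 x2] [y1 y2]; congr pair; rewrite /= linearP. Qed.
HB.instance Definition _ g := GRing.isLinear.Build C (pi * rho)%type (pi * rho)%type _
  (prod_act g) (prod_act_linear g).
Fact prod_act1 x : prod_act 1%g x = x.
Proof. by case: x => x y; rewrite /prod_act !rep_act1. Qed.
Fact prod_actM g h x : prod_act (g * h)%g x = prod_act g (prod_act h x).
Proof. by rewrite /prod_act !rep_actM. Qed.
Definition prod_rep : rep C G :=
  @Rep C G (pi * rho)%type (fun g => prod_act g) prod_act1 prod_actM.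
End Product.

(** A homomorphism given by its graph, a stable subspace of the product. Linearity reduces
    single-valuedness to the fibre over 0. Used for maps out of principal series, compact inductions
    and quotients. *)
Lemma graph_hom (pi rho : rep C G) (Gamma : pi -> rho -> Prop) :
  Gamma 0 0 ->
  (forall a x x' y y', Gamma x y -> Gamma x' y' -> Gamma (a *: x + x') (a *: y + y')) ->
  (forall g x y, Gamma x y -> Gamma (rep_act pi g x) (rep_act rho g y)) ->
  (forall y, Gamma 0 y -> y = 0) ->
  (forall x, exists y, Gamma x y) ->
  exists phi : rep_hom pi rho, forall x y, Gamma x y -> phi x = y.
Proof.
move=> G0 GP Ginv Gfun /choice[phi Gphi].
have uniq x y y' : Gamma x y -> Gamma x y' -> y = y'.
  move=> Gy Gy'; apply/eqP; rewrite -subr_eq0; apply/eqP/Gfun.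
  by have := GP (-1) _ _ _ _ Gy' Gy; rewrite !scaleN1r addNr addrC.
have phiP : linear phi.
  by move=> a x y; apply: (uniq (a *: x + y)) => //; exact: GP.
pose phiL := GRing.isLinear.Build C pi rho _ phi phiP.
pose phi' : {linear pi -> rho} := HB.pack phi phiL.
have phiJ g x : phi' (rep_act pi g x) = rep_act rho g (phi' x).
  by apply: (uniq (rep_act pi g x)) => //; exact: Ginv.
by exists (RepHom phiJ) => x y Gxy; apply: uniq (Gphi x) Gxy.
Qed.

Section Twist.
Variables (pi : rep C G) (c : G -> G) (c1 : c 1%g = 1%g).
Hypothesis cM : forall g h, c (g * h)%g = (c g * c h)%g.
Fact twist_act1 x : rep_act pi (c 1%g) x = x.
Proof. by rewrite c1 rep_act1. Qed.
Fact twist_actM g h x : rep_act pi (c (g * h)%g) x = rep_act pi (c g) (rep_act pi (c h) x).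
Proof. by rewrite cM rep_actM. Qed.
(** Used with conjugation by a matrix outside SL2, so that statements on one maximal compact
    subgroup apply to the other. *)
Definition twist : rep C G := @Rep C G pi (fun g => rep_act pi (c g)) twist_act1 twist_actM.
End Twist.

(** The subrepresentation generated by [x], in the form of explicit finite combinations of
    translates. *)
Definition gspan pi (x y : pi) : Prop := exists s : seq (C * G),
  y = \sum_(z <- s) z.1 *: rep_act pi z.2 x.

Lemma gspan_subsp pi (x : pi) : subsp (gspan x).
Proof.
split; first by exists [::]; rewrite big_nil.
move=> a _ _ [s ->] [s' ->]; exists ([seq (a * z.1, z.2) | z <- s] ++ s').
rewrite big_cat big_map scaler_sumr; congr (_ + _).
by apply: eq_bigr => z _; rewrite scalerA.
Qed.

Lemma gspan_inv pi (x : pi) g y : gspan x y -> gspan x (rep_act pi g y).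
Proof.
move=> [s ->]; exists [seq (z.1, (g * z.2)%g) | z <- s].
rewrite big_map linear_sum; apply: eq_bigr => z _.
by rewrite linearZ /= rep_actM.
Qed.

Lemma gspan_act pi (x : pi) g : gspan x (rep_act pi g x).
Proof. by exists [:: (1, g)]; rewrite big_seq1 scale1r. Qed.

Lemma gspan_id pi (x : pi) : gspan x x.
Proof. by exists [:: (1, 1%g)]; rewrite big_seq1 scale1r rep_act1. Qed.

Lemma gspan_min pi (P : pi -> Prop) x y : subsp P ->
  (forall g z, P z -> P (rep_act pi g z)) -> P x -> gspan x y -> P y.
Proof.
move=> sP iP Px [s ->]; apply: (subsp_sum sP) => z _; apply: (subspZ sP).
exact: iP.
Qed.

End Representations.

(** * The valuation ring and its residue field *)

Section Valuation.
Variable F : valuedFieldType.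
Implicit Types (x y : F) (m n : int).
Local Notation om := (uniformizer : F).
Local Notation v := (@valuation F).

Lemma om_neq0 : om != 0. Proof. exact: uniformizer_neq0. Qed.
Lemma omX_neq0 n : om ^ n != 0. Proof. exact: expfz_neq0 om_neq0. Qed.

Lemma valV x : x != 0 -> v x^-1 = - v x.
Proof.
move=> x0; have := valuationM _ _ x0 (invr_neq0 x0); rewrite mulfV // valuation1.
by move=> /eqP; rewrite eq_sym addrC addr_eq0 => /eqP.
Qed.

Lemma val_omn (n : nat) : v (om ^+ n) = n%:Z.
Proof.
elim: n => [|n IHn]; first by rewrite expr0 valuation1.
rewrite exprS valuationM ?expf_neq0 ?om_neq0 // IHn valuation_uniformizer; lia.
Qed.

Lemma val_omX n : v (om ^ n) = n.
Proof.
case: n => n; first exact: val_omn.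
by rewrite NegzE -exprnN valV ?expf_neq0 ?om_neq0 // val_omn.
Qed.

Lemma vgeE n x : x != 0 -> vge n x = (n <= v x).
Proof. by rewrite /vge => /negPf ->. Qed.

Lemma vge_le m n x : n <= m -> vge m x -> vge n x.
Proof. by rewrite /vge => nm /orP[->|/(le_trans nm) ->] //; rewrite orbT. Qed.

Lemma vgePn n x : ~~ vge n x -> x != 0 /\ v x < n.
Proof. by rewrite /vge negb_or -ltNge => /andP. Qed.

Lemma vge_val x : vge (v x) x. Proof. by rewrite /vge lexx orbT. Qed.

Lemma vge_omX n : vge n (om ^ n).
Proof. by rewrite /vge val_omX lexx orbT. Qed.

Lemma vge_om : vge 1 om. Proof. by rewrite /vge valuation_uniformizer orbT. Qed.

Lemma vge1 : vge 0 (1 : F). Proof. by rewrite /vge valuation1 lexx orbT. Qed.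

Lemma vgeB n x y : vge n x -> vge n y -> vge n (x - y).
Proof. by move=> xn yn; apply: vgeD => //; exact: vgeN. Qed.

Lemma vgeBC n x y : vge n (x - y) = vge n (y - x).
Proof. by apply/idP/idP => /vgeN; rewrite opprB. Qed.

Lemma vge_sym n x y : vge n (x - y) -> vge n (y - x).
Proof. by rewrite vgeBC. Qed.

Lemma vge_trans n y x z : vge n (x - y) -> vge n (y - z) -> vge n (x - z).
Proof. by move=> xy yz; have := vgeD xy yz; rewrite addrA subrK. Qed.

Lemma vgeMl n x y : vge 0 x -> vge n y -> vge n (x * y).
Proof. by move=> x0 /(vgeM x0); rewrite add0r. Qed.

Lemma vgeMr n x y : vge n x -> vge 0 y -> vge n (x * y).
Proof. by move=> xn /(vgeM xn); rewrite addr0. Qed.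

Lemma vge_omM m n x : vge n (om ^ m * x) = vge (n - m) x.
Proof.
have [->|x0] := eqVneq x 0; first by rewrite mulr0 !vge0.
by rewrite !vgeE ?mulf_neq0 ?omX_neq0 // valuationM ?omX_neq0 // val_omX lerBlDl.
Qed.

Lemma vge_om1M n x : vge n (om * x) = vge (n - 1) x.
Proof. by rewrite -vge_omM expr1z. Qed.

Lemma vge01 x : vge 1 x -> vge 0 x. Proof. exact: vge_le. Qed.

Lemma vge_nat (n : nat) : vge 0 (n%:R : F).
Proof. by elim: n => [|n IHn]; rewrite ?vge0 // mulrS vgeD // vge1. Qed.

Lemma vgeX x (n : nat) : vge 0 x -> vge 0 (x ^+ n).
Proof. by move=> x0; elim: n => [|n IHn]; rewrite ?expr0 ?vge1 // exprS vgeMl. Qed.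

Definition unitO x := (x != 0) && (v x == 0).

Lemma unitO_neq0 x : unitO x -> x != 0. Proof. by case/andP. Qed.
Lemma unitO_val x : unitO x -> v x = 0. Proof. by case/andP=> _ /eqP. Qed.
Lemma unitO_vge x : unitO x -> vge 0 x.
Proof. by case/andP=> x0 /eqP e; rewrite vgeE // e. Qed.
Lemma unitOE x : unitO x = vge 0 x && ~~ vge 1 x.
Proof.
have [->|x0] := eqVneq x 0; first by rewrite /unitO eqxx !vge0.
by rewrite /unitO x0 !vgeE //=; lia.
Qed.
Lemma unitOM x y : unitO x -> unitO y -> unitO (x * y).
Proof.
move=> /andP[x0 /eqP vx] /andP[y0 /eqP vy].
by rewrite /unitO mulf_neq0 // valuationM // vx vy.
Qed.
Lemma unitOV x : unitO x -> unitO x^-1.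
Proof. by move=> /andP[x0 /eqP vx]; rewrite /unitO invr_neq0 // valV // vx. Qed.
Lemma unitO1 : unitO 1. Proof. by rewrite /unitO oner_eq0 valuation1. Qed.
Lemma unitON x : unitO x -> unitO (- x).
Proof.
by rewrite !unitOE => /andP[x0 x1]; rewrite vgeN //; apply: contra x1 => /vgeN; rewrite opprK.
Qed.
Lemma unitO_vgeV x : unitO x -> vge 0 x^-1.
Proof. by move=> /unitOV; exact: unitO_vge. Qed.
Lemma unitOD x y : unitO x -> vge 1 y -> unitO (x + y).
Proof.
rewrite !unitOE => /andP[x0 x1] y1; rewrite vgeD // ?vge01 //=.
by apply: contra x1 => xy; rewrite -[x](addrK y) vgeB.
Qed.
Lemma unitO_1D x : vge 1 (x - 1) -> unitO x.
Proof. by move=> x1; rewrite -(subrK 1 x) addrC unitOD // unitO1. Qed.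
Lemma vge_unitM n x y : unitO x -> vge n (x * y) = vge n y.
Proof.
move=> ux; apply/idP/idP; last exact: vgeMl (unitO_vge ux).
by move=> /(vgeMl (unitO_vgeV ux)); rewrite mulKf ?unitO_neq0.
Qed.
Lemma unitO_or x : vge 0 x -> unitO x \/ vge 1 x.
Proof. by rewrite unitOE => ->; case: (vge 1 x); [right|left]. Qed.
Lemma not_vge0_inv x : ~~ vge 0 x -> x != 0 /\ vge 1 x^-1.
Proof. by move=> /vgePn[x0 vx]; split=> //; rewrite vgeE ?invr_neq0 // valV //; lia. Qed.
Lemma unit_part x : x != 0 -> unitO (om ^ (- v x) * x).
Proof.
move=> x0; rewrite /unitO mulf_neq0 ?omX_neq0 // valuationM ?omX_neq0 //.
by rewrite val_omX addNr.
Qed.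
Lemma unit_partE x : x = om ^ v x * (om ^ (- v x) * x).
Proof. by rewrite mulrA -expfzDr ?om_neq0 // subrr mul1r. Qed.

End Valuation.

(** A system of representatives [lam] of the residue field among the integers, together with the
    consequences of the hypotheses used throughout. The zero class is represented by 0 itself, so
    that its term in a sum can be evaluated literally. *)
Record resdata (p f : nat) (F : completeValuedFieldType) (C : closedFieldType)
    (iota : {rmorphism residue_field F -> C}) := Resdata {
  lam : 'I_(p ^ f) -> F;
  lam_zero : 'I_(p ^ f);
  rd_prime : prime p;
  rd_pchar : p \in [pchar C];
  rd_f : (0 < f)%N;
  lam_int : forall i, vge 0 (lam i);
  lam0 : lam lam_zero = 0;
  lam_cov : forall x : F, vge 0 x -> exists i, vge 1 (x - lam i);
  lam_inj : forall i j, vge 1 (lam i - lam j) -> i = j;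
  iota_injective : injective iota
}.

Section ResidueLemmas.
Variable F : valuedFieldType.
Implicit Types x y : F.

Lemma residue_eq x y : vge 0 x -> vge 0 y -> (residue x == residue y) = vge 1 (x - y).
Proof.
move=> x0 y0; rewrite /residue -Quotient.idealrBE.
have xO : x \in is_integral by [].
have yO : y \in is_integral by [].
apply/asboolP/idP => [[z /(congr1 val)]|xy].
  rewrite /= !insubdK // => ->; rewrite vge_om1M subrr; exact: (svalP z).
have zO : (uniformizer^-1 * (x - y) : F) \in is_integral.
  have : vge 1 (uniformizer * (uniformizer^-1 * (x - y))) by rewrite mulVKf ?om_neq0.
  by rewrite vge_om1M subrr.
exists (exist (fun x => x \in is_integral) _ zO); apply: val_inj; rewrite /= !insubdK //.
by rewrite mulVKf ?om_neq0.
Qed.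

Lemma residue_surj (z : residue_field F) : exists2 x : F, vge 0 x & residue x = z.
Proof.
exists (val (repr z)); first exact: (valP (repr z)).
by rewrite /residue valKd reprK.
Qed.

Lemma residueD x y : vge 0 x -> vge 0 y -> residue (x + y) = residue x + residue y.
Proof.
move=> x0 y0; rewrite /residue -rmorphD; congr (\pi_(_) _); apply: val_inj => /=.
by rewrite !insubdK //; exact: vgeD.
Qed.

Lemma residueM x y : vge 0 x -> vge 0 y -> residue (x * y) = residue x * residue y.
Proof.
move=> x0 y0; rewrite /residue -rmorphM; congr (\pi_(_) _); apply: val_inj => /=.
by rewrite !insubdK //; exact: vgeMl.
Qed.

Lemma residue1 : residue (1 : F) = 1.
Proof.
rewrite /residue -(rmorph1 (\pi_(residue_field F))); congr (\pi_(_) _).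
by apply: val_inj; rewrite /= insubdK //; exact: vge1.
Qed.

End ResidueLemmas.

Lemma exists_resdata (p f : nat) (F : completeValuedFieldType) (C : closedFieldType)
    (iota : {rmorphism residue_field F -> C}) :
  prime p -> ([set: residue_field F] #= `I_(p ^ f))%card -> is_Fp_closure p C ->
  injective iota -> exists D : resdata p f iota, True.
Proof.
move=> pP cardk [h _] iotaI.
have pC : p \in [pchar C] by exact: (rmorph_pchar h (pchar_Fp pP)).
have /card_set_bijP[e [eF eI eS]] := cardk.
have {}eI : injective e by move=> x y; apply: eI; rewrite inE.
have {}eF x : (e x < p ^ f)%N by exact: eF.
have lamP (i : 'I_(p ^ f)) : exists x : F,
    [/\ vge 0 x, e (residue x) = i & e 0 = i -> x = 0].
  have [e0i|e0i] := eqVneq (e 0) i.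
    exists 0; rewrite vge0; split=> //; rewrite -e0i; congr e.
    have := residueD (vge0 F 0) (vge0 F 0); rewrite addr0 => /eqP.
    by rewrite -subr_eq0 opprD addNKr oppr_eq0 => /eqP.
  have [z _ ez] := eS i (ltn_ord i); have [x x0 xz] := residue_surj z.
  by exists x; rewrite xz ez; split=> // e0; rewrite e0 eqxx in e0i.
have [lam Hlam] := choice lamP.
(* For f = 0 the residue field would have a single element, contradicting 1 <> 0. *)
have f0 : (0 < f)%N.
  rewrite lt0n; apply: contraPneq (oner_neq0 (residue_field F)) => f0.
  apply/negP; rewrite negbK; apply/eqP/eI.
  by have := eF 0; have := eF 1; rewrite f0 expn0; case: (e 0) (e 1) => [|?] [|?].
unshelve eexists; last by [].
apply: (@Resdata p f F C iota lam (Ordinal (eF 0))) => //.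
- by move=> i; have [] := Hlam i.
- by have [_ _] := Hlam (Ordinal (eF 0)); apply.
- move=> x x0; exists (Ordinal (eF (residue x))); have [l0 le _] := Hlam (Ordinal (eF (residue x))).
  by rewrite -residue_eq //; apply/eqP/eI; rewrite le.
- move=> i j; have [i0 ei _] := Hlam i; have [j0 ej _] := Hlam j.
  by rewrite -residue_eq // => /eqP ij; apply: val_inj; rewrite /= -[LHS]ei -[RHS]ej ij.
Qed.

Section Residue.
Variables (p f : nat) (F : completeValuedFieldType) (C : closedFieldType).
Variables (iota : {rmorphism residue_field F -> C}) (D : resdata p f iota).
Implicit Types (x y : F).
Local Notation q := (p ^ f)%N.
Local Notation om := (uniformizer : F).
Local Notation lam := (lam D).
Local Notation i0 := (lam_zero D).

(** Reduction followed by the embedding into [C]. It is additive and multiplicative on integral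
    elements; on the others [residue] returns the class of 0. *)
Definition rho (x : F) : C := iota (residue x).
Lemma rho_eq x y : vge 0 x -> vge 0 y -> (rho x == rho y) = vge 1 (x - y).
Proof. by move=> x0 y0; rewrite (inj_eq (iota_injective D)) residue_eq. Qed.
Lemma rhoD x y : vge 0 x -> vge 0 y -> rho (x + y) = rho x + rho y.
Proof. by move=> x0 y0; rewrite /rho residueD // rmorphD. Qed.
Lemma rhoM x y : vge 0 x -> vge 0 y -> rho (x * y) = rho x * rho y.
Proof. by move=> x0 y0; rewrite /rho residueM // rmorphM. Qed.
Lemma rho1 : rho 1 = 1.
Proof. by rewrite /rho residue1 rmorph1. Qed.
Lemma rho0 : rho 0 = 0.
Proof.
have := rhoD (vge0 F 0) (vge0 F 0); rewrite addr0 => /eqP.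
by rewrite -subr_eq0 opprD addNKr oppr_eq0 => /eqP.
Qed.
Lemma rhoN x : vge 0 x -> rho (- x) = - rho x.
Proof.
move=> x0; apply/eqP; rewrite -addr_eq0 -rhoD ?vgeN //.
by rewrite addNr rho0.
Qed.
Lemma rho_eq0 x : vge 0 x -> (rho x == 0) = vge 1 x.
Proof. by move=> x0; rewrite -{1}rho0 rho_eq ?vge0 // subr0. Qed.
Lemma rho_small x : vge 1 x -> rho x = 0.
Proof. by move=> x1; apply/eqP; rewrite rho_eq0 // vge01. Qed.
Lemma rho_congr x y : vge 0 x -> vge 0 y -> vge 1 (x - y) -> rho x = rho y.
Proof. by move=> x0 y0 xy; apply/eqP; rewrite rho_eq. Qed.
Lemma rho_neq0 x : unitO x -> rho x != 0.
Proof. by rewrite unitOE => /andP[x0]; rewrite -rho_eq0. Qed.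
Lemma rhoV x : unitO x -> rho x^-1 = (rho x)^-1.
Proof.
move=> ux; apply: (mulfI (rho_neq0 ux)); rewrite mulfV ?rho_neq0 //.
by rewrite -rhoM ?unitO_vge ?unitOV // mulfV ?unitO_neq0 // rho1.
Qed.
Lemma rhoX x (n : nat) : vge 0 x -> rho (x ^+ n) = rho x ^+ n.
Proof.
move=> x0; elim: n => [|n IHn]; first by rewrite !expr0 rho1.
by rewrite [x ^+ _]exprS rhoM ?vgeX // IHn exprS.
Qed.

Lemma q_gt1 : (1 < q)%N.
Proof.
have p1 := prime_gt1 (rd_prime D).
by rewrite -[1%N](expn0 p) ltn_exp2l // (rd_f D).
Qed.

Lemma q_eq0 : q%:R = 0 :> C.
Proof.
by apply/eqP; rewrite -(dvdn_pcharf (rd_pchar D)); apply: dvdn_exp (rd_f D) _.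
Qed.

Lemma vge1_p : vge 1 (p%:R : F).
Proof.
rewrite -rho_eq0 ?vge_nat //; apply/eqP.
have -> : rho p%:R = p%:R.
  elim: (p) => [|n IHn]; first by rewrite rho0.
  by rewrite -addn1 natrD rhoD ?vge_nat ?vge1 // rho1 IHn natrD.
exact: pcharf0 (rd_pchar D).
Qed.

Lemma unit_lam i : i != i0 -> unitO (lam i).
Proof.
move=> ii0; rewrite unitOE lam_int; apply: contra ii0.
by rewrite -[lam i]subr0 -(lam0 D) => /lam_inj ->.
Qed.

Lemma rho_lam_inj : injective (fun i => rho (lam i)).
Proof. by move=> i j /eqP; rewrite rho_eq ?lam_int // => /lam_inj. Qed.

Section Reindex.
Variables (R : Type) (idx : R) (op : Monoid.com_law idx).

(** A map injective modulo the uniformizer permutes the finite residue field. The representatives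
    themselves are not permuted, which is why [T] must be periodic. *)
Lemma big_lam_reindex (m : F -> F) (T : F -> R) :
  (forall x, vge 0 x -> vge 0 (m x)) ->
  (forall x y, vge 0 x -> vge 0 y -> vge 1 (m x - m y) -> vge 1 (x - y)) ->
  (forall x y, vge 0 x -> vge 0 y -> vge 1 (x - y) -> T x = T y) ->
  \big[op/idx]_i T (m (lam i)) = \big[op/idx]_i T (lam i).
Proof.
move=> mO mI TP; have mlamO i := mO _ (lam_int D i).
have [s sP] := choice (fun i => lam_cov D (mlamO i)).
have sI : injective s.
  move=> i j sij; apply: (@lam_inj _ _ _ _ _ D); apply: mI; rewrite ?lam_int //.
  by apply: vge_trans (sP i) _; rewrite sij; apply: vge_sym.
rewrite [RHS](reindex_inj sI); apply: eq_bigr => i _.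
by apply: TP => //; exact: lam_int.
Qed.

Lemma big_lam_reindex0 (m : F -> F) (T : F -> R) :
  (forall x, unitO x -> unitO (m x)) ->
  (forall x y, unitO x -> unitO y -> vge 1 (m x - m y) -> vge 1 (x - y)) ->
  (forall x y, unitO x -> unitO y -> vge 1 (x - y) -> T x = T y) ->
  \big[op/idx]_(i | i != i0) T (m (lam i)) = \big[op/idx]_(i | i != i0) T (lam i).
Proof.
move=> mO mI TP.
(* Both functions are extended to nonunits, [m] by 0 and [T] by the neutral element, so that the
   full reindexing applies. *)
pose m' x := if vge 1 x then 0 else m x.
pose T' x := if vge 1 x then idx else T x.
have notv i : vge 1 (lam i) = (i == i0).
  apply/idP/eqP => [|->]; last by rewrite lam0 vge0.
  by rewrite -[lam i]subr0 -(lam0 D) => /lam_inj.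
have unit_not x : unitO x -> vge 1 x = false by rewrite unitOE => /andP[_ /negPf].
have unitI x : vge 0 x -> vge 1 x = false -> unitO x by rewrite unitOE => -> ->.
have sub1 x y : vge 1 (x - y) -> vge 1 x = vge 1 y.
  move=> xy; apply/idP/idP => [x1|y1]; last by rewrite -(subrK y x) vgeD.
  by rewrite -(subrK x y) vgeD // vgeBC.
have H := @big_lam_reindex m' T'; rewrite big_mkcond [in RHS]big_mkcond.
transitivity (\big[op/idx]_i T' (m' (lam i))).
  apply: eq_bigr => i _; rewrite /m' /T' notv; case: eqVneq => [_|ii0] /=.
    by rewrite vge0.
  by rewrite unit_not // mO // unit_lam.
rewrite H; first by apply: eq_bigr => i _; rewrite /T' notv; case: eqVneq.
- move=> x x0; rewrite /m'; case: ifP => [_|x1]; first exact: vge0.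
  by apply: unitO_vge; apply: mO; exact: unitI.
- move=> x y x0 y0; rewrite /m'; case: ifP => x1; case: ifP => y1.
  + by move=> _; exact: vgeB.
  + by rewrite sub0r => /vgeN; rewrite opprK unit_not // mO // unitI.
  + by rewrite subr0 unit_not // mO // unitI.
  + by apply: mI; exact: unitI.
- move=> x y x0 y0 xy; rewrite /T' (sub1 _ _ xy); case: ifP => // y1.
  by apply: TP => //; apply: unitI => //; rewrite (sub1 _ _ xy).
Qed.

End Reindex.

Lemma sum_lam_const (V : lmodType C) (v : V) : \sum_(i < q) v = 0.
Proof. by rewrite sumr_const card_ord -scaler_nat q_eq0 scale0r. Qed.

(** Fermat's argument: multiplication by [x] permutes the nonzero classes, so their product is at
    once unchanged and multiplied by the (q-1)-st power of [rho x]. *)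
Lemma rho_unit_order x : unitO x -> rho x ^+ q.-1 = 1.
Proof.
move=> ux; have H : \prod_(i < q | i != i0) rho (x * lam i) = \prod_(i < q | i != i0) rho (lam i).
  apply: (@big_lam_reindex0 _ _ _ (fun y => x * y) rho).
  - by move=> y; exact: unitOM.
  - by move=> y z uy uz; rewrite -mulrBr vge_unitM.
  - by move=> y z uy uz; apply: rho_congr; exact: unitO_vge.
have P0 : \prod_(i < q | i != i0) rho (lam i) != 0.
  by apply/prodf_neq0 => i ii0; apply: rho_neq0; exact: unit_lam.
apply: (mulIf P0); rewrite mul1r -{2}H.
under [RHS]eq_bigr => i ii0 do rewrite rhoM ?unitO_vge // ?unit_lam //.
rewrite big_split prodr_const /=; congr (_ ^+ _ * _).
by rewrite (@eq_card _ _ (predC1 i0)) // cardC1 card_ord.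
Qed.

Lemma exists_prim_unit : exists2 g : F, unitO g & q.-1.-primitive_root (rho g).
Proof.
pose rs := [seq rho (lam i) | i <- enum (predC1 i0)].
have szq : size rs = q.-1 by rewrite size_map -cardE cardC1 card_ord.
have q0 : (0 < q.-1)%N by rewrite -subn1 subn_gt0 q_gt1.
have allr : all (q.-1).-unity_root rs.
  apply/allP => z /mapP[i]; rewrite mem_enum => ii0 ->.
  by rewrite unity_rootE rho_unit_order // unit_lam.
have urs : uniq rs by rewrite map_inj_uniq ?enum_uniq //; exact: rho_lam_inj.
have /hasP[z /mapP[i]] := has_prim_root q0 allr urs (eq_leq (esym szq)).
rewrite mem_enum => ii0 ->.
by exists (lam i) => //; exact: unit_lam.
Qed.

(** For s = 0 the q terms equal 1. For s > 0 the zero class contributes nothing, which leaves q-1 =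
    -1 when q-1 divides s; otherwise a generator [g] of the unit classes multiplies the sum by
    [rho g ^+ s], which is not 1. *)
Lemma sum_rho_pow s : \sum_(i < q) rho (lam i) ^+ s =
  if (0 < s)%N && (q.-1 %| s)%N then -1 else 0.
Proof.
case: s => [|s] /=.
  by under eq_bigr do rewrite expr0; exact: (sum_lam_const (1 : C^o)).
case: ifP => [/dvdnP[k ek]|nd].
  rewrite (bigD1 i0) //= lam0 rho0 expr0n /= add0r.
  rewrite (eq_bigr (fun=> 1)) => [|i ii0]; last first.
    by rewrite ek mulnC exprM rho_unit_order ?unit_lam // expr1n.
  rewrite sumr_const (@eq_card _ _ (predC1 i0)) // cardC1 card_ord.
  by apply/eqP; rewrite -addr_eq0 natr1 prednK ?q_eq0 // ltnW // q_gt1.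
have [g ug gP] := exists_prim_unit.
have g1 : rho g ^+ s.+1 - 1 != 0.
  by rewrite subr_eq0 -(prim_order_dvd gP) nd.
apply: (mulfI g1); rewrite mulr0 mulrBl mul1r; apply/eqP; rewrite subr_eq0; apply/eqP.
rewrite mulr_sumr (eq_bigr (fun i => rho (g * lam i) ^+ s.+1)); last first.
  by move=> i _; rewrite -exprMn -rhoM ?lam_int ?unitO_vge.
apply: (@big_lam_reindex _ _ _ (fun y => g * y) (fun y => rho y ^+ s.+1)).
- by move=> y; apply: vgeMl; exact: unitO_vge.
- by move=> y z y0 z0; rewrite -mulrBr vge_unitM.
- by move=> y z y0 z0 yz; rewrite (rho_congr y0 z0 yz).
Qed.

Section Residues.
Variable V : lmodType C.
Implicit Types T : F -> V.

Definition periodic T := forall x y, vge 0 x -> vge 0 y -> vge 1 (x - y) -> T x = T y.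

Lemma sum_lam_shift T b : vge 0 b -> periodic T ->
  \sum_i T (b + lam i) = \sum_i T (lam i).
Proof.
move=> b0; apply: (@big_lam_reindex _ _ _ (fun x => b + x) T).
- by move=> x; exact: vgeD.
- by move=> x y _ _; rewrite opprD addrACA subrr add0r.
Qed.

Lemma sum_lam_scale T a : unitO a -> periodic T ->
  \sum_i T (a * lam i) = \sum_i T (lam i).
Proof.
move=> ua; apply: (@big_lam_reindex _ _ _ (fun x => a * x) T).
- by move=> x; apply: vgeMl; exact: unitO_vge.
- by move=> x y _ _; rewrite -mulrBr vge_unitM.
Qed.

End Residues.

(** Representatives of the integers modulo the 2n-th power of the uniformizer, two digits at a time
    because S0 S1 contributes a pair of digits. The minus sign comes from
    [w * l x = u (- x) * w]. *)
Fixpoint digits (n : nat) : seq F :=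
  if n is m.+1 then [seq z + om ^+ 2 * y | z <- [seq lam i - om * lam j | i <- enum 'I_q, j <- enum 'I_q],
                                           y <- digits m]
  else [:: 0].

Definition digit2 : seq F := [seq lam i - om * lam j | i <- enum 'I_q, j <- enum 'I_q].

Lemma digitsS n : digits n.+1 = [seq z + om ^+ 2 * y | z <- digit2, y <- digits n].
Proof. by []. Qed.

Lemma digit2_int z : z \in digit2 -> vge 0 z.
Proof.
move=> /allpairsP[[i j] [_ _ ->]] /=; apply: vgeB; first exact: lam_int.
by rewrite vge_om1M; apply: vge_le (lam_int D j).
Qed.

Lemma digits_int n z : z \in digits n -> vge 0 z.
Proof.
elim: n z => [|n IHn] z; first by rewrite inE => /eqP ->; exact: vge0.
rewrite digitsS => /allpairsP[[a b] [/= /digit2_int a0 /IHn b0 ->]].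
by rewrite vgeD // vgeMl // vgeX // vge01 // vge_om.
Qed.

Lemma vge_om2M n x : vge n (om ^+ 2 * x) = vge (n - 2) x.
Proof. by rewrite -(vge_omM 2). Qed.

Lemma digit2_cov x : vge 0 x -> exists2 z, z \in digit2 & vge 2 (x - z).
Proof.
move=> x0; have [i xi] := lam_cov D x0.
have y0 : vge 0 ((lam i - x) / om).
  by rewrite -(subrr 1) -vge_om1M mulrC divfK ?om_neq0 // vgeBC.
have [j yj] := lam_cov D y0.
exists (lam i - om * lam j); first by apply/allpairsP; exists (i, j); rewrite !mem_enum.
have -> : x - (lam i - om * lam j) = om * (- ((lam i - x) / om - lam j)).
  by field; rewrite om_neq0.
by rewrite vge_om1M vgeN.
Qed.

Lemma digits_cov n x : vge 0 x -> exists2 z, z \in digits n & vge (2 * n)%N%:Z (x - z).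
Proof.
elim: n x => [|n IHn] x x0; first by exists 0; rewrite ?inE // subr0.
have [z zR xz] := digit2_cov x0.
have y0 : vge 0 ((x - z) / om ^+ 2).
  by rewrite -(subrr 2) -vge_om2M mulrC divfK // expf_neq0 // om_neq0.
have [y yR xy] := IHn _ y0; exists (z + om ^+ 2 * y).
  by rewrite digitsS; apply/allpairsP; exists (z, y).
have -> : x - (z + om ^+ 2 * y) = om ^+ 2 * ((x - z) / om ^+ 2 - y).
  by field; rewrite om_neq0.
by rewrite vge_om2M; apply: vge_le xy; lia.
Qed.

Lemma digit2_inj i j i' j' :
  vge 2 ((lam i - om * lam j) - (lam i' - om * lam j')) -> i = i' /\ j = j'.
Proof.
move=> ij; have ii' : i = i'.
  apply: (@lam_inj _ _ _ _ _ D).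
  have -> : lam i - lam i' = ((lam i - om * lam j) - (lam i' - om * lam j'))
    + om * (lam j - lam j') by ring.
  rewrite vgeD //; first exact: vge_le ij.
  by rewrite vge_om1M subrr vgeB // lam_int.
split=> //; apply: (@lam_inj _ _ _ _ _ D); move: ij; rewrite ii'.
have -> : lam i' - om * lam j - (lam i' - om * lam j') = om * (lam j' - lam j) by ring.
by rewrite vge_om1M vgeBC.
Qed.

Lemma digit2_uniq : uniq digit2.
Proof.
apply: allpairs_uniq; rewrite ?enum_uniq // => -[i j] [i' j'] _ _ /= e.
by have [|-> ->] := @digit2_inj i j i' j'; rewrite ?e ?subrr ?vge0.
Qed.

Lemma digits_sep n : uniq (digits n) /\ forall z z', z \in digits n -> z' \in digits n ->
  vge (2 * n)%N%:Z (z - z') -> z = z'.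
Proof.
elim: n => [|n [IHu IHn]]; first by split=> // z z'; rewrite !inE => /eqP -> /eqP ->.
have key z y z' y' : z \in digit2 -> y \in digits n -> z' \in digit2 -> y' \in digits n ->
    vge (2 * n.+1)%N%:Z ((z + om ^+ 2 * y) - (z' + om ^+ 2 * y')) -> z = z' /\ y = y'.
  move=> zR yR z'R y'R e.
  have zz' : z = z'.
    move: zR z'R e => /allpairsP[[i j] [_ _ ->]] /allpairsP[[i' j'] [_ _ ->]] /= e.
    have [|-> ->] := @digit2_inj i j i' j' => //.
    set a := lam i - _; set b := lam i' - _.
    have -> : a - b = (a + om ^+ 2 * y - (b + om ^+ 2 * y')) - om ^+ 2 * (y - y') by ring.
    rewrite vgeB //; first by apply: vge_le e; lia.
    by rewrite vge_om2M subrr vgeB // (@digits_int n).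
  split=> //; apply: IHn => //; move: e; rewrite zz'.
  have -> : z' + om ^+ 2 * y - (z' + om ^+ 2 * y') = om ^+ 2 * (y - y') by ring.
  by rewrite vge_om2M; apply: vge_le; lia.
split.
  rewrite digitsS; apply: allpairs_uniq; rewrite ?digit2_uniq // => -[z y] [z' y'].
  move=> /allpairsP[[a b] [/= aR bR [-> ->]]] /allpairsP[[a' b'] [/= aR' bR' [-> ->]]] /= e.
  by have [||||| -> ->] := key a b a' b'; rewrite ?e ?subrr ?vge0.
move=> z z'; rewrite digitsS.
move=> /allpairsP[[a b] [/= aR bR ->]] /allpairsP[[a' b'] [/= aR' bR' ->]] /= e.
by have [||||| -> ->] := key a b a' b'.
Qed.

Lemma digits0 n : 0 \in digits n.
Proof.
elim: n => [|n IHn]; first by rewrite inE.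
rewrite digitsS; apply/allpairsP; exists (0, 0); split=> //=; last by rewrite mulr0 addr0.
by apply/allpairsP; exists (i0, i0); rewrite !mem_enum /= lam0 mulr0 subr0.
Qed.

Lemma big_digits1 (V : nmodType) n z (T : F -> V) : z \in digits n ->
  (forall y, y \in digits n -> ~~ vge (2 * n)%N%:Z (y - z) -> T y = 0) ->
  \sum_(y <- digits n) T y = T z.
Proof.
move=> zR T0; have [uR sR] := digits_sep n.
rewrite (bigD1_seq z) //= big_seq_cond big1 ?addr0 // => y /andP[yR yz].
by apply: T0 => //; apply: contra yz => /(sR _ _ yR zR) ->.
Qed.

Lemma finite_net (N n : int) : exists s : seq F, forall x, vge N x ->
  exists2 y, y \in s & vge n (x - y).
Proof.
pose m := `|n - N|%N.
exists [seq om ^ N * z | z <- digits m] => x xN.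
have [|z zR xz] := @digits_cov m (om ^ (- N) * x).
  by rewrite vge_omM sub0r opprK.
exists (om ^ N * z); first exact: map_f.
have -> : x - om ^ N * z = om ^ N * (om ^ (- N) * x - z).
  by rewrite mulrBr mulrA -expfzDr ?om_neq0 // subrr expr0z mul1r.
by rewrite vge_omM; apply: vge_le xz; rewrite /m; lia.
Qed.

End Residue.

(** * Elements of SL2 *)

Section SL2Elements.
Variable F : fieldType.
Implicit Types (a b c d x y : F) (g h k : SL2 F).

Definition ea g : F := val g ord0 ord0.
Definition eb g : F := val g ord0 ord_max.
Definition ec g : F := val g ord_max ord0.
Definition ed g : F := val g ord_max ord_max.

Definition mx2 a b c d : 'M[F]_2 := \matrix_(i, j)
  if i == ord0 then (if j == ord0 then a else b) else (if j == ord0 then c else d).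

Lemma mx2P (P : 'I_2 -> Prop) : P ord0 -> P ord_max -> forall i, P i.
Proof.
by move=> P0 P1 i; rewrite -[i]inord_val; case: i => [[|[|i]] ?] //=;
  [move: P0 | move: P1]; congr P; apply: val_inj; rewrite /= inordK.
Qed.

Lemma mx2_eq (A B : 'M[F]_2) : A ord0 ord0 = B ord0 ord0 ->
  A ord0 ord_max = B ord0 ord_max -> A ord_max ord0 = B ord_max ord0 ->
  A ord_max ord_max = B ord_max ord_max -> A = B.
Proof. by move=> e0 e1 e2 e3; apply/matrixP; do 2![apply: mx2P]. Qed.

Lemma mul_mx2 (A B : 'M[F]_2) i j :
  (A *m B) i j = A i ord0 * B ord0 j + A i ord_max * B ord_max j.
Proof.
rewrite mxE big_ord_recl big_ord1; congr (_ + A i _ * B _ j); exact: val_inj.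
Qed.

Lemma det_mx2E (A : 'M[F]_2) :
  \det A = A ord0 ord0 * A ord_max ord_max - A ord0 ord_max * A ord_max ord0.
Proof.
rewrite (expand_det_row _ ord0) big_ord_recl big_ord1 /cofactor !det_mx11 !mxE /=.
rewrite expr0 mul1r expr1 mulN1r mulrN.
by congr (_ * A _ _ - A _ _ * A _ _); exact: val_inj.
Qed.

Lemma ead_bc g : ea g * ed g - eb g * ec g = 1.
Proof. by rewrite -det_mx2E; apply/eqP; exact: (valP g). Qed.

Lemma sl2P g h : ea g = ea h -> eb g = eb h -> ec g = ec h -> ed g = ed h -> g = h.
Proof. by move=> *; apply: val_inj; exact: mx2_eq. Qed.

Lemma eaM g h : ea (g * h)%g = ea g * ea h + eb g * ec h. Proof. exact: mul_mx2. Qed.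
Lemma ebM g h : eb (g * h)%g = ea g * eb h + eb g * ed h. Proof. exact: mul_mx2. Qed.
Lemma ecM g h : ec (g * h)%g = ec g * ea h + ed g * ec h. Proof. exact: mul_mx2. Qed.
Lemma edM g h : ed (g * h)%g = ec g * eb h + ed g * ed h. Proof. exact: mul_mx2. Qed.
Lemma ea1 : ea 1%g = 1. Proof. by rewrite /ea /= mxE. Qed.
Lemma eb1 : eb 1%g = 0. Proof. by rewrite /eb /= mxE. Qed.
Lemma ec1 : ec 1%g = 0. Proof. by rewrite /ec /= mxE. Qed.
Lemma ed1 : ed 1%g = 1. Proof. by rewrite /ed /= mxE. Qed.

(* The identity when the determinant is not 1. *)
Definition mk a b c d : SL2 F := insubd (1%g : SL2 F) (mx2 a b c d).

Lemma val_mk a b c d : a * d - b * c = 1 -> val (mk a b c d) = mx2 a b c d.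
Proof.
by move=> e; rewrite insubdK // unfold_in det_mx2E !mxE /= e.
Qed.

Section MkEntries.
Variables (a b c d : F) (e : a * d - b * c = 1).
Lemma ea_mk : ea (mk a b c d) = a. Proof. by rewrite /ea val_mk // mxE. Qed.
Lemma eb_mk : eb (mk a b c d) = b. Proof. by rewrite /eb val_mk // mxE. Qed.
Lemma ec_mk : ec (mk a b c d) = c. Proof. by rewrite /ec val_mk // mxE. Qed.
Lemma ed_mk : ed (mk a b c d) = d. Proof. by rewrite /ed val_mk // mxE. Qed.
End MkEntries.

Lemma invg_mk g : g^-1%g = mk (ed g) (- eb g) (- ec g) (ea g).
Proof.
have e : ed g * ea g - (- eb g) * (- ec g) = 1 by rewrite -(ead_bc g); ring.
suff H : (mk (ed g) (- eb g) (- ec g) (ea g) * g = 1)%g by rewrite -[LHS]mul1g -H mulgK.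
by apply: sl2P; rewrite ?eaM ?ebM ?ecM ?edM ?ea_mk ?eb_mk ?ec_mk ?ed_mk //
  ?ea1 ?eb1 ?ec1 ?ed1 -?(ead_bc g); ring.
Qed.

Lemma inv_det g : ed g * ea g - (- eb g) * (- ec g) = 1.
Proof. by rewrite -(ead_bc g); ring. Qed.
Lemma eaV g : ea g^-1%g = ed g. Proof. by rewrite invg_mk ea_mk ?inv_det. Qed.
Lemma ebV g : eb g^-1%g = - eb g. Proof. by rewrite invg_mk eb_mk ?inv_det. Qed.
Lemma ecV g : ec g^-1%g = - ec g. Proof. by rewrite invg_mk ec_mk ?inv_det. Qed.
Lemma edV g : ed g^-1%g = ea g. Proof. by rewrite invg_mk ed_mk ?inv_det. Qed.

Definition u x : SL2 F := mk 1 x 0 1.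
Definition l x : SL2 F := mk 1 0 x 1.
Definition hh a : SL2 F := mk a 0 0 a^-1.
Definition w : SL2 F := mk 0 1 (-1) 0.

Fact u_det x : 1 * 1 - x * 0 = 1 :> F. Proof. ring. Qed.
Fact l_det x : 1 * 1 - 0 * x = 1 :> F. Proof. ring. Qed.
Fact h_det a : a != 0 -> a * a^-1 - 0 * 0 = 1 :> F. Proof. by move=> a0; field. Qed.
Fact w_det : 0 * 0 - 1 * (-1) = 1 :> F. Proof. ring. Qed.

Lemma uE x : (ea (u x) = 1) * (eb (u x) = x) * (ec (u x) = 0) * (ed (u x) = 1).
Proof. by rewrite /u ea_mk ?eb_mk ?ec_mk ?ed_mk ?u_det. Qed.
Lemma lE x : (ea (l x) = 1) * (eb (l x) = 0) * (ec (l x) = x) * (ed (l x) = 1).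
Proof. by rewrite /l ea_mk ?eb_mk ?ec_mk ?ed_mk ?l_det. Qed.
Lemma hE a : a != 0 ->
  (ea (hh a) = a) * (eb (hh a) = 0) * (ec (hh a) = 0) * (ed (hh a) = a^-1).
Proof. by move=> a0; rewrite /hh ea_mk ?eb_mk ?ec_mk ?ed_mk ?h_det. Qed.
Lemma wE : (ea w = 0) * (eb w = 1) * (ec w = -1) * (ed w = 0).
Proof. by rewrite /w ea_mk ?eb_mk ?ec_mk ?ed_mk ?w_det. Qed.

Definition eM := (eaM, ebM, ecM, edM, eaV, ebV, ecV, edV, ea1, eb1, ec1, ed1, uE, lE, wE).

End SL2Elements.
Arguments w {F}.

Ltac fld := field; rewrite ?oppr_eq0 ?invr_eq0 ?oner_eq0; repeat (apply/andP; split).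
Ltac sl2 := apply: sl2P; rewrite !(eM, hE) //; try ring; try by fld.

Section SL2Identities.
Variable F : fieldType.
Implicit Types (a b c d x y z : F) (g h k : SL2 F).

Lemma uD x y : (u (x + y) = u x * u y)%g. Proof. sl2. Qed.
Lemma u0 : u (0 : F) = 1%g. Proof. sl2. Qed.
Lemma l0 : l (0 : F) = 1%g. Proof. sl2. Qed.
Lemma uN x : (u (- x) = (u x)^-1)%g. Proof. sl2. Qed.
Lemma hM a b : a != 0 -> b != 0 -> (hh (a * b) = hh a * hh b)%g.
Proof. by move=> a0 b0; have ab0 := mulf_neq0 a0 b0; sl2. Qed.
Lemma h1 : hh (1 : F) = 1%g.
Proof. by have i0 := oner_neq0 F; sl2. Qed.
Lemma hV a : a != 0 -> (hh a^-1 = (hh a)^-1)%g.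
Proof. by move=> a0; have a0' := invr_neq0 a0; sl2. Qed.
Lemma h_u a x : a != 0 -> (hh a * u x = u (a ^+ 2 * x) * hh a)%g.
Proof. by move=> a0; sl2. Qed.
Lemma w_l x : (w * l x = u (- x) * w)%g. Proof. sl2. Qed.
Lemma w_h a : a != 0 -> (w * hh a = hh a^-1 * w)%g.
Proof. by move=> a0; have a0' := invr_neq0 a0; sl2. Qed.
Lemma u_w x : (u x * w = w * l (- x))%g. Proof. sl2. Qed.
Lemma h_w a : a != 0 -> (hh a * w = w * hh a^-1)%g.
Proof. by move=> a0; have a0' := invr_neq0 a0; sl2. Qed.
Lemma ww : (w * w = hh (-1 : F))%g.
Proof. by have i0 : (-1 : F) != 0; [rewrite oppr_eq0 oner_eq0 | sl2]. Qed.
(** The rank one relation behind the quadratic relations of S0 and S1: for a unit x it rewrites a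
    product with two factors [w] as one with a single [w], up to the torus and I1. *)
Lemma wuw x : x != 0 -> (w * u x * w = u (- x^-1) * w * hh (- x) * u (- x^-1))%g.
Proof. by move=> x0; have x0' : - x != 0; [rewrite oppr_eq0 | sl2]. Qed.
Lemma bruhat_ulu g : ec g != 0 ->
  g = (u ((ea g - 1) / ec g) * l (ec g) * u ((ed g - 1) / ec g))%g.
Proof.
move=> c0; have eb' : eb g = (ea g * ed g - 1) / ec g.
  by apply: (mulIf c0); rewrite divfK // -(ead_bc g); ring.
by apply: sl2P; rewrite !eM //; rewrite ?eb'; fld.
Qed.

Lemma bruhat_uwu g : ec g != 0 ->
  g = (u (ea g / ec g) * hh (- (ec g)^-1) * w * u (ed g / ec g))%g.
Proof.
move=> c0; have eb' : eb g = (ea g * ed g - 1) / ec g.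
  by apply: (mulIf c0); rewrite divfK // -(ead_bc g); ring.
have nc0 : - (ec g)^-1 != 0 by rewrite oppr_eq0 invr_eq0.
by apply: sl2P; rewrite !(eM, hE) //; rewrite ?eb'; fld.
Qed.

Lemma factor_uhl g : ed g != 0 ->
  g = (u (eb g / ed g) * hh (ed g)^-1 * l (ec g / ed g))%g.
Proof.
move=> d0; have ea' : ea g = (1 + eb g * ec g) / ed g.
  by apply: (mulIf d0); rewrite divfK // -(ead_bc g); ring.
have nd0 : (ed g)^-1 != 0 by rewrite invr_eq0.
by apply: sl2P; rewrite !(eM, hE) //; rewrite ?ea'; fld.
Qed.

End SL2Identities.

(** * Congruence subgroups and compactness *)

Section CongruenceSubgroups.
Variable F : valuedFieldType.
Implicit Types (g h k : SL2 F) (n m N : int) (A B : 'M[F]_2).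
Local Notation om := (uniformizer : F).

Definition bdd N g := [&& vge N (ea g), vge N (eb g), vge N (ec g) & vge N (ed g)].
Definition inK g := bdd 0 g.
Definition Kn n g := [&& vge n (ea g - 1), vge n (eb g), vge n (ec g) & vge n (ed g - 1)].
(** The pro-p Iwahori subgroup: upper unipotent modulo the uniformizer. *)
Definition I1 g := [&& vge 1 (ea g - 1), vge 0 (eb g), vge 1 (ec g) & vge 1 (ed g - 1)].
Definition near n g h := [&& vge n (ea g - ea h), vge n (eb g - eb h),
  vge n (ec g - ec h) & vge n (ed g - ed h)].

Lemma bddM N M g h : bdd N g -> bdd M h -> bdd (N + M) (g * h)%g.
Proof.
by move=> /and4P[? ? ? ?] /and4P[? ? ? ?]; rewrite /bdd !eM !vgeD // vgeM.
Qed.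
Lemma bddV N g : bdd N g -> bdd N g^-1%g.
Proof. by move=> /and4P[? ? ? ?]; rewrite /bdd !eM !vgeN //; apply/and4P. Qed.
Lemma bdd_ex g : exists N, bdd N g /\ N <= 0.
Proof.
pose N := Num.min (Num.min (Num.min (valuation (ea g)) (valuation (eb g)))
  (Num.min (valuation (ec g)) (valuation (ed g)))) 0.
exists N; split; last by rewrite /N; lia.
by apply/and4P; split; apply: vge_le (vge_val _); rewrite /N; lia.
Qed.

Lemma inK1 : inK 1%g.
Proof. by rewrite /inK /bdd !eM !vge1 !vge0. Qed.
Lemma inKM g h : inK g -> inK h -> inK (g * h)%g.
Proof. by move=> gK hK; have := bddM gK hK; rewrite addr0. Qed.
Lemma inKV g : inK g -> inK g^-1%g. Proof. exact: bddV. Qed.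

(** g^-1 h - 1 = g^-1 (h - g), so passing to the quotient costs at most the bound [N] on the entries
    of [g]. *)
Lemma near_KnV N n g h : bdd N g -> near n g h -> Kn (N + n) (g^-1 * h)%g.
Proof.
move=> /and4P[? ? ? ?] /and4P[? ? ? ?]; have e := ead_bc g.
apply/and4P; rewrite !eM; split.
- have -> : ed g * ea h + - eb g * ec h - 1 =
    - (ed g * (ea g - ea h) - eb g * (ec g - ec h)) by rewrite -e; ring.
  by rewrite vgeN // vgeB // vgeM.
- have -> : ed g * eb h + - eb g * ed h = - (ed g * (eb g - eb h) - eb g * (ed g - ed h)) by ring.
  by rewrite vgeN // vgeB // vgeM.
- have -> : - ec g * ea h + ea g * ec h = - (ea g * (ec g - ec h) - ec g * (ea g - ea h)) by ring.
  by rewrite vgeN // vgeB // vgeM.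
- have -> : - ec g * eb h + ea g * ed h - 1 =
    - (ea g * (ed g - ed h) - ec g * (eb g - eb h)) by rewrite -e; ring.
  by rewrite vgeN // vgeB // vgeM.
Qed.

Lemma Kn_near N n g k : bdd N g -> Kn n k -> near (N + n) (g * k)%g g.
Proof.
move=> /and4P[? ? ? ?] /and4P[? ? ? ?].
apply/and4P; rewrite !eM; split.
- have -> : ea g * ea k + eb g * ec k - ea g = ea g * (ea k - 1) + eb g * ec k by ring.
  by rewrite vgeD // vgeM.
- have -> : ea g * eb k + eb g * ed k - eb g = ea g * eb k + eb g * (ed k - 1) by ring.
  by rewrite vgeD // vgeM.
- have -> : ec g * ea k + ed g * ec k - ec g = ec g * (ea k - 1) + ed g * ec k by ring.
  by rewrite vgeD // vgeM.
- have -> : ec g * eb k + ed g * ed k - ed g = ec g * eb k + ed g * (ed k - 1) by ring.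
  by rewrite vgeD // vgeM.
Qed.

Lemma near_sym n g h : near n g h -> near n h g.
Proof. by move=> /and4P[*]; apply/and4P; split; rewrite vgeBC. Qed.

Lemma near_trans n g h k : near n g h -> near n h k -> near n g k.
Proof.
by move=> /and4P[? ? ? ?] /and4P[? ? ? ?]; apply/and4P; split; apply: vge_trans; eassumption.
Qed.

Lemma near_le n m g h : m <= n -> near n g h -> near m g h.
Proof. by move=> mn /and4P[*]; apply/and4P; split; apply: vge_le mn _. Qed.

Lemma near1 n g : near n g 1%g = Kn n g.
Proof. by rewrite /near /Kn !eM !subr0. Qed.

Lemma Kn_le n m g : m <= n -> Kn n g -> Kn m g.
Proof. by rewrite -!near1; exact: near_le. Qed.

Lemma Kn_inK n g : 0 <= n -> Kn n g -> inK g.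
Proof.
move=> n0 /(Kn_le n0) /and4P[a1 b c d1]; apply/and4P; split=> //.
  by rewrite -[ea g](subrK 1) vgeD // vge1.
by rewrite -[ed g](subrK 1) vgeD // vge1.
Qed.

Lemma KnM n g h : 0 <= n -> Kn n g -> Kn n h -> Kn n (g * h)%g.
Proof.
move=> n0 gn hn; rewrite -near1; apply: (@near_trans _ _ g); last by rewrite near1.
by have := Kn_near (Kn_inK n0 gn) hn; rewrite add0r.
Qed.

Lemma I1_inK g : I1 g -> inK g.
Proof.
move=> /and4P[a1 b c d1]; apply/and4P; split=> //; last 2 first.
- exact: vge01.
- by rewrite -[ed g](subrK 1) vgeD // ?vge1 // vge01.
by rewrite -[ea g](subrK 1) vgeD // ?vge1 // vge01.
Qed.

Lemma Kn_I1 n g : 1 <= n -> Kn n g -> I1 g.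
Proof.
by move=> n1 /(Kn_le n1) /and4P[? ? ? ?]; apply/and4P; split=> //; exact: vge01.
Qed.

Lemma I1_1 : I1 1%g.
Proof. by rewrite /I1 !eM !subrr !vge0. Qed.

Lemma I1M g h : I1 g -> I1 h -> I1 (g * h)%g.
Proof.
move=> gI hI; have /and4P[? ? ? ?] := I1_inK gI; have /and4P[? ? ? ?] := I1_inK hI.
move: gI hI => /and4P[? ? ? ?] /and4P[? ? ? ?].
apply/and4P; rewrite !eM; split.
- have -> : ea g * ea h + eb g * ec h - 1 = (ea g - 1) * ea h + (ea h - 1) + eb g * ec h by ring.
  by rewrite vgeD ?vgeMl // vgeD ?vgeMr.
- by rewrite vgeD // vgeMl.
- by apply: vgeD; [exact: vgeMr | exact: vgeMl].
- have -> : ec g * eb h + ed g * ed h - 1 = ec g * eb h + ((ed g - 1) * ed h + (ed h - 1)) by ring.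
  by rewrite vgeD ?vgeMr // vgeD ?vgeMr.
Qed.

Lemma I1V g : I1 g -> I1 g^-1%g.
Proof.
move=> /and4P[? ? ? ?]; apply/and4P; rewrite !eM; split=> //; exact: vgeN.
Qed.

Lemma inK_u x : vge 0 x -> inK (u x).
Proof. by move=> x0; rewrite /inK /bdd !eM vge1 vge0 x0. Qed.
Lemma inK_l x : vge 0 x -> inK (l x).
Proof. by move=> x0; rewrite /inK /bdd !eM vge1 vge0 x0. Qed.
Lemma inK_w : inK w.
Proof. by rewrite /inK /bdd !eM vge1 vge0 vgeN // vge1. Qed.
Lemma inK_h a : unitO a -> inK (hh a).
Proof.
move=> ua; have a0 := unitO_neq0 ua.
by rewrite /inK /bdd !hE // !vge0 unitO_vge //= unitO_vgeV.
Qed.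
Lemma I1_u x : vge 0 x -> I1 (u x).
Proof. by move=> x0; rewrite /I1 !eM subrr !vge0 x0. Qed.
Lemma I1_l x : vge 1 x -> I1 (l x).
Proof. by move=> x0; rewrite /I1 !eM subrr !vge0 x0. Qed.
Lemma I1_h a : vge 1 (a - 1) -> I1 (hh a).
Proof.
move=> a1; have ua := unitO_1D a1; have a0 := unitO_neq0 ua.
rewrite /I1 !hE // !vge0 a1 /=.
have -> : a^-1 - 1 = - (a^-1 * (a - 1)) by field.
by rewrite vgeN // vgeMl // unitO_vgeV.
Qed.

(** The Iwahori factorization: the lower right entry is a unit, so elimination stays integral. *)
Lemma I1_factor g : I1 g -> exists x a y, [/\ vge 0 x, vge 1 (a - 1), vge 1 y &
  g = (u x * hh a * l y)%g].
Proof.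
move=> /and4P[a1 b0 c1 d1]; have ud := unitO_1D d1; have d0 := unitO_neq0 ud.
exists (eb g / ed g), (ed g)^-1, (ec g / ed g); split.
- by rewrite vgeMr // unitO_vgeV.
- have -> : (ed g)^-1 - 1 = - ((ed g)^-1 * (ed g - 1)) by field.
  by rewrite vgeN // vgeMl // unitO_vgeV.
- by rewrite vgeMr // unitO_vgeV.
- exact: factor_uhl.
Qed.

(** If the lower left entry is a unit, the factors of [bruhat_ulu] are integral. Otherwise the
    determinant makes the upper left entry a unit, and [w] moves it, up to sign, into the lower left
    corner. *)
Lemma inK_ind (P : SL2 F -> Prop) : (forall g h, P g -> P h -> P (g * h)%g) ->
  (forall x, vge 0 x -> P (u x)) -> P w -> forall g, inK g -> P g.
Proof.
move=> PM Pu Pw.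
have Pww : P (w * w)%g by exact: (PM).
have Pwi : P (w^-1)%g.
  have -> : (w^-1 = w * (w * w) :> SL2 F)%g by sl2.
  exact: (PM).
have Pl x : vge 0 x -> P (l x).
  move=> x0; have -> : l x = (w^-1 * u (- x) * w)%g by rewrite -mulgA -w_l mulKg.
  by apply: (PM) => //; apply: (PM) => //; apply: Pu; exact: vgeN.
have Pc g : inK g -> unitO (ec g) -> P g.
  move=> /and4P[ga gb gc gd] uc; rewrite (bruhat_ulu (unitO_neq0 uc)).
  apply: (PM); last by apply: Pu; rewrite vgeMr ?unitO_vgeV // vgeB // vge1.
  by apply: (PM); [apply: Pu; rewrite vgeMr ?unitO_vgeV // vgeB // vge1 | exact: Pl].
move=> g gK; have /and4P[ga gb gc gd] := gK.
have [uc|c1] := unitO_or gc; first exact: Pc.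
rewrite -(mulKg w g); apply: (PM) => //; apply: Pc; first exact: inKM (inK_w) gK.
rewrite !eM mul0r addr0 mulN1r unitON //.
have [//|a1] := unitO_or ga.
have : vge 1 (1 : F) by rewrite -(ead_bc g); apply: vgeB; [exact: vgeMr | exact: vgeMl].
by rewrite vgeE ?oner_neq0 // valuation1.
Qed.

End CongruenceSubgroups.

Section MatrixTopology.
Variable F : valuedFieldType.
Implicit Types (n m N : int) (A B : 'M[F]_2).

Definition mnear n A B := forall i j, vge n (A i j - B i j).
Definition mbdd n A := forall i j, vge n (A i j).

Lemma nbhs_mxP A (U : set 'M[F]_2) :
  nbhs A U <-> exists n, forall B, mnear n A B -> U B.
Proof.
split=> [[P nP PU]|[n nU]].
  have nP' i j := (nbhs_vgeP _ _).1 (nP i j).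
  have [e eP] := choice (fun ij : 'I_2 * 'I_2 => nP' ij.1 ij.2).
  pose n := Num.max (Num.max (e (ord0, ord0)) (e (ord0, ord_max)))
    (Num.max (e (ord_max, ord0)) (e (ord_max, ord_max))).
  exists n => B nB; apply: PU => i j; apply: (eP (i, j)); apply: vge_le (nB i j).
  by move: i j; do 2![apply: mx2P]; rewrite /n; lia.
exists (fun i j => [set y | vge n (A i j - y)]) => [i j|B]; last exact: nU.
by apply/nbhs_vgeP; exists n.
Qed.

Lemma nbhs_SL2P (g : SL2 F) (U : set (SL2 F)) :
  nbhs g U <-> exists n, forall h : SL2 F, mnear n (val g) (val h) -> U h.
Proof.
split; first rewrite nbhsE => -[B [[V oV eV] Bg] BU].
  have : nbhs (val g) V by apply: open_nbhs_nbhs; split=> //; move: Bg; rewrite -eV.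
  by move=> /nbhs_mxP[n nV]; exists n => h /nV Vh; apply: BU; rewrite -eV.
move=> [n nU]; have : nbhs (val g) [set B | mnear n (val g) B] by apply/nbhs_mxP; exists n.
rewrite nbhsE => -[V [oV Vg] VU]; rewrite nbhsE; exists (val @^-1` V); last first.
  by move=> h /VU /nU.
by split=> //; exists V.
Qed.

Lemma nbhs_GL2P (g : GL2 F) (U : set (GL2 F)) :
  nbhs g U <-> exists n, forall h : GL2 F, mnear n (val g) (val h) -> U h.
Proof.
split; first rewrite nbhsE => -[B [[V oV eV] Bg] BU].
  have : nbhs (val g) V by apply: open_nbhs_nbhs; split=> //; move: Bg; rewrite -eV.
  by move=> /nbhs_mxP[n nV]; exists n => h /nV Vh; apply: BU; rewrite -eV.
move=> [n nU]; have : nbhs (val g) [set B | mnear n (val g) B] by apply/nbhs_mxP; exists n.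
rewrite nbhsE => -[V [oV Vg] VU]; rewrite nbhsE; exists (val @^-1` V); last first.
  by move=> h /VU /nU.
by split=> //; exists V.
Qed.

Lemma mnear_SL2 n (g h : SL2 F) : mnear n (val g) (val h) <-> near n g h.
Proof.
split=> [H|/and4P[ha hb hc hd]]; first by apply/and4P; split; exact: H.
by do 2![apply: mx2P].
Qed.

Lemma mbdd_SL2 n (g : SL2 F) : mbdd n (val g) <-> bdd n g.
Proof.
split=> [H|/and4P[ha hb hc hd]]; first by apply/and4P; split; exact: H.
by do 2![apply: mx2P].
Qed.

Lemma nbhs_nearP (g : SL2 F) (U : set (SL2 F)) :
  nbhs g U <-> exists n, forall h, near n g h -> U h.
Proof.
rewrite nbhs_SL2P; split=> -[n nU]; exists n => h.
  by move=> /mnear_SL2; exact: nU.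
by move=> /mnear_SL2; exact: nU.
Qed.

Lemma smoothP (C : fieldType) (pi : rep C (SL2 F)) : smooth pi <->
  forall x, exists2 n, 1 <= n & forall k, Kn n k -> rep_act pi k x = x.
Proof.
split=> [sm x|sm x].
  have : nbhs (1%g : SL2 F) [set g | rep_act pi g x = x].
    by apply: open_nbhs_nbhs; split; [exact: sm | exact: rep_act1].
  move=> /nbhs_nearP[n nU]; exists (Num.max n 1); first by rewrite le_max lexx orbT.
  move=> k; rewrite -near1 => /near_sym kn; apply: nU; apply: near_le kn.
  by rewrite le_max lexx.
rewrite openE => g /= gx; rewrite /interior; apply/nbhs_nearP.
have [n n1 nK] := sm x; have [N [gN _]] := bdd_ex g.
exists (n - N) => h /(near_KnV gN); rewrite addrC subrK => /nK e /=.
by rewrite -[h](mulVKg g) rep_actM e.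
Qed.

Lemma det_near N n A B : mbdd N A -> mbdd N B -> mnear n A B ->
  vge (n + N) (\det A - \det B).
Proof.
move=> bA bB nAB; rewrite !det_mx2E.
have -> : A ord0 ord0 * A ord_max ord_max - A ord0 ord_max * A ord_max ord0 -
  (B ord0 ord0 * B ord_max ord_max - B ord0 ord_max * B ord_max ord0) =
  (A ord0 ord0 - B ord0 ord0) * A ord_max ord_max +
  (A ord_max ord_max - B ord_max ord_max) * B ord0 ord0 -
  ((A ord0 ord_max - B ord0 ord_max) * A ord_max ord0 +
   (A ord_max ord0 - B ord_max ord0) * B ord0 ord_max) by ring.
by apply: vgeB; apply: vgeD; apply: vgeM; try exact: nAB; try exact: bA; exact: bB.
Qed.

End MatrixTopology.

(** * Compactness of bounded sets of matrices *)

Section Compactness.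
Variables (p f : nat) (F : completeValuedFieldType) (C : closedFieldType).
Variables (iota : {rmorphism residue_field F -> C}) (D : resdata p f iota).
Implicit Types (n m N : int) (A B : 'M[F]_2).

Lemma complete_seq N (a : nat -> F) :
  (forall k : nat, vge (N + k%:Z) (a k - a k.+1)) ->
  exists L, forall k : nat, vge (N + k%:Z) (a k - L).
Proof.
move=> ak.
have akj k j : vge (N + k%:Z) (a k - a (k + j)%N).
  elim: j => [|j IHj]; first by rewrite addn0 subrr vge0.
  apply: vge_trans IHj _; rewrite addnS; apply: vge_le (ak _); lia.
have akl k j : (k <= j)%N -> vge (N + k%:Z) (a k - a j).
  by move=> kj; rewrite -(subnKC kj).
have : cauchy (a @ \oo).
  move=> E; rewrite valuation_entourage => -[n _ nE].
  pose k := `|n - N|%N.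
  exists (a @` [set j | (k <= j)%N], a @` [set j | (k <= j)%N]).
    by split; exists k => // j kj; exists j.
  move=> [y z] [[i ki /= <-] [j kj /= <-]]; apply: nE; rewrite /=.
  apply: (@vge_le _ (N + k%:Z)); first by rewrite /k; lia.
  by apply: vge_trans (vge_sym _) (akl _ _ kj); exact: akl.
move=> /cauchy_cvg/cvg_ex[L aL]; exists L => k.
have /aL[j _ jL] : nbhs L [set y | vge (N + k%:Z) (L - y)].
  by apply/nbhs_vgeP; exists (N + k%:Z).
apply: vge_trans (akl k (maxn k j) (leq_maxl _ _)) _; apply: vge_sym.
by apply: jL; exact: leq_maxr.
Qed.

Lemma finite_mx_net N n : exists s : seq 'M[F]_2, forall A, mbdd N A ->
  exists2 B, B \in s & mnear n A B.
Proof.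
have [s sP] := finite_net D N n.
exists [seq mx2 x.1.1 x.1.2 x.2.1 x.2.2 | x <- [seq (y, z) |
  y <- [seq (a, b) | a <- s, b <- s], z <- [seq (c, d) | c <- s, d <- s]]] => A bA.
have [a as_ na] := sP _ (bA ord0 ord0); have [b bs nb] := sP _ (bA ord0 ord_max).
have [c cs nc] := sP _ (bA ord_max ord0); have [d ds nd] := sP _ (bA ord_max ord_max).
exists (mx2 a b c d); last by do 2![apply: mx2P]; rewrite mxE.
apply/mapP; exists ((a, b), (c, d)) => //; apply: allpairs_f; exact: allpairs_f.
Qed.

(** Compactness of the ball as an induction principle. If [P] failed for the ball, finite nets would
    give shrinking balls on which it fails; their centres converge by completeness, and [P] holds
    near the limit. *)
Lemma ball_induction N (P : set 'M[F]_2 -> Prop) :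
  (forall X Y, X `<=` Y -> P Y -> P X) -> (forall X Y, P X -> P Y -> P (X `|` Y)) ->
  P set0 -> (forall A, mbdd N A -> exists n, P [set B | mnear n A B]) ->
  P [set A | mbdd N A].
Proof.
move=> Pmono PU P0 Ploc; apply: contrapT => nP.
pose X n A := [set B | mbdd N B /\ mnear n A B].
have step n A : ~ P (X n A) ->
    exists A', [/\ mbdd N A', mnear n A A' & ~ P (X (n + 1) A')].
  move=> nPX; apply: contrapT => H; apply: nPX.
  have {}H B : X n A B -> P (X (n + 1) B).
    by move=> [bB nB]; apply: contrapT => nPB; apply: H; exists B.
  have [s sP] := finite_mx_net N (n + 1).
  have Ps (y : 'M[F]_2) : P (X n A `&` [set B | mnear (n + 1) B y]).
    have [[B [XB nB]]|nB] := pselect (exists B, X n A B /\ mnear (n + 1) B y).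
      apply: Pmono (H B XB) => B' [[bB' _] nB']; split=> // i j.
      by apply: vge_trans (nB i j) _; apply: vge_sym; exact: nB'.
    by apply: Pmono P0 => B [XB yB]; apply: nB; exists B.
  have {}Ps : P (\bigcup_(y in [set` s]) (X n A `&` [set B | mnear (n + 1) B y])).
    elim: s {sP} => [|y s IHs]; first by apply: Pmono P0 => B [y].
    apply: Pmono (PU _ _ (Ps y) IHs) => B [z]; rewrite /= inE => /orP[/eqP ->|zs] XB.
      by left.
    by right; exists z.
  apply: Pmono Ps => B XB; have [y ys ny] := sP B XB.1.
  by exists y.
(* Level N - 1 around 0 contains the whole ball, so that [step] yields a first centre at level N. *)
have [A0 [b0 _ n0]] : exists A', [/\ mbdd N A', mnear (N - 1) 0 A' & ~ P (X (N - 1 + 1) A')].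
  apply: step => PX; apply: nP; apply: Pmono PX => B bB; split=> // i j.
  rewrite mxE sub0r; apply: vgeN; apply: vge_le (bB i j); lia.
rewrite subrK in n0.
have next (kA : nat * 'M[F]_2) : exists A', ~ P (X (N + kA.1%:Z) kA.2) ->
    [/\ mbdd N A', mnear (N + kA.1%:Z) kA.2 A' & ~ P (X (N + kA.1.+1%:Z) A')].
  have [PX|nPX] := pselect (P (X (N + kA.1%:Z) kA.2)); first by exists kA.2.
  have [A' [bA' nA' PA']] := step _ _ nPX; exists A' => _; split=> //.
  by rewrite -addn1 PoszD addrA.
have [nx nxP] := choice next.
pose fix sq (k : nat) : 'M[F]_2 := if k is k'.+1 then nx (k', sq k') else A0.
have sqP k : mbdd N (sq k) /\ ~ P (X (N + k%:Z) (sq k)).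
  elim: k => [|k [_ IHk]]; first by rewrite addr0.
  by have [] := nxP (k, sq k) IHk.
have sqL ij : exists L, forall k : nat, vge (N + k%:Z) (sq k ij.1 ij.2 - L).
  apply: complete_seq => k; have [_ + _] := nxP (k, sq k) (sqP k).2.
  exact.
have [L LP] := choice sqL.
pose A := \matrix_(i, j) L (i, j).
have bA : mbdd N A.
  move=> i j; rewrite mxE.
  have := LP (i, j) 0; rewrite addr0 => /(vgeB ((sqP 0).1 i j)).
  by rewrite /= subKr.
have [n nA] := Ploc A bA; pose k := `|n - N|%N.
apply: (sqP k).2; apply: Pmono nA => B [_ kB] i j.
apply: (@vge_le _ (N + k%:Z)); first by rewrite /k; lia.
apply: vge_trans (vge_sym _) (kB i j); rewrite mxE; exact: (LP (i, j)).
Qed.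

(** [ball_induction] is applied to the sets of matrices whose preimage a filter without cluster
    point avoids. The last hypothesis says that the image of [Q] is closed: a matrix of the ball is
    attained or stays away from the image. *)
Lemma compact_bounded (T : topologicalType) (e : T -> 'M[F]_2) N (Q : set T) :
  (forall g U, nbhs g U -> exists n, forall h, mnear n (e g) (e h) -> U h) ->
  (forall g, Q g -> mbdd N (e g)) ->
  (forall A, mbdd N A -> (exists2 g, Q g & e g = A) \/
     exists n, forall h, Q h -> ~ mnear n A (e h)) ->
  compact Q.
Proof.
move=> nbhsT bQ clQ Phi FPhi PhiQ; apply: contrapT => ncl.
pose P X := Phi [set h | Q h -> ~ X (e h)].
have : P [set A | mbdd N A].
  apply: ball_induction => [X Y XY PY|X Y PX PY||A bA].
  - have {PY}PY : Phi [set h | Q h -> ~ Y (e h)] := PY.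
    by rewrite /P; apply: filterS PY => h QY /QY nY /XY.
  - have {PY}PY : Phi [set h | Q h -> ~ Y (e h)] := PY.
    have {PX}PX : Phi [set h | Q h -> ~ X (e h)] := PX.
    by rewrite /P; apply: filterS2 PX PY => h QX QY Qh [/(QX Qh)|/(QY Qh)].
  - by rewrite /P; apply: (@filterS _ Phi _ setT) filterT => h _ _ [].
  have [[g Qg <-]|[n nA]] := clQ A bA; last first.
    by exists n; rewrite /P; apply: (@filterS _ Phi _ setT) filterT => h _ Qh; exact: nA.
  have [S [U [PS nU SU]]] : exists S U, [/\ Phi S, nbhs g U & forall h, S h -> ~ U h].
    apply: contrapT => H; apply: ncl; exists g; split=> // S U PS nU.
    apply: contrapT => SU; apply: H; exists S, U; split=> // h Sh Uh.
    by apply: SU; exists h.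
  have [n nU'] := nbhsT _ _ nU; exists n.
  by rewrite /P; apply: (@filterS _ Phi _ S) PS => h Sh Qh /nU' Uh; exact: SU Sh Uh.
move=> PX; have {PX}PX : Phi [set h | Q h -> ~ mbdd N (e h)] := PX.
have : Phi set0; last exact: filter_not_empty.
by apply: filterS2 PX PhiQ => h + Qh => /(_ Qh); apply; exact: bQ.
Qed.

Lemma compact_SL2 N : compact [set g : SL2 F | bdd N g].
Proof.
apply: (@compact_bounded _ (fun g : SL2 F => val g) N) => [g U /nbhs_SL2P //|g /mbdd_SL2 //|A bA].
have [dA|dA] := eqVneq (\det A) 1.
  left; have dA' : \det A == 1 by rewrite dA.
  by exists (MkSL2 dA') => //; apply/mbdd_SL2.
right; exists (valuation (\det A - 1) + 1 - N) => h /mbdd_SL2 bh nh.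
have := det_near bA bh nh; by rewrite (eqP (valP h)) subrK vgeE ?subr_eq0 // gerDl.
Qed.

(** Bounding the valuation of the determinant from above keeps limits invertible. *)
Lemma compact_GL2 N :
  compact [set g : GL2 F | [/\ mbdd N (val g), vge 0 (\det (val g)) & ~~ vge 2 (\det (val g))]].
Proof.
apply: (@compact_bounded _ (fun g : GL2 F => val g) N) => [g U /nbhs_GL2P //|g []//|A bA].
have [d2|nd2] := boolP (vge 2 (\det A)).
  right; exists (2 - N) => h [bh _ /negP nd2h] nh; apply: nd2h.
  by have := det_near bA bh nh; rewrite subrK => dd; rewrite -(subKr (\det A) (\det _)) vgeB.
have [d0|nd0] := boolP (vge 0 (\det A)).
  have uA : A \in unitmx.
    by rewrite unitmxE unitfE; apply: contraNneq nd2 => ->; exact: vge0.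
  by left; exists (MkGL2 uA).
right; exists (0 - N) => h [bh d0h _] nh; move/negP: nd0; apply.
by have := det_near bA bh nh; rewrite subrK => dd; rewrite -(subrK (\det (val h)) (\det A)) vgeD.
Qed.

(** Each matrix of a net is replaced by an element of [S] close to it, when there is one; the net
    thus lies in [S] itself. *)
Lemma SL2_net N n (S : SL2 F -> Prop) : (forall g, S g -> bdd N g) ->
  exists s : seq (SL2 F), (forall g, g \in s -> S g) /\
    forall g, S g -> exists2 h, h \in s & near n g h.
Proof.
move=> bS; have [s sP] := finite_mx_net N n.
suff [s' [s'S s'P]] : exists s' : seq (SL2 F), (forall g, g \in s' -> S g) /\
    forall A, A \in s -> forall g, S g -> mnear n (val g) A -> exists2 h, h \in s' & near n g h.
  exists s'; split=> // g Sg; have [A As gA] := sP _ ((mbdd_SL2 _ _).2 (bS g Sg)).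
  exact: s'P As g Sg gA.
elim: s {sP} => [|A s [s' [s'S s'P]]]; first by exists [::].
have [[g0 [Sg0 g0A]]|nA] := pselect (exists g, S g /\ mnear n (val g) A).
  exists (g0 :: s'); split=> [g|B]; rewrite !inE.
    by move=> /orP[/eqP ->|/s'S].
  move=> /orP[/eqP -> g Sg gA|Bs g Sg gB].
    exists g0; rewrite ?mem_head //; apply/mnear_SL2 => i j.
    by apply: vge_trans (gA i j) _; apply: vge_sym; exact: g0A.
  by have [h hs gh] := s'P _ Bs g Sg gB; exists h => //; rewrite inE hs orbT.
exists s'; split=> // B; rewrite inE => /orP[/eqP -> g Sg gA|Bs]; last exact: s'P.
by case: nA; exists g.
Qed.

End Compactness.

(** * Pro-p invariants and the operators S0, S1 *)

Section ProP.
Variables (p f : nat) (F : completeValuedFieldType) (C : closedFieldType).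
Variables (iota : {rmorphism residue_field F -> C}) (D : resdata p f iota).
Implicit Types (g h : SL2 F) (i j k n m : int).
Local Notation om := (uniformizer : F).

Lemma near_mulr n g h (k : SL2 F) : inK k -> near n g h -> near n (g * k)%g (h * k)%g.
Proof.
move=> /and4P[? ? ? ?] /and4P[? ? ? ?]; apply/and4P; rewrite !eM.
by split; rewrite opprD addrACA -!mulrBl vgeD // vgeMr.
Qed.

Lemma near_mull n g h (k : SL2 F) : inK k -> near n g h -> near n (k * g)%g (k * h)%g.
Proof.
move=> /and4P[? ? ? ?] /and4P[? ? ? ?]; apply/and4P; rewrite !eM.
by split; rewrite opprD addrACA -!mulrBr vgeD // vgeMl.
Qed.

Lemma Kn_conj n g (k : SL2 F) : inK g -> Kn n k -> Kn n (g^-1 * k * g)%g.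
Proof.
move=> gK; rewrite -!near1 => /(near_mulr gK); rewrite mul1g.
by move=> /(near_mull (inKV gK)); rewrite mulVg mulgA.
Qed.

(** Levels for the diagonal, the upper right and the lower left entry. The triples (m, m, m) and (1,
    0, 1) give [Kn m] and [I1], which are treated together. *)
Definition Qn i j k g := [&& vge i (ea g - 1), vge j (eb g), vge k (ec g) & vge i (ed g - 1)].

(** The entries of gh - hg are bilinear in the deviations of g and h from the identity. *)
Lemma Qn_comm i j k n g h : n <= i + j -> n <= i + k -> n <= j + k ->
  Qn i j k g -> Qn i j k h -> near n (g * h)%g (h * g)%g.
Proof.
move=> nij nik njk /and4P[ga gb gc gd] /and4P[ha hb hc hd]; apply/and4P; rewrite !eM; split.
- have -> : ea g * ea h + eb g * ec h - (ea h * ea g + eb h * ec g) =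
    eb g * ec h - eb h * ec g by ring.
  by rewrite vgeB //; apply: vge_le njk _; exact: vgeM.
- have -> : ea g * eb h + eb g * ed h - (ea h * eb g + eb h * ed g) =
    ((ea g - 1) - (ed g - 1)) * eb h - ((ea h - 1) - (ed h - 1)) * eb g by ring.
  by rewrite vgeB //; apply: vge_le nij _; apply: vgeM => //; exact: vgeB.
- have -> : ec g * ea h + ed g * ec h - (ec h * ea g + ed h * ec g) =
    ((ea h - 1) - (ed h - 1)) * ec g - ((ea g - 1) - (ed g - 1)) * ec h by ring.
  by rewrite vgeB //; apply: vge_le nik _; apply: vgeM => //; exact: vgeB.
- have -> : ec g * eb h + ed g * ed h - (ec h * eb g + ed h * ed g) =
    eb h * ec g - eb g * ec h by ring.
  by rewrite vgeB //; apply: vge_le njk _; exact: vgeM.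
Qed.

Definition pw g (r : nat) : SL2 F := iter r (fun h => g * h)%g 1%g.

(** By induction g^r = 1 + r (g - 1) modulo level n, because the products of deviations that occur
    vanish at that level. For r = p the linear term gains one level, as p lies in the maximal
    ideal. *)
Lemma Qn_power i j k n g : n <= i + j -> n <= i + k -> n <= j + k -> n <= i + i ->
  n <= 1 + i -> n <= 1 + j -> n <= 1 + k ->
  (forall r, Qn i j k (pw g r)) -> Kn n (pw g p).
Proof.
move=> nij nik njk nii ni nj nk Qr.
have /and4P[ga gb gc gd] : Qn i j k g by have := Qr 1%N; rewrite /pw /= mulg1.
have H r : [&& vge n (ea (pw g r) - 1 - r%:R * (ea g - 1)),
    vge n (eb (pw g r) - r%:R * eb g), vge n (ec (pw g r) - r%:R * ec g) &
    vge n (ed (pw g r) - 1 - r%:R * (ed g - 1))].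
  elim: r => [|r /and4P[ha hb hc hd]].
    by rewrite /pw /= !eM !mul0r !subr0 subrr !vge0.
  have /and4P[ra rb rc rd] := Qr r.
  rewrite /pw iterS -/(pw g r) !eM -natr1; apply/and4P; split.
  - have -> : ea g * ea (pw g r) + eb g * ec (pw g r) - 1 - (r%:R + 1) * (ea g - 1) =
      (ea (pw g r) - 1 - r%:R * (ea g - 1)) + (ea g - 1) * (ea (pw g r) - 1) + eb g * ec (pw g r) by ring.
    apply: vgeD; last by apply: vge_le njk _; exact: vgeM.
    by apply: vgeD => //; apply: vge_le nii _; exact: vgeM.
  - have -> : ea g * eb (pw g r) + eb g * ed (pw g r) - (r%:R + 1) * eb g =
      (eb (pw g r) - r%:R * eb g) + (ea g - 1) * eb (pw g r) + (ed (pw g r) - 1) * eb g by ring.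
    apply: vgeD; last by apply: vge_le nij _; exact: vgeM.
    by apply: vgeD => //; apply: vge_le nij _; exact: vgeM.
  - have -> : ec g * ea (pw g r) + ed g * ec (pw g r) - (r%:R + 1) * ec g =
      (ec (pw g r) - r%:R * ec g) + (ea (pw g r) - 1) * ec g + (ed g - 1) * ec (pw g r) by ring.
    apply: vgeD; last by apply: vge_le nik _; exact: vgeM.
    by apply: vgeD => //; apply: vge_le nik _; exact: vgeM.
  - have -> : ec g * eb (pw g r) + ed g * ed (pw g r) - 1 - (r%:R + 1) * (ed g - 1) =
      (ed (pw g r) - 1 - r%:R * (ed g - 1)) + (ed g - 1) * (ed (pw g r) - 1) + eb (pw g r) * ec g by ring.
    apply: vgeD; last by apply: vge_le njk _; exact: vgeM.
    by apply: vgeD => //; apply: vge_le nii _; exact: vgeM.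
have /and4P[ha hb hc hd] := H p; have p1 := vge1_p D.
apply/and4P; split.
- rewrite -(subrK (p%:R * (ea g - 1)) (_ - 1)) vgeD //; apply: vge_le ni _; exact: vgeM.
- rewrite -(subrK (p%:R * eb g) (eb _)) vgeD //; apply: vge_le nj _; exact: vgeM.
- rewrite -(subrK (p%:R * ec g) (ec _)) vgeD //; apply: vge_le nk _; exact: vgeM.
- rewrite -(subrK (p%:R * (ed g - 1)) (_ - 1)) vgeD //; apply: vge_le ni _; exact: vgeM.
Qed.

Lemma nth_error_map_mem (T : eqType) (S : Type) (e : T -> S) (s : seq T) (i : nat) y :
  List.nth_error [seq e x | x <- s] i = Some y -> exists2 x, x \in s & y = e x.
Proof.
elim: s i => [[]//|x s IHs] [|i] /=; first by move=> [<-]; exists x; rewrite ?mem_head.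
by move=> /IHs[z zs ->]; exists z; rewrite // inE zs orbT.
Qed.

Lemma nth_error_map (T : eqType) (S : Type) (e : T -> S) (s : seq T) x :
  x \in s -> exists i : nat, List.nth_error [seq e x | x <- s] i = Some (e x).
Proof.
elim: s => //= y s IHs; rewrite inE => /orP[/eqP ->|/IHs[i ei]]; first by exists 0.
by exists i.+1.
Qed.

Section Step.
Variables (pi : rep C (SL2 F)) (W : pi -> Prop) (sW : subsp W).
Hypothesis invW : forall g x, inK g -> W x -> W (rep_act pi g x).

Definition fixedby (H : SL2 F -> bool) (x : pi) := forall g, H g -> rep_act pi g x = x.

Lemma iter_act g r x : iter r (rep_act pi g) x = rep_act pi (pw g r) x.
Proof.
by elim: r => [|r IHr]; rewrite /pw /= ?rep_act1 // IHr -rep_actM.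
Qed.

(** [H'] modulo [Kn n] is abelian of exponent p, so finitely many representatives act on the vectors
    fixed by [Kn n] through commuting operators with p-th power 1. *)
Lemma fixed_step (H H' : SL2 F -> bool) n x :
  (forall g, H' g -> inK g) -> (forall g, Kn n g -> H g) ->
  (forall g, H g -> Kn n g) ->
  (forall g h, H' g -> H' h -> near n (g * h)%g (h * g)%g) ->
  (forall g, H' g -> Kn n (pw g p)) ->
  W x -> x != 0 -> fixedby H x -> exists y, [/\ W y, y != 0 & fixedby H' y].
Proof.
move=> H'K KH HK comm power Wx x0 Hx.
have [s [sH' sP]] := SL2_net D n H'K.
pose Good y := W y /\ fixedby H y.
have sG : subsp Good.
  split; first by split; [exact: sW.1 | move=> g _; rewrite linear0].
  move=> a y z [Wy Hy] [Wz Hz]; split; first exact: sW.2.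
  by move=> g Hg; rewrite linearP Hy // Hz.
have invG g y : H' g -> Good y -> Good (rep_act pi g y).
  move=> H'g [Wy Hy]; split; first by apply: invW => //; exact: H'K.
  move=> h Hh; rewrite -rep_actM -[(h * g)%g](mulVKg g) rep_actM.
  rewrite Hy // mulgA; apply/KH/Kn_conj; [exact: H'K | exact: HK].
have [||z [[Wz Hz] z0 Fz]] := @commuting_unipotents_fixed C pi p
    [seq rep_act pi g | g <- s] Good x (rd_pchar D) sG (conj Wx Hx) x0.
- move=> i L Hi y Gy; have [g gs ->] := nth_error_map_mem Hi; have H'g := sH' _ gs.
  by split; [exact: invG | rewrite iter_act; apply/Gy.2/KH/power].
- move=> i j L M Hi Hj y [Wy Hy].
  have [g gs ->] := nth_error_map_mem Hi; have [h hs ->] := nth_error_map_mem Hj.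
  have H'g := sH' _ gs; have H'h := sH' _ hs.
  have e : rep_act pi ((h * g)^-1 * (g * h))%g y = y.
    apply: Hy; apply: KH.
    have := near_KnV (inKM (H'K _ H'h) (H'K _ H'g)) (near_sym (comm _ _ H'g H'h)).
    by rewrite add0r.
  by rewrite -!rep_actM -{2}e -rep_actM mulVKg.
exists z; split=> // g H'g; have [h hs gh] := sP g H'g.
have [i ei] := nth_error_map (fun g => rep_act pi g) hs.
rewrite -[g](mulVKg h) rep_actM Hz ?(Fz _ _ ei) //; apply: KH.
by have := near_KnV (H'K _ (sH' _ hs)) (near_sym gh); rewrite add0r.
Qed.

Lemma pw_closed (H : SL2 F -> bool) g : H 1%g -> (forall g h, H g -> H h -> H (g * h)%g) ->
  H g -> forall r, H (pw g r).
Proof. by move=> H1 HM Hg; elim=> //= r; exact: HM. Qed.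

(** Descent through the levels n, n - 1, ..., 1: for m >= 1 one has m + 1 <= m + m, so each quotient
    is abelian of exponent p. *)
Lemma exists_K1_fixed n x : 1 <= n -> W x -> x != 0 -> fixedby (Kn n) x ->
  exists y, [/\ W y, y != 0 & fixedby (Kn 1) y].
Proof.
move=> n1; have -> : n = 1 + (`|n - 1|%N)%:Z by lia.
elim: (`|n - 1|%N) x => [|r IHr] x Wx x0; first by rewrite addr0; exists x.
move=> Hx; pose m : int := 1 + r%:Z.
have H1 : forall g h, Kn m g -> Kn m h -> near (1 + r.+1%:Z) (g * h)%g (h * g)%g.
  by move=> g h; apply: Qn_comm; rewrite /m; lia.
have H2 : forall g, Kn m g -> Kn (1 + r.+1%:Z) (pw g p).
  move=> g gm; apply: (@Qn_power m m m); rewrite /m; try lia.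
  apply: (@pw_closed (Kn m)) => //; last by move=> ? ?; apply: KnM; rewrite /m; lia.
  by rewrite /Kn !eM subrr !vge0.
have H0 : forall g, Kn m g -> inK g by move=> g; apply: Kn_inK; rewrite /m; lia.
have [y [Wy y0 Hy]] := fixed_step H0 (fun g e => e) (fun g e => e) H1 H2 Wx x0 Hx.
exact: IHr Wy y0 Hy.
Qed.

(** The last step, from [Kn 1] to [I1]; the quotient is the group of upper unipotent matrices over
    the residue field. *)
Lemma exists_I1_fixed n x : 1 <= n -> W x -> x != 0 -> fixedby (Kn n) x ->
  exists y, [/\ W y, y != 0 & fixedby (@I1 F) y].
Proof.
move=> n1 Wx x0 Hx; have [y [Wy y0 Hy]] := exists_K1_fixed n1 Wx x0 Hx.
have H1 : forall g h, I1 g -> I1 h -> near 1 (g * h)%g (h * g)%g.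
  by move=> g h; apply: (@Qn_comm 1 0 1).
have H2 : forall g, I1 g -> Kn 1 (pw g p).
  move=> g gI; apply: (@Qn_power 1 0 1) => //.
  by apply: (@pw_closed (@I1 F)) => //; [exact: I1_1 | exact: I1M].
exact: (fixed_step (@I1_inK F) (fun g e => e) (fun g e => e) H1 H2 Wy y0 Hy).
Qed.

End Step.

Lemma smooth_I1_fixed (pi : rep C (SL2 F)) (W : pi -> Prop) x : smooth pi -> subsp W ->
  (forall g y, W y -> W (rep_act pi g y)) -> W x -> x != 0 ->
  exists y, [/\ W y, y != 0 & fixedby (@I1 F) y].
Proof.
move=> /smoothP sm sW iW Wx x0; have [n n1 nx] := sm x.
exact: (exists_I1_fixed sW (fun g y _ => iW g y) n1 Wx x0 nx).
Qed.

Lemma smooth_K1_fixed (pi : rep C (SL2 F)) (W : pi -> Prop) x : smooth pi -> subsp W ->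
  (forall g y, W y -> W (rep_act pi g y)) -> W x -> x != 0 ->
  exists y, [/\ W y, y != 0 & fixedby (Kn (1 : int)) y].
Proof.
move=> /smoothP sm sW iW Wx x0; have [n n1 nx] := sm x.
exact: (exists_K1_fixed sW (fun g y _ => iW g y) n1 Wx x0 nx).
Qed.

End ProP.

(** * Relations between S0, S1 and the two maximal compact subgroups *)

Section Hecke.
Variables (p f : nat) (F : completeValuedFieldType) (C : closedFieldType).
Variables (iota : {rmorphism residue_field F -> C}) (D : resdata p f iota).
Implicit Types (g h k : SL2 F) (pi : rep C (SL2 F)).
Local Notation om := (uniformizer : F).
Local Notation q := (p ^ f)%N.
Local Notation lam := (lam D).
Local Notation i0 := (lam_zero D).
Local Notation rho := (@rho F C iota).

(* Conjugation by [[0, 1], [varpi, 0]], which normalizes the Iwahori subgroup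
   and exchanges the two maximal compact subgroups containing it. *)
Definition cPi g : SL2 F := mk (ed g) (ec g / om) (om * eb g) (ea g).

Fact cPi_det g : ed g * ea g - ec g / om * (om * eb g) = 1.
Proof. by rewrite -(ead_bc g); field; exact: om_neq0. Qed.
Lemma cPiE g : (ea (cPi g) = ed g) * (eb (cPi g) = ec g / om) *
  (ec (cPi g) = om * eb g) * (ed (cPi g) = ea g).
Proof. by rewrite /cPi ea_mk ?eb_mk ?ec_mk ?ed_mk ?cPi_det. Qed.
Fact cPi1 : cPi 1%g = 1%g.
Proof. by apply: sl2P; rewrite !cPiE !eM ?mul0r ?mulr0. Qed.
Fact cPiM g h : cPi (g * h)%g = (cPi g * cPi h)%g.
Proof. by have o0 := om_neq0 F; apply: sl2P; rewrite !(cPiE, eM); fld. Qed.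
Lemma cPiK g : cPi (cPi g) = g.
Proof. by apply: sl2P; rewrite !cPiE //; field; exact: om_neq0. Qed.
Lemma cPi_I1 g : I1 g -> I1 (cPi g).
Proof.
move=> /and4P[a1 b0 c1 d1]; apply/and4P; rewrite !cPiE; split=> //.
  by move: c1; rewrite -{1}(divfK (om_neq0 F) (ec g)) mulrC vge_om1M subrr.
by rewrite vge_om1M subrr.
Qed.
Lemma cPi_u x : cPi (u x) = l (om * x).
Proof. by apply: sl2P; rewrite !cPiE !eM ?mul0r. Qed.
Lemma cPi_h a : a != 0 -> cPi (hh a) = hh a^-1.
Proof.
move=> a0; have a0' := invr_neq0 a0.
by apply: sl2P; rewrite !cPiE !hE // ?invrK ?mul0r ?mulr0.
Qed.
(** [w] and [w1] are the simple reflections of the affine Weyl group. *)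
Definition w1 : SL2 F := cPi w.
Lemma w1E : (ea w1 = 0) * (eb w1 = - om^-1) * (ec w1 = om) * (ed w1 = 0).
Proof. by rewrite /w1 !cPiE !eM mulr1 mulN1r. Qed.
Lemma w_w1 : (w * w1 = hh om)%g.
Proof. by apply: sl2P; rewrite !(eM, w1E) !hE ?om_neq0 //; ring. Qed.
Lemma w1_tV : w1 = ((hh om)^-1 * w^-1)%g.
Proof. by apply: sl2P; rewrite !(eM, w1E) !hE ?om_neq0 //; ring. Qed.

Definition tw pi : rep C (SL2 F) := twist pi cPi1 cPiM.

Definition I1f pi (v : pi) := fixedby (@I1 F) v.
Definition chi pi (theta : F -> C) (v : pi) :=
  forall a, unitO a -> rep_act pi (hh a) v = theta a *: v.
Definition I1chi pi theta (v : pi) := I1f v /\ chi theta v.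

Lemma I1chi_subsp pi theta : subsp (@I1chi pi theta).
Proof.
split; first by split=> [g _|a _]; rewrite linear0 ?scaler0.
move=> a x y [Ix cx] [Iy cy]; split=> [g Ig|b ub].
  by rewrite linearP Ix // Iy.
by rewrite linearP cx // cy // scalerDr !scalerA mulrC.
Qed.

Lemma I1chi_tw pi theta (v : pi) : I1chi theta v -> @I1chi (tw pi) (fun a => theta a^-1) v.
Proof.
move=> [Iv cv]; split=> [g Ig|a ua]; first by apply: Iv; exact: cPi_I1.
by rewrite /= cPi_h ?unitO_neq0 // cv // unitOV.
Qed.

Lemma I1chi_ext pi th th' (v : pi) : (forall a, unitO a -> th a = th' a) ->
  I1chi th v -> I1chi th' v.
Proof. by move=> e [Iv cv]; split=> // a ua; rewrite -e // cv. Qed.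

Lemma I1chi_twV pi theta (v : pi) : @I1chi (tw pi) theta v -> @I1chi pi (fun a => theta a^-1) v.
Proof.
move=> [Iv cv]; split=> [g Ig|a ua].
  by have := Iv _ (cPi_I1 Ig); rewrite /= cPiK.
have := cv _ (unitOV ua); rewrite /= cPi_h ?invr_neq0 ?unitO_neq0 //.
by rewrite invrK.
Qed.

Definition S0fun pi (v : pi) : pi := \sum_(i < q) rep_act pi (u (lam i) * w)%g v.
Fact S0fun_linear pi : linear (@S0fun pi).
Proof.
move=> a x y; rewrite /S0fun scaler_sumr -big_split; apply: eq_bigr => i _ /=.
by rewrite linearP.
Qed.
HB.instance Definition _ pi := GRing.isLinear.Build C pi pi _ (@S0fun pi) (@S0fun_linear pi).
Definition S0 pi : {linear pi -> pi} := @S0fun pi.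
(** Defining S1 as S0 of the twist makes every statement on S0 available for S1 without a second
    computation. *)
Definition S1 pi : {linear pi -> pi} := S0 (tw pi).
Definition At pi : {linear pi -> pi} := S0 pi \o S1 pi.

Lemma S0E pi (v : pi) : S0 pi v = \sum_(i < q) rep_act pi (u (lam i) * w)%g v.
Proof. by []. Qed.
Lemma S1E pi (v : pi) : S1 pi v = \sum_(i < q) rep_act pi (l (om * lam i) * w1)%g v.
Proof. by rewrite /S1 S0E; apply: eq_bigr => i _; rewrite /= cPiM cPi_u. Qed.
Lemma AtE0 pi (v : pi) : At pi v = S0 pi (S1 pi v). Proof. by []. Qed.

Lemma hom_S0 pi rho' (phi : rep_hom pi rho') v : phi (S0 pi v) = S0 rho' (phi v).
Proof. by rewrite !S0E linear_sum; apply: eq_bigr => i _; rewrite rep_homJ. Qed.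
Lemma hom_S1 pi rho' (phi : rep_hom pi rho') v : phi (S1 pi v) = S1 rho' (phi v).
Proof. by rewrite !S1E linear_sum; apply: eq_bigr => i _; rewrite rep_homJ. Qed.
Lemma hom_At pi rho' (phi : rep_hom pi rho') v : phi (At pi v) = At rho' (phi v).
Proof. by rewrite !AtE0 hom_S0 hom_S1. Qed.
Lemma hom_I1chi pi rho' (phi : rep_hom pi rho') th v : I1chi th v -> I1chi th (phi v).
Proof.
move=> [Iv cv]; split=> [g Ig|a ua]; first by rewrite -rep_homJ Iv.
by rewrite -rep_homJ cv // linearZ.
Qed.

(** [w * w1 = hh om] turns the two reflections into a translation by two steps of the tree. *)
Lemma AtE pi (v : pi) : At pi v = \sum_(z <- digit2 D) rep_act pi (u z * hh om)%g v.
Proof.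
rewrite AtE0 S0E S1E big_allpairs_dep /= big_enum /=; apply: eq_bigr => i _.
rewrite linear_sum big_enum /=; apply: eq_bigr => j _.
rewrite -rep_actM -mulgA [(w * _)%g]mulgA w_l -mulgA w_w1 mulgA -uD.
by [].
Qed.

Lemma om2n_neq0 (n : nat) : om ^+ n != 0. Proof. by rewrite expf_neq0 // om_neq0. Qed.

Lemma iter_At pi (v : pi) n :
  iter n (At pi) v = \sum_(z <- digits D n) rep_act pi (u z * hh (om ^+ n))%g v.
Proof.
elim: n => [|n IHn].
  by rewrite big_seq1 expr0 h1 u0 mulg1 rep_act1.
rewrite iterS IHn AtE digitsS [RHS]big_allpairs_dep /=; apply: eq_bigr => z _.
rewrite linear_sum; apply: eq_bigr => y _; rewrite -rep_actM; apply: rep_ext.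
rewrite -!mulgA [(hh om * _)%g]mulgA h_u ?om_neq0 // uD -!mulgA.
by rewrite [om ^+ n.+1]exprS hM ?om_neq0 ?om2n_neq0.
Qed.

Section Theory.
Variables (pi : rep C (SL2 F)) (theta : F -> C) (v : pi).
Hypothesis Iv : I1f v.

Lemma I1f_u x : vge 0 x -> rep_act pi (u x) v = v. Proof. by move=> ?; apply/Iv/I1_u. Qed.
Lemma I1f_l x : vge 1 x -> rep_act pi (l x) v = v. Proof. by move=> ?; apply/Iv/I1_l. Qed.

Lemma uw_periodic : periodic (fun x => rep_act pi (u x * w)%g v).
Proof.
move=> x y x0 y0 xy; have -> : (u x * w = u y * w * l (y - x))%g.
  by rewrite -mulgA w_l mulgA -uD opprB addrC subrK.
by rewrite rep_actM I1f_l // vgeBC.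
Qed.

Lemma S0_u x : vge 0 x -> rep_act pi (u x) (S0 pi v) = S0 pi v.
Proof.
move=> x0; rewrite S0E linear_sum.
rewrite -[RHS](sum_lam_shift D x0 uw_periodic); apply: eq_bigr => i _.
by rewrite -rep_actM mulgA -uD.
Qed.

(** Each of the three Iwahori factors permutes the cosets of the [u (lam i) * w] modulo I1. *)
Lemma S0_I1f : I1f (S0 pi v).
Proof.
move=> g /I1_factor[x [a [y [x0 a1 y1 ->]]]].
have ua := unitO_1D a1; have an0 := unitO_neq0 ua.
have -> : rep_act pi (u x * hh a * l y)%g (S0 pi v) = rep_act pi (u x) (S0 pi v); last exact: S0_u.
rewrite -mulgA rep_actM; congr (rep_act pi _ _); rewrite rep_actM.
have -> : rep_act pi (l y) (S0 pi v) = S0 pi v.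
  rewrite S0E linear_sum; apply: eq_bigr => i _; rewrite -rep_actM.
  have y0 := vge01 y1; have xi0 := lam_int D i.
  have d1 : vge 1 ((1 + y * lam i) - 1) by rewrite addrC addKr vgeMr.
  have ud := unitO_1D d1; have dn0 := unitO_neq0 ud.
  (* Moving [l y] to the right acts on the parameter by the homography x -> x / (1 + y x), which is
     the identity modulo the uniformizer because y vanishes there. *)
  have -> : (l y * (u (lam i) * w) = u (lam i / (1 + y * lam i)) * w *
      (hh (1 + y * lam i) * u (- (y / (1 + y * lam i)))))%g.
    apply: sl2P; rewrite !(eM, hE) //; fld; exact: dn0.
  rewrite rep_actM Iv; last first.
    apply: I1M; first exact: I1_h.
    by apply/I1_u/vgeN/vgeMr; [exact: y0 | exact: unitO_vgeV].
  apply: uw_periodic => //; first by rewrite vgeMr // unitO_vgeV.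
  have -> : lam i / (1 + y * lam i) - lam i = - (lam i / (1 + y * lam i) * (y * lam i)).
    by field; exact: dn0.
  by rewrite vgeN // vgeMl ?vgeMr // unitO_vgeV.
rewrite S0E linear_sum; apply: eq_bigr => i _; rewrite -rep_actM mulgA h_u // -mulgA h_w //.
rewrite mulgA rep_actM Iv; last first.
  apply: I1_h; have -> : a^-1 - 1 = - (a^-1 * (a - 1)) by field.
  by rewrite vgeN // vgeMl // unitO_vgeV.
apply: uw_periodic; rewrite ?lam_int //.
  by rewrite vgeMl ?lam_int // vgeX // unitO_vge.
have -> : a ^+ 2 * lam i - lam i = (a - 1) * ((a + 1) * lam i) by ring.
by rewrite vgeMr // vgeMl ?lam_int // vgeD ?vge1 // unitO_vge.
Qed.

Hypothesis cv : chi theta v.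

Lemma S0_chi : chi (fun a => theta a^-1) (S0 pi v).
Proof.
move=> a ua; have an0 := unitO_neq0 ua; rewrite S0E linear_sum scaler_sumr.
have P : periodic (fun x => theta a^-1 *: rep_act pi (u x * w)%g v).
  by move=> x y x0 y0 xy; rewrite (uw_periodic x0 y0 xy).
rewrite -[RHS](sum_lam_scale D (unitOM ua ua) P); apply: eq_bigr => i _.
rewrite -rep_actM mulgA h_u // -mulgA h_w // mulgA rep_actM cv ?unitOV //.
by rewrite linearZ.
Qed.

(** The coefficient of the quadratic relations: the sum of a character over the nonzero residue
    classes, -1 for the trivial character and 0 for the others that occur. *)
Definition csum (th : F -> C) : C := \sum_(i < q | i != i0) th (lam i).

Lemma wuw_v x : unitO x ->
  rep_act pi (w * u x * w)%g v = theta (- x) *: rep_act pi (u (- x^-1) * w)%g v.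
Proof.
move=> ux; have x0 := unitO_neq0 ux; rewrite wuw // rep_actM I1f_u; last first.
  by rewrite vgeN // unitO_vgeV.
by rewrite rep_actM cv ?unitON // linearZ.
Qed.

(** The zero class gives q equal vectors, hence 0. By [wuw] each other class gives a scalar times S0
    v, up to an integral [u] that S0 v absorbs. *)
Lemma S0S0 : S0 pi (S0 pi v) = csum (fun a => theta (- a)) *: S0 pi v.
Proof.
transitivity (S0 pi (\sum_(i < q) rep_act pi (u (lam i) * w)%g v)); first by rewrite -S0E.
rewrite linear_sum (bigD1 i0) //= lam0 u0 mul1g.
have -> : S0fun (rep_act pi w v) = 0.
  rewrite S0E (eq_bigr (fun=> theta (-1) *: v)) => [|i _]; first exact: (sum_lam_const D).
  rewrite -rep_actM -mulgA ww rep_actM cv ?unitON ?unitO1 // linearZ /=.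
  by rewrite I1f_u // lam_int.
rewrite add0r /csum scaler_suml; apply: eq_bigr => i ii0.
have ui := unit_lam ii0; have y0 : vge 0 (- (lam i)^-1) by rewrite vgeN // unitO_vgeV.
rewrite -(S0_u y0) !S0E linear_sum scaler_sumr; apply: eq_bigr => j _.
rewrite -!rep_actM.
have -> : (u (lam j) * w * (u (lam i) * w) = u (lam j) * (w * u (lam i) * w))%g by rewrite !mulgA.
by rewrite (rep_actM (u (lam j))) (wuw_v ui) linearZ /= -rep_actM !mulgA -!uD [_ + lam j]addrC.
Qed.

End Theory.

Lemma csum_inv th : (forall a b, unitO a -> unitO b -> vge 1 (a - b) -> th a = th b) ->
  csum (fun a => th a^-1) = csum th.
Proof.
move=> thP; apply: (@big_lam_reindex0 _ _ _ _ _ D _ _ _ (fun x => x^-1) th) => //.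
  exact: unitOV.
move=> x y ux uy; have x0 := unitO_neq0 ux; have y0 := unitO_neq0 uy.
have -> : x^-1 - y^-1 = (x * y)^-1 * (y - x) by fld.
by rewrite vge_unitM ?unitOV ?unitOM // vgeBC.
Qed.

Lemma S1_I1chi pi theta (v : pi) : I1chi theta v -> I1chi (fun a => theta a^-1) (S1 pi v).
Proof.
move=> /I1chi_tw[Iv cv]; apply: I1chi_ext (I1chi_twV (conj (S0_I1f Iv) (S0_chi Iv cv))).
by move=> a _; rewrite invrK.
Qed.

Lemma S0_I1chi pi theta (v : pi) : I1chi theta v -> I1chi (fun a => theta a^-1) (S0 pi v).
Proof. by move=> [Iv cv]; split; [exact: S0_I1f | exact: S0_chi]. Qed.

Lemma At_I1chi pi theta (v : pi) : I1chi theta v -> I1chi theta (At pi v).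
Proof.
move=> /S1_I1chi /S0_I1chi; apply: I1chi_ext => a _; by rewrite invrK.
Qed.

Lemma S1S1 pi theta (v : pi) : I1chi theta v ->
  S1 pi (S1 pi v) = csum (fun a => theta (- a)^-1) *: S1 pi v.
Proof. by move=> /I1chi_tw[Iv cv]; exact: S0S0 Iv cv. Qed.

Section Trivial.
Variables (pi : rep C (SL2 F)) (v : pi).
Hypothesis Iv : I1chi (fun=> 1) v.

Lemma K_fixed_of_gen (x : pi) : (forall y, vge 0 y -> rep_act pi (u y) x = x) ->
  rep_act pi w x = x -> forall g, inK g -> rep_act pi g x = x.
Proof.
move=> xu xw; apply: inK_ind => // g h eg eh.
by rewrite rep_actM eh eg.
Qed.

(** v + S0 v is the sum of the translates of [v] over the projective line of the residue field, with
    [v] itself at infinity. [w] exchanges 0 and infinity and acts by x -> -1/x on the other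
    points. *)
Lemma w_addS0 : rep_act pi w (v + S0 pi v) = v + S0 pi v.
Proof.
have [If cf] := Iv; rewrite linearD S0E linear_sum (bigD1 i0) //= lam0 u0 mul1g.
rewrite -rep_actM ww cf ?unitON ?unitO1 // scale1r addrCA; congr (_ + _).
rewrite [in RHS](bigD1 i0) //= lam0 u0 mul1g; congr (_ + _).
transitivity (\sum_(i < q | i != i0) rep_act pi (u (- (lam i)^-1) * w)%g v).
  apply: eq_bigr => i ii0; rewrite -rep_actM mulgA (wuw_v If cf) ?scale1r //.
  exact: unit_lam.
apply: (@big_lam_reindex0 _ _ _ _ _ D _ _ _ (fun x => - x^-1)
  (fun x => rep_act pi (u x * w)%g v)) => [x ux|x y ux uy|x y ux uy].
- by rewrite unitON // unitOV.
- have x0 := unitO_neq0 ux; have y0 := unitO_neq0 uy.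
  have -> : - x^-1 - - y^-1 = (x * y)^-1 * (x - y) by fld.
  by rewrite vge_unitM // unitOV // unitOM.
- by apply: uw_periodic => //; exact: unitO_vge.
Qed.

Lemma addS0_K g : inK g -> rep_act pi g (v + S0 pi v) = v + S0 pi v.
Proof.
apply: K_fixed_of_gen w_addS0 g => y y0.
by rewrite linearD (I1f_u Iv.1) // (S0_u Iv.1).
Qed.

Lemma K_fixed : S0 pi v = 0 -> forall g, inK g -> rep_act pi g v = v.
Proof. by move=> e g gK; have := addS0_K gK; rewrite e addr0. Qed.

End Trivial.

(** Conjugation by powers of [hh om] makes every [u x] integral; the big cell and its translate by
    [w] then cover the group. *)
Lemma SL2_gen_ind (P : SL2 F -> Prop) : (forall g h, P g -> P h -> P (g * h)%g) ->
  (forall x, vge 0 x -> P (u x)) -> P w -> P (hh om) -> P (hh om)^-1%g -> forall g, P g.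
Proof.
move=> PM Pu Pw Pt PtV.
have Ptn (n : nat) : P (hh (om ^+ n)) /\ P (hh (om ^+ n))^-1%g.
  elim: n => [|n [IH1 IH2]].
    have P1 : P 1%g by rewrite -(mulgV (hh om)); exact: (PM).
    by rewrite expr0 h1 invg1.
  by rewrite exprS hM ?om_neq0 ?om2n_neq0 // invgM; split; exact: (PM).
have PU x : P (u x).
  have [->|x0] := eqVneq x 0; first exact: Pu (vge0 _ _).
  pose n := `|valuation x|%N.
  have -> : u x = ((hh (om ^+ n))^-1 * u (om ^+ n ^+ 2 * x) * hh (om ^+ n))%g.
    by rewrite -mulgA -h_u ?om2n_neq0 // mulKg.
  apply: (PM); last exact: (Ptn n).1.
  apply: (PM); first exact: (Ptn n).2.
  apply: Pu; rewrite vgeE ?mulf_neq0 ?expf_neq0 ?om_neq0 //.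
  rewrite valuationM ?expf_neq0 ?om_neq0 // -exprM val_omn; rewrite /n; lia.
have Pwi : P w^-1%g.
  have -> : (w^-1 = w * (w * w) :> SL2 F)%g by sl2.
  by apply: (PM) => //; exact: (PM).
have PL x : P (l x).
  have -> : l x = (w^-1 * u (- x) * w)%g by rewrite -mulgA -w_l mulKg.
  by apply: (PM) => //; exact: (PM).
have Pc g : ec g != 0 -> P g.
  by move=> c0; rewrite (bruhat_ulu c0); apply: (PM) => //; exact: (PM).
move=> g; have [c0|] := eqVneq (ec g) 0; last exact: Pc.
rewrite -(mulKg w g); apply: (PM) => //; apply: Pc.
rewrite !eM mul0r addr0 mulN1r oppr_eq0; apply: contra_eq_neq (ead_bc g) => ->.
by rewrite c0 mul0r mulr0 subr0 eq_sym oner_eq0.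
Qed.

(** [v] is fixed by K and, through the twist, by its conjugate, hence by [w * w1 = hh om]. *)
Lemma G_fixed pi (v : pi) : I1chi (fun=> 1) v -> S0 pi v = 0 -> S1 pi v = 0 ->
  forall g, rep_act pi g v = v.
Proof.
move=> Iv e0 e1; have Kv := K_fixed Iv e0.
have w1v : rep_act pi w1 v = v by exact: (K_fixed (I1chi_tw Iv) e1 (inK_w F)).
have tv : rep_act pi (hh om) v = v.
  by rewrite -w_w1 rep_actM w1v Kv // inK_w.
apply: SL2_gen_ind => //.
- by move=> g h eg eh; rewrite rep_actM eh eg.
- by move=> x x0; rewrite Kv // inK_u.
- by rewrite Kv // inK_w.
- by rewrite -{1}tv rep_actK.
Qed.

End Hecke.

(** * Induction from the Borel subgroup *)

Lemma irreducible_intro (C : fieldType) (G : groupType) (pi : rep C G) :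
  (exists x : pi, x != 0) ->
  (forall P : pi -> Prop, subsp P -> (forall g y, P y -> P (rep_act pi g y)) ->
    forall x, P x -> x != 0 -> forall y, P y) -> irreducible pi.
Proof.
move=> nz H; split=> // W.
have [W0|/existsNP[y /not_implyP[Wy y0]]] := pselect (forall x, x \in W -> x = 0); first by left.
right; apply: (H (fun x => x \in W) (subrep_subsp W) _ y Wy); last exact/eqP.
by move=> g x Wx; exact: (Defs.invariant g Wx).
Qed.

Lemma S1_I1f (p f : nat) (F : completeValuedFieldType) (C : closedFieldType)
    (iota : {rmorphism residue_field F -> C}) (D : resdata p f iota)
    (pi : rep C (SL2 F)) (v : pi) : I1f v -> I1f (S1 D pi v).
Proof.
move=> Iv; have Iv' : @I1f _ _ (tw pi) v by move=> g Ig; exact: (Iv _ (cPi_I1 Ig)).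
by move=> g Ig; have := S0_I1f D Iv' (cPi_I1 Ig); rewrite /= cPiK.
Qed.

Section Characters.
Variables (p f : nat) (F : completeValuedFieldType) (C : closedFieldType).
Variables (iota : {rmorphism residue_field F -> C}) (D : resdata p f iota).
Variables (eta : F -> C) (sm : smooth_character eta).
Local Notation om := (uniformizer : F).
Local Notation q := (p ^ f)%N.
Local Notation lam := (lam D).
Local Notation i0 := (lam_zero D).

Lemma eta_neq0 x : x != 0 -> eta x != 0. Proof. by have [h _ _] := sm; exact: h. Qed.
Lemma etaM x y : x != 0 -> y != 0 -> eta (x * y) = eta x * eta y.
Proof. by have [_ h _] := sm; exact: h. Qed.
Lemma eta1 : eta 1 = 1.
Proof.
have := etaM (oner_neq0 F) (oner_neq0 F); rewrite mulr1 => e.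
by apply: (mulfI (eta_neq0 (oner_neq0 F))); rewrite -e mulr1.
Qed.
Lemma etaV x : x != 0 -> eta x^-1 = (eta x)^-1.
Proof.
move=> x0; apply: (mulfI (eta_neq0 x0)); rewrite -etaM ?invr_neq0 //.
by rewrite !mulfV ?eta1 // eta_neq0.
Qed.
Lemma etaX x (n : nat) : x != 0 -> eta (x ^+ n) = eta x ^+ n.
Proof.
move=> x0; elim: n => [|n IHn]; first by rewrite !expr0 eta1.
by rewrite !exprS etaM ?expf_neq0 // IHn.
Qed.

Lemma vge_power k (x : F) : 1 <= k -> vge k (x - 1) -> vge (k + 1) (x ^+ p - 1).
Proof.
move=> k1 xk; rewrite subrX1; apply: vgeM => //.
have x1 : vge 1 (x - 1) by apply: vge_le xk.
have x0 : vge 0 x by apply: unitO_vge; exact: unitO_1D.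
rewrite (eq_bigr (fun i : 'I_p => (x ^+ i - 1) + 1)) => [|i _]; last by rewrite subrK.
rewrite big_split sumr_const card_ord /= vgeD ?vge1_p //; last exact: (vge1_p D).
elim/big_ind: _ => [||i _]; [exact: vge0 | by move=> *; exact: vgeD |].
rewrite subrX1 vgeMr //; elim/big_ind: _ => [||j _]; [exact: vge0 | by move=> *; exact: vgeD |].
exact: vgeX.
Qed.

(** Taking p-th powers moves 1 + (varpi) towards 1, where [eta] is trivial by smoothness, and an
    element of [C] whose p-th power is 1 equals 1. The induction is on the distance to the level [n]
    of triviality. *)
Lemma eta_pro x : vge 1 (x - 1) -> eta x = 1.
Proof.
have [_ _ op] := sm.
have : nbhs (1 : F) [set x | x != 0 /\ eta x = 1].
  by apply: open_nbhs_nbhs; split=> //; split; [exact: oner_neq0 | exact: eta1].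
move=> /nbhs_vgeP[n nU].
suff H (k : nat) : vge (n - k%:Z) (x - 1) -> vge 1 (x - 1) -> eta x = 1.
  move=> x1; apply: (H (`|n|%N + 1)%N) => //; apply: vge_le x1; lia.
elim: k x => [|k IHk] x xn x1.
  have xn' : vge n (1 - x) by rewrite vgeBC; move: xn; rewrite subr0.
  by have [_ ->] := nU x xn'.
have x0 : x != 0 by apply/unitO_neq0/unitO_1D.
pose k' : int := Num.max 1 (n - k.+1%:Z).
have xk' : vge k' (x - 1) by rewrite /k'; case: (leP 1 (n - k.+1%:Z)).
have xp : vge (k' + 1) (x ^+ p - 1) by apply: vge_power => //; rewrite /k'; lia.
have : eta (x ^+ p) = 1.
  apply: IHk; apply: vge_le xp; rewrite /k'; lia.
rewrite etaX // => e; apply/eqP; rewrite -subr_eq0.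
have := pFrobenius_autB_comm (rd_pchar D) (commr1 (eta x)).
rewrite !pFrobenius_autE e expr1n subrr => /eqP.
by rewrite expf_eq0 => /andP[].
Qed.

Lemma eta_unit x y : unitO x -> unitO y -> vge 1 (x - y) -> eta x = eta y.
Proof.
move=> ux uy xy; have y0 := unitO_neq0 uy.
rewrite -[x](divfK y0) etaM ?mulf_neq0 ?invr_neq0 // ?unitO_neq0 //.
rewrite eta_pro ?mul1r //; have -> : x / y - 1 = y^-1 * (x - y) by field.
by rewrite vge_unitM // unitOV.
Qed.

Definition kap := csum D (fun a => eta (- a^-1)).

Lemma kap_trivial : (forall x, unitO x -> eta x = 1) -> kap = -1.
Proof.
move=> e; rewrite /kap /csum (eq_bigr (fun=> 1)) => [|i ii0].
  rewrite sumr_const (@eq_card _ _ (predC1 i0)) // cardC1 card_ord.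
  by apply/eqP; rewrite -addr_eq0 natr1 prednK ?(q_eq0 D) // ltnW // (q_gt1 D).
by rewrite e // unitON // unitOV // unit_lam.
Qed.

(** Reindexing by a unit on which [eta] is not 1 multiplies the sum by that value. *)
Lemma kap_nontrivial : (exists2 x, unitO x & eta x != 1) -> kap = 0.
Proof.
move=> [a ua a1]; pose T x := eta (- x^-1).
have TP x y : unitO x -> unitO y -> vge 1 (x - y) -> T x = T y.
  move=> ux uy xy; apply: eta_unit; rewrite ?unitON ?unitOV //.
  have x0 := unitO_neq0 ux; have y0 := unitO_neq0 uy.
  have -> : - x^-1 - - y^-1 = (x * y)^-1 * (x - y) by fld.
  by rewrite vge_unitM // unitOV // unitOM.
have := @big_lam_reindex0 _ _ _ _ _ D _ _ +%R (fun x => a^-1 * x) T.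
have a0 := unitO_neq0 ua => H.
have e : kap = eta a * kap.
  rewrite {1}/kap /csum -[LHS]H //; last 2 first.
  - by move=> x ux; rewrite unitOM // unitOV.
  - by move=> x y ux uy; rewrite -mulrBr vge_unitM // unitOV.
  rewrite mulr_sumr; apply: eq_bigr => i ii0; have l0 := unitO_neq0 (unit_lam ii0).
  rewrite /T invfM invrK -mulrN etaM // oppr_eq0 invr_eq0 //.
apply/eqP; apply: contraTT a1 => k0; rewrite negbK; apply/eqP.
by apply: (mulIf k0); rewrite mul1r -e.
Qed.

Local Notation B := (Ind_B eta).
Implicit Types (g h k : SL2 F).

(** The double cosets B w I1 and B I1 ([smallcell]) read on the bottom row: either d/c is integral,
    or c/d lies in the maximal ideal. *)
Definition bigcell g := (ec g != 0) && vge 0 (ed g / ec g).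
Definition smallcell g := (ed g != 0) && vge 1 (ec g / ed g).

Lemma smallcellE g : smallcell g = ~~ bigcell g.
Proof.
rewrite /smallcell /bigcell; have [c0|c0] := eqVneq (ec g) 0; have [d0|d0] := eqVneq (ed g) 0 => /=.
- by have := ead_bc g; rewrite c0 d0 !mulr0 subr0 => /eqP; rewrite eq_sym oner_eq0.
- by rewrite c0 mul0r vge0.
- by rewrite d0 mul0r vge0.
by rewrite !vgeE ?mulf_neq0 ?invr_neq0 // !valuationM ?invr_neq0 // !valV //; lia.
Qed.

Lemma bigcell_I1 g k : I1 k -> bigcell g ->
  bigcell (g * k)%g /\ eta (- (ec (g * k)%g)^-1) = eta (- (ec g)^-1).
Proof.
move=> kI; have /and4P[ka kb kc kd] := I1_inK kI; move: kI => /and4P[a1 _ c1 d1].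
move=> /andP[c0 z0]; pose z := ed g / ec g; rewrite -/z in z0.
have ez : ed g = ec g * z by rewrite /z mulrCA mulfV ?mulr1.
pose s := ea k + z * ec k; have s1 : vge 1 (s - 1).
  have -> : s - 1 = (ea k - 1) + z * ec k by rewrite /s; ring.
  by rewrite vgeD // vgeMl.
have us := unitO_1D s1; have s0 := unitO_neq0 us.
have ec' : ec (g * k)%g = ec g * s by rewrite eM ez /s; ring.
split; last first.
  rewrite ec' invfM -mulNr etaM ?oppr_eq0 ?invr_eq0 // [eta s^-1]eta_pro ?mulr1 //.
  have -> : s^-1 - 1 = - (s^-1 * (s - 1)) by field.
  by rewrite vgeN // vgeMl // unitO_vgeV.
rewrite /bigcell ec' mulf_neq0 //=.
have -> : ed (g * k)%g / (ec g * s) = (eb k + z * ed k) / s by rewrite eM ez; fld.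
by rewrite vgeMr ?unitO_vgeV // vgeD // vgeMl.
Qed.

Lemma smallcell_I1 g k : I1 k -> smallcell g ->
  smallcell (g * k)%g /\ eta (ed (g * k)%g)^-1 = eta (ed g)^-1.
Proof.
move=> kI; have /and4P[ka kb kc kd] := I1_inK kI; move: kI => /and4P[a1 _ c1 d1].
move=> /andP[d0 z0]; pose z := ec g / ed g; rewrite -/z in z0.
have ez : ec g = ed g * z by rewrite /z mulrCA mulfV ?mulr1.
pose s := ed k + z * eb k; have s1 : vge 1 (s - 1).
  have -> : s - 1 = (ed k - 1) + z * eb k by rewrite /s; ring.
  by rewrite vgeD // vgeMr.
have us := unitO_1D s1; have s0 := unitO_neq0 us.
have ed' : ed (g * k)%g = ed g * s by rewrite eM ez /s; ring.
split; last first.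
  rewrite ed' invfM etaM ?invr_eq0 ?invr_neq0 // [eta s^-1]eta_pro ?mulr1 //.
  have -> : s^-1 - 1 = - (s^-1 * (s - 1)) by field.
  by rewrite vgeN // vgeMl // unitO_vgeV.
rewrite /smallcell ed' mulf_neq0 //=.
have -> : ec (g * k)%g / (ed g * s) = (ec k + z * ea k) / s by rewrite eM ez; fld.
by rewrite vgeMr ?unitO_vgeV // vgeD // vgeMr.
Qed.

(** The I1-invariant function supported on B w I1 with value 1 at [w]; [f1fun] is the one supported
    on B I1 with value 1 at 1. The arguments of [eta] are the diagonal entries in [bigcell_decomp]
    and [smallcell_decomp]. *)
Definition fwfun : SL2 F -> C^o := fun g => if bigcell g then eta (- (ec g)^-1) else 0.
Definition f1fun : SL2 F -> C^o := fun g => if smallcell g then eta (ed g)^-1 else 0.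

Lemma fwfun_I1 g k : I1 k -> fwfun (g * k)%g = fwfun g.
Proof.
move=> kI; rewrite /fwfun; case: ifP => [b1|b1]; case: ifP => [b2|b2] //.
- by have [_] := bigcell_I1 kI b2.
- by have [] := bigcell_I1 (I1V kI) b1; rewrite mulgK b2.
- by have [] := bigcell_I1 kI b2; rewrite b1.
Qed.

Lemma f1fun_I1 g k : I1 k -> f1fun (g * k)%g = f1fun g.
Proof.
move=> kI; rewrite /f1fun; case: ifP => [b1|b1]; case: ifP => [b2|b2] //.
- by have [_] := smallcell_I1 kI b2.
- by have [] := smallcell_I1 (I1V kI) b1; rewrite mulgK b2.
- by have [] := smallcell_I1 kI b2; rewrite b1.
Qed.

Lemma locally_constantP (V : Type) (e : SL2 F -> V) : locally_constant e <->
  forall g, exists2 n, 1 <= n & forall k, Kn n k -> e (g * k)%g = e g.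
Proof.
split=> lc g.
  have /nbhs_nearP[n nU] := lc g; have [N [gN N0]] := bdd_ex g.
  exists (Num.max 1 (n - N)); first by rewrite le_max lexx.
  move=> k kn; apply: nU; apply: near_sym; apply: near_le (Kn_near gN kn).
  by rewrite -lerBlDl; lia.
have [n _ nK] := lc g; have [N [gN N0]] := bdd_ex g.
apply/nbhs_nearP; exists (n - N) => h gh.
have := near_KnV gN gh; rewrite addrC subrK => /nK.
by rewrite mulVKg.
Qed.

Lemma Kn_locally_constant (V : Type) (e : SL2 F -> V) n : 1 <= n ->
  (forall g k, Kn n k -> e (g * k)%g = e g) -> locally_constant e.
Proof. by move=> n1 H; apply/locally_constantP => g; exists n => //; exact: H. Qed.

Lemma borel_ea (b : SL2 F) : ec b = 0 -> ea b != 0 /\ ed b = (ea b)^-1.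
Proof.
move=> c0; have := ead_bc b; rewrite c0 mulr0 subr0 => e.
have a0 : ea b != 0 by apply: contra_eq_neq e => ->; rewrite mul0r eq_sym oner_eq0.
by split=> //; apply: (mulfI a0); rewrite e mulfV.
Qed.

Definition iv (e : B) (g : SL2 F) : C := sval e g.
Arguments iv e g : simpl never.

Lemma sum_constC (c : C) : \sum_(i < q) c = 0.
Proof. exact: (sum_lam_const D (c : C^o)). Qed.

Lemma Ind_equiv (e : B) b g : ec b = 0 -> iv e (b * g)%g = eta (ea b) * iv e g.
Proof. by have /asboolP[_ eq] := valP e; move=> c0; exact: (eq b g c0). Qed.

Lemma Ind_lc (e : B) : locally_constant (iv e).
Proof. by have /asboolP[lc _] := valP e; exact: lc. Qed.

Lemma Ind_intro (e : SL2 F -> C^o) : locally_constant e ->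
  (forall b g, ec b = 0 -> e (b * g)%g = eta (ea b) * e g) -> exists x : B, forall g, iv x g = e g.
Proof.
move=> lc eq; have eP : e \in Ind_pred (@borel F) (borel_character eta).
  by apply/asboolP; split=> // b g; exact: eq.
by exists (exist _ e eP : B).
Qed.

Lemma fwfun_equiv b g : ec b = 0 -> fwfun (b * g)%g = eta (ea b) * fwfun g.
Proof.
move=> c0; have [a0 eb] := borel_ea c0; rewrite /fwfun /bigcell !eM c0 !mul0r !add0r eb.
rewrite mulf_eq0 invr_eq0 (negPf a0) /=.
have [->|cg] := eqVneq (ec g) 0; first by rewrite /= mulr0.
have -> : (ea b)^-1 * ed g / ((ea b)^-1 * ec g) = ed g / ec g by fld.
case: ifP => _ /=; last by rewrite mulr0.
by rewrite invfM invrK -mulrN etaM // oppr_eq0 invr_eq0.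
Qed.

Lemma f1fun_equiv b g : ec b = 0 -> f1fun (b * g)%g = eta (ea b) * f1fun g.
Proof.
move=> c0; have [a0 eb] := borel_ea c0; rewrite /f1fun /smallcell !eM c0 !mul0r !add0r eb.
rewrite mulf_eq0 invr_eq0 (negPf a0) /=.
have [->|cg] := eqVneq (ed g) 0; first by rewrite /= mulr0.
have -> : (ea b)^-1 * ec g / ((ea b)^-1 * ed g) = ec g / ed g by fld.
case: ifP => _ /=; last by rewrite mulr0.
by rewrite invfM invrK etaM // invr_eq0.
Qed.

Lemma exists_fw : exists x : B, forall g, iv x g = fwfun g.
Proof.
apply: Ind_intro fwfun_equiv; apply: (@Kn_locally_constant _ _ 1) => // g k /Kn_I1-/(_ isT).
exact: fwfun_I1.
Qed.
Lemma exists_f1 : exists x : B, forall g, iv x g = f1fun g.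
Proof.
apply: Ind_intro f1fun_equiv; apply: (@Kn_locally_constant _ _ 1) => // g k /Kn_I1-/(_ isT).
exact: f1fun_I1.
Qed.
Definition fw : B := projT1 (cid exists_fw).
Definition f1 : B := projT1 (cid exists_f1).
Lemma fwE g : iv fw g = fwfun g. Proof. exact: (projT2 (cid exists_fw)). Qed.
Lemma f1E g : iv f1 g = f1fun g. Proof. exact: (projT2 (cid exists_f1)). Qed.

Lemma Ind_actE (e : B) g h : iv (rep_act B g e) h = iv e (h * g)%g. Proof. reflexivity. Qed.
Lemma Ind_ext (e e' : B) : (forall g, iv e g = iv e' g) -> e = e'.
Proof. by move=> H; apply: val_inj; apply/funext; exact: H. Qed.
Lemma Ind_addE (e e' : B) g : iv (e + e') g = iv e g + iv e' g.
Proof. reflexivity. Qed.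
Lemma Ind_scaleE c (e : B) g : iv (c *: e) g = c * iv e g.
Proof. reflexivity. Qed.
Lemma Ind_zeroE g : iv (0 : B) g = 0.
Proof. reflexivity. Qed.
Lemma Ind_sumE (I : Type) (s : seq I) (P : pred I) (E : I -> B) g :
  iv (\sum_(i <- s | P i) E i) g = \sum_(i <- s | P i) iv (E i) g.
Proof.
elim: s => [|i s IHs]; first by rewrite !big_nil Ind_zeroE.
by rewrite !big_cons; case: ifP; rewrite ?Ind_addE IHs.
Qed.

Lemma fw_I1f : I1f fw.
Proof. by move=> g Ig; apply: Ind_ext => h; rewrite Ind_actE !fwE fwfun_I1. Qed.
Lemma f1_I1f : I1f f1.
Proof. by move=> g Ig; apply: Ind_ext => h; rewrite Ind_actE !f1E f1fun_I1. Qed.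
Lemma fw_1 : iv fw 1%g = 0. Proof. by rewrite fwE /fwfun /bigcell !eM eqxx. Qed.
Lemma fw_w : iv fw w = 1.
Proof.
by rewrite fwE /fwfun /bigcell !eM oppr_eq0 oner_eq0 mul0r vge0 /= invrN opprK invr1 eta1.
Qed.
Lemma f1_1 : iv f1 1%g = 1.
Proof. by rewrite f1E /f1fun /smallcell !eM oner_eq0 mul0r vge0 /= invr1 eta1. Qed.
Lemma f1_w : iv f1 w = 0. Proof. by rewrite f1E /f1fun /smallcell !eM eqxx. Qed.

Lemma bigcell_decomp g : bigcell g -> exists b, [/\ ec b = 0, ea b = - (ec g)^-1,
  g = (b * (w * u (ed g / ec g)))%g & vge 0 (ed g / ec g)].
Proof.
move=> /andP[c0 z0]; exists (u (ea g / ec g) * hh (- (ec g)^-1))%g.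
have n0 : - (ec g)^-1 != 0 by rewrite oppr_eq0 invr_eq0.
split=> //; rewrite ?eM ?hE // ?mulr0 ?mul0r ?add0r ?addr0 ?mul1r //.
by rewrite mulgA; exact: bruhat_uwu.
Qed.

Lemma smallcell_decomp g : smallcell g -> exists b, [/\ ec b = 0, ea b = (ed g)^-1,
  g = (b * l (ec g / ed g))%g & vge 1 (ec g / ed g)].
Proof.
move=> /andP[d0 z0]; exists (u (eb g / ed g) * hh (ed g)^-1)%g.
have n0 : (ed g)^-1 != 0 by rewrite invr_eq0.
split=> //; rewrite ?eM ?hE // ?mulr0 ?mul0r ?add0r ?addr0 ?mul1r //.
exact: factor_uhl.
Qed.

(** The group is the disjoint union of B I1 and B w I1, so an invariant function is determined by
    its values at 1 and [w]. *)
Lemma I1f_Ind (e : B) : I1f e -> e = iv e 1%g *: f1 + iv e w *: fw.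
Proof.
move=> Ie; apply: Ind_ext => g; rewrite Ind_addE !Ind_scaleE f1E fwE /f1fun /fwfun smallcellE.
have IeE h k : I1 k -> iv e (h * k)%g = iv e h.
  by move=> kI; rewrite -Ind_actE Ie.
have [bg|nbg] := boolP (bigcell g) => /=.
  rewrite mulr0 add0r; have [b [c0 <- eg z0]] := bigcell_decomp bg.
  by rewrite {1}eg mulgA IeE ?I1_u // Ind_equiv // mulrC.
move: nbg; rewrite -smallcellE => sg; rewrite mulr0 addr0.
have [b [c0 <- eg z1]] := smallcell_decomp sg.
by rewrite {1}eg IeE ?I1_l // -{1}[b]mulg1 Ind_equiv // mulrC.
Qed.

Lemma I1f_Ind_eq (e e' : B) : I1f e -> I1f e' -> iv e 1%g = iv e' 1%g ->
  iv e w = iv e' w -> e = e'.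
Proof. by move=> Ie Ie' e1 ew; rewrite (I1f_Ind Ie) (I1f_Ind Ie') e1 ew. Qed.

Local Notation etaN1 := (eta (-1)).
Lemma N1_neq0 : (-1 : F) != 0. Proof. by rewrite oppr_eq0 oner_eq0. Qed.

(** At 1 the q translates have equal values, which add up to 0. At [w] the zero class gives the term
    in eta(-1) and the unit classes give [kap]. *)
Lemma S0_Ind (e : B) : I1f e -> S0 D B e = (etaN1 * iv e 1%g + kap * iv e w) *: fw.
Proof.
move=> Ie; have IeE h k : I1 k -> iv e (h * k)%g = iv e h.
  by move=> kI; rewrite -Ind_actE Ie.
apply: I1f_Ind_eq.
- exact: S0_I1f.
- by move=> g Ig; rewrite linearZ /= fw_I1f.
- rewrite Ind_scaleE fw_1 mulr0 S0E Ind_sumE (eq_bigr (fun=> iv e w)).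
    exact: sum_constC.
  by move=> i _; rewrite Ind_actE mul1g Ind_equiv ?eM // eta1 mul1r.
rewrite Ind_scaleE fw_w mulr1 S0E Ind_sumE (bigD1 i0) //= lam0 u0 mul1g; congr (_ + _).
  by rewrite Ind_actE ww -[hh _]mulg1 Ind_equiv ?hE // N1_neq0.
rewrite /kap /csum mulr_suml; apply: eq_bigr => i ii0; have ui := unit_lam ii0.
have l0 := unitO_neq0 ui; have n0 : - lam i != 0 by rewrite oppr_eq0.
rewrite Ind_actE mulgA wuw // -[(_ * w * _)%g]mulgA w_h // mulgA -!mulgA mulgA mulgA.
rewrite IeE; last by apply: I1_u; rewrite vgeN // unitO_vgeV.
by rewrite Ind_equiv !eM ?hE ?invr_eq0 // ?mulr0 ?mul0r ?addr0 // mul1r invrN.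
Qed.

Lemma S1_Ind (e : B) : I1f e ->
  S1 D B e = (etaN1 * (eta om)^-1 * iv e w + kap * iv e 1%g) *: f1.
Proof.
move=> Ie; have IeE h k : I1 k -> iv e (h * k)%g = iv e h.
  by move=> kI; rewrite -Ind_actE Ie.
have o0 := om_neq0 F.
apply: I1f_Ind_eq.
- exact: S1_I1f.
- by move=> g Ig; rewrite linearZ /= f1_I1f.
- rewrite Ind_scaleE f1_1 mulr1 S1E Ind_sumE (bigD1 i0) //= lam0 mulr0 l0 mul1g; congr (_ + _).
    have n0 : - om^-1 != 0 by rewrite oppr_eq0 invr_eq0.
    have -> : w1 F = (hh (- om^-1) * w)%g by apply: sl2P; rewrite !(eM, w1E) !hE //; fld.
    rewrite Ind_actE mul1g Ind_equiv ?hE // -[- om^-1]mulN1r etaM ?invr_eq0 ?N1_neq0 //.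
    by rewrite etaV.
  rewrite /kap /csum mulr_suml; apply: eq_bigr => i ii0; have ui := unit_lam ii0.
  rewrite Ind_actE mul1g; set g := (_ * _)%g.
  have l0' := unitO_neq0 ui.
  have cg : ec g = om by rewrite /g !(eM, w1E); ring.
  have dg : ed g = - lam i by rewrite /g !(eM, w1E); fld.
  have sg : smallcell g.
    rewrite /smallcell cg dg oppr_eq0 l0' /= vge_om1M subrr.
    by rewrite invrN vgeN // unitO_vgeV.
  have [b [c0 ab eg z1]] := smallcell_decomp sg.
  by rewrite {1}eg IeE ?I1_l // -{1}[b]mulg1 Ind_equiv // ab dg invrN.
rewrite Ind_scaleE f1_w mulr0 S1E Ind_sumE (eq_bigr (fun=> eta om * iv e 1%g)).
  exact: sum_constC.
move=> i _; rewrite Ind_actE mulgA w_l -mulgA w_w1 -[(_ * _)%g]mulg1.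
by rewrite Ind_equiv !eM !hE // ?mulr0 ?mul0r ?addr0 ?mul1r.
Qed.

End Characters.

Section QuotientHom.
Variables (C : fieldType) (G : groupType) (pi : rep C G) (W : subrep pi).

Definition qfun (x : pi) : quot_rep W := \pi_(quot_space W) x.
Fact qfun_linear : linear qfun.
Proof. by move=> a x y; rewrite /qfun raddfD; congr (_ + _); exact/esym/pi_quot_scale. Qed.
HB.instance Definition _ := GRing.isLinear.Build C pi (quot_rep W) _ qfun qfun_linear.
Fact qfunJ g x : qfun (rep_act pi g x) = rep_act (quot_rep W) g (qfun x).
Proof. by rewrite /= /qfun pi_quot_act. Qed.
Definition qhom : rep_hom pi (quot_rep W) := @RepHom _ _ _ _ qfun qfunJ.

Lemma qhom_surj y : exists x, qhom x = y.
Proof. by elim/(@quot_spaceW _ _ _ W): y => x; exists x. Qed.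

Lemma qhom_eq0 x : qhom x = 0 <-> x \in W.
Proof.
have -> : (0 : quot_rep W) = qfun 0 by rewrite linear0.
split=> [/quot_eqP|xW]; first by rewrite subr0.
by apply/quot_eqP; rewrite subr0.
Qed.
End QuotientHom.

Lemma smooth_hom (C : fieldType) (F : valuedFieldType) (pi rho : rep C (SL2 F))
    (phi : rep_hom pi rho) : (forall y, exists x, phi x = y) -> smooth pi -> smooth rho.
Proof.
move=> surj /smoothP sm; apply/smoothP => y; have [x <-] := surj y.
by have [n n1 nx] := sm x; exists n => // k /nx kx; rewrite -rep_homJ kx.
Qed.

Lemma smooth_iso (C : fieldType) (F : valuedFieldType) (pi rho : rep C (SL2 F)) :
  rep_iso pi rho -> smooth pi -> smooth rho.
Proof.
move=> [phi [psi _ psiK]]; apply: (@smooth_hom _ _ _ _ phi) => y.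
by exists (psi y).
Qed.

(** * Smoothness, generation and irreducibility of Ind_B(eta) *)

Section IndStructure.
Variables (p f : nat) (F : completeValuedFieldType) (C : closedFieldType).
Variables (iota : {rmorphism residue_field F -> C}) (D : resdata p f iota).
Variables (eta : F -> C) (sm : smooth_character eta).
Local Notation om := (uniformizer : F).
Local Notation q := (p ^ f)%N.
Local Notation lam := (lam D).
Local Notation i0 := (lam_zero D).
Local Notation B := (Ind_B eta).
Local Notation fw := (fw D sm).
Local Notation f1 := (f1 D sm).
Implicit Types (g h k : SL2 F) (e : B).

Lemma iwasawa g : exists b k, [/\ ec b = 0, inK k & g = (b * k)%g].
Proof.
have [bg|] := boolP (bigcell g).
  have [b [b0 _ eg z0]] := bigcell_decomp bg.
  by exists b, (w * u (ed g / ec g))%g; split=> //; apply: inKM; [exact: inK_w | exact: inK_u].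
rewrite -smallcellE => sg; have [b [b0 _ eg z0]] := smallcell_decomp sg.
by exists b, (l (ec g / ed g)); split=> //; apply: inK_l; exact: vge01.
Qed.

(** By the Iwasawa decomposition only g in K has to be considered, and K is compact. This uniform
    level is what makes the induced representation smooth. *)
Lemma Ind_uniform e : exists2 n, 1 <= n & forall g k, Kn n k -> iv e (g * k)%g = iv e g.
Proof.
pose P (X : set 'M[F]_2) := exists2 n, 1 <= n & forall g, inK g -> X (val g) ->
  forall k, Kn n k -> iv e (g * k)%g = iv e g.
have [n n1 H] : P [set A | mbdd 0 A].
  apply: (ball_induction D) => [X Y XY [n n1 nY]|X Y [n n1 nX] [m m1 mY]||A bA].
  - by exists n => // g gK /XY; exact: nY.
  - exists (Num.max n m); first by rewrite le_max n1.
    move=> g gK [Xg|Yg] k kn; [apply: nX|apply: mY] => //; apply: Kn_le kn.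
      by rewrite le_max lexx.
    by rewrite le_max lexx orbT.
  - by exists 1.
  have [dA|dA] := eqVneq (\det A) 1; last first.
    exists (valuation (\det A - 1) + 1), 1 => // g gK nA.
    have := det_near bA ((mbdd_SL2 _ _).2 gK) nA.
    by rewrite (eqP (valP g)) addr0 vgeE ?subr_eq0 // gerDl.
  have dA' : \det A == 1 by rewrite dA.
  pose g0 : SL2 F := MkSL2 dA'; have g0K : inK g0 by apply/mbdd_SL2.
  have [n n1 nK] := (locally_constantP (iv e)).1 (Ind_lc e) g0.
  exists n, n => // g gK /(mnear_SL2 n g0 g) ng k kn.
  have := near_KnV g0K ng; rewrite add0r => k'n; rewrite -[g](mulVKg g0) -mulgA.
  by rewrite !nK //; apply: KnM => //; lia.
exists n => // g k kn; have [b [k' [b0 k'K ->]]] := iwasawa g.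
by rewrite -mulgA [LHS]Ind_equiv // [RHS]Ind_equiv // H //; apply/mbdd_SL2.
Qed.

Lemma Ind_smooth : smooth B.
Proof.
apply/smoothP => e; have [n n1 nK] := Ind_uniform e.
by exists n => // k kn; apply: Ind_ext => g; rewrite Ind_actE nK.
Qed.

(** In the coordinate d/c this translate of [fw] is supported on the ball of level 2m around z. *)
Lemma fw_shift g z (m : nat) : fwfun eta (g * (u (- z) * hh (om ^+ m)))%g =
  if (ec g != 0) && vge (2 * m)%N%:Z (ed g / ec g - z) then
    eta (- (ec g)^-1) * (eta (om ^+ m))^-1 else 0.
Proof.
have a0 := om2n_neq0 F m; rewrite /fwfun /bigcell mulgA !(eM, hE) //.
rewrite !mulr0 !addr0 !add0r mulr1 mulf_eq0 (negPf a0) orbF.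
have [//|c0] := eqVneq (ec g) 0; rewrite /=.
have -> : (ec g * - z + ed g * 1) * (om ^+ m)^-1 / (ec g * om ^+ m) =
  (om ^ (- (2 * m)%N%:Z)) * (ed g / ec g - z).
  by rewrite -exprnN mulnC exprM; fld.
rewrite vge_omM sub0r opprK; case: ifP => // _.
by rewrite invfM -mulNr etaM ?oppr_eq0 ?invr_eq0 // etaV.
Qed.

Section Generation.
Variables (W : B -> Prop) (sW : subsp W).
Hypotheses (iW : forall g e, W e -> W (rep_act B g e)) (Wfw : W fw).

(** Up to a factor in [eta], a function of level n on the big cell is a function of the integer d/c
    that is constant on balls of level 2m >= n, hence a combination of translates of [fw]. *)
Lemma W_bigcell e n : 1 <= n -> (forall g k, Kn n k -> iv e (g * k)%g = iv e g) ->
  (forall g, ~~ bigcell g -> iv e g = 0) -> W e.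
Proof.
move=> n1 nK supp; pose m := `|n|%N.
suff -> : e = \sum_(z <- digits D m)
    (iv e (w * u z)%g * eta (om ^+ m)) *: rep_act B (u (- z) * hh (om ^+ m))%g fw.
  by apply: subsp_sum => // z _; apply: subspZ => //; exact: iW.
apply: Ind_ext => g; rewrite Ind_sumE.
rewrite (eq_bigr (fun z => iv e (w * u z)%g * (if (ec g != 0) &&
    vge (2 * m)%N%:Z (ed g / ec g - z) then eta (- (ec g)^-1) else 0))); last first.
  move=> z _; rewrite Ind_scaleE Ind_actE fwE fw_shift; case: ifP => _.
    by rewrite -mulrA [eta (om ^+ m) * _]mulrC divfK ?eta_neq0 ?om2n_neq0.
  by rewrite !mulr0.
have [bg|nbg] := boolP (bigcell g); last first.
  rewrite supp // big_seq big1 // => z zR; case: ifP => [/andP[c0 yz]|_]; last by rewrite mulr0.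
  case/negP: nbg; rewrite /bigcell c0 -(subrK z (ed g / ec g)) vgeD ?(digits_int zR) //.
  by apply: vge_le yz.
have [b [b0 ab eg y0]] := bigcell_decomp bg; have /andP[c0 _] := bg.
have [z zR yz] := digits_cov D m y0.
rewrite (big_digits1 zR) => [|z' z'R]; last first.
  move=> zz'; case: ifP => [/andP[_ yz']|_]; last by rewrite mulr0.
  by case/negP: zz'; apply: vge_trans yz; apply: vge_sym.
rewrite c0 yz /= {1}eg Ind_equiv // ab mulrC; congr (_ * _).
rewrite -[ed g / ec g](subrK z) addrC uD mulgA (nK (w * u z)%g) //.
rewrite /Kn !eM !subrr !vge0 /= andbT; apply: vge_le yz; rewrite /m; lia.
Qed.

(** The part supported on the small cell is carried into the big cell by [w], so [fw] generates the
    whole representation. *)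
Lemma W_all e : W e.
Proof.
have [n n1 nK] := Ind_uniform e.
have nI k : Kn n k -> I1 k by exact: Kn_I1.
have big_eq g k : I1 k -> bigcell (g * k)%g = bigcell g.
  move=> kI; apply/idP/idP => [b1|b1]; last by have [] := bigcell_I1 D sm kI b1.
  by have [] := bigcell_I1 D sm (I1V kI) b1; rewrite mulgK.
have [e1 e1E] : exists x : B, forall g, iv x g = if bigcell g then iv e g else 0.
  apply: Ind_intro => [|b g b0].
    by apply: (@Kn_locally_constant _ _ _ n) => // g k kn; rewrite big_eq ?nI // nK.
  rewrite Ind_equiv //; have [a0 db] := borel_ea b0.
  have -> : bigcell (b * g)%g = bigcell g.
    rewrite /bigcell !eM b0 !mul0r !add0r db mulf_eq0 invr_eq0 (negPf a0) /=.
    have [//|cg] := eqVneq (ec g) 0.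
    by have -> : (ea b)^-1 * ed g / ((ea b)^-1 * ec g) = ed g / ec g by fld.
  by case: ifP => _ //=; rewrite mulr0.
have We1 : W e1.
  apply: (W_bigcell n1) => [g k kn|g]; rewrite !e1E; last by move=> /negPf ->.
  by rewrite big_eq ?nI // nK.
suff We2 : W (rep_act B w (e - e1)).
  have -> : e = rep_act B w^-1%g (rep_act B w (e - e1)) + e1 by rewrite rep_actK subrK.
  by apply: subspD => //; exact: iW.
have e2E g : iv (rep_act B w (e - e1)) g = if bigcell (g * w)%g then 0 else iv e (g * w)%g.
  rewrite Ind_actE -[e - e1]addrC -scaleN1r Ind_addE Ind_scaleE e1E mulN1r.
  by case: ifP; rewrite ?addNr ?oppr0 ?add0r.
apply: (W_bigcell n1) => [g k kn|g nbg].
  rewrite !e2E; have -> : (g * k * w = g * w * (w^-1 * k * w))%g by rewrite !mulgA mulgK.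
  have kn' := Kn_conj (inK_w F) kn.
  by rewrite big_eq ?nI // nK.
rewrite e2E; move: nbg; rewrite -smallcellE => /andP[d0 z1].
suff -> : bigcell (g * w)%g by [].
rewrite /bigcell !eM !mulr0 !add0r mulrN1 oppr_eq0 d0 /= addr0 mulr1.
by rewrite invrN mulrN vgeN // vge01.
Qed.

End Generation.

Lemma Ind_I1_sub (W : B -> Prop) e : subsp W -> (forall g e, W e -> W (rep_act B g e)) ->
  W e -> e != 0 -> exists e', [/\ W e', e' != 0 & I1f e'].
Proof. by move=> sW iW We e0; exact: (smooth_I1_fixed D Ind_smooth sW iW We e0). Qed.

Lemma fw_neq0 : fw != 0.
Proof.
apply/eqP => e; have := fw_w D sm; rewrite e Ind_zeroE => /eqP.
by rewrite eq_sym oner_eq0.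
Qed.

(** S0 maps invariants to multiples of [fw], S1 maps them to multiples of [f1], and S0 maps [f1] to
    [fw] up to a unit. So a nonzero coefficient in [e], S0 e or S1 e suffices; it is missing only
    for trivial [eta] and a constant function. *)
Lemma Ind_sub_all (W : B -> Prop) e : subsp W -> (forall g e, W e -> W (rep_act B g e)) ->
  W e -> I1f e -> e != 0 -> iv e 1%g <> iv e w \/ (exists2 x, x != 0 & eta x != 1) -> forall e', W e'.
Proof.
move=> sW iW We Ie e0 H; apply: W_all => //.
have WZ (c : C) (x : B) : c != 0 -> W (c *: x) -> W x.
  by move=> c0 /(subspZ sW c^-1); rewrite scalerA mulVf // scale1r.
have WS0 x : W x -> W (S0 D B x).
  by move=> Wx; rewrite S0E; apply: subsp_sum => // i _; exact: iW.
have WS1 x : W x -> W (S1 D B x).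
  by move=> Wx; rewrite S1E; apply: subsp_sum => // i _; exact: iW.
have Wf1 : W f1 -> W fw.
  move=> /WS0; rewrite (S0_Ind D sm (f1_I1f D sm)) f1_1 f1_w mulr1 mulr0 addr0.
  by apply: WZ; exact: eta_neq0 (N1_neq0 F).
have eN0 := eta_neq0 sm (N1_neq0 F).
have W0 := WS0 _ We; rewrite (S0_Ind D sm Ie) in W0.
have W1 := WS1 _ We; rewrite (S1_Ind D sm Ie) in W1.
have [z0|/WZ/(_ W0) //] := eqVneq (eta (-1) * iv e 1%g + kap D eta * iv e w) 0.
have nzero : iv e 1%g = 0 -> iv e w = 0 -> False.
  by move=> e1 ew; move: e0; rewrite (I1f_Ind D sm Ie) e1 ew !scale0r addr0 eqxx.
have [[x ux x1]|tr] := pselect (exists2 x, unitO x & eta x != 1).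
  have k0 : kap D eta = 0 by apply: kap_nontrivial => //; exists x.
  move: z0; rewrite k0 mul0r addr0 => /eqP; rewrite mulf_eq0 (negPf eN0) /= => /eqP e1.
  have ew : iv e w != 0 by apply/eqP; exact: nzero.
  by apply: (WZ (iv e w)) => //; move: We; rewrite {1}(I1f_Ind D sm Ie) e1 scale0r add0r.
have tr' x : unitO x -> eta x = 1.
  by move=> ux; apply: contrapT => /eqP x1; apply: tr; exists x.
move: z0; rewrite (kap_trivial D tr') tr' ?unitON ?unitO1 // mul1r mulN1r => /eqP.
rewrite subr_eq0 => /eqP e1w.
case: H => [//|[x x0 x1]]; apply: Wf1; apply: WZ W1.
rewrite (kap_trivial D tr') tr' ?unitON ?unitO1 // mul1r mulN1r e1w.
have ew : iv e w != 0 by apply/eqP => ew; apply: nzero; rewrite ?e1w.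
rewrite -[- _]mulN1r -mulrDl mulf_neq0 // subr_eq0 invr_eq1.
(* If eta(varpi) were 1, then [eta], already trivial on units, would be trivial at [x]. *)
apply: contra x1 => /eqP o1; rewrite [x]unit_partE etaM //; last exact/unitO_neq0/unit_part.
  rewrite (tr' _ (unit_part x0)) mulr1.
  case: (valuation x) => n; first by rewrite (etaX sm) ?om_neq0 // o1 expr1n.
  by rewrite NegzE -exprnN (etaV sm) ?om2n_neq0 // (etaX sm) ?om_neq0 // o1 expr1n invr1.
exact: omX_neq0.
Qed.

Lemma Ind_irreducible : (exists2 x, x != 0 & eta x != 1) -> irreducible B.
Proof.
move=> ne; apply: irreducible_intro; first by exists fw; exact: fw_neq0.
move=> W sW iW e We e0.
have [e' [We' e'0 Ie']] := Ind_I1_sub sW iW We e0.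
by apply: (Ind_sub_all sW iW We' Ie' e'0); right.
Qed.

(* The values at [1] and [w] detect the failure of invariance up to constants. *)
Lemma I1f_mod_const e : (forall x, eta x = 1) ->
  (forall g, I1 g -> exists c, forall h, iv (rep_act B g e) h = iv e h + c) -> I1f e.
Proof.
move=> e1 H; have E b g : ec b = 0 -> iv e (b * g)%g = iv e g.
  by move=> b0; rewrite Ind_equiv // e1 mul1r.
have key g h : I1 g -> iv e (h * g)%g = iv e h -> rep_act B g e = e.
  move=> gI eh; have [c cP] := H g gI; apply: Ind_ext => h'.
  have : c = 0 by have := cP h; rewrite Ind_actE eh => /eqP; rewrite addrC -subr_eq subrr => /eqP.
  by rewrite cP => ->; rewrite addr0.
move=> g /I1_factor[x [a [y [x0 a1 y1 ->]]]].
have an0 : a != 0 by apply/unitO_neq0/unitO_1D.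
rewrite !rep_actM (key (l y) w); last 2 first.
- exact: I1_l.
- by rewrite w_l E // eM.
rewrite (key (hh a) 1%g); last 2 first.
- exact: I1_h.
- by rewrite mul1g -[hh a]mulg1 E // hE.
rewrite (key (u x) 1%g) //; first exact: I1_u.
by rewrite mul1g -[u x]mulg1 E // eM.
Qed.

Lemma Ind_not_1dim e0 : exists e, I1f e /\ forall c, e != c *: e0.
Proof.
have [->|n0] := eqVneq e0 0.
  by exists fw; split; [exact: fw_I1f | move=> c; rewrite scaler0 fw_neq0].
have [[c ec]|nf] := pselect (exists c, fw = c *: e0); last first.
  by exists fw; split=> [|c]; [exact: fw_I1f | apply/eqP => e; apply: nf; exists c].
exists f1; split=> [|c']; first exact: f1_I1f.
apply/eqP => e'; have c0 : c != 0 by apply: contraNneq fw_neq0 => c0; rewrite ec c0 scale0r.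
have := f1_1 D sm; rewrite e' Ind_scaleE; have := fw_1 D sm; rewrite ec Ind_scaleE => /eqP.
by rewrite mulf_eq0 (negPf c0) /= => /eqP ->; rewrite mulr0 => /eqP; rewrite eq_sym oner_eq0.
Qed.

End IndStructure.

Lemma smooth_character_intro (F : valuedFieldType) (C : fieldType) (eta : F -> C) :
  (forall x, x != 0 -> eta x != 0) ->
  (forall x y, x != 0 -> y != 0 -> eta (x * y) = eta x * eta y) ->
  (forall x, vge 1 (x - 1) -> eta x = 1) -> smooth_character eta.
Proof.
move=> e0 eM e1; split=> //; rewrite openE => x [x0 ex]; apply/nbhs_vgeP.
exists (valuation x + 1) => y xy.
have yx : vge 1 (y / x - 1).
  have -> : y / x - 1 = x^-1 * (y - x) by field.
  rewrite vgeBC in xy; have := vgeM (vge_val x^-1) xy; rewrite valV //.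
  by rewrite addrA addNr add0r.
have y0 : y != 0.
  apply: contraTneq yx => ->; rewrite mul0r sub0r; apply/negP => /vgeN.
  by rewrite opprK vgeE ?oner_neq0 // valuation1.
split=> //; rewrite -[y](divfK x0) eM ?ex ?mulr1 ?e1 //.
by rewrite mulf_neq0 // invr_eq0.
Qed.

(** * The special representation *)

Section Special.
Variables (p f : nat) (F : completeValuedFieldType) (C : closedFieldType).
Variables (iota : {rmorphism residue_field F -> C}) (D : resdata p f iota).
Local Notation Sp := (special_series F C).
Local Notation one := (fun=> 1 : C).

Lemma one_smooth : smooth_character (one : F -> C).
Proof.
by apply: smooth_character_intro => *; rewrite ?mulr1 ?oner_neq0.
Qed.

Local Notation fw := (fw D one_smooth).
Local Notation f1 := (f1 D one_smooth).
Local Notation B := (Ind_1 F C).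
Implicit Types e : B.

Definition sp : rep_hom B Sp := qhom (Subrep (@constants_submod F C) (@constants_invariant F C)).

Lemma sp_surj y : exists e, sp e = y. Proof. exact: qhom_surj. Qed.

Lemma sp_eq0 e : sp e = 0 <-> exists c, forall g, iv e g = c.
Proof. by split=> [/qhom_eq0/asboolP|ec]; last by apply/qhom_eq0/asboolP. Qed.

Lemma kap1 : kap D one = -1. Proof. exact: kap_trivial. Qed.

Lemma exists_one : exists e : B, forall g, iv e g = 1.
Proof.
apply: Ind_intro => [g|b g _]; last by rewrite mul1r.
exact: ((@Kn_locally_constant _ _ (fun=> 1 : C^o) 1 isT (fun _ _ _ => erefl)) g).
Qed.

Lemma fw_nonconst : sp fw != 0.
Proof.
apply/eqP => /sp_eq0[c cP].
have := fw_1 D one_smooth; have := fw_w D one_smooth.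
by rewrite !cP => -> /eqP; rewrite oner_eq0.
Qed.

Lemma sp_f1 : sp f1 = - sp fw.
Proof.
apply/eqP; rewrite -addr_eq0 -linearD; apply/eqP/sp_eq0; exists 1 => g.
rewrite Ind_addE f1E fwE /f1fun /fwfun smallcellE.
by case: (bigcell g); rewrite /= ?add0r ?addr0.
Qed.

Lemma Sp_smooth : smooth Sp.
Proof. by apply: (smooth_hom (phi := sp)); [exact: sp_surj | exact: (Ind_smooth D)]. Qed.

(** Invariants of the quotient lift to invariants of Ind_B(1) by [I1f_mod_const], and [f1] equals
    [- fw] modulo constants. *)
Lemma Sp_I1f (y : Sp) : I1f y -> exists c, y = c *: sp fw.
Proof.
have [e <-] := sp_surj y => Iy.
have Ie : I1f e.
  apply: I1f_mod_const => // g gI.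
  have : sp (rep_act B g e - e) = 0 by rewrite linearB rep_homJ Iy // subrr.
  move=> /sp_eq0[c cP]; exists c => h.
  have := cP h; rewrite -scaleN1r Ind_addE Ind_scaleE mulN1r => <-.
  by rewrite addrC subrK.
exists (iv e w - iv e 1%g).
rewrite {1}(I1f_Ind D one_smooth Ie) linearD !linearZ /= sp_f1 scalerN -scaleNr -scalerDl.
by rewrite addrC.
Qed.

Lemma Sp_S0 : S0 D Sp (sp fw) = - sp fw.
Proof.
rewrite -hom_S0 (S0_Ind D one_smooth (fw_I1f D one_smooth)) fw_1 fw_w kap1.
by rewrite mulr0 add0r mulr1 linearZ /= scaleN1r.
Qed.

Lemma Sp_S1 : S1 D Sp (sp fw) = - sp fw.
Proof.
rewrite -hom_S1 (S1_Ind D one_smooth (fw_I1f D one_smooth)) fw_1 fw_w kap1.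
by rewrite mulr0 addr0 invr1 !mulr1 scale1r sp_f1.
Qed.

Lemma Sp_irreducible : irreducible Sp.
Proof.
apply: irreducible_intro; first by exists (sp fw); exact: fw_nonconst.
move=> W sW iW x Wx x0.
have [y [Wy y0 Iy]] := smooth_I1_fixed D Sp_smooth sW iW Wx x0.
have [c yE] := Sp_I1f Iy; have c0 : c != 0 by apply: contraNneq y0 => c0; rewrite yE c0 scale0r.
have Wfw : W (sp fw).
  by have := subspZ sW c^-1 Wy; rewrite yE scalerA mulVf // scale1r.
move=> z; have [e <-] := sp_surj z.
apply: (@W_all _ _ _ _ _ D _ one_smooth (fun e => W (sp e))) => //.
  split; first by rewrite linear0; exact: sW.1.
  by move=> a e1 e2 W1 W2; rewrite linearP; exact: sW.2.
by move=> g e1 We1; rewrite rep_homJ; exact: iW.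
Qed.

(** The map kills the constants, hence factors through Sp. Otherwise [pi] would be the line spanned
    by the image of the function 1, and [fw] minus a multiple of 1 would be an invariant of the
    kernel with distinct values at 1 and [w]; by [Ind_sub_all] the kernel would be everything. *)
Lemma quotient_Ind1 (pi : rep C (SL2 F)) (phi : rep_hom B pi) e : irreducible pi ->
  phi e != 0 -> rep_iso pi Sp.
Proof.
move=> irr phie; have surj := irreducible_hom_surj irr phie.
have sK := ker_subsp phi; have iK g e' := @ker_inv _ _ _ _ phi g e'.
have kfw : phi fw != 0.
  apply: contra_neq phie => k0; exact: (W_all sK iK k0).
have kerW e' : phi e' = 0 -> I1f e' -> e' != 0 -> iv e' 1%g = iv e' w.
  move=> k0 Ie' e'0; apply: contrapT => ne.
  have H := Ind_sub_all D one_smooth sK iK k0 Ie' e'0 (or_introl ne).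
  by move: kfw; rewrite H eqxx.
have [one1 oneE] := exists_one.
have one_f : one1 = f1 + fw.
  apply: Ind_ext => g; rewrite oneE Ind_addE f1E fwE /f1fun /fwfun smallcellE.
  by case: (bigcell g); rewrite /= ?add0r ?addr0.
have phi1 : phi one1 = 0.
  have [//|p1] := eqVneq (phi one1) 0.
  have c1 : (phi one1) = 0 -> False by move=> e1; rewrite e1 eqxx in p1.
  exfalso; pose P y := exists c, y = c *: phi one1.
  have sP : subsp P.
    split; first by exists 0; rewrite scale0r.
    by move=> a _ _ [c ->] [d ->]; exists (a * c + d); rewrite scalerDl scalerA.
  have iP g y : P y -> P (rep_act pi g y).
    move=> [c ->]; exists c; rewrite linearZ -rep_homJ; congr (_ *: phi _).
    by apply: Ind_ext => h; rewrite Ind_actE !oneE.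
  have [c cP] := irreducibleP irr sP iP (ex_intro _ 1 (esym (scale1r _))) p1 (phi fw).
  have k0 : phi (fw - c *: one1) = 0 by rewrite linearB linearZ cP subrr.
  have := kerW _ k0; rewrite -scaleN1r scalerA !Ind_addE !Ind_scaleE !oneE fw_1 fw_w.
  move=> H; have : (0 : C) = 1; last by move/eqP; rewrite eq_sym oner_eq0.
  apply: (addIr (-1 * c * 1)); apply: H.
    have [s _ Z] : [/\ True, True & forall g, I1 g -> rep_act B g one1 = one1].
      by split=> // g _; apply: Ind_ext => h; rewrite Ind_actE !oneE.
    by move=> g gI; rewrite linearD linearZ /= Z // fw_I1f.
  apply/eqP => e0; have := congr1 (fun e => iv e 1%g - iv e w) e0.
  rewrite Ind_addE Ind_scaleE oneE fw_1.
  have -> : iv (fw + -1 * c *: one1) w = 1 + -1 * c * 1.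
    by rewrite Ind_addE Ind_scaleE oneE fw_w.
  rewrite !Ind_zeroE => /eqP; rewrite add0r opprD addrCA subrr addr0 subr0 oppr_eq0.
  by rewrite oner_eq0.
have [psi psiP] : exists psi : rep_hom Sp pi, forall y x, (exists2 e, sp e = y & phi e = x) -> psi y = x.
  have const0 e' : sp e' = 0 -> phi e' = 0.
    move=> /sp_eq0[c cP]; have -> : e' = c *: one1.
      by apply: Ind_ext => g; rewrite Ind_scaleE oneE cP mulr1.
    by rewrite linearZ /= phi1 scaler0.
  apply: (@graph_hom _ _ Sp pi (fun y x => exists2 e, sp e = y & phi e = x)).
  - by exists 0; rewrite linear0.
  - move=> a _ _ _ _ [e1 <- <-] [e2 <- <-].
    by exists (a *: e1 + e2); rewrite linearP.
  - by move=> g _ _ [e1 <- <-]; exists (rep_act B g e1); rewrite rep_homJ.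
  - by move=> x [e1 /const0 -> <-].
  - by move=> y; have [e1 <-] := sp_surj y; exists (phi e1), e1.
apply: rep_iso_sym; apply: (@irreducible_quotient_iso _ _ _ _ psi (sp fw)) => //.
  exact: Sp_irreducible.
by rewrite (psiP _ (phi fw)) //; exists fw.
Qed.

End Special.

(** * Eigenvectors of S0 S1 *)

Arguments At : simpl never.
Arguments S0 : simpl never.
Arguments S1 : simpl never.
Arguments digits : simpl never.

Section EigenSpan.
Variables (p f : nat) (F : completeValuedFieldType) (C : closedFieldType).
Variables (iota : {rmorphism residue_field F -> C}) (D : resdata p f iota).
Local Notation om := (uniformizer : F).
Implicit Types (g h k : SL2 F).

(** The Iwasawa decomposition with lower triangular matrices: these are the ones whose unipotent
    part becomes small when conjugated by high powers of [hh om]. *)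
Lemma iwasawa_lower g : exists2 k, inK k & eb (k^-1 * g)%g = 0.
Proof.
have [d0|d0] := eqVneq (ed g) 0.
  by exists w; [exact: inK_w | rewrite !eM d0 !(mul0r, mulr0, oppr0, addr0, add0r)].
have [z0|/not_vge0_inv[z0 zi]] := boolP (vge 0 (eb g / ed g)).
  exists (u (eb g / ed g)); first exact: inK_u.
  by rewrite !eM mul1r mulNr divfK // subrr.
have b0 : eb g != 0 by apply: contraNneq z0 => ->; rewrite mul0r.
rewrite invfM invrK mulrC in zi.
exists (l (ed g / eb g) * w)%g; first by apply: inKM; [apply: inK_l; exact: vge01 | exact: inK_w].
by rewrite !eM; fld.
Qed.

Lemma l_h a x : a != 0 -> (l x * hh a = hh a * l (a ^+ 2 * x) :> SL2 F)%g.
Proof. by move=> a0; sl2. Qed.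

Lemma hu_om (m : nat) z : (hh (om ^+ m) * u z = u (om ^+ (2 * m) * z) * hh (om ^+ m))%g.
Proof. by rewrite h_u ?om2n_neq0 // mulnC exprM. Qed.

Lemma shift_nat (N e : int) : N <= 0 -> N <= e -> e <= - N ->
  exists m : nat, e + (absz N).+1%:Z = m%:Z /\ (m <= (absz N).+1 + absz N)%N.
Proof. by move=> N0 Ne eN; exists (absz (e + (absz N).+1%:Z)); split; lia. Qed.

Lemma vge0_omX (n : nat) : vge 0 ((om : F) ^ n%:Z).
Proof. by rewrite -[X in vge 0 X]mulr1 vge_omM; apply: vge_le (vge1 F); lia. Qed.

Lemma lower_decomp h : eb h = 0 -> h = (hh (ea h) * l (ea h * ec h))%g.
Proof.
move=> b0; have ad1 : ea h * ed h = 1 by have := ead_bc h; rewrite b0 mul0r subr0.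
have a0 : ea h != 0 by apply: contra_eq_neq ad1 => ->; rewrite mul0r eq_sym oner_eq0.
have dE : ed h = (ea h)^-1 by apply: (mulfI a0); rewrite ad1 mulfV.
by apply: sl2P; rewrite !(eM, hE, lE) ?b0 ?dE //; fld.
Qed.

Section Rep.
Variables (pi : rep C (SL2 F)) (V0 : pi) (th : F -> C) (mu : C).
Hypotheses (IV : I1chi th V0) (AV : At D pi V0 = mu *: V0) (mu0 : mu != 0).

(** Layer m of the subrepresentation generated by [V0]. As A V0 = mu V0 with mu <> 0, each layer is
    contained in the next, so a finite combination of translates can be brought into a single
    layer. *)
Definition Gam (m : nat) (x : pi) := exists2 s : seq (C * SL2 F), all (fun z => inK z.2) s &
  x = \sum_(z <- s) z.1 *: rep_act pi (z.2 * hh (om ^+ m))%g V0.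

Lemma Gam_subsp m : subsp (Gam m).
Proof.
split; first by exists [::]; rewrite // big_nil.
move=> a _ _ [s sK ->] [s' s'K ->]; exists ([seq (a * z.1, z.2) | z <- s] ++ s').
  by rewrite all_cat s'K andbT all_map.
rewrite big_cat big_map scaler_sumr; congr (_ + _).
by apply: eq_bigr => z _; rewrite scalerA.
Qed.

Lemma Gam_K m k : inK k -> Gam m (rep_act pi (k * hh (om ^+ m))%g V0).
Proof. by move=> kK; exists [:: (1, k)]; rewrite /= ?kK // big_seq1 scale1r. Qed.

Lemma V0_expand n : V0 = mu ^- n *: \sum_(z <- digits D n) rep_act pi (u z * hh (om ^+ n))%g V0.
Proof.
rewrite -iter_At; have -> : iter n (At D pi) V0 = mu ^+ n *: V0.
  elim: n => [|n IHn]; first by rewrite expr0 scale1r.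
  by rewrite iterS IHn linearZ_LR AV scalerA exprSr.
by rewrite scalerA mulVf ?scale1r // expf_neq0.
Qed.

Lemma GamS m x : Gam m x -> Gam m.+1 x.
Proof.
move=> [s sK ->]; rewrite big_seq; apply: (subsp_sum (Gam_subsp _)) => z zs.
apply: (subspZ (Gam_subsp _)); have zK := allP sK _ zs.
rewrite {1}(V0_expand 1) linearZ; apply: (subspZ (Gam_subsp _)).
rewrite linear_sum /= big_seq; apply: (subsp_sum (Gam_subsp _)) => y yR.
rewrite -rep_actM; have -> : (z.2 * hh (om ^+ m) * (u y * hh (om ^+ 1)) =
    (z.2 * u (om ^+ (2 * m) * y)) * hh (om ^+ m.+1))%g.
  rewrite expr1 -[RHS]mulgA exprSr hM ?om_neq0 ?om2n_neq0 //.
  by rewrite !mulgA -[(_ * _ * u y)%g]mulgA hu_om !mulgA.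
apply: Gam_K; apply: inKM => //; apply: inK_u; rewrite vgeMl ?(digits_int yR) //.
by rewrite vgeX // vge01 // vge_om.
Qed.

Lemma Gam_le m m' x : (m <= m')%N -> Gam m x -> Gam m' x.
Proof. by move=> /subnKC <-; elim: (m' - m)%N => [|n IHn]; rewrite ?addn0 // addnS => /IHn/GamS. Qed.

Definition Gam_ev x := exists M, forall m, (M <= m)%N -> Gam m x.

Lemma Gam_ev_subsp : subsp Gam_ev.
Proof.
split; first by exists 0 => m _; exact: (Gam_subsp m).1.
move=> a x y [M HM] [N HN]; exists (maxn M N) => m; rewrite geq_max => /andP[Mm Nm].
by apply: (Gam_subsp m).2; [exact: HM | exact: HN].
Qed.

(** [V0] is expanded at depth n and g u(z) is written k h with h lower triangular. The unipotent
    part of h, moved across [hh (om ^+ n)], falls into I1 and fixes [V0]; the diagonal part shifts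
    the layer by a bounded amount. *)
Lemma Gam_ev_act g : Gam_ev (rep_act pi g V0).
Proof.
(* With n = |N| + 1 one has 2n + 2N >= 1, the level at which the lower unipotent part lies in I1. *)
have [N [gN N0]] := bdd_ex g; pose n0 := `|N|%N; pose n := n0.+1.
suff H : Gam (n + n0) (rep_act pi g V0) by exists (n + n0)%N => m /Gam_le; apply.
rewrite {1}(V0_expand n) linearZ; apply: (subspZ (Gam_subsp _)).
rewrite linear_sum /= big_seq; apply: (subsp_sum (Gam_subsp _)) => z zR.
rewrite -rep_actM mulgA; set g' := (g * u z)%g.
have g'N : bdd N g' by have := bddM gN (inK_u (digits_int zR)); rewrite addr0.
have [k kK b0] := iwasawa_lower g'; pose h := (k^-1 * g')%g; rewrite -/h in b0.
have hN : bdd N h by have := bddM (inKV kK) g'N; rewrite add0r.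
have /and4P[aN _ cN dN] := hN.
have ad1 : ea h * ed h = 1 by have := ead_bc h; rewrite b0 mul0r subr0.
have a0 : ea h != 0 by apply: contra_eq_neq ad1 => ->; rewrite mul0r eq_sym oner_eq0.
have dE : ed h = (ea h)^-1 by apply: (mulfI a0); rewrite ad1 mulfV.
have -> : g' = (k * h)%g by rewrite /h mulVKg.
rewrite (lower_decomp b0) -!mulgA l_h ?om2n_neq0 // !mulgA rep_actM (I1f_l IV.1); last first.
  rewrite -exprM; apply: (@vge_le _ ((n0.+1 * 2)%N%:Z + (N + N))); first by rewrite /n0; lia.
  by apply: vgeM; [rewrite -{1}(val_omn F (n * 2)); exact: vge_val | exact: vgeM].
pose e := valuation (ea h); pose a' := om ^ (- e) * ea h.
have ua' : unitO a' by exact: unit_part.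
have eN : N <= e by move: aN; rewrite vgeE.
have eN' : e <= - N by move: dN; rewrite dE vgeE ?invr_neq0 // valV // => ?; rewrite /e; lia.
have en : exists m : nat, e + n%:Z = m%:Z /\ (m <= n + n0)%N.
  exact: shift_nat.
have [m [em mn]] := en.
have -> : (k * hh (ea h) * hh (om ^+ n) = k * hh (om ^+ m) * hh a')%g.
  have eam : ea h * om ^+ n = om ^+ m * a'.
    rewrite /a' -[om ^+ m]/(om ^ m%:Z) -em -[om ^+ n]/(om ^ n%:Z) mulrA -expfzDr ?om_neq0 //.
    by rewrite addrAC subrr add0r mulrC.
  rewrite -!mulgA; congr (_ * _)%g; rewrite -hM ?om2n_neq0 // eam hM ?om2n_neq0 //.
  exact: unitO_neq0.
rewrite rep_actM IV.2 // linearZ; apply: (subspZ (Gam_subsp _)).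
exact: (Gam_le mn (Gam_K m kK)).
Qed.

Lemma gspan_Gam x : gspan V0 x -> exists2 m, (0 < m)%N & Gam m x.
Proof.
move=> [s ->]; suff [M HM] : Gam_ev (\sum_(z <- s) z.1 *: rep_act pi z.2 V0).
  by exists M.+1 => //; apply: HM.
apply: (subsp_sum Gam_ev_subsp) => z _; apply: (subspZ Gam_ev_subsp).
exact: Gam_ev_act.
Qed.

Lemma Iwahori_V0 k : inK k -> vge 1 (ec k) -> rep_act pi k V0 = th (ed k)^-1 *: V0.
Proof.
move=> /and4P[ka kb kc kd] c1.
have ud : unitO (ed k).
  have [//|d1] := unitO_or kd; have : vge 1 (1 : F).
    by rewrite -(ead_bc k); apply: vgeB; [exact: vgeMl | exact: vgeMl].
  by rewrite vgeE ?oner_neq0 // valuation1.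
have d0 := unitO_neq0 ud.
rewrite {1}(factor_uhl d0) !rep_actM (I1f_l IV.1); last by rewrite vgeMr // unitO_vgeV.
by rewrite IV.2 ?unitOV // linearZ /= (I1f_u IV.1) // vgeMr // unitO_vgeV.
Qed.

(** [hh (om ^+ m)] conjugates k^-1 k' into the Iwahori subgroup. The scalar depends only on [th] and
    on k^-1 k', so it is the same for [fw] and for [v]. *)
Lemma same_ball m k k' : (0 < m)%N -> inK k -> inK k' -> vge (2 * m)%N%:Z (eb (k^-1 * k')%g) ->
  rep_act pi (k' * hh (om ^+ m))%g V0 =
  th (ed (k^-1 * k')%g)^-1 *: rep_act pi (k * hh (om ^+ m))%g V0.
Proof.
clear AV mu0; move=> m0 kK k'K; set c := (k^-1 * k')%g => bm.
have cK : inK c by apply: inKM => //; exact: inKV.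
have ek : k' = (k * c)%g by rewrite /c mulVKg.
clearbody c.
have a0 := om2n_neq0 F m; have /and4P[ca cb cc cd] := cK.
pose c' := mk (ea c) (eb c / (om ^+ m) ^+ 2) ((om ^+ m) ^+ 2 * ec c) (ed c).
have od : ((om : F) ^+ m) ^+ 2 = om ^ (2 * m)%N%:Z by rewrite -exprM mulnC.
have o2 : ((om : F) ^+ m) ^+ 2 != 0 by rewrite expf_neq0.
have bm' : vge 0 (eb c / (om ^+ m) ^+ 2).
  by move: bm; rewrite -[in X in X -> _](divfK o2 (eb c)) mulrC {1}od vge_omM subrr.
have c'd : ea c * ed c - eb c / (om ^+ m) ^+ 2 * ((om ^+ m) ^+ 2 * ec c) = 1.
  by rewrite mulrA divfK //; exact: ead_bc.
have -> : (k' * hh (om ^+ m) = k * hh (om ^+ m) * c')%g.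
  rewrite ek -!mulgA; congr (_ * _)%g; apply: sl2P;
    rewrite !(eM, hE) // /c' ?ea_mk ?eb_mk ?ec_mk ?ed_mk //; fld; rewrite ?a0 //.
rewrite rep_actM Iwahori_V0; last 2 first.
- rewrite /inK /bdd /c' ea_mk // eb_mk // ec_mk // ed_mk // ca cd /=.
  rewrite bm' od vge_omM /= andbT.
  by apply: vge_le cc; lia.
- rewrite /c' ec_mk // od vge_omM; apply: vge_le cc; lia.
by rewrite /c' ed_mk // linearZ.
Qed.

End Rep.
End EigenSpan.

(** * The homomorphism attached to an eigenvector *)

Section EigenHom.
Variables (p f : nat) (F : completeValuedFieldType) (C : closedFieldType).
Variables (iota : {rmorphism residue_field F -> C}) (D : resdata p f iota).
Variables (eta : F -> C) (sm : smooth_character eta).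
Local Notation om := (uniformizer : F).
Local Notation B := (Ind_B eta).
Local Notation fw := (fw D sm).
Implicit Types (g h k : SL2 F).

Lemma fw_I1chi_eta : I1chi (fun a => (eta a)^-1) fw.
Proof.
split; first exact: fw_I1f.
move=> a ua; have a0 := unitO_neq0 ua; apply: Ind_ext => g.
rewrite Ind_actE Ind_scaleE !fwE /fwfun /bigcell !(eM, hE) // !mulr0 addr0 add0r mulf_eq0.
rewrite (negPf a0) orbF; have [|c0] := eqVneq (ec g) 0; first by rewrite /= mulr0.
rewrite /=; have -> : ed g / a / (ec g * a) = (a * a)^-1 * (ed g / ec g) by fld.
rewrite vge_unitM; last by rewrite unitOV // unitOM.
case: ifP => _; last by rewrite mulr0.
by rewrite invfM -mulNr etaM ?oppr_eq0 ?invr_eq0 // etaV // mulrC.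
Qed.

Lemma At_fw : At D B fw = (eta om)^-1 *: fw.
Proof.
rewrite AtE0 (S1_Ind D sm (fw_I1f D sm)) fw_1 fw_w mulr0 addr0 mulr1 linearZ /=.
rewrite (S0_Ind D sm (f1_I1f D sm)) f1_1 f1_w mulr0 addr0 mulr1 scalerA.
by rewrite mulrAC -etaM ?N1_neq0 // mulrNN mulr1 eta1 // mul1r.
Qed.

Variables (pi : rep C (SL2 F)) (v : pi).
Hypotheses (Iv : I1chi (fun a => (eta a)^-1) v) (Av : At D pi v = (eta om)^-1 *: v).

Local Notation R := (prod_rep B pi).
Let V0 : R := (fw, v).

Definition fst_fun (x : R) : B := x.1.
Definition snd_fun (x : R) : pi := x.2.
Fact fst_linear : linear fst_fun. Proof. by []. Qed.
Fact snd_linear : linear snd_fun. Proof. by []. Qed.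
HB.instance Definition _ := GRing.isLinear.Build C R B _ fst_fun fst_linear.
HB.instance Definition _ := GRing.isLinear.Build C R pi _ snd_fun snd_linear.
Definition fst_hom : rep_hom R B :=
  @RepHom _ _ R B fst_fun (fun _ _ => erefl).
Definition snd_hom : rep_hom R pi :=
  @RepHom _ _ R pi snd_fun (fun _ _ => erefl).

Fact V0_I1chi : I1chi (fun a => (eta a)^-1) V0.
Proof.
have [If cf] := fw_I1chi_eta; have [I c] := Iv.
split=> [g gI|a ua].
  by rewrite -[LHS]/(rep_act B g fw, rep_act pi g v) If // I.
by rewrite -[LHS]/(rep_act B (hh a) fw, rep_act pi (hh a) v) cf // c.
Qed.

Fact V0_At : At D R V0 = (eta om)^-1 *: V0.
Proof.
have e1 := hom_At D fst_hom V0; have e2 := hom_At D snd_hom V0.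
rewrite [LHS]surjective_pairing; congr pair.
- by rewrite -[LHS]/(fst_hom _) e1; exact: At_fw.
- by rewrite -[LHS]/(snd_hom _) e2; exact: Av.
Qed.

(** Within one layer the supports of two translates of [fw] are equal or disjoint: a common point
    already forces the condition of [same_ball]. *)
Lemma bigcell_ball m g k k' : inK k -> inK k' ->
  bigcell (g * (k * hh (om ^+ m)))%g -> bigcell (g * (k' * hh (om ^+ m)))%g ->
  vge (2 * m)%N%:Z (eb (k^-1 * k')%g).
Proof.
move=> kK k'K; set g0 := (g * (k * _))%g; set c := (k^-1 * k')%g.
have cK : inK c by apply: inKM => //; exact: inKV.
have a0 := om2n_neq0 F m; have /and4P[ca cb cc cd] := cK.
move=> b0 b1; pose h := ((hh (om ^+ m))^-1 * c * hh (om ^+ m))%g.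
have e1 : (g * (k' * hh (om ^+ m)) = g0 * h)%g.
  by rewrite /g0 /h /c !mulgA mulgK mulgK.
rewrite e1 in b1; move: b0 b1 => /andP[c0 x0] /andP[c1 y0].
pose x := ed g0 / ec g0; pose y := ed (g0 * h)%g / ec (g0 * h)%g.
have hb : eb h = eb c / (om ^+ m) ^+ 2 by rewrite /h !(eM, hE) //; fld.
have ha : ea h = ea c by rewrite /h !(eM, hE) //; fld.
have hc : ec h = ec c * (om ^+ m) ^+ 2 by rewrite /h !(eM, hE) //; fld.
have hd : ed h = ed c by rewrite /h !(eM, hE) //; fld.
have ex : ed g0 = ec g0 * x by rewrite /x mulrC divfK.
have ey : ed (g0 * h)%g = ec (g0 * h)%g * y by rewrite /y mulrC divfK.
have ey' : eb c = (om ^+ m) ^+ 2 * (y * (ea c + x * (ec c * (om ^+ m) ^+ 2)) - x * ed c).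
  move: ey; rewrite edM ecM ex ha hb hc hd => ey.
  apply: (mulfI c0).
  have -> : ec g0 * eb c = (om ^+ m) ^+ 2 * (ec g0 * (eb c / (om ^+ m) ^+ 2) + ec g0 * x * ed c
    - ec g0 * x * ed c) by fld.
  by rewrite ey; ring.
have o2 : vge 0 (om ^+ m) by rewrite vgeX // vge01 // vge_om.
rewrite ey'; have -> : ((om : F) ^+ m) ^+ 2 = om ^ (2 * m)%N%:Z by rewrite -exprM mulnC.
rewrite vge_omM subrr.
have o3 := vge0_omX F (2 * m).
apply: vgeB; last exact: vgeMl.
apply: vgeMl => //; apply: vgeD => //; apply: vgeMl => //; exact: vgeMl.
Qed.

(** A relation between translates of [fw] in one layer splits along the disjoint supports. Within a
    class the translates are proportional, so a weighted sum of the coefficients vanishes, and the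
    same weights govern the translates of [v]. *)
Lemma gspan_functional y : gspan V0 (0 : B, y) -> y = 0.
Proof.
have mu0 : (eta om)^-1 != 0 by rewrite invr_eq0 eta_neq0 // om_neq0.
move=> /(gspan_Gam V0_I1chi V0_At mu0)[m m0 [s sK e]].
pose a (z : C * SL2 F) : B := if inK z.2 then z.1 *: rep_act B (z.2 * hh (om ^+ m))%g fw else 0.
pose b (z : C * SL2 F) : pi := if inK z.2 then z.1 *: rep_act pi (z.2 * hh (om ^+ m))%g v else 0.
(* Elements outside K form one artificial class, on which [a] and [b] are zero. *)
pose E (i j : C * SL2 F) := if inK i.2 then inK j.2 && vge (2 * m)%N%:Z (eb (i.2^-1 * j.2)%g) else ~~ inK j.2.
pose th (x : F) := (eta x)^-1.
have aE i j : inK i.2 -> E i j -> a j = (j.1 * th (ed (i.2^-1 * j.2)%g)^-1) *: rep_act B (i.2 * hh (om ^+ m))%g fw.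
  move=> iK; rewrite /E /a iK => /andP[jK ij]; rewrite jK (same_ball fw_I1chi_eta m0 iK jK ij).
  by rewrite scalerA.
have bE i j : inK i.2 -> E i j -> b j = (j.1 * th (ed (i.2^-1 * j.2)%g)^-1) *: rep_act pi (i.2 * hh (om ^+ m))%g v.
  move=> iK; rewrite /E /b iK => /andP[jK ij]; rewrite jK (same_ball Iv m0 iK jK ij).
  by rewrite scalerA.
have sa : \sum_(z <- s) a z = 0.
  apply: (etrans _ (esym (congr1 fst_hom e))); rewrite linear_sum.
  by rewrite big_seq [RHS]big_seq; apply: eq_bigr => z /(allP sK); rewrite /a => ->.
have <- : \sum_(z <- s) b z = y.
  apply: (etrans _ (esym (congr1 snd_hom e))); rewrite linear_sum.
  by rewrite big_seq [RHS]big_seq; apply: eq_bigr => z /(allP sK); rewrite /b => ->.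
apply: (@relation_transfer C B pi _ a b E) sa.
- move=> i; rewrite /E; case: ifP => [iK|->] //=.
  by rewrite iK mulVg eM vge0.
- move=> i t ta; have [iK|iK] := boolP (inK i.2); last first.
    by apply: big1 => j; rewrite /E (negPf iK) /a => /negPf ->.
  apply: Ind_ext => g; rewrite Ind_zeroE Ind_sumE.
  have [big|nbig] := boolP (bigcell (g * (i.2 * hh (om ^+ m)))%g); last first.
    apply: big1 => j /(aE _ _ iK) ->; rewrite Ind_scaleE Ind_actE fwE /fwfun (negPf nbig).
    by rewrite mulr0.
  have := congr1 (fun x => iv x g) ta; rewrite Ind_zeroE Ind_sumE => e1; apply: (etrans _ e1).
  rewrite [RHS](bigID (E i)) /= [X in _ + X]big1 ?addr0 // => j.
  rewrite /E iK /a; have [jK|jK _] := boolP (inK j.2); last by rewrite Ind_zeroE.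
  rewrite Ind_scaleE Ind_actE fwE /fwfun => nv; case: ifP => [bj|_]; last by rewrite mulr0.
  by case/negP: nv; apply: bigcell_ball big bj.
- move=> i t; have [iK|iK] := boolP (inK i.2); last first.
    by move=> _; apply: big1 => j; rewrite /E (negPf iK) /b => /negPf ->.
  rewrite (eq_bigr _ (fun j => aE i j iK)) (eq_bigr _ (fun j => bE i j iK)) -!scaler_suml.
  move=> /eqP; rewrite scaler_eq0 rep_act_eq0 (negPf (fw_neq0 D sm)) orbF => /eqP ->.
  by rewrite scale0r.
Qed.

Lemma eigen_hom : exists phi : rep_hom B pi, phi fw = v.
Proof.
have [phi phiP] : exists phi : rep_hom B pi, forall x y, gspan V0 (x, y) -> phi x = y.
  have sG := gspan_subsp V0; apply: graph_hom.
  - exact: sG.1.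
  - by move=> a x x' y y' H H'; exact: sG.2 H H'.
  - by move=> g x y H; exact: gspan_inv g _ H.
  - exact: gspan_functional.
  - move=> x; apply: (@W_all _ _ _ _ _ D _ sm (fun x => exists y, gspan V0 (x, y))).
    + split; first by exists 0; exact: sG.1.
      by move=> a e1 e2 [y1 H1] [y2 H2]; exists (a *: y1 + y2); exact: sG.2 H1 H2.
    + by move=> g e [y H]; exists (rep_act pi g y); exact: gspan_inv g _ H.
    + by exists v; exact: gspan_id.
by exists phi; apply: phiP; exact: gspan_id.
Qed.

End EigenHom.

Section EigenClassify.
Variables (p f : nat) (F : completeValuedFieldType) (C : closedFieldType).
Variables (iota : {rmorphism residue_field F -> C}) (D : resdata p f iota).
Local Notation om := (uniformizer : F).
Local Notation rho := (@rho F C iota).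

(** The character with eta(a)^-1 = rho(a)^s on units and eta(varpi)^-1 = mu. The inverses match the
    action of the torus and of A on [fw]. *)
Definition eta_of (s : nat) (mu : C) (x : F) : C :=
  (rho (om ^ (- valuation x) * x) ^+ s * mu ^ valuation x)^-1.

Lemma eta_of_smooth s mu : mu != 0 -> smooth_character (eta_of s mu).
Proof.
move=> mu0; apply: smooth_character_intro => [x x0|x y x0 y0|x x1].
- by rewrite invr_neq0 // mulf_neq0 ?expf_neq0 ?expfz_neq0 // (rho_neq0 D) // unit_part.
- rewrite /eta_of valuationM // opprD expfzDr ?om_neq0 // mulrACA (rhoM iota) ?unitO_vge ?unit_part //.
  by rewrite exprMn expfzDr // mulrACA invfM.
have ux := unitO_1D x1.
rewrite /eta_of (unitO_val ux) -[om ^ _]/(1 : F) -[mu ^ _]/(1 : C) mul1r mulr1.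
rewrite (rho_congr D (y := 1)) ?unitO_vge ?unitO1 //.
by rewrite rho1 expr1n invr1.
Qed.

(** For nontrivial eta, Ind_B(eta) is irreducible and the map given by the eigenvector is an
    isomorphism; for trivial eta, [pi] is an irreducible quotient of Ind_B(1). *)
Lemma eigen_classify (pi : rep C (SL2 F)) (v : pi) s mu : irreducible pi -> v != 0 -> mu != 0 ->
  I1chi (fun a => rho a ^+ s) v -> At D pi v = mu *: v ->
  principal_series pi \/ rep_iso pi (special_series F C).
Proof.
move=> irr v0 mu0 Iv Av; pose eta := eta_of s mu.
have sm := eta_of_smooth s mu0.
have eu a : unitO a -> (eta a)^-1 = rho a ^+ s.
  by move=> ua; rewrite /eta /eta_of (unitO_val ua) -[om ^ _]/(1 : F) -[mu ^ _]/(1 : C) mul1r mulr1 invrK.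
have eo : (eta om)^-1 = mu.
  rewrite /eta /eta_of valuation_uniformizer exprN1 mulVf ?om_neq0 //.
  by rewrite rho1 expr1n mul1r expr1z invrK.
have [ne|tr] := pselect (exists2 x, x != 0 & eta x != 1).
  left; have Iv' : I1chi (fun a => (eta a)^-1) v by apply: I1chi_ext Iv => a /eu.
  have Av' : At D pi v = (eta om)^-1 *: v by rewrite eo.
  have [phi phiv] := eigen_hom sm Iv' Av'; have irr' := Ind_irreducible D sm ne.
  exists eta; split=> //; apply: rep_iso_sym.
  by apply: (irreducible_quotient_iso (phi := phi) (x := fw D sm)) => //; rewrite phiv.
right; have tr' x : x != 0 -> eta x = 1.
  by move=> x0; apply: contrapT => /eqP x1; apply: tr; exists x.
have Iv' : I1chi (fun a => (1 : C)^-1) v.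
  by apply: I1chi_ext Iv => a ua; rewrite -eu // tr' ?invr1 // unitO_neq0.
have Av' : At D pi v = 1^-1 *: v by rewrite Av -eo tr' ?om_neq0.
have [phi phiv] := eigen_hom (one_smooth F C) Iv' Av'.
by apply: (quotient_Ind1 D irr (e := fw D (one_smooth F C)) (phi := phi)); rewrite phiv.
Qed.

End EigenClassify.

(** * Weights *)

Lemma prod_sum_dffun (R : comNzRingType) (I : finType) (T_ : I -> finType)
    (P_ : forall i, T_ i -> R) :
  \prod_i \sum_(j : T_ i) P_ i j = \sum_(t : {dffun forall i, T_ i}) \prod_i P_ i (t i).
Proof.
rewrite (reindex (@dffun_of_fprod I T_)); last first.
  by exists (@fprod_of_dffun I T_) => x _; [exact: dffun_of_fprodK | exact: fprod_of_dffunK].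
pose Q i := finfun (P_ i).
transitivity (\sum_(t : fprod T_) \prod_(i in I) Q i (t i)); last first.
  by apply: eq_bigr => t _; apply: eq_bigr => i _; rewrite !ffunE.
rewrite big_fprod -(@bigA_distr_big_dep R 0 1 _ _ I {i : I & T_ i} (fun i => tagged_with T_ i) (fun i => untag 0 (Q i))); apply: eq_bigr => i _.
by apply: (etrans _ (big_tag (fun i => Q i) i)); apply: eq_bigr => j _; rewrite ffunE.
Qed.

Lemma digit_sum_inj p f (k k' : 'I_f -> nat) : (forall j, k j < p)%N -> (forall j, k' j < p)%N ->
  (\sum_j k j * p ^ j = \sum_j k' j * p ^ j)%N -> k =1 k'.
Proof.
elim: f k k' => [|f IHf] k k' kp k'p; first by move=> _ [].
have p0 : (0 < p)%N by apply: leq_ltn_trans (kp ord0).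
have E (h : 'I_f.+1 -> nat) : (\sum_j h j * p ^ j = (\sum_(j < f) h (lift ord0 j) * p ^ j) * p + h ord0)%N.
  rewrite big_ord_recl muln1 addnC; congr (_ + _)%N; rewrite big_distrl /=.
  by apply: eq_bigr => j _; rewrite /bump add1n expnSr mulnA.
rewrite !E => e; have e0 : k ord0 = k' ord0.
  by move/(congr1 (modn^~ p)): e; rewrite !modnMDl !modn_small.
have {}e : (\sum_(j < f) k (lift ord0 j) * p ^ j = \sum_(j < f) k' (lift ord0 j) * p ^ j)%N.
  by apply/eqP; rewrite -(eqn_pmul2r p0) -(eqn_add2r (k ord0)) {2}e0; apply/eqP.
move=> j; have [j' ->|->//] := unliftP ord0 j.
by apply: (IHf (fun j => k (lift ord0 j)) (fun j => k' (lift ord0 j))).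
Qed.

Lemma digit_sum_lt p f (k : 'I_f -> nat) : (forall j, k j < p)%N -> (\sum_j k j * p ^ j < p ^ f)%N.
Proof.
elim: f k => [|f IHf] k kp; first by rewrite big_ord0.
rewrite big_ord_recr /=; have := IHf (fun j => k (widen_ord (leqnSn f) j)) (fun j => kp _).
have := leq_mul (kp ord_max) (leqnn (p ^ f)); rewrite mulSn expnS /=; lia.
Qed.

Lemma digit_sum_ex p f E : (E < p ^ f)%N ->
  exists r : 'I_f -> 'I_p, (\sum_j r j * p ^ j)%N = E.
Proof.
elim: f E => [|f IHf] E Ef.
  exists (fun j : 'I_0 => False_rect _ (notF (ltn_ord j))); rewrite big_ord0.
  by move: Ef; rewrite expn0 ltnS leqn0 => /eqP ->.
have p0 : (0 < p)%N by move: Ef; rewrite expnS; case: (p).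
have [r rE] : exists r : 'I_f -> 'I_p, (\sum_j r j * p ^ j)%N = (E %/ p)%N.
  by apply: IHf; rewrite ltn_divLR // -expnSr.
exists (fun j => if unlift ord0 j is Some j' then r j' else Ordinal (ltn_pmod E p0)).
rewrite big_ord_recl unlift_none /= muln1 [RHS](divn_eq E p) addnC -rE big_distrl /=.
by congr (_ + _)%N; apply: eq_bigr => j _; rewrite liftK /bump add1n expnSr mulnA.
Qed.

Section Homogeneous.
Variable R : comNzRingType.
Implicit Types (P : {poly R}) (x y a c : R).

(** Undoes the dehomogenization of [sym_mx]: a polynomial of degree at most d is read as a form of
    degree d and evaluated at (x, y). *)
Definition hom_eval d P x y := \sum_(k < d.+1) x ^+ (d - k) * y ^+ k * P`_k.

Lemma hom_evalM d P x y a c : (size P <= d.+1)%N ->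
  hom_eval d.+1 (P * (a%:P + c *: 'X)) x y = hom_eval d P x y * (a * x + c * y).
Proof.
move=> sP; have cE k : (P * (a%:P + c *: 'X))`_k = P`_k * a + (P * 'X)`_k * c.
  by rewrite mulrDr coefD coefMC -mul_polyC mulrCA [c%:P * _]mulrC coefMC.
rewrite /hom_eval; under eq_bigr do rewrite cE mulrDr.
rewrite big_split mulrDr /=; congr (_ + _).
  rewrite big_ord_recr /= (nth_default 0 sP) mul0r mulr0 addr0 mulr_suml.
  by apply: eq_bigr => k _; rewrite subSn ?exprSr; [ring | rewrite -ltnS].
rewrite big_ord_recl /= coefMX /= mul0r mulr0 add0r mulr_suml.
apply: eq_bigr => k _; rewrite coefMX /= /bump /= add1n add0n subSS exprS; ring.
Qed.

Lemma hom_evalMX d (n : nat) P x y a c : (size P <= d.+1)%N ->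
  (size (P * (a%:P + c *: 'X) ^+ n)%R <= (d + n).+1)%N /\
  hom_eval (d + n) (P * (a%:P + c *: 'X) ^+ n) x y = hom_eval d P x y * (a * x + c * y) ^+ n.
Proof.
move=> sP; elim: n => [|n [sIH IHn]]; first by rewrite addn0 !expr0 !mulr1.
rewrite addnS !exprSr !mulrA hom_evalM // IHn; split=> //.
apply: leq_trans (size_polyMleq _ _) _.
have sl : (size (a%:P + c *: 'X)%R <= 2)%N.
  apply: leq_trans (size_polyD _ _) _; rewrite geq_max (leq_trans (size_polyC_leq1 _)) //.
  by rewrite (leq_trans (size_scale_leq _ _)) // size_polyX.
by move: sIH sl; lia.
Qed.

Lemma hom_eval_forms d i x y a c b e : (i <= d)%N ->
  hom_eval d ((a%:P + c *: 'X) ^+ (d - i) * (b%:P + e *: 'X) ^+ i) x y =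
  (a * x + c * y) ^+ (d - i) * (b * x + e * y) ^+ i.
Proof.
move=> id; have s1 : (size (1%R : {poly R}) <= 1%N)%N by rewrite size_poly1.
have [s2 E2] := @hom_evalMX 0 (d - i) 1 x y a c s1.
have [_] := @hom_evalMX _ i _ x y b e s2.
rewrite E2 mul1r add0n subnK // => ->.
by rewrite /hom_eval big_ord_recl big_ord0 coef1 !mulr1 addr0 mul1r.
Qed.

End Homogeneous.

Section Weights.
Variables (p f : nat) (F : completeValuedFieldType) (C : closedFieldType).
Variables (iota : {rmorphism residue_field F -> C}) (D : resdata p f iota).
Variable r : 'I_f -> 'I_p.
Local Notation om := (uniformizer : F).
Local Notation rho := (@rho F C iota).
Local Notation q := (p ^ f)%N.
Local Notation V := (weight C r).
Local Notation index := {dffun forall j : 'I_f, 'I_(r j).+1}.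
Local Notation sigma := (sigma iota r).
Implicit Types (X Y : C) (y : V) (g h : GL2 F).

Definition expo (k : index) : nat := \sum_j k j * p ^ j.
Definition total : nat := \sum_j r j * p ^ j.

(* Evaluation at [(X, Y)] of the polynomial functions whose coordinates are the
   elements of the weight; the tensor factor [j] is twisted by [Frob^j]. *)
Definition ev X Y y : C^o :=
  \sum_(k : index) (\prod_j (X ^+ ((r j - k j) * p ^ j) * Y ^+ (k j * p ^ j))) * y k.

Fact ev_linear X Y : linear (ev X Y).
Proof.
move=> a y z; rewrite /ev scaler_sumr -big_split /=; apply: eq_bigr => k _.
by rewrite !ffunE mulrDr; congr (_ + _); exact: mulrCA.
Qed.
HB.instance Definition _ X Y := GRing.isLinear.Build C V C^o _ (ev X Y) (ev_linear X Y).

Lemma ev_tensor X Y M y : ev X Y (tensor_op M y) = \sum_(i : index)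
  (\prod_j \sum_(k < (r j).+1) X ^+ ((r j - k) * p ^ j) * Y ^+ (k * p ^ j) * M j k (i j)) * y i.
Proof.
rewrite /ev; under eq_bigr do rewrite ffunE mulr_sumr.
rewrite exchange_big; apply: eq_bigr => i _ /=.
rewrite prod_sum_dffun mulr_suml; apply: eq_bigr => k _.
by rewrite mulrA -big_split.
Qed.

(** The group acts on forms by substitution. The Frobenius twists are absorbed because raising to
    the power p^j is additive in characteristic p. *)
Lemma ev_sigma X Y g y : ev X Y (sigma g y) =
  ev (reduce_mx iota g ord0 ord0 * X + reduce_mx iota g ord_max ord0 * Y)
     (reduce_mx iota g ord0 ord_max * X + reduce_mx iota g ord_max ord_max * Y) y.
Proof.
rewrite ev_tensor; apply: eq_bigr => i _; congr (_ * _); apply: eq_bigr => j _.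
set A := reduce_mx iota g.
have pn : [pchar C].-nat (p ^ j)%N.
  by rewrite pnatX; apply/orP; left; rewrite pnatE ?(rd_prime D) // (rd_pchar D).
have ij : (i j <= r j)%N by rewrite -ltnS.
have frob a c : a ^+ (p ^ j) * X ^+ (p ^ j) + c ^+ (p ^ j) * Y ^+ (p ^ j) = (a * X + c * Y) ^+ (p ^ j).
  by rewrite exprDn_pchar // !exprMn.
under eq_bigr do rewrite mulnC exprM mulnC exprM !mxE.
rewrite [LHS](hom_eval_forms (X ^+ (p ^ j)) (Y ^+ (p ^ j))) // !frob -!exprM.
by rewrite ![(p ^ j * _)%N]mulnC /A !mxE.
Qed.

Lemma p_gt1 : (1 < p)%N. Proof. exact: prime_gt1 (rd_prime D). Qed.

Lemma expo_lt k : (expo k < q)%N.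
Proof. by apply: digit_sum_lt => j; apply: leq_trans (ltn_ord (r j)); exact: ltn_ord. Qed.

Lemma expo_inj : injective expo.
Proof.
move=> k k' e; apply/ffunP => j; apply: val_inj.
by apply: (digit_sum_inj (p := p) (k := fun j => k j) (k' := fun j => k' j)) e j => j;
  apply: leq_trans (ltn_ord (r j)); exact: ltn_ord.
Qed.

Lemma ev1 t y : ev 1 t y = \sum_k t ^+ expo k * y k.
Proof.
apply: eq_bigr => k _; congr (_ * _); rewrite -prodrXr; apply: eq_bigr => j _.
by rewrite expr1n mul1r.
Qed.

(** The exponents [expo k] are distinct and below q, by uniqueness of base p expansions, so [y] is a
    polynomial of degree less than q with q roots. *)
Lemma ev_eq0 y : (forall b, vge 0 b -> ev 1 (rho b) y = 0) -> y = 0.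
Proof.
move=> H; pose P := \sum_k y k *: 'X^(expo k).
have P0 : P = 0.
  apply: (@roots_geq_poly_eq0 _ _ [seq rho (lam D i) | i <- enum 'I_q]).
  - apply/allP => _ /mapP[i _ ->]; apply/eqP; rewrite /P horner_sum.
    rewrite -[RHS](H (lam D i)) ?lam_int // ev1; apply: eq_bigr => k _.
    by rewrite hornerZ hornerXn mulrC.
  - by rewrite map_inj_uniq ?enum_uniq //; exact: rho_lam_inj.
  rewrite size_map size_enum_ord; apply: leq_trans (size_sum _ _ _) _.
  apply/bigmax_leqP => k _; apply: leq_trans (size_scale_leq _ _) _.
  by rewrite size_polyXn expo_lt.
apply/ffunP => k; rewrite [RHS]ffunE; have := congr1 (fun P : {poly C} => P`_(expo k)) P0.
rewrite coef0 /P coef_sum (bigD1 k) //= coefZ coefXn eqxx mulr1 big1 ?addr0 // => k' kk'.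
by rewrite coefZ coefXn; case: eqP => [/expo_inj e|_]; rewrite ?mulr0 // e eqxx in kk' *.
Qed.

Lemma ev_ext y z : (forall X Y, ev X Y y = ev X Y z) -> y = z.
Proof.
move=> H; apply/eqP; rewrite -subr_eq0; apply/eqP/ev_eq0 => b _.
by rewrite linearB /= H subrr.
Qed.

Definition kbot : index := [ffun j : 'I_f => ord0].
Definition ktop : index := [ffun j : 'I_f => ord_max].
Definition xr : V := [ffun k : index => (k == kbot)%:R : C^o].
Definition yr : V := [ffun k : index => (k == ktop)%:R : C^o].

Lemma ev_delta X Y k0 : ev X Y [ffun k : index => (k == k0)%:R : C^o] =
  \prod_j (X ^+ ((r j - k0 j) * p ^ j) * Y ^+ (k0 j * p ^ j)).
Proof.
rewrite /ev (bigD1 k0) //= ffunE eqxx mulr1 [X in _ + X]big1 ?addr0 // => k /negPf kk0.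
by rewrite ffunE kk0 mulr0.
Qed.

Lemma ev_xr X Y : ev X Y xr = X ^+ total.
Proof.
rewrite ev_delta -prodrXr; apply: eq_bigr => j _.
by rewrite ffunE /= mul0n expr0 mulr1 subn0.
Qed.

Lemma ev_yr X Y : ev X Y yr = Y ^+ total.
Proof.
rewrite ev_delta -prodrXr; apply: eq_bigr => j _.
by rewrite ffunE /= subnn mul0n expr0 mul1r.
Qed.

Lemma xr_neq0 : xr != 0.
Proof. by apply/negP => /eqP/ffunP/(_ kbot)/eqP; rewrite !ffunE eqxx oner_eq0. Qed.

Lemma prod_natr (I : finType) (b : I -> bool) : \prod_i ((b i)%:R : C) = [forall i, b i]%:R.
Proof.
have [/forallP H|/forallPn[i Hi]] := boolP [forall i, b i].
  by rewrite big1 // => i _; rewrite H.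
by rewrite (bigD1 i) //= (negPf Hi) mul0r.
Qed.

Lemma ev0 Y y : ev 0 Y y = Y ^+ total * y ktop.
Proof.
rewrite /ev (bigD1 ktop) //= [X in _ + X]big1 ?addr0 => [|k kk].
  congr (_ * _); rewrite -prodrXr; apply: eq_bigr => j _.
  by rewrite ffunE /= subnn mul0n expr0 mul1r.
have /forallPn[j jk] : ~~ [forall j, k j == ktop j].
  by apply: contra kk => /forallP H; apply/eqP; apply/ffunP => j; exact: (eqP (H j)).
rewrite (bigD1 j) //= expr0n muln_eq0 subn_eq0.
have -> : (r j <= k j)%N = false.
  apply: contraNF jk => rk; rewrite ffunE; apply/eqP/val_inj/eqP.
  by rewrite eqn_leq rk -ltnS ltn_ord.
by rewrite expn_eq0 (gtn_eqF (ltnW p_gt1)) !mul0r.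
Qed.

Lemma U_opE y : U_op C r y = ev 0 1 y *: yr.
Proof.
apply/ffunP => k; rewrite ev0 expr1n mul1r !ffunE.
have E (i : index) : \prod_j (delta_mx ord_max ord_max : 'M[C]_((r j).+1)) (k j) (i j) =
    ((k == ktop) && (i == ktop))%:R.
  under eq_bigr do rewrite mxE.
  rewrite prod_natr; congr (nat_of_bool _)%:R; apply/forallP/andP => [H|[/eqP -> /eqP ->] j].
    by split; apply/eqP/ffunP => j; have /andP[/eqP a /eqP b] := H j; rewrite ?a ?b ffunE.
  by rewrite !ffunE !eqxx.
under eq_bigr do rewrite E.
rewrite (bigD1 ktop) //= eqxx andbT big1 ?addr0 => [|i /negPf ->]; last by rewrite andbF mul0r.
by rewrite mulrC.
Qed.

(** The invariants of the integral unipotents form the line of [xr]: invariance makes the associated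
    polynomial function constant on the residue field. *)
Lemma V_unip y : (forall x X Y, vge 0 x -> ev X (rho x * X + Y) y = ev X Y y) ->
  y = ev 1 0 y *: xr.
Proof.
move=> H; apply/eqP; rewrite -subr_eq0; apply/eqP/ev_eq0 => b b0.
have := H b 1 0 b0; rewrite mulr1 addr0 => e.
by rewrite linearB linearZ /= e ev_xr expr1n [_ *: _]mulr1 subrr.
Qed.

Lemma tensor_xr M k : tensor_op M xr k = \prod_j M j (k j) ord0.
Proof.
rewrite ffunE (bigD1 kbot) //= ffunE eqxx mulr1 [X in _ + X]big1 ?addr0 => [|i /negPf ib]; last first.
  by rewrite ffunE ib mulr0.
by apply: eq_bigr => j _; rewrite ffunE.
Qed.

End Weights.

(** * Compact induction *)

Lemma compact_finite_cover (T : topologicalType) (x0 : T) (Q : set T) (J : choiceType)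
    (U : J -> set T) : compact Q -> (forall j, open (U j)) -> (forall x, Q x -> exists j, U j x) ->
  exists s : seq J, forall x, Q x -> exists2 j, j \in s & U j x.
Proof.
(* The covering form of compactness is stated for pointed spaces; [x0] provides the point. *)
pose T' : ptopologicalType :=
  HB.pack_for ptopologicalType (T : Type) (Topological.on T) (isPointed.Build T x0).
move=> cQ oU UQ; have cQ' : cover_compact (T := T') Q by rewrite -compact_cover; exact: cQ.
have [|x Qx|s _ sQ] := cQ' J setT U; first by move=> j _; exact: oU.
  by have [j Uj] := UQ x Qx; exists j.
by exists (finmap.enum_fset s) => x /sQ[j js Uj]; exists j.
Qed.

Section CompactInduction.
Variables (C : fieldType) (G : rightTopGroupType) (V : lmodType C).
Variables (H : set G) (sigma : G -> {linear V -> V}).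
Implicit Types (g h : G) (v : V).

(* The hypotheses under which the brackets belong to the compact induction and span it. *)
Record inducible : Prop := Inducible {
  ind_1 : H 1%g;
  ind_M : forall g h, H g -> H h -> H (g * h)%g;
  ind_V : forall g, H g -> H g^-1%g;
  ind_open : open H;
  ind_centre : @centre G `<=` H;
  ind_compact : exists2 Q : set G, compact Q &
    forall h, H h -> [set (z * q)%g | z in @centre G & q in Q] h;
  ind_sigma1 : forall v, sigma 1%g v = v;
  ind_sigmaM : forall g h v, H g -> H h -> sigma (g * h)%g v = sigma g (sigma h v);
  ind_smooth : exists H1 : set G, [/\ open H1, H1 1%g, H1 `<=` H &
    forall h v, H1 h -> sigma h v = v]
}.

Hypothesis I : inducible.
Local Notation X := (cInd H sigma).
Local Notation bracket := (bracket H sigma).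

Definition cv (x : X) : G -> V := sval x.
Arguments cv x g : simpl never.

Lemma cv_act (x : X) g h : cv (rep_act X g x) h = cv x (h * g)%g.
Proof. reflexivity. Qed.
Lemma cv_ext (x y : X) : (forall g, cv x g = cv y g) -> x = y.
Proof. by move=> e; apply: val_inj; apply/funext; exact: e. Qed.
Lemma cv_add (x y : X) g : cv (x + y) g = cv x g + cv y g. Proof. reflexivity. Qed.
Lemma cv_scale c (x : X) g : cv (c *: x) g = c *: cv x g. Proof. reflexivity. Qed.
Lemma cv_zero g : cv (0 : X) g = 0. Proof. reflexivity. Qed.
Lemma cv_sum (J : Type) (s : seq J) (P : pred J) (E : J -> X) g :
  cv (\sum_(i <- s | P i) E i) g = \sum_(i <- s | P i) cv (E i) g.
Proof.
elim: s => [|i s IHs]; first by rewrite !big_nil cv_zero.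
by rewrite !big_cons; case: ifP; rewrite ?cv_add IHs.
Qed.

Lemma cv_equiv (x : X) h g : H h -> cv x (h * g)%g = sigma h (cv x g).
Proof. by have /asboolP[_ eq _] := valP x => Hh; exact: (eq h g Hh). Qed.

Lemma ind_sigmaVr h v : H h -> sigma h (sigma h^-1%g v) = v.
Proof. by move=> Hh; rewrite -(ind_sigmaM I) ?mulgV ?(ind_sigma1 I) //; exact: (ind_V I). Qed.

Lemma ind_Ml g h : H g -> H (g * h)%g <-> H h.
Proof.
move=> Hg; split=> [Hgh|]; last exact: (ind_M I).
by rewrite -(mulKg g h); apply: (ind_M I) => //; exact: (ind_V I).
Qed.

Lemma bracketE g v h : H (h * g)%g -> bracket g v h = sigma (h * g)%g v.
Proof. by rewrite /Defs.bracket => Hh; case: asboolP. Qed.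

Lemma bracket0 g v h : ~ H (h * g)%g -> bracket g v h = 0.
Proof. by rewrite /Defs.bracket => Hh; case: asboolP. Qed.

Lemma open_translate (U : set G) g : open U -> open [set h | U (h * g)%g].
Proof. by move=> oU; have /continuousP := @mulgr_continuous G g; apply. Qed.

Lemma locally_constant_equivariant (f : G -> V) :
  (forall h g, H h -> f (h * g)%g = sigma h (f g)) -> locally_constant f.
Proof.
move=> ef x; have [H1 [o1 H11 H1H triv]] := ind_smooth I.
have : nbhs x [set h | H1 (h * x^-1)%g].
  by apply: open_nbhs_nbhs; split; [exact: open_translate | rewrite /= mulgV].
apply: filterS => y /= Hy; rewrite -{1}(mulgVK x y) ef ?triv //; exact: H1H.
Qed.

Lemma cInd_intro (f : G -> V) : (forall h g, H h -> f (h * g)%g = sigma h (f g)) ->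
  compact_mod_centre f -> exists x : X, cv x = f.
Proof.
move=> ef cf; have fP : f \in cInd_pred H sigma.
  by apply/asboolP; split=> //; exact: locally_constant_equivariant.
by exists (exist _ f fP : X).
Qed.

Fact bracket_ex g v : exists x : X, cv x = bracket g v.
Proof.
apply: cInd_intro => [h k Hh|].
  have [Hk|Hk] := pselect (H (k * g)%g).
    have Hhk : H (h * k * g)%g by rewrite -mulgA; apply: (ind_M I).
    by rewrite !bracketE // -mulgA (ind_sigmaM I _ Hh Hk).
  rewrite !bracket0 ?linear0 //; rewrite -mulgA ind_Ml //.
have [Q cQ HQ] := ind_compact I; exists [set (q * g^-1)%g | q in Q].
  apply: continuous_compact => //; apply: continuous_subspaceT; exact: mulgr_continuous.
move=> h; rewrite /Defs.bracket; case: asboolP => [Hh _|]; last by rewrite eqxx.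
have [z Zz [k Qk e]] := HQ _ Hh; exists z => //; exists (k * g^-1)%g; first by exists k.
by rewrite mulgA e mulgK.
Qed.

Definition br g v : X := projT1 (cid (bracket_ex g v)).

Lemma brE g v : cv (br g v) = bracket g v.
Proof. by rewrite /br; case: cid. Qed.

Lemma br_in g v h : H (h * g)%g -> cv (br g v) h = sigma (h * g)%g v.
Proof. by rewrite brE; exact: bracketE. Qed.

Lemma br_out g v h : ~ H (h * g)%g -> cv (br g v) h = 0.
Proof. by rewrite brE; exact: bracket0. Qed.

Lemma br_act g h v : rep_act X g (br h v) = br (g * h)%g v.
Proof. by apply: cv_ext => k; rewrite cv_act !brE /Defs.bracket mulgA. Qed.

Lemma br_H g h v : H h -> br (g * h)%g v = br g (sigma h v).
Proof.
move=> Hh; apply: cv_ext => k.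
have E : H (k * (g * h))%g <-> H (k * g)%g.
  split=> Hk; last by rewrite mulgA; exact: (ind_M I).
  by rewrite -(mulgK h (k * g)%g) -(mulgA k); apply: (ind_M I) => //; exact: (ind_V I).
have [Hk|Hk] := pselect (H (k * g)%g).
  have Hk' : H (k * (g * h))%g by exact/E.
  by rewrite (br_in _ Hk') (br_in _ Hk) mulgA (ind_sigmaM I _ Hk Hh).
by rewrite !br_out // => /E.
Qed.

Lemma br_linear g : linear (br g).
Proof.
move=> a v v'; apply: cv_ext => k; rewrite cv_add cv_scale.
have [Hk|Hk] := pselect (H (k * g)%g); first by rewrite !br_in // linearP.
by rewrite !br_out // scaler0 addr0.
Qed.
HB.instance Definition _ g := GRing.isLinear.Build C V X _ (br g) (br_linear g).

(** By compactness modulo the centre the support is covered by finitely many cosets of [H];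
    subtracting one bracket per coset exhausts the function. *)
Lemma br_span (x : X) : exists s : seq (G * V), x = \sum_(z <- s) br z.1 z.2.
Proof.
have /asboolP[_ _ [Q cQ sQ]] := valP x.
have [||t tQ] := @compact_finite_cover G 1%g Q G (fun g => [set h | H (h * g)%g]) cQ.
- by move=> g; apply: open_translate; exact: (ind_open I).
- by move=> g _; exists g^-1%g; rewrite /= mulgV; exact: (ind_1 I).
have tS g : cv x g != 0 -> exists2 h, h \in t & H (g * h)%g.
  move=> /sQ[z Zz [k Qk <-]]; have [h ht Hh] := tQ _ Qk.
  exists h => //; rewrite -mulgA; apply: (ind_M I) => //; exact: (ind_centre I).
elim: t {tQ} x {sQ} tS => [|h t IHt] x tS.
  exists [::]; rewrite big_nil; apply: cv_ext => g; rewrite cv_zero.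
  by apply/eqP/negPn/negP => /tS[].
pose y := x - br h (cv x h^-1%g).
have [s ys] : exists s : seq (G * V), y = \sum_(z <- s) br z.1 z.2.
  apply: IHt => g; rewrite /y -scaleN1r cv_add cv_scale scaleN1r.
  have [Hg|Hg] := pselect (H (g * h)%g).
    by rewrite br_in // -cv_equiv // -mulgA mulgV mulg1 subrr eqxx.
  rewrite br_out // subr0 => /tS[k]; rewrite inE => /orP[/eqP ->//|kt Hk].
  by exists k.
by exists ((h, cv x h^-1%g) :: s); rewrite big_cons -ys /y addrC subrK.
Qed.

(** Frobenius reciprocity. A relation between brackets splits over the left cosets of [H], where the
    supports are disjoint; within a coset it is a relation in [V] between values of [sigma], which
    [Psi] respects. *)
Lemma frobenius (pi : rep C G) (Psi : {linear V -> pi}) :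
  (forall h v, H h -> Psi (sigma h v) = rep_act pi h (Psi v)) ->
  exists phi : rep_hom X pi, forall g v, phi (br g v) = rep_act pi g (Psi v).
Proof.
move=> PsiH; pose a (z : G * V) := br z.1 z.2; pose b (z : G * V) := rep_act pi z.1 (Psi z.2).
have [phi phiP] : exists phi : rep_hom X pi, forall x y,
    (exists2 s : seq (G * V), x = \sum_(z <- s) a z & y = \sum_(z <- s) b z) -> phi x = y.
  apply: graph_hom.
  - by exists [::]; rewrite !big_nil.
  - move=> c x x' y y' [s -> ->] [s' -> ->].
    exists ([seq (z.1, c *: z.2) | z <- s] ++ s').
      rewrite big_cat big_map scaler_sumr; congr (_ + _).
      by apply: eq_bigr => z _; rewrite /a linearZ.
    rewrite big_cat big_map scaler_sumr; congr (_ + _).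
    by apply: eq_bigr => z _; rewrite /b !linearZ.
  - move=> g x y [s -> ->]; exists [seq ((g * z.1)%g, z.2) | z <- s].
      by rewrite big_map linear_sum; apply: eq_bigr => z _; rewrite /a -br_act.
    by rewrite big_map linear_sum; apply: eq_bigr => z _; rewrite /b -rep_actM.
  - move=> y [s e ->]; move: (esym e).
    apply: (relation_transfer (E := fun i j : G * V => `[< H (i.1^-1 * j.1)%g >])).
    + by move=> i; apply/asboolP; rewrite mulVg; exact: (ind_1 I).
    + move=> i t ta; apply: cv_ext => h; rewrite cv_zero cv_sum.
      have [Hh|Hh] := pselect (H (h * i.1)%g).
        have := congr1 (fun x => cv x h) ta; rewrite cv_zero cv_sum => e1.
        apply: (etrans _ e1).
        rewrite [RHS](bigID (fun j : G * V => `[< H (i.1^-1 * j.1)%g >])) /=.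
        rewrite [X in _ = _ + X]big1 ?addr0 // => j /asboolP nE.
        apply: br_out => Hj; apply: nE.
        have -> : (i.1^-1 * j.1 = (h * i.1)^-1 * (h * j.1))%g by rewrite invgM -mulgA mulKg.
        by apply: (ind_M I) => //; exact: (ind_V I).
      apply: big1 => j /asboolP Hij; apply: br_out => Hj; apply: Hh.
      have -> : (h * i.1 = (h * j.1) * (i.1^-1 * j.1)^-1)%g by rewrite invgM invgK -mulgA mulVKg.
      by apply: (ind_M I) => //; exact: (ind_V I).
    + move=> i t ta.
      have e0 : \sum_(j <- t | `[< H (i.1^-1 * j.1)%g >]) sigma (i.1^-1 * j.1)%g j.2 = 0.
        have := congr1 (fun x => cv x (i.1^-1)%g) ta; rewrite cv_zero cv_sum => e1.
        by apply: (etrans _ e1); apply: eq_bigr => j /asboolP Hj; rewrite br_in.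
      have := congr1 (fun v => rep_act pi i.1 (Psi v)) e0.
      rewrite !linear_sum /= !linear0 => e1; apply: (etrans _ e1).
      by apply: eq_bigr => j /asboolP Hj; rewrite PsiH // -rep_actM mulVKg.
  - by move=> x; have [s ->] := br_span x; exists (\sum_(z <- s) b z), s.
exists phi => g v; apply: phiP.
by exists [:: (g, v)]; rewrite big_seq1.
Qed.

End CompactInduction.

(** * The subgroup KZ of GL2 *)

Section GL2Elements.
Variable F : fieldType.
Implicit Types (a b c d : F) (g h : GL2 F) (s : SL2 F).

Definition ga g : F := val g ord0 ord0.
Definition gb g : F := val g ord0 ord_max.
Definition gc g : F := val g ord_max ord0.
Definition gd g : F := val g ord_max ord_max.
Definition gdet g : F := \det (val g).

Lemma gdetE g : gdet g = ga g * gd g - gb g * gc g. Proof. exact: det_mx2E. Qed.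
Lemma gdet_neq0 g : gdet g != 0.
Proof. by have := valP g; rewrite unitmxE unitfE. Qed.
Lemma gdetM g h : gdet (g * h)%g = gdet g * gdet h. Proof. exact: det_mulmx. Qed.

Lemma gl2P g h : ga g = ga h -> gb g = gb h -> gc g = gc h -> gd g = gd h -> g = h.
Proof. by move=> *; apply: val_inj; exact: mx2_eq. Qed.

Lemma gaM g h : ga (g * h)%g = ga g * ga h + gb g * gc h. Proof. exact: mul_mx2. Qed.
Lemma gbM g h : gb (g * h)%g = ga g * gb h + gb g * gd h. Proof. exact: mul_mx2. Qed.
Lemma gcM g h : gc (g * h)%g = gc g * ga h + gd g * gc h. Proof. exact: mul_mx2. Qed.
Lemma gdM g h : gd (g * h)%g = gc g * gb h + gd g * gd h. Proof. exact: mul_mx2. Qed.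
Lemma ga1 : ga 1%g = 1. Proof. by rewrite /ga /= mxE. Qed.
Lemma gb1 : gb 1%g = 0. Proof. by rewrite /gb /= mxE. Qed.
Lemma gc1 : gc 1%g = 0. Proof. by rewrite /gc /= mxE. Qed.
Lemma gd1 : gd 1%g = 1. Proof. by rewrite /gd /= mxE. Qed.

(* The identity when the determinant is 0. *)
Definition gm a b c d : GL2 F := insubd (1%g : GL2 F) (mx2 a b c d).

Section GmEntries.
Variables (a b c d : F) (e : a * d - b * c != 0).
Lemma val_gm : val (gm a b c d) = mx2 a b c d.
Proof. by rewrite insubdK // unfold_in /= unitmxE unitfE det_mx2E !mxE. Qed.
Lemma ga_gm : ga (gm a b c d) = a. Proof. by rewrite /ga val_gm // mxE. Qed.
Lemma gb_gm : gb (gm a b c d) = b. Proof. by rewrite /gb val_gm // mxE. Qed.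
Lemma gc_gm : gc (gm a b c d) = c. Proof. by rewrite /gc val_gm // mxE. Qed.
Lemma gd_gm : gd (gm a b c d) = d. Proof. by rewrite /gd val_gm // mxE. Qed.
End GmEntries.

Lemma ginv_det g : gd g / gdet g * (ga g / gdet g) - (- gb g / gdet g) * (- gc g / gdet g) != 0.
Proof.
have d0 := gdet_neq0 g.
have -> : gd g / gdet g * (ga g / gdet g) - (- gb g / gdet g) * (- gc g / gdet g) =
    (ga g * gd g - gb g * gc g) / (gdet g * gdet g) by field.
by rewrite -gdetE !mulf_neq0 // invr_eq0 mulf_neq0.
Qed.

Lemma invg_gm g : g^-1%g = gm (gd g / gdet g) (- gb g / gdet g) (- gc g / gdet g) (ga g / gdet g).
Proof.
set h := gm _ _ _ _; suff H : (h * g = 1)%g by rewrite -[LHS]mul1g -H mulgK.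
have d0 := gdet_neq0 g; apply: gl2P; rewrite ?gaM ?gbM ?gcM ?gdM ?ga_gm ?gb_gm ?gc_gm ?gd_gm ?ginv_det //
  ?ga1 ?gb1 ?gc1 ?gd1; apply: (mulfI d0); rewrite ?mulr1 ?mulr0 ?[RHS]gdetE; field.
all: exact: d0.
Qed.

Lemma gaV g : ga g^-1%g = gd g / gdet g. Proof. by rewrite invg_gm ga_gm ?ginv_det. Qed.
Lemma gbV g : gb g^-1%g = - gb g / gdet g. Proof. by rewrite invg_gm gb_gm ?ginv_det. Qed.
Lemma gcV g : gc g^-1%g = - gc g / gdet g. Proof. by rewrite invg_gm gc_gm ?ginv_det. Qed.
Lemma gdV g : gd g^-1%g = ga g / gdet g. Proof. by rewrite invg_gm gd_gm ?ginv_det. Qed.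
Lemma gdet1 : gdet 1%g = 1. Proof. by rewrite gdetE ga1 gb1 gc1 gd1; ring. Qed.
Lemma gdetV g : gdet g^-1%g = (gdet g)^-1.
Proof. by apply: (mulfI (gdet_neq0 g)); rewrite -gdetM mulgV gdet1 mulfV ?gdet_neq0. Qed.

Lemma ga_SL s : ga (SL2_GL2 s) = ea s. Proof. by []. Qed.
Lemma gb_SL s : gb (SL2_GL2 s) = eb s. Proof. by []. Qed.
Lemma gc_SL s : gc (SL2_GL2 s) = ec s. Proof. by []. Qed.
Lemma gd_SL s : gd (SL2_GL2 s) = ed s. Proof. by []. Qed.
Lemma gdet_SL s : gdet (SL2_GL2 s) = 1. Proof. exact: (eqP (valP s)). Qed.
Definition gE_SL := (ga_SL, gb_SL, gc_SL, gd_SL, gdet_SL).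

Lemma SL2_GL2M s t : SL2_GL2 (s * t)%g = (SL2_GL2 s * SL2_GL2 t)%g.
Proof. by apply: val_inj. Qed.
Lemma SL2_GL21 : SL2_GL2 1%g = 1%g :> GL2 F.
Proof. by apply: val_inj. Qed.
Lemma SL2_GL2V s : SL2_GL2 s^-1%g = (SL2_GL2 s)^-1%g.
Proof. by rewrite -[RHS]mul1g -SL2_GL21 -(mulVg s) SL2_GL2M mulgK. Qed.
Lemma SL2_GL2_ex g : gdet g = 1 -> exists s, SL2_GL2 s = g.
Proof.
by move=> /eqP d1; exists (MkSL2 (d1 : \det (val g) == 1)); apply: val_inj.
Qed.

Definition dG a d : GL2 F := gm a 0 0 d.
Lemma dG_det a d : a != 0 -> d != 0 -> a * d - 0 * 0 != 0.
Proof. by move=> a0 d0; rewrite mulr0 subr0 mulf_neq0. Qed.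
Lemma dGE a d : a != 0 -> d != 0 ->
  (ga (dG a d) = a) * (gb (dG a d) = 0) * (gc (dG a d) = 0) * (gd (dG a d) = d).
Proof.
by move=> a0 d0; rewrite /dG ga_gm ?gb_gm ?gc_gm ?gd_gm ?dG_det.
Qed.
Lemma gdet_dG a d : a != 0 -> d != 0 -> gdet (dG a d) = a * d.
Proof. by move=> a0 d0; rewrite gdetE !dGE // mulr0 subr0. Qed.

Definition gM := (gaM, gbM, gcM, gdM, gaV, gbV, gcV, gdV, ga1, gb1, gc1, gd1, gE_SL).

(** Commutation with [u 1] and [l 1] is enough. *)
Lemma centre_scalar g : centre g <-> gb g = 0 /\ gc g = 0 /\ ga g = gd g.
Proof.
split=> [cg|[b0 [c0 ad]] h]; last first.
  by apply: gl2P; rewrite !gM ?b0 ?c0 ?ad; ring.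
have eu := cg (SL2_GL2 (u 1)); have el := cg (SL2_GL2 (l 1)).
have := congr1 gd eu; have := congr1 ga eu; have := congr1 ga el; have := congr1 gb eu.
rewrite !(gM, uE, lE) !(mulr1, mulr0, mul1r, mul0r, addr0, add0r) => eab /eqP.
rewrite -subr_eq0 addrAC subrr add0r => /eqP b0 /eqP.
rewrite eq_sym -subr_eq0 addrAC subrr add0r => /eqP c0 _; split=> //; split=> //.
by move: eab; rewrite b0 addr0 add0r.
Qed.

Lemma centre_dG a : a != 0 -> centre (dG a a).
Proof. by move=> a0; apply/centre_scalar; rewrite !dGE. Qed.

Lemma centre_SL2 s : centre s -> [/\ eb s = 0, ec s = 0, ea s = ed s & ea s ^+ 2 = 1].
Proof.
move=> cs; have eu := cs (u 1); have el := cs (l 1).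
have := congr1 (@ed F) eu; have := congr1 (@ea F) eu; have := congr1 (@ea F) el; have := congr1 (@eb F) eu.
rewrite !eM !(mulr1, mulr0, mul1r, mul0r, addr0, add0r) => eab /eqP.
rewrite -subr_eq0 addrAC subrr add0r => /eqP b0 /eqP.
rewrite eq_sym -subr_eq0 addrAC subrr add0r => /eqP c0 _.
have ad : ea s = ed s.
  by move: eab; rewrite b0 addr0 add0r.
by split=> //; have := ead_bc s; rewrite -ad b0 mul0r subr0 expr2.
Qed.

End GL2Elements.

Section KZ.
Variable F : completeValuedFieldType.
Local Notation om := (uniformizer : F).
Implicit Types (n : int) (g h : GL2 F) (s : SL2 F).

Definition gvge n g := [&& vge n (ga g), vge n (gb g), vge n (gc g) & vge n (gd g)].
(** The set varpi^n K: entries at level n put the determinant at level 2n, and equality makes the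
    remaining factor invertible over the integers. *)
Definition kz n g := gvge n g && (valuation (gdet g) == n *+ 2).

Lemma gvgeM m n g h : gvge m g -> gvge n h -> gvge (m + n) (g * h)%g.
Proof.
by move=> /and4P[? ? ? ?] /and4P[? ? ? ?]; rewrite /gvge !gM !vgeD // vgeM.
Qed.

Lemma vgeV_unit n (x : F) : x != 0 -> valuation x = n -> vge (- n) x^-1.
Proof. by move=> x0 e; rewrite vgeE ?invr_eq0 // valV // e. Qed.

Lemma gvgeV n g : gvge n g -> gvge (n - valuation (gdet g)) g^-1%g.
Proof.
move=> /and4P[ha hb hc hd]; have d0 := gdet_neq0 g.
have vd : vge (- valuation (gdet g)) (gdet g)^-1 by apply: vgeV_unit.
by rewrite /gvge !gM !mulNr !(vgeN, vgeM).
Qed.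

Lemma kzM m n g h : kz m g -> kz n h -> kz (m + n) (g * h)%g.
Proof.
move=> /andP[gm /eqP dg] /andP[hn /eqP dh].
by rewrite /kz gvgeM // gdetM valuationM ?gdet_neq0 // dg dh mulrnDl eqxx.
Qed.

Lemma kzV n g : kz n g -> kz (- n) g^-1%g.
Proof.
move=> /andP[gn /eqP dg]; apply/andP; split; last by rewrite gdetV valV ?gdet_neq0 // dg mulNrn.
by have := gvgeV gn; rewrite dg mulr2n opprD addrA subrr sub0r.
Qed.

Lemma kz1 : kz 0 1%g.
Proof. by rewrite /kz /gvge !gM gdet1 valuation1 !vge0 !vge1 mul0rn eqxx. Qed.

Lemma kz_dG n : kz n (dG (om ^ n) (om ^ n)).
Proof.
have o0 := omX_neq0 F n; rewrite /kz /gvge !dGE // gdet_dG // !vge0 !vge_omX /=.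
by rewrite valuationM // val_omX -mulr2n.
Qed.

Lemma KZP g : KZ g <-> exists n, kz n g.
Proof.
split=> [[k [kO kd] [z /centre_scalar[b0 [c0 ad]] <-]]|[n gn]].
  have kO' i j : vge 0 (val k i j) := kO i j.
  have k0 : kz 0 k.
    by apply/andP; split; [apply/and4P; split; exact: kO' | rewrite -[gdet k]/(\det (val k)) kd].
  have a0 : ga z != 0.
    by have := gdet_neq0 z; rewrite gdetE b0 mul0r subr0; apply: contraNneq => ->; rewrite mul0r.
  exists (0 + valuation (ga z)); apply: kzM => //.
  rewrite /kz /gvge b0 c0 -ad !vge0 vge_val gdetE b0 -ad mul0r subr0 valuationM // -mulr2n eqxx //.
have o0 := omX_neq0 F (- n).
exists (g * dG (om ^ (- n)) (om ^ (- n)))%g.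
  have /andP[/and4P[h1 h2 h3 h4] /eqP hd] : kz 0 (g * dG (om ^ (- n)) (om ^ (- n)))%g.
    by rewrite -(subrr n); apply: kzM => //; exact: kz_dG.
  by split=> //; do 2![apply: mx2P].
exists (dG (om ^ n) (om ^ n)); first exact: centre_dG (omX_neq0 F n).
apply: gl2P; rewrite !(gM, dGE) ?omX_neq0 // !(mulr0, addr0, add0r) -mulrA -expfzDr ?om_neq0 //;
  by rewrite addNr mulr1.
Qed.

Lemma kz_SL s : kz 0 (SL2_GL2 s) = inK s.
Proof. by rewrite /kz gdet_SL valuation1 mul0rn eqxx andbT. Qed.

Lemma KZ_SL s : KZ (SL2_GL2 s) <-> inK s.
Proof.
rewrite KZP -kz_SL; split=> [[n sn]|]; last by exists 0.
have n0 : n = 0 by move: sn => /andP[_]; rewrite gdet_SL valuation1; lia.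
by rewrite -n0.
Qed.

Lemma KZ_SP s : KZ_S s <-> inK s.
Proof.
split=> [[k kO [z /centre_SL2[b0 c0 ad a2] <-]]|sK].
  apply: inKM; first by apply/and4P; split; exact: kO.
  have a0 : ea z != 0 by apply/eqP => a0; move/eqP: a2; rewrite a0 expr0n eq_sym oner_eq0.
  have va : valuation (ea z) = 0.
    by have := congr1 valuation a2; rewrite expr2 valuationM // valuation1; lia.
  by rewrite /inK /bdd b0 c0 -ad !vge0 vgeE // va.
exists s; first by have /and4P[? ? ? ?] := sK; do 2![apply: mx2P].
by exists 1%g; rewrite ?mulg1 // => g; rewrite /commute mul1g mulg1.
Qed.

(** Elements of SL2(F) KZ are recognized by the parity of the valuation of the determinant. This is
    why the square of T, rather than T, acts on the functions [g, v] with g in SL2(F). *)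
Lemma even_decomp g n : valuation (gdet g) = n *+ 2 -> exists s k, kz n k /\ g = (SL2_GL2 s * k)%g.
Proof.
move=> dn; have d0 := gdet_neq0 g; have o0 := omX_neq0 F n.
pose k := dG (om ^ n) (om ^ (- n) * gdet g).
have e0 : om ^ (- n) * gdet g != 0 by rewrite mulf_neq0 ?omX_neq0.
have dk : gdet k = gdet g by rewrite gdet_dG // mulrA -expfzDr ?om_neq0 // subrr mul1r.
have [s es] : exists s, SL2_GL2 s = (g * k^-1)%g.
  by apply: SL2_GL2_ex; rewrite gdetM gdetV dk mulfV.
exists s, k; rewrite es mulgVK; split=> //.
rewrite /kz dk dn eqxx andbT /gvge !dGE // !vge0 vge_omX /=.
by rewrite vge_omM opprK vgeE // dn mulr2n.
Qed.

End KZ.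

Section SigmaK.
Variables (p f : nat) (F : completeValuedFieldType) (C : closedFieldType).
Variables (iota : {rmorphism residue_field F -> C}) (D : resdata p f iota).
Variable r : 'I_f -> 'I_p.
Local Notation om := (uniformizer : F).
Local Notation rho := (@rho F C iota).
Local Notation V := (weight C r).
Local Notation sigma := (sigma iota r).
Local Notation sigma_S := (sigma_S iota r).
Implicit Types (X Y : C) (y : V) (g h : GL2 F) (s : SL2 F) (n : int).

Definition rd n x := rho (om ^ (- n) * x).

Lemma redE n g : valuation (gdet g) = n *+ 2 ->
  (reduce_mx iota g ord0 ord0 = rd n (ga g)) * (reduce_mx iota g ord0 ord_max = rd n (gb g)) *
  (reduce_mx iota g ord_max ord0 = rd n (gc g)) * (reduce_mx iota g ord_max ord_max = rd n (gd g)).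
Proof.
move=> e; have e2 : ((n *+ 2) %/ 2)%Z = n by lia.
by rewrite !mxE -[\det (val g)]/(gdet g) e e2.
Qed.

Lemma rdM m n (x y z t : F) : vge m x -> vge n y -> vge m z -> vge n t ->
  rd (m + n) (x * y + z * t) = rd m x * rd n y + rd m z * rd n t.
Proof.
have H k a : vge k a -> vge 0 (om ^ (- k) * a) by rewrite vge_omM sub0r opprK.
move=> /H x0 /H y0 /H z0 /H t0; rewrite /rd -!(rhoM iota) // -(rhoD iota); [|by apply: vgeMl|by apply: vgeMl].
by congr rho; rewrite opprD expfzDr ?om_neq0 //; ring.
Qed.

Lemma ev_sigma_kz X Y n g y : kz n g -> ev X Y (sigma g y) =
  ev (rd n (ga g) * X + rd n (gc g) * Y) (rd n (gb g) * X + rd n (gd g) * Y) y.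
Proof. by move=> /andP[_ /eqP e]; rewrite (ev_sigma D) !(redE e). Qed.

Lemma sigma_kzM m n g h y : kz m g -> kz n h -> sigma (g * h)%g y = sigma g (sigma h y).
Proof.
move=> gm hn; apply: (ev_ext D) => X Y.
rewrite (ev_sigma_kz _ _ _ (kzM gm hn)) (ev_sigma_kz _ _ _ gm) (ev_sigma_kz _ _ _ hn).
move: gm hn => /andP[/and4P[? ? ? ?] _] /andP[/and4P[? ? ? ?] _].
by rewrite !gM !rdM //; congr (ev _ _ _); ring.
Qed.

Lemma sigma_congr1 g y : kz 0 g -> vge 1 (ga g - 1) -> vge 1 (gb g) -> vge 1 (gc g) ->
  vge 1 (gd g - 1) -> sigma g y = y.
Proof.
move=> gk a1 b0 c0 d1; apply: (ev_ext D) => X Y; rewrite (ev_sigma_kz _ _ _ gk) /rd.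
have /andP[/and4P[? ? ? ?] _] := gk; rewrite oppr0 !mul1r.
rewrite (rho_small D b0) (rho_small D c0) (rho_congr D _ _ a1) ?(rho_congr D _ _ d1) ?vge1 //.
by rewrite rho1 !mul0r !mul1r addr0 add0r.
Qed.

Lemma sigma1 y : sigma 1%g y = y.
Proof. by apply: sigma_congr1; rewrite ?kz1 // !gM ?subrr ?vge0. Qed.

Lemma ev_sigma_S X Y s y : inK s -> ev X Y (sigma_S s y) =
  ev (rho (ea s) * X + rho (ec s) * Y) (rho (eb s) * X + rho (ed s) * Y) y.
Proof.
by rewrite -kz_SL => sk; rewrite (ev_sigma_kz _ _ _ sk) /rd oppr0 !mul1r !gE_SL.
Qed.

Lemma sigma_SM s t y : inK s -> inK t -> sigma_S (s * t)%g y = sigma_S s (sigma_S t y).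
Proof. by rewrite -!kz_SL => sK tK; rewrite /Defs.sigma_S SL2_GL2M (sigma_kzM _ sK tK). Qed.

Lemma sigma_S1 y : sigma_S 1%g y = y.
Proof. by rewrite /Defs.sigma_S SL2_GL21 sigma1. Qed.

Lemma vge_near n (x y : F) : vge n x -> vge n (x - y) -> vge n y.
Proof. by move=> hx hxy; rewrite -(subKr x y); exact: vgeB. Qed.

Lemma inK_near0 s t : inK s -> near 0 s t -> inK t.
Proof.
move=> /and4P[ha hb hc hd] /and4P[na nb nc nd].
by apply/and4P; split; [apply: vge_near na | apply: vge_near nb | apply: vge_near nc | apply: vge_near nd].
Qed.

Lemma SL2_inducible : inducible (@KZ_S F) sigma_S.
Proof.
split.
- exact/KZ_SP/inK1.
- by move=> g h /KZ_SP gK /KZ_SP hK; apply/KZ_SP/inKM.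
- by move=> g /KZ_SP gK; apply/KZ_SP/inKV.
- rewrite openE => g /KZ_SP gK; apply/nbhs_nearP; exists 0 => h gh.
  by apply/KZ_SP; exact: inK_near0 gh.
- move=> z cz; exists 1%g; last by exists z; rewrite ?mul1g.
  by move=> i j /=; rewrite mxE; case: eqP => _; [exact: vge1 | exact: vge0].
- exists [set g | bdd 0 g]; first exact: compact_SL2 D 0.
  move=> h /KZ_SP hK; exists 1%g; last by exists h; rewrite ?mul1g.
  by move=> g; rewrite /commute mul1g mulg1.
- exact: sigma_S1.
- by move=> g h v /KZ_SP gK /KZ_SP hK; exact: sigma_SM.
exists [set g | Kn 1 g]; split.
- rewrite openE => g /=; rewrite -near1 => g1; apply/nbhs_nearP; exists 1 => h gh.
  by rewrite /= -near1; exact: near_trans (near_sym gh) g1.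
- by rewrite /= /Kn !eM ?subrr !vge0.
- by move=> g gK; apply/KZ_SP; exact: Kn_inK gK.
- move=> h v /= hK; apply: sigma_congr1; first by rewrite kz_SL; exact: Kn_inK hK.
  all: by have /and4P[? ? ? ?] := hK; rewrite gE_SL.
Qed.

Lemma mnear_gl2 n g h : mnear n (val g) (val h) -> [/\ vge n (ga g - ga h), vge n (gb g - gb h),
  vge n (gc g - gc h) & vge n (gd g - gd h)].
Proof. by move=> H; split; exact: H. Qed.

(** At level n + 1 the determinants differ at level 2n + 1, so the valuation 2n is kept. *)
Lemma KZ_near n g h : kz n g -> mnear (n + 1) (val g) (val h) -> kz n h.
Proof.
move=> /andP[gn /eqP dn] gh; have [na nb nc nd] := mnear_gl2 gh.
have le1 (x : F) : vge (n + 1) x -> vge n x by apply: vge_le; lia.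
have hn : gvge n h.
  have /and4P[ha hb hc hd] := gn.
  apply/and4P; split; [apply: vge_near (le1 _ na) | apply: vge_near (le1 _ nb) |
    apply: vge_near (le1 _ nc) | apply: vge_near (le1 _ nd)] => //.
have mb (k : GL2 F) : gvge n k -> mbdd n (val k) by move=> /and4P[? ? ? ?]; do 2![apply: mx2P].
have := det_near (mb _ gn) (mb _ hn) gh; rewrite -/(gdet g) -/(gdet h) => dd.
rewrite /kz hn /=; apply/eqP; have dh := gdet_neq0 h; have dg := gdet_neq0 g.
apply/eqP; rewrite eq_le; apply/andP; split; last first.
  rewrite -vgeE // -(subKr (gdet g) (gdet h)) vgeB //; first by rewrite vgeE // dn.
  by apply: vge_le dd; lia.
rewrite leNgt; apply/negP => lt; have : vge (n *+ 2 + 1) (gdet g).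
  rewrite -(subrK (gdet h) (gdet g)) vgeD //; first by apply: vge_le dd; lia.
  by rewrite vgeE //; lia.
by rewrite vgeE // dn; lia.
Qed.

Lemma GL2_inducible : inducible (@KZ F) sigma.
Proof.
split.
- by apply/KZP; exists 0; exact: kz1.
- by move=> g h /KZP[m gm] /KZP[n hn]; apply/KZP; exists (m + n); exact: kzM.
- by move=> g /KZP[m gm]; apply/KZP; exists (- m); exact: kzV.
- rewrite openE => g /KZP[n gn]; apply/nbhs_GL2P; exists (n + 1) => h gh.
  by apply/KZP; exists n; exact: KZ_near gh.
- move=> z cz; exists 1%g; last by exists z; rewrite ?mul1g.
  split; last by rewrite -[\det _]/(gdet 1%g) gdet1 valuation1.
  by move=> i j /=; rewrite mxE; case: eqP => _; [exact: vge1 | exact: vge0].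
- exists [set g : GL2 F | [/\ mbdd 0 (val g), vge 0 (\det (val g)) & ~~ vge 2 (\det (val g))]].
    exact: compact_GL2 D 0.
  move=> h [k [kO kd] [z cz <-]]; exists z => //; exists k; last exact: cz.
  have kd0 : \det (val k) != 0 := gdet_neq0 k.
  by split; [exact: kO | rewrite vgeE // kd | rewrite vgeE // kd].
- exact: sigma1.
- by move=> g h v /KZP[m gm] /KZP[n hn]; exact: sigma_kzM gm hn.
exists [set g | mnear 1 (1%:M) (val g)]; split.
- rewrite openE => g g1; apply/nbhs_GL2P; exists 1 => h gh i j.
  exact: vge_trans (g1 i j) (gh i j).
- by move=> i j; rewrite /= subrr vge0.
- move=> g g1; apply/KZP; exists 0.
  have g1' : mnear (0 + 1) (val (1%g : GL2 F)) (val g) := g1.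
  exact: KZ_near (kz1 F) g1'.
move=> h v h1; have h1' : mnear (0 + 1) (val (1%g : GL2 F)) (val h) := h1.
have [na nb nc nd] := @mnear_gl2 1 1%g h h1; move: na nb nc nd.
rewrite !gM !sub0r => na nb nc nd.
apply: sigma_congr1; first exact: KZ_near (kz1 F) h1'.
- by rewrite vgeBC.
- by rewrite -[gb h]opprK vgeN.
- by rewrite -[gc h]opprK vgeN.
- by rewrite vgeBC.
Qed.

End SigmaK.

(** * Hecke operators *)

Opaque Defs.sigma U_op alpha.

(** * The double coset of alpha and its q + 1 cosets *)

Section Cosets.
Variables (p f : nat) (F : completeValuedFieldType) (C : closedFieldType).
Variables (iota : {rmorphism residue_field F -> C}) (D : resdata p f iota).
Local Notation om := (uniformizer : F).
Local Notation q := (p ^ f)%N.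
Local Notation al := (alpha F).
Local Notation SL := (@SL2_GL2 F).
Implicit Types (g h k : GL2 F) (n m : int).

Definition dpow n : GL2 F := dG (om ^ n) 1.

Lemma dpowE n : (ga (dpow n) = om ^ n) * (gb (dpow n) = 0) * (gc (dpow n) = 0) * (gd (dpow n) = 1).
Proof. by rewrite /dpow !dGE ?omX_neq0 ?oner_neq0. Qed.
Lemma gdet_dpow n : gdet (dpow n) = om ^ n.
Proof. by rewrite /dpow gdet_dG ?omX_neq0 ?oner_neq0 // mulr1. Qed.
Lemma dpowD m n : (dpow (m + n) = dpow m * dpow n)%g.
Proof.
apply: gl2P; rewrite !gM !dpowE ?expfzDr ?om_neq0 // !(mulr0, mul0r, addr0, add0r) //.
by rewrite mulr1.
Qed.
Lemma dpow0 : dpow 0 = 1%g.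
Proof. by apply: gl2P; rewrite !dpowE !gM. Qed.

Lemma alphaE : (ga al = 1) * (gb al = 0) * (gc al = 0) * (gd al = om).
Proof. by do !split; rewrite /ga /gb /gc /gd /= !mxE ?mulr1n ?mulr0n. Qed.
Lemma gdet_alpha : gdet al = om.
Proof. by rewrite gdetE !alphaE mul1r mulr0 subr0. Qed.

Definition scG n : GL2 F := dG (om ^ n) (om ^ n).
Lemma scGE n : (ga (scG n) = om ^ n) * (gb (scG n) = 0) * (gc (scG n) = 0) * (gd (scG n) = om ^ n).
Proof. by rewrite /scG !dGE ?omX_neq0. Qed.

Lemma alpha_dpowV : (al^-1 = scG (-1) * dpow 1)%g.
Proof.
have o0 := om_neq0 F.
by apply: gl2P; rewrite !gM !dpowE !alphaE !scGE gdet_alpha ?expr1z ?exprN1; fld.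
Qed.

(** The q + 1 neighbours of the standard vertex of the tree, indexed by the projective line of the
    residue field with [None] at infinity. *)
Definition beta (i : option 'I_q) : GL2 F :=
  if i is Some i then (SL (u (lam D i)) * dpow 1)%g else al.

Lemma gdet_beta i : gdet (beta i) = om.
Proof.
by case: i => [i|]; rewrite /beta ?gdet_alpha // gdetM gdet_SL gdet_dpow mul1r expr1z.
Qed.

Lemma betaE i : (ga (beta (Some i)) = om) * (gb (beta (Some i)) = lam D i) *
  (gc (beta (Some i)) = 0) * (gd (beta (Some i)) = 1).
Proof.
by rewrite /beta !gM !dpowE !uE expr1z !(mul1r, mul0r, mulr0, mulr1, addr0, add0r).
Qed.

(* The elements of the double coset of [alpha], up to the scalar [om ^ n]. *)
Definition dc n g := gvge n g && (valuation (gdet g) == n *+ 2 + 1).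

Lemma dcMl m n k g : kz m k -> dc n g -> dc (m + n) (k * g)%g.
Proof.
move=> /andP[km /eqP dk] /andP[gn /eqP dg].
by rewrite /dc gvgeM // gdetM valuationM ?gdet_neq0 // dk dg mulrnDl addrA eqxx.
Qed.

Lemma dcMr m n k g : kz m k -> dc n g -> dc (n + m) (g * k)%g.
Proof.
move=> /andP[km /eqP dk] /andP[gn /eqP dg].
by rewrite /dc gvgeM // gdetM valuationM ?gdet_neq0 // dk dg mulrnDl addrAC eqxx.
Qed.

Lemma dcV n g : dc n g -> dc (- n - 1) g^-1%g.
Proof.
move=> /andP[gn /eqP dg]; apply/andP; split; last first.
  by rewrite gdetV valV ?gdet_neq0 // dg; apply/eqP; lia.
by have := gvgeV gn; rewrite dg; congr (is_true (gvge _ _)); lia.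
Qed.

Lemma dc_beta i : dc 0 (beta i).
Proof.
rewrite /dc gdet_beta valuation_uniformizer andbT /gvge.
case: i => [i|]; rewrite ?betaE ?alphaE !vge0 !vge1 ?(lam_int D) ?(vge01 (vge_om F)) //.
Qed.

Lemma dc_alphaV : dc (-1) al^-1%g.
Proof. exact: (dcV (dc_beta None)). Qed.

Lemma kz_betaV n g i : dc n g -> gvge n ((beta i)^-1 * g)%g -> kz n ((beta i)^-1 * g)%g.
Proof.
move=> /andP[_ /eqP dg] H; rewrite /kz H /= gdetM gdetV valuationM ?invr_eq0 ?gdet_neq0 //.
by rewrite valV ?gdet_neq0 // gdet_beta valuation_uniformizer dg; apply/eqP; lia.
Qed.

Lemma gvge_divom n (x : F) : vge (n + 1) x -> vge n (x / om).
Proof.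
by move=> x1; rewrite -[n](addrK 1) vgeM // vgeE ?invr_eq0 ?om_neq0 // valV ?om_neq0 // valuation_uniformizer.
Qed.

(** The determinant has valuation 2n + 1, so modulo varpi^(n+1) the rows are proportional. Either
    the bottom row vanishes, which is the coset of [alpha], or the top row is x times the bottom row
    and the class of x selects the representative. *)
Lemma dc_cover n g : dc n g -> exists i, kz n ((beta i)^-1 * g)%g.
Proof.
move=> gdc; have /andP[/and4P[ha hb hc hd] /eqP dg] := gdc; have o0 := om_neq0 F.
have vdet : vge (n *+ 2 + 1) (ga g * gd g - gb g * gc g).
  by rewrite -gdetE vgeE ?gdet_neq0 // dg.
have [/andP[c1 d1]|] := boolP (vge (n + 1) (gc g) && vge (n + 1) (gd g)).
  exists None; apply: kz_betaV => //; rewrite /gvge !gM !alphaE gdet_alpha.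
  have -> : om / om * ga g + - 0 / om * gc g = ga g by fld.
  have -> : om / om * gb g + - 0 / om * gd g = gb g by fld.
  have -> : - 0 / om * ga g + 1 / om * gc g = gc g / om by fld.
  have -> : - 0 / om * gb g + 1 / om * gd g = gd g / om by fld.
  by rewrite ha hb !gvge_divom.
have main x : vge 0 x -> vge (n + 1) (ga g - x * gc g) -> vge (n + 1) (gb g - x * gd g) ->
    exists i, kz n ((beta i)^-1 * g)%g.
  move=> x0 h1 h2; have [i xi] := lam_cov D x0; exists (Some i); apply: kz_betaV => //.
  have sw y z : vge n z -> vge (n + 1) (y - x * z) -> vge (n + 1) (y - lam D i * z).
    move=> zn yz; have -> : y - lam D i * z = (y - x * z) + (x - lam D i) * z by ring.
    by apply: vgeD => //; rewrite addrC; apply: vgeM.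
  rewrite /gvge; move: (beta (Some i)) (betaE i) (gdet_beta (Some i)) => b bE bd.
  rewrite !gM bd !bE.
  have -> : 1 / om * ga g + - lam D i / om * gc g = (ga g - lam D i * gc g) / om by fld.
  have -> : 1 / om * gb g + - lam D i / om * gd g = (gb g - lam D i * gd g) / om by fld.
  have -> : - 0 / om * ga g + om / om * gc g = gc g by fld.
  have -> : - 0 / om * gb g + om / om * gd g = gd g by fld.
  by rewrite hc hd !gvge_divom //; exact: sw.
have vdiv (x y : F) : vge n x -> vge n y -> ~~ vge (n + 1) y -> [/\ vge 0 (x / y), y != 0 & valuation y = n].
  move=> hx hy /vgePn[y0 vy]; have e : valuation y = n by move: hy; rewrite vgeE //; lia.
  split=> //; rewrite -(subrr n); apply: vgeM => //; exact: vgeV_unit.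
have vdd (y z : F) : y != 0 -> valuation y = n -> vge (n *+ 2 + 1) z -> vge (n + 1) (z / y).
  move=> y0 e z1; have -> : n + 1 = (n *+ 2 + 1) + - n by lia.
  by apply: vgeM => //; exact: vgeV_unit.
rewrite negb_and => /orP[c1|d1].
  have [x0 c0 ec] := vdiv _ _ ha hc c1; apply: (main (ga g / gc g)) => //.
    by rewrite divfK // subrr vge0.
  have -> : gb g - ga g / gc g * gd g = - ((ga g * gd g - gb g * gc g) / gc g) by fld.
  by apply: vgeN; exact: vdd.
have [x0 d0 ed] := vdiv _ _ hb hd d1; apply: (main (gb g / gd g)) => //; last first.
  by rewrite divfK // subrr vge0.
have -> : ga g - gb g / gd g * gc g = (ga g * gd g - gb g * gc g) / gd g by fld.
exact: vdd.
Qed.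

Lemma beta_sep i j : KZ ((beta i)^-1 * beta j)%g -> i = j.
Proof.
have o0 := om_neq0 F.
have H i' j' : KZ ((beta i')^-1 * beta j')%g -> gvge 0 ((beta i')^-1 * beta j')%g.
  move=> /KZP[n /andP[h /eqP dn]]; move: dn; rewrite gdetM gdetV !gdet_beta mulVf // valuation1.
  by move=> e; have n0 : n = 0 by [lia]; rewrite -[X in gvge X _]n0.
have no x : vge 0 x -> ~~ vge 1 x -> ~~ vge 0 (x / om).
  move=> x0; apply: contra => h; rewrite -(divfK o0 x) mulrC.
  by rewrite vge_om1M subrr.
have nV : ~~ vge 0 (om^-1) by rewrite vgeE ?invr_eq0 // valV // valuation_uniformizer.
case: i j => [i|] [j|] // /H /and4P[h1 h2 h3 h4].
- suff /(@lam_inj _ _ _ _ _ D) -> : vge 1 (lam D i - lam D j) by []; move: h2.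
  move: (beta (Some i)) (betaE i) (gdet_beta (Some i)) (beta (Some j)) (betaE j) => b bE bd b' b'E.
  rewrite !gM bd !bE !b'E.
  have -> : 1 / om * lam D j + - lam D i / om * 1 = (lam D j - lam D i) / om by fld.
  by move=> h; rewrite vgeBC -(divfK o0 (_ - _)) mulrC vge_om1M subrr.
- case/negP: nV; move: h1; move: (beta (Some i)) (betaE i) (gdet_beta (Some i)) => b bE bd.
  by rewrite /= !gM bd !bE !alphaE !mulr1 mulr0 addr0 mul1r.
case/negP: nV; move: h4; move: (beta (Some j)) (betaE j) => b bE.
by rewrite /= !gM gdet_alpha !bE !alphaE !mulr1 oppr0 !mul0r add0r mul1r.
Qed.

Lemma DCP g : @KZalphaKZ F g <-> exists n, dc n g.
Proof.
split=> [[k1 /KZP[m k1m] [k2 /KZP[n k2n] <-]]|[n gdc]].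
  exists (m + -1 + n); apply: dcMr => //; apply: dcMl => //; exact: dc_alphaV.
have [i gi] := dc_cover gdc; set k := ((beta i)^-1 * g)%g in gi.
have [k1 [k1K ek]] : exists k1, KZ k1 /\ (exists2 k2, KZ k2 & beta i = k1 * al^-1 * k2)%g.
  case: {gi k} i => [i|].
    exists (SL (u (lam D i)) * scG 1)%g; split.
      by apply/KZP; exists (0 + 1); apply: kzM; [rewrite kz_SL; apply: inK_u; exact: lam_int | exact: kz_dG].
    exists 1%g; first by apply/KZP; exists 0; exact: kz1.
    rewrite alpha_dpowV mulg1 -!mulgA; congr (_ * _)%g; apply: gl2P;
      rewrite !gM !scGE !dpowE ?expr1z ?exprN1; fld; exact: om_neq0.
  exists (scG 1 * SL w)%g; split.
    by apply/KZP; exists (1 + 0); apply: kzM; [exact: kz_dG | rewrite kz_SL; exact: inK_w].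
  exists (SL w^-1)%g; first by apply/KZP; exists 0; rewrite kz_SL; exact/inKV/inK_w.
  by rewrite alpha_dpowV; apply: gl2P; rewrite !gM !scGE !dpowE !alphaE !eM ?expr1z ?exprN1; fld; exact: om_neq0.
have [k2 k2K ek2] := ek; exists k1 => //; exists (k2 * k)%g.
  by move: k2K => /KZP[m k2m]; apply/KZP; exists (m + n); exact: kzM.
by rewrite mulgA -ek2 /k mulVKg.
Qed.

End Cosets.

Section HeckeFunction.
Variables (p f : nat) (F : completeValuedFieldType) (C : closedFieldType).
Variables (iota : {rmorphism residue_field F -> C}) (D : resdata p f iota).
Variable r : 'I_f -> 'I_p.
Local Notation om := (uniformizer : F).
Local Notation rho := (@rho F C iota).
Local Notation q := (p ^ f)%N.
Local Notation al := (alpha F).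
Local Notation SL := (@SL2_GL2 F).
Local Notation V := (weight C r).
Local Notation sigma := (sigma iota r).
Local Notation U := (U_op C r).
Local Notation xr := (xr C r).
Local Notation yr := (yr C r).
Local Notation X := (cInd_G iota r).
Local Notation IG := (GL2_inducible D r).
Local Notation br := (br IG).
Implicit Types (g h k : GL2 F) (n m : int) (v y : V).

Lemma rd_small n (x : F) : vge (n + 1) x -> rd iota n x = 0.
Proof. by move=> x1; apply: (rho_small D); rewrite vge_omM opprK addrC. Qed.

Lemma rd_om n : rd iota n (om ^ n) = 1.
Proof. by rewrite /rd -expfzDr ?om_neq0 // addNr rho1. Qed.

Lemma sigma_sc n y : sigma (scG F n) y = y.
Proof.
apply: (ev_ext D) => Y Z; rewrite (ev_sigma_kz D _ _ _ (kz_dG F n)) !scGE rd_om.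
by rewrite rd_small ?vge0 // !mul0r !mul1r addr0 add0r.
Qed.

Lemma KZ_sc n : KZ (scG F n). Proof. by apply/KZP; exists n; exact: kz_dG. Qed.
Lemma KZ_SLK s : inK s -> KZ (SL s). Proof. by move/KZ_SL. Qed.

Lemma sigmaM g h y : KZ g -> KZ h -> sigma (g * h)%g y = sigma g (sigma h y).
Proof. exact: (ind_sigmaM IG). Qed.
Lemma KZM g h : KZ g -> KZ h -> KZ (g * h)%g. Proof. exact: (ind_M IG). Qed.
Lemma KZV g : KZ g -> KZ g^-1%g. Proof. exact: (ind_V IG). Qed.
Lemma KZ1 : KZ (1%g : GL2 F). Proof. exact: (ind_1 IG). Qed.

(** This makes the Hecke function well defined on the double coset. Modulo the uniformizer, after
    scaling, m is lower triangular, m' is upper triangular and the diagonals agree; U factors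
    through the value at (0, 1), which sees nothing else. *)
Lemma U_commute (m m' : GL2 F) y : KZ m -> KZ m' -> (m * al^-1 = al^-1 * m')%g ->
  sigma m (U y) = U (sigma m' y).
Proof.
move=> /KZP[n mk] /KZP[n' m'k] e.
have nn' : n' = n.
  have := congr1 (@gdet F) e; rewrite !gdetM mulrC => /(mulfI (gdet_neq0 _)) ed.
  by move: mk m'k => /andP[_ /eqP e1] /andP[_ /eqP]; rewrite -ed e1; lia.
rewrite {}nn' in m'k; have /andP[/and4P[ha hb hc hd] _] := mk.
have /andP[/and4P[ha' hb' hc' hd'] _] := m'k.
have e' : (al * m = m' * al)%g by rewrite -[m](mulgVK al) e !mulgA mulgV mul1g.
have := congr1 (@gb F) e'; have := congr1 (@gc F) e'; have := congr1 (@gd F) e'.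
rewrite !gM !alphaE !(mul1r, mul0r, mulr0, mulr1, addr0, add0r).
rewrite [RHS]mulrC => /(mulfI (om_neq0 F)) ed ec eb.
have c0 : rd iota n (gc m') = 0 by apply: rd_small; rewrite -ec addrC vgeM // vge_om.
have b0 : rd iota n (gb m) = 0 by apply: rd_small; rewrite eb vgeM // vge_om.
apply: (ev_ext D) => Y Z; rewrite (ev_sigma_kz D _ _ _ mk) !(U_opE D) !linearZ /= !ev_yr.
rewrite (ev_sigma_kz D _ _ _ m'k) !mulr0 !mulr1 !add0r b0 c0 mul0r add0r !(ev0 D) ed expr1n mul1r.
by rewrite exprMn -![_ *: _]/(_ * _); ring.
Qed.

(** The factorization is chosen arbitrarily; by [U_commute] the value does not depend on it. *)
Definition hecke_function0 g : {linear V -> V} :=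
  match pselect (exists k : GL2 F * GL2 F, [/\ KZ k.1, KZ k.2 & g = k.1 * al^-1 * k.2]%g) with
  | left H => let k := projT1 (cid H) in
      (sigma k.1 \o (U \o sigma k.2) : {linear V -> V})
  | right _ => (\0 : {linear V -> V})
  end.

Lemma hecke_function0P : is_hecke_function iota hecke_function0.
Proof.
split=> [k1 k2 v k1K k2K|g v ng]; rewrite /hecke_function0; case: pselect; last first.
- by move=> _; reflexivity.
- by move=> [[k1 k2] /= [k1K k2K e]]; case: ng; exists k1 => //; exists k2.
- by case; exists (k1, k2).
move=> H; case: (projT1 (cid H)) (projT2 (cid H)) => [h1 h2] /= [h1K h2K e].
have ek1 : k1 = (h1 * (h1^-1 * k1))%g by rewrite mulVKg.
have mK : KZ (h1^-1 * k1)%g by apply: KZM => //; exact: KZV.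
have m'K : KZ (h2 * k2^-1)%g by apply: KZM => //; exact: KZV.
rewrite [in RHS]ek1 sigmaM // (U_commute (m' := (h2 * k2^-1)%g)) // -?sigmaM ?mulgVK //.
rewrite -mulgA; apply: (mulgI h1); rewrite mulVKg mulgA; apply: (mulIg k2).
by rewrite -[RHS]mulgA mulgVK.
Qed.

Section AnyHecke.
Variable phi : GL2 F -> {linear V -> V}.
Hypothesis hk : is_hecke_function iota phi.

Lemma hecke_Ml k g v : KZ k -> phi (k * g)%g v = sigma k (phi g v).
Proof.
move=> kK; have [[k1 k1K [k2 k2K <-]]|ng] := pselect (KZalphaKZ g).
  by rewrite !mulgA (hk.1 _ _ v (KZM kK k1K) k2K) (hk.1 _ _ v k1K k2K) (sigmaM _ kK k1K).
rewrite [phi g v](hk.2 _ _ ng) linear0; apply: hk.2 => -[k1 k1K [k2 k2K e]]; apply: ng.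
exists (k^-1 * k1)%g; first by apply: KZM => //; exact: KZV.
by exists k2 => //; rewrite -[RHS](mulKg k) -e !mulgA.
Qed.

Lemma hecke_Mr k g v : KZ k -> phi (g * k)%g v = phi g (sigma k v).
Proof.
move=> kK; have [[k1 k1K [k2 k2K <-]]|ng] := pselect (KZalphaKZ g).
  by rewrite -mulgA (hk.1 _ _ v k1K (KZM k2K kK)) (hk.1 _ _ _ k1K k2K) (sigmaM _ k2K kK).
rewrite [phi g _](hk.2 _ _ ng); apply: hk.2 => -[k1 k1K [k2 k2K e]]; apply: ng.
exists k1 => //; exists (k2 * k^-1)%g; first by apply: KZM => //; exact: KZV.
by rewrite mulgA e mulgK.
Qed.

Lemma hecke_alphaV v : phi al^-1%g v = ev 0 1 v *: yr.
Proof.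
by rewrite -[(al^-1)%g]mulg1 -[(al^-1)%g]mul1g hk.1 ?(ind_sigma1 IG) ?(U_opE D) //; exact: KZ1.
Qed.

Lemma alpha_conj : al = (scG F 1 * SL w * al^-1 * SL w^-1)%g.
Proof.
have o0 := om_neq0 F; move: al (alphaE F) (gdet_alpha F) => a aE ad.
by apply: gl2P; rewrite !gM ad !scGE !aE !eM ?expr1z; fld.
Qed.

Lemma hecke_alpha v : phi al v = ev 1 0 v *: xr.
Proof.
have wK := inK_w F; have wVK := inKV wK.
have kK := KZM (KZ_sc 1) (KZ_SLK wK); have kVK := KZ_SLK wVK.
rewrite [in LHS]alpha_conj (hk.1 _ _ v kK kVK) (sigmaM _ (KZ_sc 1) (KZ_SLK wK)) sigma_sc.
rewrite (U_opE D) linearZ /= -[sigma (SL w^-1%g) v]/(sigma_S iota r w^-1%g v) (ev_sigma_S D) //.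
rewrite !eM opprK (rho1 iota) (rho0 iota) !(mulr0, mulr1, add0r, addr0).
congr (_ *: _); apply: (ev_ext D) => Y Z.
rewrite -[sigma (SL w) yr]/(sigma_S iota r w yr) (ev_sigma_S D) // !eM.
by rewrite (rho1 iota) (rho0 iota) ev_yr ev_xr mul1r mul0r addr0.
Qed.

Lemma beta_inv i : ((beta D (Some i))^-1 = scG F (-1) * al * SL (u (- lam D i)))%g.
Proof.
have o0 := om_neq0 F; have := betaE D i; have := gdet_beta D (Some i).
move: (beta D (Some i)) => b bd bE; apply: gl2P; rewrite !gM bd !bE !scGE !alphaE !uE ?exprN1; fld; exact: o0.
Qed.

(** The value phi(g^-1) v at the representative g = [beta D i], for any Hecke function phi
    ([hecke_betaV]). *)
Definition psi_term v (i : option 'I_q) : V :=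
  if i is Some i then ev 1 (- rho (lam D i)) v *: xr else ev 0 1 v *: yr.

Lemma hecke_betaV i v : phi (beta D i)^-1%g v = psi_term v i.
Proof.
case: i => [i|]; last exact: hecke_alphaV.
have uK : inK (u (- lam D i)) by apply: inK_u; rewrite vgeN // (lam_int D).
rewrite beta_inv -mulgA hecke_Ml; last exact: KZ_sc.
rewrite sigma_sc hecke_Mr; last exact: KZ_SLK.
rewrite hecke_alpha; congr (_ *: _).
rewrite -[sigma (SL _) v]/(sigma_S iota r (u (- lam D i)) v) (ev_sigma_S D) // !uE.
by rewrite (rho1 iota) (rho0 iota) (rhoN iota) ?(lam_int D) // !mulr1 !mulr0 !addr0.
Qed.

End AnyHecke.

(** This is T [1, v]; as a function on the group it is h -> phi(h) v. *)
Definition hecke_unit v : X := \sum_i br (beta D i) (psi_term v i).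

Lemma hecke_unitE phi v h : is_hecke_function iota phi -> cv (hecke_unit v) h = phi h v.
Proof.
move=> hk; rewrite cv_sum; have [/(DCP D)[n hdc]|nh] := pselect (KZalphaKZ h).
  have [i ki] := dc_cover D (dcV hdc).
  have Ki : KZ (h * beta D i)%g.
    by have := kzV ki; rewrite invgM !invgK => H; apply/KZP; eexists; exact: H.
  rewrite (bigD1 i) //= big1 ?addr0 => [|j ji].
    by rewrite (br_in _ _ Ki) -(hecke_betaV hk) -(hecke_Ml hk) // mulgK.
  apply: br_out => Kj; case/eqP: ji; apply/esym/(beta_sep (D := D)).
  by rewrite -(mulKg h (beta D j)) mulgA -invgM; apply: KZM => //; exact: KZV.
rewrite (hk.2 _ _ nh) big1 // => i _; apply: br_out => /KZP[n Ki]; apply: nh.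
apply/(DCP D); exists (n + (- 0 - 1)); rewrite -(mulgK (beta D i) h).
by apply: dcMl => //; apply: dcV; exact: dc_beta.
Qed.

Fact hecke_unit_linear : linear hecke_unit.
Proof.
move=> a v v'; apply: cv_ext => h.
by rewrite cv_add cv_scale !(hecke_unitE _ _ hecke_function0P) linearP.
Qed.
HB.instance Definition _ := GRing.isLinear.Build C V X _ hecke_unit hecke_unit_linear.

Lemma hecke_unit_sigma k v : KZ k -> hecke_unit (sigma k v) = rep_act X k (hecke_unit v).
Proof.
move=> kK; apply: cv_ext => h.
by rewrite cv_act !(hecke_unitE _ _ hecke_function0P) (hecke_Mr hecke_function0P).
Qed.

(** The working form of the Hecke operator. It determines [T] because the brackets span, and
    [hecke_likeP] compares it with [is_hecke_operator]. *)
Definition hecke_like (T : rep_hom X X) := forall g v, T (br g v) = rep_act X g (hecke_unit v).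

Lemma hecke_like_ex : exists T, hecke_like T.
Proof. exact: (frobenius IG (Psi := hecke_unit)) hecke_unit_sigma. Qed.

Lemma hecke_conv T x h : hecke_like T ->
  cv (T x) h = \sum_i hecke_function0 (beta D i) (cv x ((beta D i)^-1 * h)%g).
Proof.
move=> HT; have [s ->] := br_span IG x; rewrite linear_sum cv_sum.
under [RHS]eq_bigr do rewrite cv_sum linear_sum.
rewrite exchange_big /=; apply: eq_bigr => -[g v] _ /=.
have hk := hecke_function0P; rewrite HT cv_act (hecke_unitE _ _ hk).
have [/(DCP D)[n hdc]|nh] := pselect (KZalphaKZ (h * g)%g).
  have [i ki] := dc_cover D hdc; have Ki : KZ ((beta D i)^-1 * (h * g))%g by apply/KZP; exists n.
  rewrite (bigD1 i) //= big1 ?addr0 => [|j ji].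
    by rewrite br_in -?mulgA // -(hecke_Mr hk) // mulVKg.
  rewrite br_out ?linear0 // -mulgA => Kj; case/eqP: ji; apply: (beta_sep (D := D)).
  have -> : ((beta D j)^-1 * beta D i = ((beta D j)^-1 * (h * g)) * ((beta D i)^-1 * (h * g))^-1)%g.
    by rewrite invgM invgK mulgA mulgK.
  by apply: KZM => //; exact: KZV.
rewrite (hk.2 _ _ nh) big1 // => i _; rewrite br_out ?linear0 // -mulgA => /KZP[n Ki]; apply: nh.
apply/(DCP D); exists (0 + n); rewrite -(mulVKg (beta D i) (h * g)%g).
by apply: dcMr => //; exact: dc_beta.
Qed.

(** Each summand is independent of the representative of its coset, and phi vanishes at the inverses
    of the cosets other than the q + 1 given by [beta]. *)
Lemma hecke_sum phi g v : is_hecke_function iota phi ->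
  \sum_(Y \in @GmodKZ F)
    bracket (@KZ F) sigma (g * coset_repr Y)%g (phi (coset_repr Y)^-1%g v) =
  cv (rep_act X g (hecke_unit v)).
Proof.
move=> hk; pose co (i : option 'I_q) : set (GL2 F) := [set (beta D i * k)%g | k in @KZ F].
have cor i : exists2 k, KZ k & coset_repr (co i) = (beta D i * k)%g.
  have : co i (coset_repr (co i)) by apply: (xgetPex 1%g); exists (beta D i); exists 1%g; [exact: KZ1 | exact: mulg1].
  by case=> k kK <-; exists k.
have co_inj : injective co.
  move=> i j e; have [k kK ek] : co j (beta D i) by rewrite -e; exists 1%g; rewrite ?mulg1 //; exact: KZ1.
  by apply/esym/(beta_sep (D := D)); rewrite -[beta D i]ek; have := kK; rewrite mulKg.
rewrite (fsbigE [seq co i | i <- enum {: option 'I_q}]).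
- rewrite big_map; apply/funext => h.
  transitivity (\sum_i cv (br (g * beta D i)%g (psi_term v i)) h); last first.
    rewrite -cv_sum linear_sum; congr (cv _ h); apply: eq_bigr => i _.
    by rewrite (br_act IG).
  rewrite fct_sumE big_enum_cond /=; apply: eq_big => [i|i _].
    by rewrite mem_set //; exists (beta D i).
  have [k kK ->] := cor i; rewrite -[bracket _ _ _ _ h]/(bracket (@KZ F) sigma (g * (beta D i * k))%g _ h).
  by rewrite -(brE IG) mulgA (br_H IG) // invgM (hecke_Ml hk) ?(ind_sigmaVr IG) ?(hecke_betaV hk) //; exact: KZV.
- by rewrite map_inj_uniq ?enum_uniq.
- by move=> Y /mapP[i _ ->]; exists (beta D i).
move=> Y [g0 eY] nY; set h := coset_repr Y.
have hY : Y h by apply: (xgetPex 1%g); exists (g0 * 1)%g; rewrite eY; exists 1%g => //; exact: KZ1.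
have nh : ~ KZalphaKZ h^-1%g.
  move=> /(DCP D)[n hd]; have := dcV hd; rewrite invgK => /(dc_cover D)[i ki0].
  have ki : KZ ((beta D i)^-1 * h)%g by apply/KZP; exists (- n - 1).
  case/negP: nY; apply/mapP; exists i; rewrite ?mem_enum //.
  move: hY; rewrite eY => -[k0 k0K e0]; apply/seteqP; split=> _ [k kK <-].
    exists ((beta D i)^-1 * h * (k0^-1 * k))%g; last by rewrite -e0 !mulgA mulgV mul1g mulgK.
    by apply: KZM => //; apply: KZM => //; exact: KZV.
  exists (k0 * ((beta D i)^-1 * h)^-1 * k)%g; last by rewrite -e0 invgM invgK !mulgA mulgV mul1g.
  by apply: KZM => //; apply: KZM => //; exact: KZV.
apply/funext => k; rewrite (hk.2 _ _ nh) /Defs.bracket; case: asboolP => // _; exact: linear0.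
Qed.

Lemma hecke_likeP T : is_hecke_operator T <-> hecke_like T.
Proof.
split=> [[phi hk HT] g v|HT].
  apply: cv_ext => h; rewrite -(hecke_sum _ _ hk) -(HT g v (br g v)) //.
  exact: (brE IG).
exists hecke_function0; first exact: hecke_function0P.
move=> g v x ex; rewrite (hecke_sum _ _ hecke_function0P) -HT; congr (cv (T _)).
by apply: cv_ext => h; rewrite (brE IG) -ex.
Qed.

End HeckeFunction.

(** * The operator tau *)

Section Cartan.
Variable F : completeValuedFieldType.
Local Notation om := (uniformizer : F).
Implicit Types (s t : SL2 F).

Lemma min_valuation (xs : seq F) : has (fun x => x != 0) xs ->
  exists x, [/\ x \in xs, x != 0 & forall y, y \in xs -> vge (valuation x) y].
Proof.
elim: xs => //= x xs IHxs; have [h|h] := boolP (has (fun x => x != 0) xs); last first.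
  rewrite orbF => x0; exists x; rewrite inE eqxx; split=> // y; rewrite inE => /orP[/eqP ->|yxs].
    exact: vge_val.
  by have /hasPn/(_ y yxs) := h; rewrite negbK => /eqP ->; exact: vge0.
move=> _; have [y [yxs y0 ymin]] := IHxs h; have [yx|/vgePn[x0 xy]] := boolP (vge (valuation y) x).
  exists y; rewrite inE yxs orbT; split=> // z; rewrite inE => /orP[/eqP ->//|]; exact: ymin.
exists x; rewrite inE eqxx; split=> // z; rewrite inE => /orP[/eqP ->|/ymin]; first exact: vge_val.
by apply: vge_le; exact: ltW.
Qed.

Definition cartan_dec t := exists (m : nat) k1 k2,
  [/\ inK k1, inK k2 & t = (k1 * (hh (om ^+ m))^-1 * k2)%g].

Lemma cartan_dec_tr t k1' k2' : inK k1' -> inK k2' -> cartan_dec (k1' * t * k2')%g -> cartan_dec t.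
Proof.
move=> K1 K2 [m [k1 [k2 [k1K k2K e]]]]; exists m, (k1'^-1 * k1)%g, (k2 * k2'^-1)%g; split.
- by apply: inKM => //; exact: inKV.
- by apply: inKM => //; exact: inKV.
apply: (mulgI k1'); apply: (mulIg k2'); rewrite e.
by rewrite !mulgA mulgV mul1g mulgVK.
Qed.

Lemma cartan_dec_ea t : ea t != 0 -> vge (valuation (ea t)) (eb t) ->
  vge (valuation (ea t)) (ec t) -> vge (valuation (ea t)) (ed t) -> cartan_dec t.
Proof.
move=> a0 tb tc td; have o0 := om_neq0 F.
have dv y : vge (valuation (ea t)) y -> vge 0 (y / ea t).
  by move=> hy; rewrite -(subrr (valuation (ea t))); apply: vgeM => //; exact: vgeV_unit.
have va : valuation (ea t) <= 0.
  have : vge (valuation (ea t) + valuation (ea t)) (1 : F).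
    by rewrite -(ead_bc t); apply: vgeB; apply: vgeM => //; exact: vge_val.
  by rewrite vgeE ?oner_neq0 // valuation1; lia.
exists (absz (valuation (ea t))); set m := absz _; have om0 := om2n_neq0 F m.
have e : om ^ (- valuation (ea t)) = om ^+ m.
  by rewrite -[om ^+ m]/(om ^ m%:Z); congr (_ ^ _); rewrite /m; lia.
have ua : unitO (om ^+ m * ea t) by rewrite -e; exact: unit_part.
exists (l (ec t / ea t) * hh (om ^+ m * ea t))%g, (u (eb t / ea t)); split.
- by apply: inKM; [apply: inK_l; exact: dv | exact: inK_h].
- by apply: inK_u; exact: dv.
have md : ed t = (1 + eb t * ec t) / ea t.
  by apply: (mulfI a0); rewrite mulrCA mulfV // mulr1 -(ead_bc t) subrK.
have n0 : om ^+ m * ea t != 0 by rewrite mulf_neq0.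
clear -a0 md om0 n0; move: (om ^+ m) om0 n0 => B B0 n0.
by apply: sl2P; rewrite !(eM, hE) // ?md; fld.
Qed.

(** Multiplication by [w] on either side brings an entry of minimal valuation to the upper left
    corner, up to sign; elimination of the other entries is then integral. *)
Lemma cartan s : cartan_dec s.
Proof.
have wK := inK_w F; have K1 := inK1 F.
have [|x [xs x0 xmin]] := @min_valuation [:: ea s; eb s; ec s; ed s].
  have := ead_bc s; apply: contra_eqT; rewrite /= !negb_or !negbK => /and5P[/eqP -> /eqP -> _ _ _].
  by rewrite !mul0r subrr eq_sym oner_eq0.
have [xa xb xc xd] : [/\ vge (valuation x) (ea s), vge (valuation x) (eb s),
    vge (valuation x) (ec s) & vge (valuation x) (ed s)].
  by split; apply: xmin; rewrite !inE eqxx ?orbT.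
have vN (y : F) : y != 0 -> valuation (- y) = valuation y.
  by move=> y0; rewrite -mulN1r valuationM ?oppr_eq0 ?oner_eq0 // valuationN1 add0r.
have N2 n (y : F) : vge n y -> vge n (- y) := @vgeN _ n y.
move: xs; rewrite !inE => /or4P[] /eqP ex; rewrite ex in x0 xa xb xc xd.
- exact: cartan_dec_ea.
- apply: (cartan_dec_tr K1 wK).
  have [e1 e2 e3 e4] : [/\ ea (1 * s * w)%g = - eb s, eb (1 * s * w)%g = ea s,
    ec (1 * s * w)%g = - ed s & ed (1 * s * w)%g = ec s] by split; rewrite !eM; ring.
  by apply: cartan_dec_ea; rewrite e1 ?e2 ?e3 ?e4 ?oppr_eq0 // ?vN ?N2.
- apply: (cartan_dec_tr wK K1).
  have [e1 e2 e3 e4] : [/\ ea (w * s * 1)%g = ec s, eb (w * s * 1)%g = ed s,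
    ec (w * s * 1)%g = - ea s & ed (w * s * 1)%g = - eb s] by split; rewrite !eM; ring.
  by apply: cartan_dec_ea; rewrite e1 ?e2 ?e3 ?e4 // ?N2.
apply: (cartan_dec_tr wK wK).
have [e1 e2 e3 e4] : [/\ ea (w * s * w)%g = - ed s, eb (w * s * w)%g = ec s,
  ec (w * s * w)%g = eb s & ed (w * s * w)%g = - ea s] by split; rewrite !eM; ring.
by apply: cartan_dec_ea; rewrite e1 ?e2 ?e3 ?e4 ?oppr_eq0 // ?vN ?N2.
Qed.
End Cartan.

Arguments Defs.sigma : simpl never.
Arguments U_op : simpl never.
Opaque br hecke_unit.

Section Abstract.
Variable C : fieldType.

Lemma eq_comp_subsp (A B : lmodType C) (h : {linear A -> A}) (e : {linear A -> B})
  (T : {linear B -> B}) : subsp (fun x => e (h x) = T (T (e x))).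
Proof. by split=> [|a x y ex ey]; rewrite ?linear0 // !linearP ex ey. Qed.

Lemma eq_linear_subsp (A B : lmodType C) (h e : {linear A -> B}) : subsp (fun x => h x = e x).
Proof. by split=> [|a x y ex ey]; rewrite ?linear0 // !linearP ex ey. Qed.

Lemma linear_preim (W A B : lmodType C) (Y : W -> A) (e : {linear A -> B}) (T : {linear B -> B})
  (b : {linear W -> B}) : injective e -> (forall v, e (Y v) = T (T (b v))) -> linear Y.
Proof. by move=> inj eY a v v'; apply: inj; rewrite linearP !eY !linearP. Qed.

End Abstract.

Section TauSum.
Variables (p f : nat) (F : completeValuedFieldType) (C : closedFieldType).
Variables (iota : {rmorphism residue_field F -> C}) (D : resdata p f iota).
Local Notation om := (uniformizer : F).
Local Notation q := (p ^ f)%N.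
Local Notation al := (alpha F).
Local Notation SL := (@SL2_GL2 F).

Lemma beta_beta i j : (beta D (Some i) * beta D (Some j) =
  SL (u (lam D i + om * lam D j) * hh om) * scG F 1)%g.
Proof.
have o0 := om_neq0 F; move: (beta D (Some i)) (betaE D i) (beta D (Some j)) (betaE D j).
by move=> b bE b' b'E; apply: gl2P; rewrite !gM !scGE !bE !b'E !(eM, hE) // ?expr1z; fld.
Qed.

Lemma beta_alpha i : (beta D (Some i) * al = SL (u (lam D i)) * scG F 1)%g.
Proof.
move: (beta D (Some i)) (betaE D i) al (alphaE F) => b bE a aE.
by apply: gl2P; rewrite !gM !scGE !bE !aE !eM ?expr1z; ring.
Qed.

Lemma alpha_beta i : (al * beta D (Some i) = SL (u (lam D i / om)) * scG F 1)%g.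
Proof.
have o0 := om_neq0 F; move: (beta D (Some i)) (betaE D i) al (alphaE F) => b bE a aE.
by apply: gl2P; rewrite !gM !scGE !bE !aE !eM ?expr1z; fld.
Qed.

Lemma alpha_alpha : (al * al = SL (hh om)^-1%g * scG F 1)%g.
Proof.
have o0 := om_neq0 F; move: al (alphaE F) => a aE.
by apply: gl2P; rewrite !gM !scGE !aE !(eM, hE) // ?expr1z; fld.
Qed.

Variables (XS XG : lmodType C) (emb : {linear XS -> XG}) (T : {linear XG -> XG}).
Variables (bS : SL2 F -> XS) (bG : GL2 F -> XG) (c : C).
Hypotheses (embP : forall s, emb (bS s) = bG (SL s)) (inj : injective emb) (cc : c * c = c).
Hypothesis TP : forall g, T (bG g) = \sum_(i < q) bG (g * beta D (Some i))%g + c *: bG (g * al)%g.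
Hypotheses (bG_sc : forall g n, bG (g * scG F n)%g = bG g).
Hypothesis bG_u : forall i, bG (SL (u (lam D i))) = bG 1%g.

(** Products of two representatives: two finite ones give the terms of A; a finite one followed by
    [alpha] returns to the start, q times in all, and cancels; the two kinds beginning with [alpha]
    keep the coefficient c, since c * c = c. *)
Lemma hecke_square_sum y : emb y = T (T (emb (bS 1%g))) ->
  y = \sum_(i < q) \sum_(j < q) bS (u (lam D i + om * lam D j) * hh om)%g +
    c *: (\sum_(i < q) bS (u (lam D i / om)) + bS (hh om)^-1%g).
Proof.
move=> ey; apply: inj; rewrite ey embP SL2_GL21 TP linearD linear_sum linearZ_LR.
rewrite [in RHS]linearD linear_sum linearZ_LR [in RHS]linearD linear_sum embP; congr (_ + _).
  transitivity (\sum_(i < q) (emb (\sum_(j < q) bS (u (lam D i + om * lam D j) * hh om)%g)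
    + c *: bG 1%g)); last by rewrite big_split /= (sum_lam_const D) addr0.
  apply: eq_bigr => i _; rewrite TP linear_sum mul1g; congr (_ + c *: _).
    by apply: eq_bigr => j _; rewrite embP beta_beta bG_sc.
  by rewrite beta_alpha bG_sc bG_u.
rewrite TP !scalerDr scalerA cc mul1g; congr (c *: _ + c *: _).
  by apply: eq_bigr => i _; rewrite embP alpha_beta bG_sc.
by rewrite alpha_alpha bG_sc.
Qed.

End TauSum.

Section Tau.
Variables (p f : nat) (F : completeValuedFieldType) (C : closedFieldType).
Variables (iota : {rmorphism residue_field F -> C}) (D : resdata p f iota).
Variable r : 'I_f -> 'I_p.
Local Notation om := (uniformizer : F).
Local Notation rho := (@rho F C iota).
Local Notation q := (p ^ f)%N.
Local Notation al := (alpha F).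
Local Notation SL := (@SL2_GL2 F).
Local Notation V := (weight C r).
Local Notation sigma := (sigma iota r).
Local Notation sigma_S := (sigma_S iota r).
Local Notation xr := (xr C r).
Local Notation yr := (yr C r).
Local Notation XG := (cInd_G iota r).
Local Notation XS := (cInd_S iota r).
Local Notation IG := (GL2_inducible D r).
Local Notation IS := (SL2_inducible D r).
Local Notation brG := (br IG).
Local Notation brS := (br IS).
Local Notation hu := (hecke_unit D (r := r)).
Local Notation E := (total r).
Implicit Types (g h k : GL2 F) (n m : int) (v y : V) (s : SL2 F).

Definition e0 : XS := brS 1%g xr.

Lemma KZ_S_SL s : KZ_S s <-> KZ (SL s).
Proof. by rewrite KZ_SP KZ_SL. Qed.

Lemma brS_ind (P : XS -> Prop) : subsp P -> (forall s v, P (brS s v)) -> forall x, P x.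
Proof.
by move=> sP Pbr x; have [t ->] := br_span IS x; apply: (subsp_sum sP) => z _; exact: Pbr.
Qed.

Definition res_act s : {linear XG -> XG} := rep_act XG (SL s).
Fact res_act1 x : res_act 1%g x = x. Proof. by rewrite /res_act SL2_GL21 rep_act1. Qed.
Fact res_actM s t x : res_act (s * t)%g x = res_act s (res_act t x).
Proof. by rewrite /res_act SL2_GL2M rep_actM. Qed.
Definition res_XG : rep C (SL2 F) := Rep res_act1 res_actM.

Definition emb_like (emb : XS -> XG) := forall s v, emb (brS s v) = brG (SL s) v.

Fact brG1_sigma s v : KZ_S s -> (brG 1%g (sigma_S s v) : res_XG) = rep_act res_XG s (brG 1%g v).
Proof.
move=> /KZ_S_SL sK; rewrite -[rep_act res_XG s _]/(rep_act XG (SL s) _) br_act mulg1.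
by rewrite -[X in brG X v]mul1g br_H.
Qed.

Lemma mk_linear (W W' : lmodType C) (Q : W -> W') : linear Q ->
  exists Q' : {linear W -> W'}, forall x, Q' x = Q x.
Proof.
move=> QL; pose m := GRing.isLinear.Build C W W' _ Q QL.
by exists (HB.pack Q m : {linear W -> W'}).
Qed.

Lemma emb_ex : exists emb : {linear XS -> XG}, emb_like emb /\
  forall s z, emb (rep_act XS s z) = rep_act XG (SL s) (emb z).
Proof.
have [Psi PsiE] := @mk_linear V res_XG (brG 1%g) (br_linear IG 1%g).
have [|emb embP] := @frobenius _ _ _ _ _ IS res_XG Psi.
  by move=> h v hK; rewrite !PsiE; exact: brG1_sigma.
have [emb' emb'E] := @mk_linear XS XG emb (linearP emb); exists emb'; split=> [s v|s z].
  rewrite emb'E embP PsiE -[rep_act res_XG s _]/(rep_act XG (SL s) (brG 1%g v)) br_act.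
  by rewrite mulg1.
by rewrite !emb'E; exact: (rep_homJ emb).
Qed.

Lemma emb_cv (emb : {linear XS -> XG}) x s : emb_like emb -> cv (emb x) (SL s) = cv x s.
Proof.
move=> embP; have [t ->] := br_span IS x; rewrite linear_sum !cv_sum.
apply: eq_bigr => -[g v] _ /=; rewrite embP !brE /bracket -SL2_GL2M.
have e : KZ (SL (s * g)%g) = KZ_S (s * g)%g := propext (iff_sym (KZ_S_SL _)).
by rewrite e.
Qed.

Lemma emb_inj (emb : {linear XS -> XG}) : emb_like emb -> injective emb.
Proof.
by move=> embP x x' e; apply: cv_ext => s; rewrite -!(emb_cv _ _ embP) e.
Qed.

Lemma emb_even (emb : {linear XS -> XG}) g v n : emb_like emb ->
  valuation (gdet g) = n *+ 2 -> exists x, emb x = brG g v.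
Proof.
move=> embP /even_decomp[s [k [kn ->]]]; exists (brS s (sigma k v)).
by rewrite embP -br_H //; apply/KZP; exists n.
Qed.

Definition tau_like (T : rep_hom XG XG) (tau : rep_hom XS XS) :=
  forall emb : {linear XS -> XG}, emb_like emb -> forall x, emb (tau x) = T (T (emb x)).

Opaque cInd.

Lemma emb_uniq (emb emb' : {linear XS -> XG}) : emb_like emb -> emb_like emb' -> emb =1 emb'.
Proof.
move=> embP embP'; apply: (brS_ind (P := fun z => emb z = emb' z)).
  exact: eq_linear_subsp.
by move=> s v; rewrite embP embP'.
Qed.

Lemma hom_br_SL (T : rep_hom XG XG) s v :
  rep_act XG (SL s) (T (T (brG 1%g v))) = T (T (brG (SL s) v)).
Proof.
rewrite -(rep_homJ T) -(rep_homJ T).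
have -> : rep_act XG (SL s) (brG 1%g v) = brG (SL s) v by rewrite br_act mulg1.
reflexivity.
Qed.

(** The square of T sends [1, v] to brackets at products of two representatives, whose determinants
    have even valuation; so the value lies in the image of the embedding, and Frobenius reciprocity
    extends the assignment. *)
Lemma tau_ex (T : rep_hom XG XG) : hecke_like D T -> exists tau, tau_like T tau.
Proof.
move=> HT; have [emb [embP embJ]] := emb_ex.
have inj := emb_inj (emb := emb) embP.
have ex_y v : exists y : XS, emb y = T (T (brG 1%g v)).
  have imD : subsp (fun z : XG => exists y : XS, emb y = z).
    split; first by exists 0; rewrite linear0.
    by move=> a z z' [y <-] [y' <-]; exists (a *: y + y'); rewrite linearP.
  rewrite HT rep_act1 linear_sum.
  apply: (subsp_sum imD) => i _; rewrite HT linear_sum; apply: (subsp_sum imD) => j _.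
  rewrite br_act; apply: (@emb_even emb _ _ 1 embP).
  by rewrite gdetM !gdet_beta valuationM ?om_neq0 // valuation_uniformizer.
have [Y YP] := choice ex_y.
have Y_linear : linear Y := linear_preim (T := T) (b := brG 1%g) inj YP.
have [Y' Y'E] := mk_linear Y_linear.
have [|tau tauP] := @frobenius _ _ _ _ _ IS XS Y'.
  move=> s v sK; apply: inj; rewrite embJ !Y'E !YP.
  have -> : brG 1%g (sigma_S s v) = rep_act XG (SL s) (brG 1%g v) := brG1_sigma v sK.
  exact: etrans (congr1 (fun z => T z) (rep_homJ T _ _)) (rep_homJ T _ _).
exists tau => emb' embP' x; rewrite !(emb_uniq embP' embP).
apply: (brS_ind (P := fun x => emb (tau x) = T (T (emb x)))).
  exact: (eq_comp_subsp tau emb T).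
move=> s v; apply: etrans (congr1 emb (tauP s v)) _.
apply: etrans (embJ s (Y' v)) _.
apply: etrans (congr1 _ (etrans (congr1 emb (Y'E v)) (YP v))) _.
apply: etrans (hom_br_SL T s v) _.
exact: (congr1 (fun z => T (T z)) (esym (embP s v))).
Qed.

Transparent cInd.

Lemma is_tauP T tau : is_tau T tau <-> tau_like T tau.
Proof.
split=> [[emb [inj embP] H] emb' embP' x|H].
  have embP0 : emb_like emb.
    move=> s v; apply: cv_ext => h; rewrite (brE IG).
    exact: (congr1 (fun f => f h) (embP s v (brS s v) (brE IS s v))).
  by rewrite !(emb_uniq embP' embP0).
have [emb [embP _]] := emb_ex; exists emb; last by move=> x; exact: H.
split; first exact: emb_inj embP.
move=> s v x ex; have -> : x = brS s v by apply: cv_ext => h; rewrite brE -ex.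
by have := congr1 (fun z : XG => cv z) (embP s v); rewrite brE.
Qed.

Opaque cInd.

Lemma xr_u (x : F) : vge 0 x -> sigma_S (u x) xr = xr.
Proof.
move=> x0; apply: (ev_ext D) => Y Z; rewrite (ev_sigma_S D) ?inK_u // !uE.
by rewrite (rho1 iota) (rho0 iota) mul1r mul0r addr0 !ev_xr.
Qed.

Lemma brS_u s (x : F) : vge 0 x -> brS (s * u x)%g xr = brS s xr.
Proof. by move=> x0; rewrite br_H ?xr_u //; apply/KZ_SP/inK_u. Qed.

Lemma xr_K0 s : E = 0%N -> inK s -> sigma_S s xr = xr.
Proof. by move=> e sK; apply: (ev_ext D) => Y Z; rewrite (ev_sigma_S D) // !ev_xr e !expr0. Qed.

Lemma brS_K0 s t : E = 0%N -> inK t -> brS (s * t)%g xr = brS s xr.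
Proof. by move=> e kK; rewrite br_H ?xr_K0 //; exact/KZ_SP. Qed.

Lemma yr_eq_xr : E = 0%N -> yr = xr.
Proof. by move=> e; apply: (ev_ext D) => Y Z; rewrite ev_yr ev_xr e !expr0. Qed.

Lemma sum_option (W : nmodType) (J : finType) (Q : option J -> W) :
  \sum_i Q i = Q None + \sum_j Q (Some j).
Proof.
rewrite (bigD1 None) //=; congr (_ + _).
rewrite (reindex_omap Some id) /=; last by case.
by apply: eq_bigl => j; rewrite eqxx.
Qed.

(** The factor 0^E keeps the [alpha] term for the trivial weight only: U kills [xr] unless E = 0. *)
Lemma hu_xr : hu xr = \sum_(i < q) brG (beta D (Some i)) xr + 0 ^+ E *: brG al xr.
Proof.
Transparent hecke_unit. rewrite /hecke_unit. Opaque hecke_unit.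
rewrite sum_option addrC; congr (_ + _).
  by apply: eq_bigr => i _; rewrite /psi_term ev_xr expr1n scale1r.
rewrite /psi_term ev_xr linearZ /=; have [e|e] := eqVneq E 0%N; first by rewrite yr_eq_xr.
by rewrite expr0n (negPf e) !scale0r.
Qed.

Section Formula.
Variables (T : rep_hom XG XG) (tau : rep_hom XS XS).
Hypotheses (HT : hecke_like D T) (Htau : tau_like T tau).

Lemma brG_sc g n v : brG (g * scG F n)%g v = brG g v.
Proof. by rewrite br_H ?(sigma_sc D) //; exact: KZ_sc. Qed.

Lemma tau_e0_sum : tau e0 = \sum_(i < q) \sum_(j < q) brS (u (lam D i + om * lam D j) * hh om)%g xr +
  0 ^+ E *: (\sum_(i < q) brS (u (lam D i / om)) xr + brS (hh om)^-1%g xr).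
Proof.
have [emb [embP _]] := emb_ex.
apply: (@hecke_square_sum _ _ _ _ _ D XS XG emb T (fun s => brS s xr) (fun g => brG g xr)).
- by move=> s; exact: embP.
- exact: emb_inj embP.
- by rewrite expr0n; case: eqP => _; rewrite ?mulr1 ?mulr0.
- move=> g; rewrite HT hu_xr linearD linear_sum linearZ_LR; congr (_ + _ *: _).
    by apply: eq_bigr => i _; rewrite br_act.
  exact: br_act.
- by move=> g n; exact: brG_sc.
- move=> i; rewrite -[SL _]mul1g br_H; last by apply/KZ_SLK/inK_u; exact: lam_int.
  by congr (brG 1%g _); apply: xr_u; exact: lam_int.
exact: Htau embP e0.
Qed.

(** The second digit appears with the opposite sign in A; this is harmless because the summand
    depends only on its residue class. *)
Lemma At_e0 : At D XS e0 =
  \sum_(i < q) \sum_(j < q) brS (u (lam D i + om * lam D j) * hh om)%g xr.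
Proof.
have o0 := om_neq0 F; rewrite AtE big_allpairs_dep big_enum; apply: eq_bigr => i _.
rewrite big_enum; pose Q x := brS (u (lam D i + om * x) * hh om)%g xr.
have Qper : periodic Q.
  move=> x y x0 y0 xy; rewrite /Q.
  have -> : (u (lam D i + om * x) * hh om = u (lam D i + om * y) * hh om * u ((x - y) / om))%g.
    by sl2.
  by rewrite brS_u // -[0](subrr 1) -vge_om1M mulrC divfK.
rewrite -[RHS](sum_lam_scale D (a := -1) _ Qper); last exact: unitON (unitO1 F).
by apply: eq_bigr => j _; rewrite br_act mulg1 /Q mulN1r mulrN.
Qed.

(** For E = 0 the vector [xr] is fixed by K, so only cosets matter. The unit classes on both sides
    are matched by inversion, the zero class of S1 gives [(hh om)^-1], and [e0] is the zero class on
    the right. *)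
Lemma S1_e0 : E = 0%N ->
  e0 + S1 D XS e0 = \sum_(i < q) brS (u (lam D i / om)) xr + brS (hh om)^-1%g xr.
Proof.
move=> e; have o0 := om_neq0 F; rewrite S1E (bigD1 (lam_zero D)) //= [in RHS](bigD1 (lam_zero D)) //=.
rewrite lam0 mul0r mulr0 l0 u0 mul1g br_act mulg1 -addrA; congr (_ + _).
rewrite addrC; congr (_ + _); last by rewrite w1_tV brS_K0 //; exact/inKV/inK_w.
pose Q x := brS (u (x / om)) xr.
rewrite -[RHS](@big_lam_reindex0 _ _ _ _ _ D _ _ _ (fun x => x^-1) Q).
- apply: eq_bigr => i ii0; have ui := unit_lam ii0; have l0 := unitO_neq0 ui.
  have d1 : - (lam D i)^-1 * (- lam D i) - 0 * om = 1 by fld.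
  rewrite br_act mulg1 /Q.
  have -> : (l (om * lam D i) * w1 F = u ((lam D i)^-1 / om) * mk (- (lam D i)^-1) 0 om (- lam D i))%g.
    by apply: sl2P; rewrite !(eM, w1E) ?ea_mk ?eb_mk ?ec_mk ?ed_mk //; fld.
  rewrite brS_K0 //; apply/and4P; rewrite ea_mk ?eb_mk ?ec_mk ?ed_mk //; split.
  + by rewrite vgeN // unitO_vgeV.
  + exact: vge0.
  + exact: vge01 (vge_om F).
  + by rewrite vgeN // (lam_int D).
- by move=> x; exact: unitOV.
- move=> x y ux uy; have x0 := unitO_neq0 ux; have y0 := unitO_neq0 uy.
  have -> : x^-1 - y^-1 = (x * y)^-1 * (y - x) by fld.
  by rewrite vge_unitM ?unitOV ?unitOM // vgeBC.
move=> x y ux uy xy; rewrite /Q -[x](subrK y) addrC mulrDl uD brS_u //.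
by rewrite -[0](subrr 1) -vge_om1M mulrC divfK // addrK.
Qed.

Lemma tau_e0 : tau e0 = At D XS e0 + 0 ^+ E *: (e0 + S1 D XS e0).
Proof.
rewrite tau_e0_sum At_e0; congr (_ + _); have [e|e] := eqVneq E 0%N; first by rewrite S1_e0.
by rewrite expr0n (negPf e) !scale0r.
Qed.

End Formula.

(** * Heights on the tree: [e0] is not in the image of tau *)

Section Heights.
Variables (T : rep_hom XG XG) (HT : hecke_like D T).

Lemma cv_sc (x : XG) n g : cv x (scG F n * g)%g = cv x g.
Proof. by rewrite (cv_equiv x g (KZ_sc F n)) (sigma_sc D). Qed.

Lemma alphaV_dpow n g : (al^-1 * (dpow F (- (n + 1)) * g) = scG F (-1) * (dpow F (- n) * g))%g.
Proof.
rewrite alpha_dpowV -!mulgA; congr (_ * _)%g; rewrite mulgA -dpowD; congr (dpow F _ * _)%g; lia.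
Qed.

Lemma dpow_u n x : (SL (u x) * dpow F n = dpow F n * SL (u (om ^ (- n) * x)))%g.
Proof.
have e : om ^ n * (om ^ (- n) * x) = x by rewrite mulrA -expfzDr ?om_neq0 // subrr mul1r.
by apply: gl2P; rewrite !gM !dpowE !uE ?mulr1 ?mulr0 ?mul0r ?mul1r ?addr0 ?add0r // e.
Qed.

Lemma betaV_dpow i n x g : ((beta D (Some i))^-1 * (dpow F (- (n + 1)) * SL (u x) * g) =
  dpow F (- (n + 2)) * SL (u (x - om ^ (n + 1) * lam D i)) * g)%g.
Proof.
rewrite /beta invgM -SL2_GL2V -uN.
have -> : ((dpow F 1)^-1 = dpow F (-1))%g.
  by apply: (mulgI (dpow F 1)); rewrite mulgV -dpowD subrr dpow0.
rewrite !mulgA; congr (_ * _)%g; rewrite -mulgA -mulgA [(SL _ * (_ * _))%g]mulgA dpow_u -!mulgA -SL2_GL2M -uD.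
rewrite mulgA -dpowD opprK mulrN [- _ + x]addrC; congr (dpow F _ * _)%g; lia.
Qed.

(* [dpow (-n) * u z] runs over the vertices of height [n] with respect to the end fixed by [B];
   [T] moves the top layer of a function one step up. *)
Lemma hecke_top (x : XG) n k : (forall z, cv x (dpow F (- (n + 2)) * SL (u z) * k)%g = 0) ->
  forall z, cv (T x) (dpow F (- (n + 1)) * SL (u z) * k)%g =
    ev 1 0 (cv x (dpow F (- n) * SL (u z) * k)%g) *: xr.
Proof.
move=> x0 z; rewrite (hecke_conv _ _ HT) sum_option big1 ?addr0 => [|i _]; last first.
  by rewrite betaV_dpow x0 linear0.
rewrite -[(dpow F (- (n + 1)) * _ * _)%g]mulgA alphaV_dpow cv_sc mulgA.
by apply: (hecke_alpha D); exact: (hecke_function0P D).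
Qed.

Definition vanish (x : XG) n k := forall m z, n <= m -> cv x (dpow F (- m) * SL (u z) * k)%g = 0.

(** The entries of g bound the heights reached by the support of a bracket at g, uniformly in the
    translation by K: higher up, the bottom row would make the determinant too divisible. *)
Lemma not_KZ_high B m z s g : inK s -> gvge B g -> valuation (gdet g) - B *+ 2 + 1 <= m ->
  ~ KZ (dpow F (- m) * SL (u z) * SL s * g)%g.
Proof.
move=> sK /and4P[Ba Bb Bc Bd] Bm /KZP[j /andP[/and4P[ha hb hc hd] /eqP dj]].
have e1 : valuation (gdet g) - m = j *+ 2.
  rewrite -dj !gdetM !gdet_SL !mulr1 gdet_dpow valuationM ?omX_neq0 ?gdet_neq0 //.
  by rewrite val_omX addrC.
have jB : j + 1 <= B by lia.
move: sK => /and4P[sa sb sc sd].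
have c1 : vge (j + 1) (gc (dpow F (- m) * SL (u z) * SL s * g)%g).
  rewrite !gM !dpowE !uE !(mul0r, mulr0, mul1r, mulr1, add0r, addr0).
  by apply: (vge_le jB); apply: vgeD; exact: vgeMl.
have d1 : vge (j + 1) (gd (dpow F (- m) * SL (u z) * SL s * g)%g).
  rewrite !gM !dpowE !uE !(mul0r, mulr0, mul1r, mulr1, add0r, addr0).
  by apply: (vge_le jB); apply: vgeD; exact: vgeMl.
have : vge (j + (j + 1)) (gdet (dpow F (- m) * SL (u z) * SL s * g)%g).
  by rewrite gdetE; apply: vgeB; exact: vgeM.
by rewrite vgeE ?gdet_neq0 // dj; clear; lia.
Qed.

Lemma vanish_ex (x : XG) : exists n, forall s, inK s -> vanish x n (SL s).
Proof.
have [t ->] := br_span IG x; elim: t => [|[g v] t [N IHt]].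
  by exists 0 => s _ m z _; rewrite big_nil.
pose B := Num.min (Num.min (valuation (gc g)) (valuation (gd g))) (Num.min (valuation (ga g)) (valuation (gb g))).
have [Ba Bb Bc Bd] : [/\ vge B (ga g), vge B (gb g), vge B (gc g) & vge B (gd g)].
  by split; apply: vge_le (vge_val _); rewrite /B !ge_min !lexx ?orbT.
exists (Num.max N (valuation (gdet g) - B *+ 2 + 1)) => s sK m z.
rewrite ge_max => /andP[Nm Bm]; rewrite big_cons cv_add IHt // addr0.
by apply: br_out; apply: (not_KZ_high sK _ Bm); apply/and4P.
Qed.

(** A top layer of [x] at height n >= -1 would reappear in the square of T at height n + 2 >= 1,
    where [1, xr] vanishes. T only sees the value of a layer at (1, 0); integral unipotents turn it
    into the values at all (1, t), so that [ev_eq0] applies. *)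
Lemma vanish_step (x : XG) n s : inK s -> T (T x) = brG 1%g xr -> -1 <= n ->
  vanish x (n + 1) (SL s) -> vanish x n (SL s).
Proof.
move=> sK TTx n1 van m z; rewrite le_eqVlt => /orP[/eqP <-{m}|nm]; last by apply: van; lia.
have top z' : ev 1 0 (cv x (dpow F (- n) * SL (u z') * SL s)%g) = 0.
  have x2 (a : F) : cv x (dpow F (- (n + 2)) * SL (u a) * SL s)%g = 0 by apply: van; lia.
  have x4 (a : F) : cv x (dpow F (- (n + 2 + 2)) * SL (u a) * SL s)%g = 0 by apply: van; lia.
  have Tx3 (a : F) : cv (T x) (dpow F (- (n + 1 + 2)) * SL (u a) * SL s)%g = 0.
    have -> : n + 1 + 2 = (n + 2) + 1 by lia.
    by rewrite (hecke_top x4) x2 linear0 scale0r.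
  have := hecke_top Tx3 z'; rewrite (hecke_top x2) TTx linearZ /= ev_xr expr1n [_ *: 1]mulr1.
  have -> : n + 1 + 1 = n + 2 by lia.
  rewrite -[(_ * SL s)%g]mulg1 br_out; last first.
    rewrite mulg1; apply: (not_KZ_high (B := 0) sK); first by have /andP[] := kz1 F.
    by rewrite gdet1 valuation1; clear -n1; lia.
  by move=> /esym/eqP; rewrite scaler_eq0 (negPf (xr_neq0 C r)) orbF => /eqP.
apply: (ev_eq0 D) => b b0; have uK := inK_u b0.
have -> : ev 1 (rho b) (cv x (dpow F (- n) * SL (u z) * SL s)%g) =
    ev 1 0 (sigma_S (u b) (cv x (dpow F (- n) * SL (u z) * SL s)%g)).
  by rewrite (ev_sigma_S D) // !uE (rho1 iota) (rho0 iota) !mulr1 !mulr0 !addr0.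
have -> : sigma_S (u b) (cv x (dpow F (- n) * SL (u z) * SL s)%g) =
    cv x (SL (u b) * (dpow F (- n) * SL (u z) * SL s))%g.
  by rewrite (cv_equiv x _ (KZ_SLK uK)).
have -> : (SL (u b) * (dpow F (- n) * SL (u z) * SL s) =
    dpow F (- n) * SL (u (om ^ (- - n) * b + z)) * SL s)%g.
  by rewrite uD SL2_GL2M !mulgA dpow_u.
exact: top.
Qed.

Lemma dpow_hh (m : nat) : (SL (hh (om ^+ m))^-1%g = scG F m%:Z * dpow F (- (m%:Z *+ 2)))%g.
Proof.
have o0 := om2n_neq0 F m; have e : om ^ (- (m%:Z *+ 2)) = (om ^+ m * om ^+ m)^-1.
  by rewrite mulr2n opprD expfzDr ?om_neq0 // -!exprnN invfM.
by apply: gl2P; rewrite !gM !scGE !dpowE !(eM, hE) // ?e -?exprnP; fld.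
Qed.

(** Descending from a height beyond the support shows that [x] vanishes at all heights >= -1,
    whatever the translation by K. By the Cartan decomposition every point is reached at some height
    2m >= 0, so x = 0. *)
Lemma hecke2_neq_e0 (emb : {linear XS -> XG}) (x : XS) : emb_like emb ->
  T (T (emb x)) <> brG 1%g xr.
Proof.
move=> embP TTx; have [N vanN] := vanish_ex (emb x).
have van1 s : inK s -> vanish (emb x) (-1) (SL s).
  move=> sK; have [M NM] : exists M : nat, N <= M%:Z - 1 by exists (absz N).+1; lia.
  suff H (M' : nat) : vanish (emb x) (M'%:Z - 1) (SL s) -> vanish (emb x) (-1) (SL s).
    by apply: (H M) => m z Mm; apply: vanN => //; apply: le_trans Mm.
  elim: M' => [|M' IH] H; first by move=> m z; exact: H.
  apply: IH; apply: vanish_step => //; first by lia.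
  by move=> m z Hm; apply: H; lia.
have x0 : x = 0.
  apply: cv_ext => s; rewrite cv_zero -(emb_cv (emb := emb) _ _ embP).
  have [m [k1 [k2 [k1K k2K ->]]]] := cartan s.
  rewrite !SL2_GL2M -mulgA (cv_equiv _ _ (KZ_SLK k1K)) dpow_hh -mulgA cv_sc.
  have -> : (dpow F (- (m%:Z *+ 2)) * SL k2 = dpow F (- (m%:Z *+ 2)) * SL (u 0) * SL k2)%g.
    by rewrite u0 SL2_GL21 mulg1.
  by rewrite (van1 _ k2K (m%:Z *+ 2) 0) ?linear0 //; lia.
have e : brG 1%g xr = 0 by rewrite -TTx x0 !linear0.
have := congr1 (fun y : XG => cv y 1%g) e; rewrite cv_zero br_in ?mulg1; last exact: (KZ1 D r).
by rewrite (ind_sigma1 IG) => /eqP; rewrite (negPf (xr_neq0 C r)).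
Qed.

Lemma tau_neq_e0 tau x : tau_like T tau -> tau x <> e0.
Proof.
move=> Htau ex; have [emb [embP _]] := emb_ex; apply: (hecke2_neq_e0 (x := x) embP).
apply: etrans (esym (Htau emb embP x)) (etrans (congr1 emb ex) (etrans (embP 1%g xr) _)).
by rewrite SL2_GL21.
Qed.

End Heights.

End Tau.

(** * Invariants of the compact induction *)

Section I1Invariants.
Variables (p f : nat) (F : completeValuedFieldType) (C : closedFieldType).
Variables (iota : {rmorphism residue_field F -> C}) (D : resdata p f iota).
Local Notation om := (uniformizer : F).
Local Notation lam := (lam D).
Implicit Types (g h k s : SL2 F) (j : int) (n m : nat).

Lemma factor_lhu g : ea g != 0 -> g = (l (ec g / ea g) * hh (ea g) * u (eb g / ea g))%g.
Proof.
move=> a0; have d1 : ed g = (1 + eb g * ec g) / ea g.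
  by apply: (mulfI a0); rewrite mulrCA mulfV // mulr1 -(ead_bc g) subrK.
by apply: sl2P; rewrite !(eM, hE) // ?d1; fld.
Qed.

(** Refines the Cartan decomposition: if the upper left entry of [k2] is a unit the exponent is -m;
    otherwise the upper right entry is one, and a Weyl element changes the exponent to m. *)
Lemma iwahori_double_coset g :
  exists j k i, [/\ inK k, I1 i & g = (k * hh (om ^ j) * i)%g].
Proof.
have [m [k1 [k2 [k1K k2K ->]]]] := cartan g; have om0 := om2n_neq0 F m.
have /and4P[ka kb kc kd] := k2K; have [ua|a1] := unitO_or ka.
  have a0 := unitO_neq0 ua; have aV := unitO_vgeV ua.
  exists (- m%:Z), (k1 * (l (om ^+ m * om ^+ m * (ec k2 / ea k2)) * hh (ea k2)))%g, (u (eb k2 / ea k2)); split.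
  - apply: inKM => //; apply: inKM; last exact: inK_h.
    apply/inK_l/vgeMl; last exact: vgeMl.
    by apply: vgeMl; exact: vgeX (vge01 (vge_om F)).
  - by apply/I1_u/vgeMl.
  rewrite {1}(factor_lhu a0) -exprnN; move: (om ^+ m) om0 => B B0.
  by apply: sl2P; rewrite !(eM, hE) ?invr_neq0 //; fld.
have bc : unitO (eb k2 * ec k2).
  have -> : eb k2 * ec k2 = -1 + ea k2 * ed k2 by rewrite -(ead_bc k2); ring.
  by apply: unitOD; [exact/unitON/unitO1 | exact: vgeMr].
have b0 : eb k2 != 0 by apply: contraTneq bc => ->; rewrite mul0r /unitO eqxx.
have ub : unitO (eb k2).
  rewrite unitOE kb /=; apply: contraTN bc => b1; rewrite unitOE negb_and negbK.
  by apply/orP; right; exact: vgeMr.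
have bV := unitO_vgeV ub.
exists m%:Z, (k1 * (w^-1 * (u (- (om ^+ m * om ^+ m * (ed k2 / eb k2))) * hh (- eb k2)^-1)))%g, (l (ea k2 / eb k2)); split.
- apply: inKM => //; apply: inKM; first exact/inKV/inK_w; apply: inKM.
    apply/inK_u/vgeN/vgeMl; last exact: vgeMl.
    by apply: vgeMl; exact: vgeX (vge01 (vge_om F)).
  by apply/inK_h/unitOV/unitON.
- by apply/I1_l/vgeMr.
rewrite -exprnP; move: (om ^+ m) om0 => B B0.
have c1 : ec k2 = (ea k2 * ed k2 - 1) / eb k2.
  by apply: (mulfI b0); rewrite mulrCA mulfV // mulr1 -(ead_bc k2); ring.
have nb : (- eb k2)^-1 != 0 by rewrite invr_eq0 oppr_eq0.
by apply: sl2P; rewrite !(eM, hE) // ?c1; fld.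
Qed.

Variables (V : lmodType C) (sg : SL2 F -> {linear V -> V}) (z0 : V).
Variables (X : rep C (SL2 F)) (ct : SL2 F -> {linear X -> V}) (e : X).
Hypotheses (ct_act : forall g x h, ct h (rep_act X g x) = ct (h * g)%g x).
Hypotheses (ct_ext : forall x y, (forall g, ct g x = ct g y) -> x = y).
Hypotheses (ct_K : forall k g x, inK k -> ct (k * g)%g x = sg k (ct g x)).
Hypotheses (ct_supp : forall x, exists N : nat, forall j, ct (hh (om ^ j)) x != 0 -> (`|j| <= N)%N).
Hypotheses (sgM : forall k k' y, inK k -> inK k' -> sg (k * k')%g y = sg k (sg k' y)).
Hypotheses (sg1 : forall y, sg 1%g y = y) (sg_I1 : forall i, I1 i -> sg i z0 = z0).
Hypotheses (sg_U : forall y, (forall x, vge 0 x -> sg (u x) y = y) -> exists c, y = c *: z0).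
Hypotheses (e_in : forall g, inK g -> ct g e = sg g z0) (e_out : forall g, ~~ inK g -> ct g e = 0).

Lemma generator_I1f : I1f e.
Proof.
move=> i iI; have iK := I1_inK iI; apply: ct_ext => g; rewrite ct_act.
have [gK|gK] := boolP (inK g); first by rewrite (e_in (inKM gK iK)) e_in // sgM // sg_I1.
rewrite !e_out //; apply: contra gK => gi.
by rewrite -[g](mulgK i); apply: inKM => //; exact: inKV.
Qed.

(** An integral upper unipotent moved across [hh (om ^ (- n%:Z))] stays integral and is absorbed by
    [x], so the value is invariant under integral unipotents. *)
Lemma I1f_neg x n : I1f x -> exists c, ct (hh (om ^ (- n%:Z))) x = c *: z0.
Proof.
move=> Ix; apply: sg_U => y y0; rewrite -ct_K ?inK_u //.
have -> : (u y * hh (om ^ (- n%:Z)) = hh (om ^ (- n%:Z)) * u (om ^+ n * om ^+ n * y))%g.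
  have := om2n_neq0 F n; rewrite -exprnN; move: (om ^+ n) => B B0.
  by apply: sl2P; rewrite !(eM, hE) ?invr_neq0 //; fld.
rewrite -ct_act Ix //; apply: I1_u; do !apply: vgeMl => //; exact: vgeX (vge01 (vge_om F)).
Qed.

(** The same with lower unipotents after applying [w]. The exponent is at least 1, which supplies
    the factor of the uniformizer required by I1. *)
Lemma I1f_pos x n : I1f x -> exists c, ct (hh (om ^ n.+1%:Z)) x = c *: sg w^-1%g z0.
Proof.
move=> Ix; have wK := inK_w F.
have [|c ec] := @sg_U (sg w (ct (hh (om ^ n.+1%:Z)) x)).
  move=> y y0; rewrite -!ct_K ?inK_u //.
  have -> : (u y * (w * hh (om ^ n.+1%:Z)) = w * hh (om ^ n.+1%:Z) * l (om * (om ^+ n * om ^+ n.+1 * - y)))%g.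
    have -> : om * (om ^+ n * om ^+ n.+1 * - y) = om ^+ n.+1 * om ^+ n.+1 * - y.
      by rewrite !mulrA -exprS.
    by rewrite mulgA u_w -[in LHS]mulgA l_h ?omX_neq0 // mulgA expr2 -exprnP.
  rewrite -ct_act Ix //; apply: I1_l; rewrite vge_om1M subrr.
  by do !apply: vgeMl; rewrite ?vgeN //; exact: vgeX (vge01 (vge_om F)).
by exists c; rewrite -linearZ -ec -sgM ?inKV // mulVg sg1.
Qed.

(** Integrality of the diagonal entries forces j = -n, and integrality of the upper right entry then
    leaves only the digit 0. *)
Lemma iter_At_value n j : ct (hh (om ^ j)) (iter n (At D X) e) = if j == - n%:Z then z0 else 0.
Proof.
rewrite iter_At linear_sum; have oj := omX_neq0 F j; have on := om2n_neq0 F n.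
have [ej|nj] := eqVneq j (- n%:Z); last first.
  rewrite big1 // => z _; rewrite ct_act e_out //; apply: contra nj => /and4P[].
  rewrite !(eM, hE) // !(mulr0, mul0r, mulr1, mul1r, addr0, add0r) => a0 _ _ d0.
  move: a0 d0; rewrite -invfM !exprnP -!expfzDr ?om_neq0 // !vgeE ?omX_neq0 ?invr_neq0 ?omX_neq0 //.
  by rewrite valV ?omX_neq0 // val_omX; lia.
rewrite (@big_digits1 _ _ _ _ _ D _ n 0) ?digits0 // => [|y yd]; last first.
  rewrite subr0 => ny; rewrite ct_act e_out //; apply: contra ny => /and4P[_ + _ _].
  rewrite !(eM, hE) // ej !(mulr0, mul0r, mulr1, mul1r, addr0, add0r) -exprnN => b0.
  have -> : y = om ^+ (n + n) * (y * (om ^+ n)^-1 * (om ^+ n)^-1) by rewrite exprD; fld.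
  apply: vgeMr; last by move: b0; congr (vge 0 _); fld.
  by rewrite addnn -mul2n exprnP vge_omX.
rewrite ct_act u0 mul1g ej -exprnN hV // mulVg e_in ?inK1 // sg1.
Qed.

Lemma S1_value x j : I1f x -> (forall i : int, 1 <= i -> ct (hh (om ^ i)) x = 0) ->
  ct (hh (om ^ j)) (S1 D X x) = if 1 <= j then sg w^-1%g (ct (hh (om ^ (1 - j))) x) else 0.
Proof.
move=> Ix x0; rewrite S1E linear_sum; have wK := inKV (inK_w F); have o0 := om_neq0 F.
have oj := omX_neq0 F j.
have eV : om ^ (1 - j) = om / om ^ j by rewrite expfzDr // expr1z -invr_expz.
have jump c : (hh (om ^ j) * (l (om * c) * w1 F) = l (om ^ (1 - j - j) * c) * w^-1 * hh (om ^ (1 - j)))%g.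
  rewrite expfzDr // eV -invr_expz; move: (om ^ j) oj => B B0.
  by apply: sl2P; rewrite !(eM, hE, w1E) ?mulf_neq0 ?invr_neq0 //; fld.
case: ifP => j1; last first.
  have j2 : 1 <= 1 - j by clear -j1; lia.
  rewrite big1 // => i _; rewrite ct_act jump -mulgA ct_K ?ct_K ?x0 ?linear0 //.
  by apply/inK_l/vgeMr; [apply: vge_le (vge_omX _ _); lia | exact: (lam_int D)].
rewrite (bigD1 (lam_zero D)) //= [X in _ + X]big1 ?addr0 => [|i ii0].
  by rewrite ct_act jump lam0 mulr0 l0 mul1g ct_K.
have ui := unit_lam ii0; have l0 := unitO_neq0 ui.
pose c := - (lam i)^-1; pose B := om ^ j.
have dk : c * (- lam i) - (- (B * B / om)) * 0 = 1 by rewrite /c; fld.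
have -> : (rep_act X (l (om * lam i) * w1 F) x = rep_act X (l (om * lam i) * w1 F * l (om * - c)) x)%g.
  rewrite [in RHS]rep_actM; apply/congr1/esym/Ix/I1_l; rewrite vge_om1M subrr.
  by rewrite /c opprK unitO_vgeV.
rewrite ct_act; have -> : (hh (om ^ j) * (l (om * lam i) * w1 F * l (om * - c)) =
    mk c (- (B * B / om)) 0 (- lam i) * hh (om ^ j))%g.
  have B0 : B != 0 := oj; rewrite -/B; move: B B0 dk => B B0 dk.
  by apply: sl2P; rewrite !(eM, hE, w1E) ?ea_mk ?eb_mk ?ec_mk ?ed_mk // /c; fld.
rewrite ct_K ?x0 ?linear0 //; apply/and4P; rewrite ea_mk ?eb_mk ?ec_mk ?ed_mk //; split.
- by rewrite /c vgeN // unitO_vgeV.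
- apply: vgeN; rewrite /B -expfzDr // -[om in _ / om]expr1z invr_expz -expfzDr //.
  by apply: vge_le (vge_omX _ _); lia.
- exact: vge0.
by rewrite vgeN // (lam_int D).
Qed.

(** P collects the values of [x] at the exponents j <= 0 and Q those at j >= 1. S1 sends exponent -n
    to n + 1, hence the shift of index in Q. *)
Lemma I1f_generated x : I1f x -> exists P Q : {poly C},
  x = peval (At D X) P e + S1 D X (peval (At D X) Q e).
Proof.
move=> Ix; have [N xN] := ct_supp x.
have [a aP] := choice (fun n => @I1f_neg x n Ix); have [b bP] := choice (fun n => @I1f_pos x n Ix).
have subI : subsp (@I1f F C X).
  by split=> [g _|c y y' Iy Iy' g gI]; rewrite ?linear0 // linearP Iy ?Iy'.
have Ipe P : I1f (peval (At D X) P e).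
  apply: (Good_peval subI) generator_I1f => y Iy; exact: S0_I1f (S1_I1f D Iy).
have pe_val (c : nat -> C) j : ct (hh (om ^ j)) (peval (At D X) (\poly_(n < N.+1) c n) e) =
    if (j <= 0) && (`|j| <= N)%N then c `|j|%N *: z0 else 0.
  rewrite (peval_widen _ _ (size_poly _ _)) linear_sum.
  under eq_bigr => n _ do rewrite linearZ_LR iter_At_value coef_poly ltn_ord.
  case: ifP => [/andP[j0 jN]|jF].
    rewrite (bigD1 (inord `|j|%N)) //= inordK // big1 ?addr0.
      by rewrite ifT //; apply/eqP; lia.
    move=> i ij; rewrite ifF ?scaler0 //; apply/negP => /eqP ej; case/eqP: ij.
    by apply: ord_inj; rewrite inordK //; lia.
  rewrite big1 // => i _; rewrite ifF ?scaler0 //; apply/negP => /eqP ej.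
  by move: jF; have := ltn_ord i; rewrite ej; lia.
exists (\poly_(n < N.+1) a n), (\poly_(n < N.+1) (if (n.+1 <= N)%N then b n else 0)).
have IS : I1f (S1 D X (peval (At D X) (\poly_(n < N.+1) (if (n.+1 <= N)%N then b n else 0)) e)).
  exact: S1_I1f.
apply: ct_ext => g; have [j [k [i [kK iI ->]]]] := iwahori_double_coset g.
rewrite -mulgA (ct_K _ x kK) (ct_K _ _ kK) -!ct_act linearD Ix //.
rewrite Ipe // IS // linearD; congr (sg k _); rewrite pe_val S1_value // => [|i' i'1]; last first.
  by rewrite pe_val ifF //; apply/negP => /andP[]; lia.
rewrite pe_val; have [j1|j0] := boolP (1 <= j).
  rewrite [in RHS]ifF ?add0r; last by apply/negP; lia.
  have [m ej] : exists m : nat, j = m.+1%:Z by exists `|j|.-1%N; lia.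
  rewrite ej bP; have -> : `|1 - m.+1%:Z|%N = m by lia.
  have -> : (1 - m.+1%:Z <= 0) = true by lia.
  rewrite andTb; have [mN|mN] := boolP (m.+1 <= N)%N.
    by rewrite (ltnW mN) linearZ.
  have : ct (hh (om ^ j)) x = 0.
    by apply: contraNeq mN => /xN; rewrite ej; lia.
  by rewrite ej bP => ->; case: ifP; rewrite ?scale0r linear0.
have [m ej] : exists m : nat, j = - m%:Z by exists `|j|%N; lia.
rewrite addr0 ej aP; have -> : `|- m%:Z|%N = m by lia.
have -> : (- m%:Z <= 0) = true by lia.
rewrite andTb; case: ifP => // /negP mN.
have : ct (hh (om ^ j)) x = 0 by apply: contra_notP mN => /eqP/xN; rewrite ej; lia.
by rewrite ej aP.
Qed.

End I1Invariants.

Section Universal.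
Variables (p f : nat) (F : completeValuedFieldType) (C : closedFieldType).
Variables (iota : {rmorphism residue_field F -> C}) (D : resdata p f iota).
Variable r : 'I_f -> 'I_p.
Local Notation om := (uniformizer : F).
Local Notation rho := (@rho F C iota).
Local Notation q := (p ^ f)%N.
Local Notation lam := (lam D).
Local Notation V := (weight C r).
Local Notation sigma_S := (sigma_S iota r).
Local Notation xr := (xr C r).
Local Notation XS := (cInd_S iota r).
Local Notation IS := (SL2_inducible D r).
Local Notation brS := (br IS).
Local Notation e0 := (e0 D r).
Local Notation E := (total r).
Implicit Types (g h k s : SL2 F) (v y : V).

Lemma sigma_I1 i : I1 i -> sigma_S i xr = xr.
Proof.
move=> /and4P[a1 b c1 d1]; apply: (ev_ext D) => X Y.
rewrite (ev_sigma_S D) ?I1_inK //; last by apply/and4P.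
rewrite !ev_xr (rho_small D c1) mul0r addr0.
have -> : rho (ea i) = 1; last by rewrite mul1r.
by rewrite -(rho1 iota); apply: (rho_congr D) => //; apply: unitO_vge; [exact: unitO_1D | exact: unitO1].
Qed.

Lemma sigma_U y : (forall x, vge 0 x -> sigma_S (u x) y = y) -> exists c, y = c *: xr.
Proof.
move=> H; exists (ev 1 0 y); apply: (V_unip D) => x X Y x0.
by rewrite -{2}(H x x0) (ev_sigma_S D) ?inK_u // !uE rho1 rho0 mul0r mul1r addr0 mul1r addrC.
Qed.

Lemma e0_in g : inK g -> cv e0 g = sigma_S g xr.
Proof. by move=> gK; rewrite br_in mulg1 //; exact/KZ_SP. Qed.

Lemma e0_out g : ~~ inK g -> cv e0 g = 0.
Proof. by move=> gK; apply: br_out; rewrite mulg1 => /KZ_SP; exact/negP. Qed.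

Lemma cv_K k g (x : XS) : inK k -> cv x (k * g)%g = sigma_S k (cv x g).
Proof. by move=> kK; rewrite cv_equiv //; exact/KZ_SP. Qed.

Lemma cv_supp (x : XS) : exists N : nat, forall j : int, cv x (hh (om ^ j)) != 0 -> (`|j| <= N)%N.
Proof.
have [t ->] := br_span IS x; elim: t => [|[g v] t [N IHt]].
  by exists 0%N => j; rewrite big_nil cv_zero eqxx.
have [B [gB B0]] := bdd_ex g^-1%g.
exists (maxn N `|B|%N) => j; rewrite big_cons cv_add /= leq_max.
have [e|n0 _] := eqVneq (cv (brS g v) (hh (om ^ j))) 0; first by rewrite e add0r => /IHt ->.
apply/orP; right; have /KZ_SP gK : KZ_S (hh (om ^ j) * g)%g.
  by apply: contrapT => nK; move: n0; rewrite br_out ?eqxx.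
have := bddM gK gB; rewrite mulgK add0r => /and4P[+ _ _].
rewrite !hE ?omX_neq0 // !vgeE ?invr_neq0 ?omX_neq0 // valV ?omX_neq0 // val_omX.
by clear -B0; lia.
Qed.

Lemma ct_ex : exists ct : SL2 F -> {linear XS -> V}, forall g x, ct g x = cv x g.
Proof.
suff H g : exists c : {linear XS -> V}, forall x, c x = cv x g.
  by have [ct ctP] := choice H; exists ct.
by apply: mk_linear => a x y; rewrite cv_add cv_scale.
Qed.

Lemma e0_I1f : I1f e0.
Proof.
have [ct ctE] := ct_ex.
apply: (generator_I1f (sg := sigma_S) (z0 := xr) (ct := ct)) => [g x h|x y H|k k' y kK k'K|i iI|g gK|g gK].
- by rewrite !ctE cv_act.
- by apply: cv_ext => g; rewrite -!ctE.
- exact: sigma_SM.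
- exact: sigma_I1.
- by rewrite ctE e0_in.
- by rewrite ctE e0_out.
Qed.

Lemma I1f_XS (x : XS) : I1f x -> exists P Q : {poly C},
  x = peval (At D XS) P e0 + S1 D XS (peval (At D XS) Q e0).
Proof.
have [ct ctE] := ct_ex.
move: x; apply: (@I1f_generated _ _ _ _ _ D V sigma_S xr XS ct e0).
- by move=> g z h; rewrite !ctE cv_act.
- by move=> z z' H; apply: cv_ext => g; rewrite -!ctE.
- by move=> k g z kK; rewrite !ctE cv_K.
- by move=> z; have [N NP] := cv_supp z; exists N => j; rewrite ctE; exact: NP.
- by move=> k k' y kK k'K; exact: sigma_SM.
- exact: sigma_S1.
- exact: sigma_I1.
- exact: sigma_U.
- by move=> g gK; rewrite ctE e0_in.
- by move=> g gK; rewrite ctE e0_out.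
Qed.

End Universal.

Lemma coef_binomial_poly (R : comNzRingType) (a : R) n k :
  ((1%:P + a *: 'X) ^+ n)`_k = a ^+ k *+ 'C(n, k).
Proof.
have -> : (1%:P + a *: 'X) ^+ n = \poly_(i < n.+1) (a ^+ i *+ 'C(n, i)).
  rewrite exprDn poly_def; apply: eq_bigr => i _.
  by rewrite expr1n mul1r exprZn scalerMnl.
by rewrite coef_poly; case: ltnP => // nk; rewrite bin_small.
Qed.

Lemma prime_ndvd_bin p n k : prime p -> (n < p)%N -> (k <= n)%N -> ~~ (p %| 'C(n, k))%N.
Proof.
move=> pp np kn; have : ~~ (p %| n`!)%N.
  elim: n np {kn} => [|n IHn] np; first by rewrite fact0 gtnNdvd ?prime_gt1.
  by rewrite factS Euclid_dvdM // negb_or gtnNdvd //= IHn // ltnW.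
by apply: contra => pb; rewrite -(bin_fact kn) dvdn_mulr.
Qed.

Section Generation.
Variables (p f : nat) (F : completeValuedFieldType) (C : closedFieldType).
Variables (iota : {rmorphism residue_field F -> C}) (D : resdata p f iota).
Variable r : 'I_f -> 'I_p.
Local Notation om := (uniformizer : F).
Local Notation rho := (@rho F C iota).
Local Notation q := (p ^ f)%N.
Local Notation lam := (lam D).
Local Notation V := (weight C r).
Local Notation sigma_S := (sigma_S iota r).
Local Notation xr := (xr C r).
Local Notation XS := (cInd_S iota r).
Local Notation IS := (SL2_inducible D r).
Local Notation brS := (br IS).
Local Notation e0 := (e0 D r).
Local Notation E := (total r).
Implicit Types (g h k s : SL2 F) (v y : V).

Transparent Defs.sigma.
Lemma sigma_l_coef c (k : {dffun forall j : 'I_f, 'I_(r j).+1}) : vge 0 c ->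
  sigma_S (l c) xr k = rho c ^+ expo k * \prod_j ('C(r j, k j))%:R.
Proof.
move=> c0; rewrite /Defs.sigma_S /Defs.sigma tensor_xr /expo -prodrXr -big_split; apply: eq_bigr => j _ /=.
have d0 : valuation (gdet (SL2_GL2 (l c))) = 0 *+ 2 by rewrite gdet_SL valuation1.
rewrite mxE subn0 expr0 mulr1 ![map_mx _ _ _ _]mxE !(redE iota d0) !gE_SL !lE /rd oppr0 expr0z !mul1r.
by rewrite (rho1 iota) expr1n coef_binomial_poly -mulr_natr -exprM mulnC.
Qed.
Opaque Defs.sigma.

(** The coordinates of the translate of [xr] by [l c] are rho(c)^(expo k) times binomial
    coefficients, which are nonzero in [C] because r_j < p. Power sums over the residue field
    isolate one coordinate at a time. *)
Lemma xr_span (P : V -> Prop) : subsp P -> (forall k, inK k -> P (sigma_S k xr)) -> forall y, P y.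
Proof.
move=> sP Pxr y; have [pr pC] := (rd_prime D, rd_pchar D).
pose dl (k : {dffun forall j : 'I_f, 'I_(r j).+1}) : V := [ffun k' => (k' == k)%:R : C^o].
have -> : y = \sum_k y k *: dl k.
  apply/ffunP => k; rewrite sum_ffunE (bigD1 k) //= big1 => [|i ik].
    by rewrite !ffunE eqxx addr0 [_ *: _]mulr1.
  by rewrite !ffunE eq_sym (negPf ik) scaler0.
apply: (subsp_sum sP) => k _; apply: (subspZ sP).
(* Exponent 0 is set apart: the power sum meant for it would also catch exponent q-1. Its basis
   vector is [xr] itself. *)
have [->|k0] := eqVneq k (kbot r); first by rewrite -[dl _](sigma_S1 D xr); apply/Pxr/inK1.
have e0 : (0 < expo k)%N.
  rewrite lt0n; apply: contra k0 => /eqP ek; apply/eqP/expo_inj; rewrite ek.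
  by rewrite /expo big1 // => j _; rewrite ffunE mul0n.
pose b (k' : {dffun forall j : 'I_f, 'I_(r j).+1}) : C := \prod_j ('C(r j, k' j))%:R.
have b0 : b k != 0.
  apply/prodf_neq0 => j _; rewrite -(dvdn_pcharf pC) prime_ndvd_bin //.
  by rewrite -ltnS.
suff -> : dl k = - (b k)^-1 *: \sum_(i < q) rho (lam i) ^+ (q.-1 - expo k) *: sigma_S (l (lam i)) xr.
  apply: (subspZ sP); apply: (subsp_sum sP) => i _; apply: (subspZ sP).
  by apply/Pxr/inK_l/(lam_int D).
have q1 := q_gt1 D; have kq := expo_lt k.
apply/ffunP => k'; rewrite ffunE; have k'q := expo_lt k'.
transitivity (- (b k)^-1 * (b k' * \sum_(i < q) rho (lam i) ^+ (q.-1 - expo k + expo k'))); last first.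
  rewrite ffunE; congr (_ * _); rewrite sum_ffunE mulr_sumr; apply: eq_bigr => i _.
  by rewrite ffunE sigma_l_coef ?(lam_int D) // -/(b k') exprD [RHS]mulrA mulrC.
rewrite (sum_rho_pow D); have [->|nk] := eqVneq k' k.
  have -> : (q.-1 - expo k + expo k = q.-1)%N by move: kq; clear; lia.
  rewrite dvdnn -subn1 subn_gt0 q1 [b k * _]mulrN1 mulrNN mulVf //.
rewrite ifF ?mulr0 //; apply/negP => /andP[s0 /dvdnP[m em]].
case/eqP: nk; apply: expo_inj; move: em s0 kq k'q e0 q1; clear.
by case: m => [|[|m]]; nia.
Qed.

Lemma brS_K k v : inK k -> rep_act XS k (brS 1%g v) = brS 1%g (sigma_S k v).
Proof. by move=> kK; rewrite br_act mulg1 -{1}[k]mul1g br_H //; exact/KZ_SP. Qed.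

Lemma e0_gen x : gspan e0 x.
Proof.
apply: (brS_ind (D := D) (P := fun x => gspan e0 x)) x => [|s v]; first exact: gspan_subsp.
suff H : gspan e0 (brS 1%g v).
  by have := gspan_inv s H; rewrite br_act mulg1.
have [br1 br1E] := mk_linear (br_linear IS 1%g); rewrite -br1E.
apply: (xr_span (P := fun v => gspan e0 (br1 v))).
  split=> [|a y z Hy Hz]; first by rewrite linear0; exact: (gspan_subsp _).1.
  by rewrite linearP; exact: (gspan_subsp _).2.
by move=> k kK; rewrite br1E -brS_K //; exact: gspan_act.
Qed.

Lemma e0_I1chi : I1chi (fun a => rho a ^+ E) e0.
Proof.
split=> [|a ua]; first exact: e0_I1f.
have [br1 br1E] := mk_linear (br_linear IS 1%g).
rewrite /e0 brS_K ?inK_h // -!br1E -linearZ; congr (br1 _).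
apply: (ev_ext D) => X Y; rewrite (ev_sigma_S D) ?inK_h // linearZ /= !ev_xr.
by rewrite !hE ?unitO_neq0 // (rho0 iota) mul0r addr0 exprMn.
Qed.

(** The sum is invariant under integral unipotents, hence a multiple of [xr] by [V_unip]; the scalar
    is its value at (1, 0). *)
Lemma xr_sum : \sum_(i < q) sigma_S (u (lam i) * w)%g xr = (\sum_(i < q) rho (lam i) ^+ E) *: xr.
Proof.
have uwK i : inK (u (lam i) * w)%g by apply: inKM; [exact/inK_u/(lam_int D) | exact: inK_w].
have evE X Y : ev X Y (\sum_(i < q) sigma_S (u (lam i) * w)%g xr) =
    \sum_(i < q) (rho (- lam i) * X - Y) ^+ E.
  rewrite linear_sum; apply: eq_bigr => i _; apply: etrans (ev_sigma_S D _ _ _ _) _; first exact: uwK.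
  rewrite ev_xr !eM.
  rewrite !(mulr0, mul0r, mulr1, mul1r, addr0, add0r) mulrN1.
  by rewrite [rho (-1)](rhoN iota) ?(rho1 iota) ?mulN1r //; exact/unitO_vge/unitO1.
rewrite [LHS](V_unip D) => [|x X Y x0].
  rewrite evE; congr (_ *: _).
  rewrite -(@sum_lam_scale _ _ _ _ _ D C^o (fun x => rho x ^+ E) (-1)) ?unitON ?unitO1 //; last first.
    by move=> x y x0 y0 xy; rewrite (rho_congr D x0 y0 xy).
  by apply: eq_bigr => i _; rewrite mulr1 subr0 mulN1r.
rewrite !evE; pose Q x := (rho (- x) * X - Y) ^+ E : C^o.
have Qper : periodic Q.
  move=> a b a0 b0 ab; rewrite /Q (rho_congr D (x := - a) (y := - b)) ?vgeN //.
  by rewrite -opprD vgeN // vgeBC.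
rewrite -[RHS](sum_lam_shift D x0 Qper); apply: eq_bigr => i _; rewrite /Q.
rewrite [- (x + _)]opprD (rhoD iota) ?vgeN ?(lam_int D) // [rho (- x)](rhoN iota) //.
by congr (_ ^+ E); ring.
Qed.

Lemma S0_e0 : S0 D XS e0 = (\sum_(i < q) rho (lam i) ^+ E) *: e0.
Proof.
have [br1 br1E] := mk_linear (br_linear IS 1%g).
rewrite /e0 -!br1E -linearZ_LR -xr_sum linear_sum S0E; apply: eq_bigr => i _.
by rewrite !br1E brS_K //; apply: inKM; [exact/inK_u/(lam_int D) | exact: inK_w].
Qed.

End Generation.

Section Smooth.
Variables (F : completeValuedFieldType) (C : fieldType) (pi : rep C (SL2 F)).

Lemma near_Kn_l N n (g k : SL2 F) : bdd N g -> Kn n k -> near (n + N) (k * g)%g g.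
Proof.
move=> /and4P[? ? ? ?] /and4P[? ? ? ?]; apply/and4P; rewrite !eM; split.
- have -> : ea k * ea g + eb k * ec g - ea g = (ea k - 1) * ea g + eb k * ec g by ring.
  by apply: vgeD; apply: vgeM.
- have -> : ea k * eb g + eb k * ed g - eb g = (ea k - 1) * eb g + eb k * ed g by ring.
  by apply: vgeD; apply: vgeM.
- have -> : ec k * ea g + ed k * ec g - ec g = ec k * ea g + (ed k - 1) * ec g by ring.
  by apply: vgeD; apply: vgeM.
have -> : ec k * eb g + ed k * ed g - ed g = ec k * eb g + (ed k - 1) * ed g by ring.
by apply: vgeD; apply: vgeM.
Qed.

Lemma Kn_conj_ex (g : SL2 F) n : exists m, 1 <= m /\ forall k, Kn m k -> Kn n (g^-1 * k * g)%g.
Proof.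
have [N [gN N0]] := bdd_ex g.
exists (Num.max 1 (n - N - N)); split; first by rewrite le_max lexx.
move=> k kn; rewrite -mulgA; apply: Kn_le (near_KnV gN (near_sym (near_Kn_l gN kn))).
by clear; lia.
Qed.

Lemma smooth_gspan (e : pi) n : 1 <= n -> (forall k, Kn n k -> rep_act pi k e = e) ->
  (forall x, gspan e x) -> smooth pi.
Proof.
move=> n1 eK egen; apply/smoothP => x.
pose P x := exists2 n, 1 <= n & forall k, Kn n k -> rep_act pi k x = x.
apply: (gspan_min (P := P) _ _ _ (egen x)); last by exists n.
  split=> [|a y z [m m1 my] [m' m'1 mz]]; first by exists 1 => // k _; rewrite linear0.
  exists (Num.max m m') => [|k kn]; first by rewrite le_max m1.
  by rewrite linearP my ?mz //; apply: Kn_le kn; rewrite le_max lexx ?orbT.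
move=> g z [m m1 mz]; have [m' [m'1 conj]] := Kn_conj_ex g m.
exists m' => // k kn; rewrite -rep_actM -[(k * g)%g](mulVKg g) rep_actM mulgA mz //.
exact: conj.
Qed.

End Smooth.

Section Kernel.
Variables (p f : nat) (F : completeValuedFieldType) (C : closedFieldType).
Variables (iota : {rmorphism residue_field F -> C}) (D : resdata p f iota).
Variable r : 'I_f -> 'I_p.
Local Notation XS := (cInd_S iota r).
Local Notation e0 := (e0 D r).

Lemma XS_smooth : smooth XS.
Proof.
have H k : Kn 1 k -> rep_act XS k e0 = e0 by move=> kn; apply: (e0_I1f D r); exact: Kn_I1 kn.
exact: (smooth_gspan (n := 1) isT H (e0_gen D (r := r))).
Qed.

Lemma hom_peval (pi pi' : rep C (SL2 F)) (phi : rep_hom pi pi') P x :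
  phi (peval (At D pi) P x) = peval (At D pi') P (phi x).
Proof.
rewrite /peval linear_sum; apply: eq_bigr => i _; rewrite linearZ_LR; congr (_ *: _).
by elim: (i : nat) => //= n IHn; rewrite hom_At IHn.
Qed.

Lemma kernel_relation (pi : rep C (SL2 F)) (phi : rep_hom XS pi) x : x != 0 -> phi x = 0 ->
  exists P Q, [/\ ~~ ((P == 0) && (Q == 0)) &
    peval (At D pi) P (phi e0) + S1 D pi (peval (At D pi) Q (phi e0)) = 0].
Proof.
move=> x0 ex; have [y [ey y0 Iy]] := smooth_I1_fixed D XS_smooth (ker_subsp phi)
  (fun g z => @ker_inv _ _ _ _ phi g z) ex x0.
have [P [Q eyPQ]] := I1f_XS D Iy; exists P, Q; split.
  apply: contra y0 => /andP[/eqP P0 /eqP Q0].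
  by rewrite eyPQ P0 Q0 !peval0 linear0 addr0.
by rewrite -!hom_peval -hom_S1 -linearD -eyPQ.
Qed.

End Kernel.

(** * Weights in a smooth representation *)

Section FiniteSpan.
Variables (C : fieldType) (V : lmodType C).
Implicit Types (s : seq V) (W L : V -> Prop).

(** The length of the list serves as a bound for the dimension in the inductions below. *)
Fixpoint lspan s (x : V) : Prop :=
  if s is e :: s' then exists a : C, lspan s' (x - a *: e) else x = 0.

Lemma lspan_subsp s : subsp (lspan s).
Proof.
elim: s => [|e s IHs]; first by split=> // a x y -> ->; rewrite scaler0 addr0.
split=> [|a x y [b xb] [c yc]]; first by exists 0; rewrite scale0r subr0; exact: IHs.1.
exists (a * b + c); have -> : a *: x + y - (a * b + c) *: e = a *: (x - b *: e) + (y - c *: e).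
  by rewrite scalerBr scalerA scalerDl opprD addrACA.
exact: IHs.2.
Qed.

(** Either the tail already spans [W], or the coefficient of the head modulo the span of the tail is
    well defined and not identically zero on [W]. *)
Lemma functional_ex W s : subsp W -> (forall x, W x -> lspan s x) -> (exists2 x, W x & x != 0) ->
  exists2 l : V -> C^o, forall a x y, W x -> W y -> l (a *: x + y) = a *: l x + l y &
    exists2 x, W x & l x != 0.
Proof.
move=> sW; elim: s => [|e s IHs] Ws [x0 Wx0 nx0]; first by have := Ws _ Wx0; move: nx0 => /eqP.
have [|/existsNP[y /not_implyP[Wy ny]]] := pselect (forall x, W x -> lspan s x).
  by move=> H; apply: IHs => //; exists x0.
have sS := lspan_subsp s.
have ne : ~ lspan s e.
  move=> se; have [a ya] := Ws y Wy; apply: ny.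
  by rewrite -[y](subrK (a *: e)); apply: (subspD sS) => //; exact: (subspZ sS).
have uniq_c x a b : lspan s (x - a *: e) -> lspan s (x - b *: e) -> a = b.
  move=> ha hb; apply/eqP; rewrite eq_sym -subr_eq0; apply: contra_notT ne => ab.
  have -> : e = (b - a)^-1 *: ((x - a *: e) - (x - b *: e)).
    by rewrite opprB [X in _ *: X]addrC addrA subrK -scalerBl scalerA mulVf // scale1r.
  by apply: (subspZ sS); exact: (subspB sS).
have coef x : exists a : C^o, W x -> lspan s (x - a *: e).
  have [Wx|nW] := pselect (W x); first by have [a xa] := Ws x Wx; exists a.
  by exists 0.
have [l lP] := choice coef.
exists l => [a x z Wx Wz|]; last first.
  by exists y => //; apply/eqP => l0; apply: ny; have := lP y Wy; rewrite l0 scale0r subr0.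
apply: (uniq_c (a *: x + z)); first by apply: lP; exact: sW.2.
have -> : a *: x + z - (a *: l x + l z) *: e = a *: (x - l x *: e) + (z - l z *: e).
  by rewrite scalerBr scalerA scalerDl opprD addrACA.
by apply: sS.2; exact: lP.
Qed.

(** If [L] lies in the span of the tail, the head is dropped. Otherwise a vector [y] of [L] replaces
    the head as pivot, and induction applies to the parts of [W] and [L] inside the span of the
    tail. *)
Lemma span_proper W L s : subsp W -> subsp L -> (forall x, L x -> W x) ->
  (forall x, W x -> lspan s x) -> (exists2 x, W x & ~ L x) ->
  exists2 s', (size s' < size s)%N & forall x, L x -> lspan s' x.
Proof.
elim: s W L => [|e s IHs] W L sW sL LW Ws [x Wx nLx].
  by case: nLx; rewrite (Ws x Wx); exact: sL.1.
have [|/existsNP[y /not_implyP[Ly ny]]] := pselect (forall x, L x -> lspan s x).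
  by move=> H; exists s.
have sS := lspan_subsp s.
have [a ya] := Ws y (LW y Ly); have [b xb] := Ws x Wx.
have a0 : a != 0 by apply: contra_not_neq ny => a0; move: ya; rewrite a0 scale0r subr0.
have red z c : lspan s (z - c *: e) -> lspan s (z - (c / a) *: y).
  move=> zc; have -> : z - (c / a) *: y = (z - c *: e) - (c / a) *: (y - a *: e).
    by rewrite scalerBr scalerA divfK // opprB addrA subrK.
  by apply: (subspB sS) => //; exact: (subspZ sS).
have [|||||t tl Lt] := IHs (fun z => W z /\ lspan s z) (fun z => L z /\ lspan s z).
- split=> [|c z z' [Wz sz] [Wz' sz']]; first by split; [exact: sW.1 | exact: sS.1].
  by split; [exact: sW.2 | exact: sS.2].
- split=> [|c z z' [Wz sz] [Wz' sz']]; first by split; [exact: sL.1 | exact: sS.1].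
  by split; [exact: sL.2 | exact: sS.2].
- by move=> z [Lz sz]; split=> //; exact: LW.
- by move=> z [].
- exists (x - (b / a) *: y); last first.
    by move=> [Lxy _]; apply: nLx; rewrite -[x](subrK ((b / a) *: y)); apply: (subspD sL) => //; exact: (subspZ sL).
  by split; [apply: (subspB sW) => //; apply: (subspZ sW); exact: LW | exact: red].
exists (y :: t) => // z Lz; have [c zc] := Ws z (LW z Lz); exists (c / a); apply: Lt; split.
  by apply: (subspB sL) => //; exact: (subspZ sL).
exact: red.
Qed.

End FiniteSpan.

Section TorusEigen.
Variables (p f : nat) (F : completeValuedFieldType) (C : closedFieldType).
Variables (iota : {rmorphism residue_field F -> C}) (D : resdata p f iota).
Local Notation rho := (@rho F C iota).
Local Notation q := (p ^ f)%N.

(** The units act through a cyclic group of order q-1, and X^(q-1) - 1 splits over [C] with roots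
    the powers of [rho g], which gives the exponent s. *)
Lemma torus_eigen (V : lmodType C) (h : F -> {linear V -> V}) (Good : V -> Prop) x :
  subsp Good -> Good x -> x != 0 -> (forall a y, unitO a -> Good y -> Good (h a y)) ->
  (forall a b y, unitO a -> unitO b -> Good y -> h (a * b) y = h a (h b y)) ->
  (forall a y, vge 1 (a - 1) -> Good y -> h a y = y) ->
  exists y s, [/\ Good y, y != 0 & forall a, unitO a -> h a y = rho a ^+ s *: y].
Proof.
move=> sG Gx x0 Gh hMul h1; have [g ug gP] := exists_prim_unit D.
have unitX n : unitO (g ^+ n).
  by elim: n => [|n IHn]; rewrite ?expr0 ?exprS; [exact: unitO1 | exact: unitOM].
have h_iter n y : Good y -> iter n (h g) y = h (g ^+ n) y.
  move=> Gy; elim: n => [|n IHn]; first by rewrite expr0 h1 // subrr vge0.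
  by rewrite iterS IHn exprS hMul.
have rho1P a b : unitO a -> unitO b -> rho a = rho b -> vge 1 (a / b - 1).
  move=> ua ub e; have b0 := unitO_neq0 ub.
  have -> : a / b - 1 = b^-1 * (a - b) by fld.
  by rewrite vge_unitM ?unitOV // -(rho_eq D) ?unitO_vge // e.
have [|c [y [cs Gy y0 ey]]] := @exists_eigenvector C V (h g) Good sG (fun y => Gh g y ug)
    [seq rho g ^+ i | i <- index_iota 0 q.-1] x Gx x0.
  rewrite big_map factor_Xn_sub_1 // pevalB pevalXn (pevalC (h g) 1) scale1r h_iter // h1 ?subrr //.
  rewrite -[g ^+ _]divr1; apply: rho1P => //; first exact: unitO1.
  by rewrite (rhoX iota) ?unitO_vge // (prim_expr_order gP) (rho1 iota).
have /mapP[s _ ec] := cs; exists y, s; split=> // a ua.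
have [m em] : exists m, rho a = rho g ^+ m.
  have [m ->] := prim_rootP gP (rho_unit_order D ua); by exists m.
have um := unitX m; have m0 := unitO_neq0 um.
rewrite -[a in LHS](divfK m0) [_ / _ * _]mulrC hMul ?unitOM ?unitOV //.
have -> : h (a / g ^+ m) y = y.
  by apply: h1 => //; apply: rho1P; rewrite ?(rhoX iota) ?unitO_vge.
rewrite -h_iter //.
have -> n : iter n (h g) y = c ^+ n *: y.
  by elim: n => [|n IHn]; rewrite ?expr0 ?scale1r // iterS IHn linearZ_LR ey scalerA exprSr.
by rewrite ec em -!exprM mulnC.
Qed.

End TorusEigen.

Lemma linear_sum_scale (C : fieldType) (V V' : lmodType C) (L : {linear V -> V'}) (T : Type)
    (s : seq (C * T)) (a : T -> V) (b : T -> V') (P : pred T) :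
  (forall t, P t -> L (a t) = b t) -> all (fun x => P x.2) s ->
  L (\sum_(x <- s) x.1 *: a x.2) = \sum_(x <- s) x.1 *: b x.2.
Proof.
move=> ab; elim: s => [|x s IHs] /=; first by rewrite !big_nil linear0.
by move=> /andP[/ab ax /IHs IH]; rewrite !big_cons linearD linearZ ax IH.
Qed.

Section Frob.
Variables (p f : nat) (F : completeValuedFieldType) (C : closedFieldType).
Variables (iota : {rmorphism residue_field F -> C}) (D : resdata p f iota).
Variable r : 'I_f -> 'I_p.
Local Notation sigma_S := (sigma_S iota r).
Local Notation xr := (xr C r).
Local Notation XS := (cInd_S iota r).
Local Notation e0 := (e0 D r).

(** As [xr] generates the weight under K, a K-map out of it amounts to an image [z] of [xr] that
    satisfies all linear relations between the K-translates of [xr]. *)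
Lemma frobenius_xr (pi : rep C (SL2 F)) (z : pi) :
  (forall s : seq (C * SL2 F), all (fun x => inK x.2) s ->
     \sum_(x <- s) x.1 *: sigma_S x.2 xr = 0 -> \sum_(x <- s) x.1 *: rep_act pi x.2 z = 0) ->
  exists phi : rep_hom XS pi, phi e0 = z.
Proof.
move=> H; pose Gam (y : weight C r) (x : pi) := exists2 s : seq (C * SL2 F), all (fun x => inK x.2) s &
  y = \sum_(x <- s) x.1 *: sigma_S x.2 xr /\ x = \sum_(x <- s) x.1 *: rep_act pi x.2 z.
have G0 : Gam 0 0 by exists [::]; rewrite ?big_nil.
have Glin a y y' x x' : Gam y x -> Gam y' x' -> Gam (a *: y + y') (a *: x + x').
  move=> [s sK [-> ->]] [s' s'K [-> ->]]; exists ([seq (a * x.1, x.2) | x <- s] ++ s').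
    by rewrite all_cat all_map s'K andbT.
  rewrite !big_cat !big_map !scaler_sumr; split; congr (_ + _); apply: eq_bigr => c _; exact: scalerA.
have Guniq y x x' : Gam y x -> Gam y x' -> x = x'.
  move=> Gx Gx'; apply/eqP; rewrite -subr_eq0 -[x]scale1r addrC -scaleN1r scale1r.
  have [s sK [es ->]] := Glin (-1) y y _ _ Gx' Gx.
  by apply/eqP/H; rewrite // -es scaleN1r addNr.
have Gex y : exists x, Gam y x.
  apply: (xr_span D (P := fun y => exists x, Gam y x)) y => [|k kK].
    by split=> [|a y y' [x Gx] [x' Gx']]; [exists 0 | exists (a *: x + x'); exact: Glin].
  by exists (rep_act pi k z), [:: (1, k)]; rewrite /= ?kK // !big_seq1 !scale1r.
have [Psi PsiG] := choice Gex.
have [Psi' PsiE] : exists Psi' : {linear weight C r -> pi}, forall y, Psi' y = Psi y.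
  by apply: mk_linear => a y y'; apply: (Guniq (a *: y + y')) => //; exact: Glin.
have [|phi phiP] := @frobenius _ _ _ _ _ (SL2_inducible D r) pi Psi'.
  move=> k v /KZ_SP kK; rewrite !PsiE; apply: (Guniq (sigma_S k v)) => //.
  have [s sK [ev ex]] := PsiG v; exists [seq (x.1, (k * x.2)%g) | x <- s].
    by rewrite all_map; apply: sub_all sK => x /= xK; exact: inKM.
  rewrite !big_map {1}ev {1}ex; split.
    apply: (linear_sum_scale (L := sigma_S k) (a := fun g => sigma_S g xr)
      (b := fun g => sigma_S (k * g)%g xr) _ sK) => g gK.
    exact: (esym (sigma_SM D xr kK gK)).
  apply: (linear_sum_scale (L := rep_act pi k) (a := fun g => rep_act pi g z)
    (b := fun g => rep_act pi (k * g)%g z) _ sK) => g gK.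
  by rewrite rep_actM.
exists phi; rewrite /e0 phiP rep_act1 PsiE; apply: (Guniq xr) => //.
exists [:: (1, 1%g)]; rewrite /= ?inK1 // !big_seq1 !scale1r rep_act1; split=> //.
by rewrite sigma_S1.
Qed.

End Frob.

(** * K-stable subspaces and their matrix coefficients *)

Section WeightStep.
Variables (p f : nat) (F : completeValuedFieldType) (C : closedFieldType).
Variables (iota : {rmorphism residue_field F -> C}) (D : resdata p f iota).
Local Notation om := (uniformizer : F).
Local Notation rho := (@rho F C iota).
Local Notation q := (p ^ f)%N.
Local Notation lam := (lam D).
Variables (pi : rep C (SL2 F)).
Implicit Types (g h k : SL2 F) (W : pi -> Prop) (x y v : pi).

Lemma I1_conj_h (a : F) (i : SL2 F) : unitO a -> I1 i -> I1 ((hh a)^-1 * i * hh a)%g.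
Proof.
move=> ua iI; have a0 := unitO_neq0 ua; have aV := unitO_vgeV ua; have av := unitO_vge ua.
move: iI => /and4P[a1 b c d1]; apply/and4P; rewrite !(eM, hE) //.
rewrite !(mulr0, mul0r, oppr0, addr0, add0r); split.
- by have -> : a^-1 * ea i * a - 1 = ea i - 1 by fld.
- by do !apply: vgeMr => //; exact: vgeMl.
- by apply: vgeMr => //; exact: vgeMl.
by have -> : a * ed i * a^-1 - 1 = ed i - 1 by fld.
Qed.

Definition Kstable W := subsp W /\ forall k x, inK k -> W x -> W (rep_act pi k x).

Lemma I1_eigen W x : Kstable W -> (forall k y, Kn 1 k -> W y -> rep_act pi k y = y) ->
  W x -> x != 0 -> exists v s, [/\ W v, v != 0 & I1chi (fun a => rho a ^+ s) v].
Proof.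
move=> [sW invW] fixW Wx x0.
have [y [Wy y0 Iy]] := exists_I1_fixed D sW invW (lexx 1) Wx x0 (fun k kn => fixW k x kn Wx).
have [||||v [s [[Wv Iv] v0 cv]]] := @torus_eigen _ _ _ _ _ D pi (fun a => rep_act pi (hh a))
    (fun y => W y /\ I1f y) y _ (conj Wy Iy) y0.
- split=> [|a z z' [Wz Iz] [Wz' Iz']]; first by split; [exact: sW.1 | move=> g _; rewrite linear0].
  by split=> [|g gI]; [exact: sW.2 | rewrite linearP Iz ?Iz'].
- move=> a z ua [Wz Iz]; split=> [|i iI]; first by apply: invW => //; exact: inK_h.
  by rewrite -rep_actM -[(i * hh a)%g](mulVKg (hh a)) rep_actM mulgA Iz //; exact: I1_conj_h.
- by move=> a b z ua ub _; rewrite hM ?unitO_neq0 // rep_actM.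
- by move=> a z a1 [_ Iz]; apply/Iz/I1_h.
by exists v, s.
Qed.

(** The dual counterpart of an I1-eigenvector: integral unipotents act on functionals as commuting
    operators with p-th power 1, and the torus is then diagonalized on their common fixed space. *)
Lemma iwahori_functional W s : Kstable W -> (forall k y, Kn 1 k -> W y -> rep_act pi k y = y) ->
  (forall x, W x -> lspan s x) -> (exists2 x, W x & x != 0) ->
  exists (l : pi -> C^o) t, [/\ forall a x y, W x -> W y -> l (a *: x + y) = a *: l x + l y,
    exists2 x, W x & l x != 0, forall z x, vge 0 z -> W x -> l (rep_act pi (u z) x) = l x &
    forall a x, unitO a -> W x -> l (rep_act pi (hh a) x) = rho a ^+ t * l x].
Proof.
move=> [sW invW] fixW Ws Wne; have [l0 l0L [x0 Wx0 l0x0]] := functional_ex sW Ws Wne.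
pose Fn : lmodType C := pi -> C^o.
have [P PE] : exists P : SL2 F -> {linear Fn -> Fn}, forall g (l : Fn) x, P g l x = l (rep_act pi g x).
  have H g : exists P : {linear Fn -> Fn}, forall (l : Fn) x, P l x = l (rep_act pi g x).
    have [|P PE] := @mk_linear C Fn Fn (fun l x => l (rep_act pi g x)); first by move=> a l l'.
    by exists P => l x; rewrite PE.
  by have [P PE] := choice H; exists P.
(* Functionals are 0 outside [W], so that equality on [W] becomes equality of functions. *)
pose lin (l : Fn) := (forall a x y, W x -> W y -> l (a *: x + y) = a *: l x + l y) /\
  forall x, ~ W x -> l x = 0.
have slin : subsp lin.
  split; first by split=> [a x y _ _|//]; rewrite scaler0 addr0.
  move=> c l l' [lL l0'] [l'L l'0]; split=> [a x y Wx Wy|x nx]; last first.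
    by rewrite /= !fctE l0' // l'0 // scaler0 addr0.
  rewrite /= !fctE lL // l'L // !scalerDr !scalerA [c * a]mulrC -!addrA; congr (_ + _).
  by rewrite addrCA.
have WV k x : inK k -> W (rep_act pi k x) -> W x.
  by move=> kK /(invW k^-1%g _ (inKV kK)); rewrite rep_actK.
have Plin k l : inK k -> lin l -> lin (P k l).
  move=> kK [lL l0']; split=> [a x y Wx Wy|x nx]; first by rewrite !PE linearP lL //; exact: invW.
  by rewrite PE l0' // => /(WV k _ kK).
have Pext k l : inK k -> lin l -> (forall x, W x -> l (rep_act pi k x) = l x) -> P k l = l.
  move=> kK [lL l0'] H; apply/funext => x; rewrite PE; have [Wx|nW] := pselect (W x); first exact: H.
  by rewrite !l0' // => /(WV k _ kK).
have piter z n (l : Fn) x : iter n (P (u z)) l x = l (rep_act pi (u (z *+ n)) x).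
  elim: n x => [|n IHn] x; first by rewrite mulr0n u0 rep_act1.
  by rewrite iterS PE IHn -rep_actM -uD mulrSr.
pose l1 : Fn := fun x => if `[< W x >] then l0 x else 0.
have l1lin : lin l1.
  split=> [a x y Wx Wy|x nx]; last by rewrite /l1 ifF //; exact/asboolP.
  by rewrite /l1 !ifT ?l0L //; apply/asboolP => //; exact: sW.2.
have l1n : l1 != 0.
  apply: contraNneq l0x0 => e; have := congr1 (fun l : Fn => l x0) e; rewrite /l1.
  by case: asboolP => // _ ->.
have uK (z : F) : vge 0 z -> inK (u z) := @inK_u _ z.
have [||l2 [l2lin l2n l2u]] := @commuting_unipotents_fixed C Fn p [seq P (u (lam i)) | i <- enum 'I_q]
    lin l1 (rd_pchar D) slin l1lin l1n.
- move=> i L Hi l ll; have [j _ ->] := nth_error_map_mem Hi; split.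
    by apply: Plin => //; exact/uK/(lam_int D).
  apply/funext => x; rewrite piter; have [Wx|nW] := pselect (W x).
    rewrite fixW //; apply/and4P; rewrite !uE subrr !vge0; split=> //.
    by rewrite -mulr_natr mulrC; apply: vgeMr; [exact: vge1_p D | exact: lam_int].
  have uKp : inK (u (lam j *+ p)).
    by apply: uK; rewrite -mulr_natr; apply: vgeMr; [exact: lam_int | exact: vge_nat].
  by rewrite !ll.2 // => /(WV _ x uKp).
- move=> i j L M Hi Hj l _; have [i' _ ->] := nth_error_map_mem Hi.
  have [j' _ ->] := nth_error_map_mem Hj; apply/funext => x.
  by rewrite !PE -!rep_actM -!uD addrC.
have l2U z x : vge 0 z -> W x -> l2 (rep_act pi (u z) x) = l2 x.
  move=> z0 Wx; have [i zi] := lam_cov D z0.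
  have [n en] := nth_error_map (fun i => P (u (lam i))) (mem_enum 'I_q i : i \in enum 'I_q).
  have := congr1 (fun l : Fn => l x) (l2u _ _ en); rewrite PE => <-.
  rewrite -{1}[z](subrK (lam i)) addrC uD rep_actM; congr (l2 (rep_act pi _ _)).
  by apply: fixW => //; apply/and4P; rewrite !uE subrr !vge0.
pose Good l := lin l /\ forall z x, vge 0 z -> W x -> l (rep_act pi (u z) x) = l x.
have [||||l [t [[ll lu] ln lt]]] := @torus_eigen _ _ _ _ _ D Fn (fun a => P (hh a)) Good l2 _ (conj l2lin l2U) l2n.
- split=> [|a m m' [ml mU] [m'l m'U]]; first by split; [exact: slin.1 | ].
  split=> [|z x z0 Wx]; first exact: slin.2.
  by rewrite /= !fctE mU // m'U.
- move=> a m ua [ml mU]; split=> [|z x z0 Wx]; first by apply: Plin => //; exact: inK_h.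
  rewrite !PE -rep_actM h_u ?unitO_neq0 // rep_actM mU //; last exact/invW/Wx/inK_h.
  by apply: vgeMl => //; exact/vgeX/unitO_vge.
- move=> a b m ua ub _; apply/funext => x.
  by rewrite !PE -rep_actM mulrC hM ?unitO_neq0.
- move=> a m a1 [ml mU]; apply: Pext => //; first exact/I1_inK/I1_h.
  move=> x Wx; rewrite fixW //; have ua := unitO_1D a1; have a0 := unitO_neq0 ua.
  apply/and4P; rewrite !hE // a1 !vge0; split=> //.
  have -> : a^-1 - 1 = a^-1 * (1 - a) by fld.
  by apply: vgeMl; [exact: unitO_vgeV | rewrite vgeBC].
exists l, t; split=> //; first exact: ll.1.
  apply: contrapT => H; case/eqP: ln; apply/funext => x.
  have [Wx|nW] := pselect (W x); last exact: ll.2.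
  by apply: contrapT => lx; apply: H; exists x => //; exact/eqP.
by move=> a x ua Wx; have := congr1 (fun l : Fn => l x) (lt a ua); rewrite PE.
Qed.

Definition has_weight_hom := exists (r : 'I_f -> 'I_p) (phi : rep_hom (cInd_S iota r) pi),
  total r <> 0%N /\ phi (e0 D r) != 0.

Definition has_K_fixed := exists2 v, v != 0 & forall k, inK k -> rep_act pi k v = v.

Section Embedding.
Variables (W : pi -> Prop) (SW : Kstable W) (l : pi -> C^o) (t : nat).
Hypothesis l_lin : forall a x y, W x -> W y -> l (a *: x + y) = a *: l x + l y.
Hypothesis l_u : forall z x, vge 0 z -> W x -> l (rep_act pi (u z) x) = l x.
Hypothesis l_h : forall a x, unitO a -> W x -> l (rep_act pi (hh a) x) = rho a ^+ t * l x.
Hypothesis l_faithful : forall x, W x -> (forall k, inK k -> l (rep_act pi k x) = 0) -> x = 0.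
Variables (v : pi) (s : nat).
Hypotheses (Wv : W v) (v0 : v != 0) (Iv : I1chi (fun a => rho a ^+ s) v).

Lemma l_zero : l 0 = 0.
Proof.
have := l_lin (-1) SW.1.1 SW.1.1; rewrite scaler0 addr0 => /eqP.
by rewrite scaleN1r addNr => /eqP.
Qed.

Lemma l_sum (J : Type) (js : seq J) (Q : pred J) (G : J -> pi) :
  (forall i, Q i -> W (G i)) -> l (\sum_(i <- js | Q i) G i) = \sum_(i <- js | Q i) l (G i).
Proof.
move=> WG; elim: js => [|i js IHjs]; first by rewrite !big_nil l_zero.
rewrite !big_cons; case: ifP => // Qi; rewrite -[G i]scale1r l_lin ?scale1r ?IHjs //; first exact: WG.
by apply: (subsp_sum SW.1) => j; exact: WG.
Qed.

Lemma l_combination (z : seq (C * SL2 F)) k : inK k -> all (fun c => inK c.2) z ->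
  W (\sum_(c <- z) c.1 *: rep_act pi c.2 v) /\
  l (rep_act pi k (\sum_(c <- z) c.1 *: rep_act pi c.2 v)) =
    \sum_(c <- z) c.1 *: l (rep_act pi (k * c.2)%g v).
Proof.
have [sW iW] := SW; move=> kK; elim: z => [|c z IHz] /=.
  by rewrite !big_nil linear0 l_zero; split=> //; exact: sW.1.
move=> /andP[cK /IHz[Wz ez]]; rewrite !big_cons; split.
  by apply: sW.2 => //; exact: iW.
by rewrite linearP l_lin ?ez ?rep_actM //; apply: (iW) => //; exact: iW.
Qed.

(** Off the big cell k multiplies [v] by a scalar, and l v = 0. On the big cell only the torus part
    matters, because [v] and [l] absorb the unipotent factors. *)
Lemma l_orbit k : l v = 0 -> inK k ->
  l (rep_act pi k v) = if unitO (ec k) then rho (- (ec k)^-1) ^+ t * l (rep_act pi w v) else 0.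
Proof.
move=> lv kK; have /and4P[ka kb kc kd] := kK; have wK := inK_w F; have [_ iW] := SW.
have Ww : W (rep_act pi w v) by exact: iW.
case: ifP => uc; last first.
  have c1 : vge 1 (ec k) by have [] := unitO_or kc; rewrite ?uc.
  rewrite (Iwahori_V0 Iv) // -[_ *: _]addr0 l_lin //; last exact: SW.1.1.
  by rewrite l_zero lv scaler0 addr0.
have c0 := unitO_neq0 uc; have cV := unitO_vgeV uc.
have uh : unitO (- (ec k)^-1) by exact/unitON/unitOV.
rewrite {1}(bruhat_uwu c0) !rep_actM [rep_act pi (u (ed k / _)) v]Iv.1; last by apply/I1_u/vgeMl.
by rewrite l_u ?l_h //; [exact: vgeMl | apply: iW => //; exact: inK_h].
Qed.

(** For k and g in K, l(k g v) is a constant times the value of sigma(g) xr at the bottom row of k.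
    A relation between translates of [xr] is therefore killed by all l(k .) when written for [v],
    and [l_faithful] concludes. *)
Lemma weight_hom_of_functional : l v = 0 -> has_weight_hom.
Proof.
(* e is congruent to -t modulo q-1 and lies between 1 and q-1. Being positive, it makes rho(c)^e
   vanish off the big cell as well, and the weight is not the trivial one. *)
move=> lv; pose e := (q.-1 - t %% q.-1)%N.
have q1 := q_gt1 D; have q0 : (0 < q.-1)%N by rewrite -subn1 subn_gt0.
have tq : (t %% q.-1 < q.-1)%N by rewrite ltn_mod.
have e_gt0 : (0 < e)%N by rewrite /e subn_gt0.
have [r rE] : exists r : 'I_f -> 'I_p, total r = e.
  by apply: digit_sum_ex; rewrite /e; move: tq q1; clear; lia.
have [_ iW] := SW; have [sW _] := SW.
pose K0 := rho (-1) ^+ t * l (rep_act pi w v).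
have rhoc c : unitO c -> rho (- c^-1) ^+ t = rho (-1) ^+ t * rho c ^+ e.
  move=> uc; have r0 := rho_neq0 D uc; have cV := unitOV uc.
  have -> : - c^-1 = -1 * c^-1 by rewrite mulN1r.
  rewrite (rhoM iota) ?unitO_vge ?unitON ?unitO1 // exprMn; congr (_ * _).
  rewrite (rhoV D) // exprVn; apply: (mulfI (expf_neq0 t r0)); rewrite mulfV ?expf_neq0 //.
  rewrite -exprD {1}(divn_eq t q.-1) /e -addnA subnKC 1?ltnW // -mulSnr mulnC exprM.
  by rewrite (rho_unit_order D uc) expr1n.
have lk k : inK k -> l (rep_act pi k v) = K0 * rho (ec k) ^+ e.
  move=> kK; rewrite l_orbit //; case: ifP => uc.
    by rewrite rhoc // /K0 mulrAC.
  have /and4P[_ _ kc _] := kK; have c1 : vge 1 (ec k) by have [] := unitO_or kc; rewrite ?uc.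
  by rewrite (rho_small D c1) expr0n gtn_eqF // mulr0.
have [|phi phiP] := @frobenius_xr _ _ _ _ _ D r pi v.
  move=> z zK ez; apply: l_faithful; first exact: (l_combination (inK1 F) zK).1.
  move=> k kK; rewrite (l_combination kK zK).2.
  transitivity (K0 * ev (rho (ec k)) (rho (ed k)) (\sum_(x <- z) x.1 *: sigma_S iota r x.2 (xr C r))); last first.
    by rewrite ez linear0 mulr0.
  rewrite (linear_sum_scale (L := ev (rho (ec k)) (rho (ed k))) (a := fun g => sigma_S iota r g (xr C r))
    (b := fun g => (rho (ea g) * rho (ec k) + rho (ec g) * rho (ed k)) ^+ e : C^o) _ zK).
    rewrite mulr_sumr big_seq [RHS]big_seq; apply: eq_bigr => x xz.
    have xK : inK x.2 by move/allP: zK => /(_ x xz).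
    rewrite (lk _ (inKM kK xK)) mulrCA; congr (_ * (K0 * _)).
    move: kK xK => /and4P[? ? ? ?] /and4P[? ? ? ?].
    rewrite eM (rhoD iota) ?(rhoM iota) //; do ?exact: vgeMl.
    by congr (_ ^+ e); rewrite [rho (ec k) * _]mulrC [rho (ed k) * _]mulrC.
  move=> g gK; apply: etrans (ev_sigma_S D _ _ _ gK) _.
  by rewrite ev_xr rE.
exists r, phi; rewrite phiP rE; split=> //.
by apply/eqP; rewrite -lt0n.
Qed.

End Embedding.

(** N is the part of [W] that no K-translate of [l] detects; if nonzero, it is a smaller stable
    subspace. Otherwise an eigenvector [v] with l v = 0 gives a weight; if l v <> 0, S0 v does when
    nonzero, as l(S0 v) consists of q equal terms. There remains S0 v = 0, which makes [v] fixed by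
    K. *)
Lemma weight_step W s : Kstable W -> (forall k y, Kn 1 k -> W y -> rep_act pi k y = y) ->
  (forall x, W x -> lspan s x) -> (exists2 x, W x & x != 0) ->
  [\/ has_weight_hom, has_K_fixed | exists (W' : pi -> Prop) s', [/\ Kstable W', (size s' < size s)%N,
     forall x, W' x -> W x, forall x, W' x -> lspan s' x & exists2 x, W' x & x != 0]].
Proof.
move=> SW fixW Ws Wne; have [sW iW] := SW.
have [l [t [l_lin [x0 Wx0 lx0] l_u l_h]]] := iwahori_functional SW fixW Ws Wne.
pose N x := W x /\ forall k, inK k -> l (rep_act pi k x) = 0.
have l0 := l_zero SW l_lin.
have sN : subsp N.
  split=> [|a x y [Wx lx] [Wy ly]].
    by split; [exact: sW.1 | move=> k _; rewrite linear0].
  split=> [|k kK]; first exact: sW.2.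
  by rewrite linearP l_lin ?lx ?ly ?scaler0 ?addr0 //; exact: iW.
have [[x [Nx nx0]]|nN] := pselect (exists x, N x /\ x != 0).
  apply: Or33; have [|s' ss' Ns'] := span_proper sW sN (fun x Nx => Nx.1) Ws.
    by exists x0 => // -[_ /(_ 1%g (inK1 F))]; rewrite rep_act1; exact/eqP.
  exists N, s'; split=> //; [split=> // | by move=> y [] | by exists x].
  move=> k y kK [Wy ly]; split; first exact: iW.
  by move=> k' k'K; rewrite -rep_actM; apply: ly; exact: inKM.
have faith x : W x -> (forall k, inK k -> l (rep_act pi k x) = 0) -> x = 0.
  by move=> Wx lx; apply: contrapT => /eqP x1; apply: nN; exists x.
have [x Wx nx0] := Wne; have [v [n [Wv v0 Iv]]] := I1_eigen SW fixW Wx nx0.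
have [lv|lv] := eqVneq (l v) 0.
  by apply: Or31; exact: (weight_hom_of_functional SW l_lin l_u l_h faith Wv v0 Iv lv).
have wK := inK_w F; have Ww : W (rep_act pi w v) by exact: iW.
have uwK i : inK (u (lam i) * w)%g by apply: inKM wK; exact/inK_u/lam_int.
have [S0v|S0v] := eqVneq (S0 D pi v) 0; last first.
  have WS : W (S0 D pi v) by rewrite S0E; apply: (subsp_sum sW) => i _; exact: iW.
  have [m IS] : exists m, I1chi (fun a => rho a ^+ m) (S0 D pi v).
    exists (n * q.-1 - n)%N; apply: I1chi_ext (S0_I1chi D Iv) => a ua.
    have r0 := rho_neq0 D ua; rewrite (rhoV D) // exprVn.
    apply: (mulfI (expf_neq0 n r0)); rewrite mulfV ?expf_neq0 // -exprD subnKC.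
      by rewrite mulnC exprM (rho_unit_order D ua) expr1n.
    by rewrite leq_pmulr // -subn1 subn_gt0 (q_gt1 D).
  apply: Or31; apply: (weight_hom_of_functional SW l_lin l_u l_h faith WS S0v IS).
  transitivity (\sum_(i < q) l (rep_act pi w v)); last exact: (sum_lam_const D (l (rep_act pi w v))).
  rewrite S0E (l_sum SW l_lin) => [|i _]; last exact: iW.
  by apply: eq_bigr => i _; rewrite rep_actM l_u // lam_int.
apply: Or32; exists v => //; suff I1v : I1chi (fun=> 1) v by exact: K_fixed I1v S0v.
apply: (I1chi_ext _ Iv) => a ua.
(* Applying [l] to w (S0 v) = 0 shows that the character of [v] is trivial: if q-1 did not divide n,
   the power sum would vanish and leave l v = 0. *)
have : rho (-1) ^+ n * l v + (\sum_(i < q | i != lam_zero D) rho (- lam i) ^+ n) * l (rep_act pi w v) = 0.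
  have e := congr1 (fun y => l (rep_act pi w y)) S0v; rewrite linear0 l0 in e; rewrite -[RHS]e.
  rewrite S0E linear_sum (l_sum SW l_lin) => [|i _]; last by apply: SW.2 => //; exact: SW.2.
  rewrite [in RHS](bigD1 (lam_zero D)) //= lam0 u0 mul1g -rep_actM ww.
  have uN1 := unitON (unitO1 F); rewrite Iv.2 // -[_ *: v]addr0 l_lin //;
    last exact: SW.1.1.
  rewrite l0 addr0; congr (_ + _); rewrite mulr_suml; apply: eq_bigr => i ii0.
  have ui := unit_lam ii0; rewrite -rep_actM mulgA (wuw_v Iv.1 Iv.2 ui) -[_ *: _]addr0.
  rewrite l_lin //; [|by apply: SW.2 => //; apply: inKM wK; apply/inK_u/vgeN/unitO_vgeV | exact: SW.1.1].
  by rewrite l0 addr0 rep_actM l_u //; exact/vgeN/unitO_vgeV.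
have [/dvdnP[m ->] _|nd] := boolP (q.-1 %| n)%N.
  by rewrite mulnC exprM (rho_unit_order D ua) expr1n.
have n0 : (0 < n)%N by rewrite lt0n; apply: contraNneq nd => ->.
have -> : \sum_(i < q | i != lam_zero D) rho (- lam i) ^+ n = 0.
  transitivity (rho (-1) ^+ n * \sum_(i < q) rho (lam i) ^+ n).
    rewrite [in RHS](bigD1 (lam_zero D)) //= lam0 (rho0 iota) expr0n gtn_eqF // add0r mulr_sumr.
    by apply: eq_bigr => i _; rewrite -exprMn -(rhoM iota) ?mulN1r ?lam_int // unitO_vge // unitON // unitO1.
  by rewrite (sum_rho_pow D) (negPf nd) andbF mulr0.
rewrite mul0r addr0 => /eqP; rewrite mulf_eq0 (negPf lv) orbF expf_eq0 n0 /= => /eqP r0.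
by have := rho_neq0 D (unitON (unitO1 F)); rewrite r0 eqxx.
Qed.

(** W is the K-span of a vector fixed by [Kn 1]. It is finitely spanned because finitely many
    elements of K approximate all of K at level 1, so [weight_step] can shrink it only finitely
    often. *)
Lemma weight_hom_or_K_fixed : smooth pi -> (exists x : pi, x != 0) -> has_weight_hom \/ has_K_fixed.
Proof.
move=> sm [x x0].
have [y [_ y0 Hy]] := smooth_K1_fixed D (W := fun=> True) sm (conj I (fun _ _ _ _ _ => I)) (fun _ _ _ => I) I x0.
have [t [tK tP]] := @SL2_net _ _ _ _ _ D 0 1 (fun g : SL2 F => inK g) (fun g gK => gK).
pose W z := exists2 s : seq (C * SL2 F), all (fun c => inK c.2) s &
  z = \sum_(c <- s) c.1 *: rep_act pi c.2 y.
have sW : subsp W.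
  split=> [|a z z' [s sK ->] [s' s'K ->]]; first by exists [::]; rewrite ?big_nil.
  exists ([seq (a * c.1, c.2) | c <- s] ++ s'); first by rewrite all_cat all_map sK.
  rewrite big_cat big_map scaler_sumr; congr (_ + _); apply: eq_bigr => c _; exact: scalerA.
have SW : Kstable W.
  split=> // k z kK [s sK ->]; exists [seq (c.1, (k * c.2)%g) | c <- s].
    by rewrite all_map; apply: sub_all sK => c /= cK; exact: inKM.
  rewrite big_map linear_sum; apply: eq_bigr => c _; rewrite linearZ_LR rep_actM //.
have Wy : W y by exists [:: (1, 1%g)]; rewrite /= ?inK1 // big_seq1 scale1r rep_act1.
have fixW k z : Kn 1 k -> W z -> rep_act pi k z = z.
  move=> k1 [s sK ->]; rewrite linear_sum big_seq [RHS]big_seq; apply: eq_bigr => c cs.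
  have cK : inK c.2 by move/allP: sK => /(_ c cs).
  rewrite linearZ_LR -rep_actM -[(k * _)%g](mulVKg c.2) rep_actM Hy // mulgA.
  by apply: Kn_conj.
have Wt z : W z -> lspan [seq rep_act pi g y | g <- t] z.
  have sS := lspan_subsp [seq rep_act pi g y | g <- t].
  have mem g : g \in t -> lspan [seq rep_act pi g y | g <- t] (rep_act pi g y).
    elim: (t) => //= h t' IHt; rewrite inE => /orP[/eqP ->|gt].
      by exists 1; rewrite scale1r subrr; exact: (lspan_subsp _).1.
    by exists 0; rewrite scale0r subr0; exact: IHt.
  move=> [s sK ->]; rewrite big_seq; apply: (subsp_sum sS) => c cs; apply: (subspZ sS).
  have cK : inK c.2 by move/allP: sK => /(_ c cs).
  have [h ht ch] := tP _ cK; rewrite -[c.2](mulVKg h) rep_actM Hy; first exact: mem.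
  by have := near_KnV (tK _ ht) (near_sym ch); rewrite add0r.
have [n] := ubnP (size [seq rep_act pi g y | g <- t]).
have Wne : exists2 z, W z & z != 0 by exists y.
move: (map _ t) Wt => s; elim: n s W SW fixW Wne {sW Wy} => // n IHn s W SW fixW Wne Ws sn.
have [hw|hk|[W' [s' [SW' ss W'W W's W'ne]]]] := weight_step SW fixW Ws Wne; [by left|by right|].
apply: (IHn s' W') => // [k z k1 /W'W|]; first exact: fixW.
exact: leq_trans ss sn.
Qed.

End WeightStep.

(** * Classification *)

Lemma quot_factor (C : fieldType) (G : groupType) (pi sg : rep C G) (W : subrep pi)
    (phi : rep_hom pi sg) : (forall x, x \in W -> phi x = 0) ->
  exists psi : rep_hom (quot_rep W) sg, forall x, psi (qhom W x) = phi x.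
Proof.
move=> phiW; have [psi psiP] : exists psi : rep_hom (quot_rep W) sg,
    forall y z, (exists2 x, qhom W x = y & phi x = z) -> psi y = z.
  apply: graph_hom.
  - by exists 0; rewrite linear0.
  - by move=> a _ _ _ _ [x <- <-] [y <- <-]; exists (a *: x + y); rewrite linearP.
  - by move=> g _ _ [x <- <-]; exists (rep_act pi g x); rewrite rep_homJ.
  - by move=> _ [x /qhom_eq0/phiW e <-].
  - by move=> y; have [x <-] := qhom_surj y; exists (phi x), x.
by exists psi => x; apply: psiP; exists x.
Qed.

Lemma trivial_of_fixed (C : closedFieldType) (G : groupType) (pi : rep C G) (v : pi) :
  irreducible pi -> v != 0 -> (forall g, rep_act pi g v = v) -> rep_iso pi (trivial_rep C G).
Proof.
move=> irr v0 fv; apply: rep_iso_sym.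
have [h hE] := @mk_linear C (trivial_rep C G) pi (fun a : C => a *: v)
  (fun a x y => etrans (scalerDl _ _ _) (congr1 (fun z => z + y *: v) (esym (scalerA _ _ _)))).
have hJ g x : h (rep_act (trivial_rep C G) g x) = rep_act pi g (h x).
  by rewrite !hE linearZ fv.
apply: (@bij_iso _ _ _ _ (RepHom hJ)) => [x y /=|].
  rewrite !hE => /eqP; rewrite -subr_eq0 -scalerBl scaler_eq0 (negPf v0) orbF subr_eq0.
  by move/eqP.
pose one : trivial_rep C G := (1 : C^o).
apply: (irreducible_hom_surj (x := one) irr).
by rewrite /= hE scale1r.
Qed.

Section Classification.
Variables (p f : nat) (F : completeValuedFieldType) (C : closedFieldType).
Variables (iota : {rmorphism residue_field F -> C}) (D : resdata p f iota).
Local Notation om := (uniformizer : F).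
Local Notation rho := (@rho F C iota).
Local Notation q := (p ^ f)%N.
Local Notation lam := (lam D).
Local Notation XS := (cInd_S iota).
Local Notation e0 := (e0 D).
Implicit Types (pi : rep C (SL2 F)) (g h k : SL2 F).

(** [e0] generates, so killing tau e0 amounts to killing the image of tau. *)
Lemma supersingular_intro pi r (T : rep_hom (cInd_G iota r) (cInd_G iota r))
    (tau : rep_hom (XS r) (XS r)) (psi : rep_hom (XS r) pi) :
  hecke_like D T -> tau_like D T tau -> irreducible pi -> psi (e0 r) != 0 ->
  psi (tau (e0 r)) = 0 -> supersingular iota p f pi.
Proof.
move=> HT Htau irr n0 k0; split=> //; exists r, T, tau; split; [exact/(hecke_likeP D) | exact/(is_tauP D) | ].
have kill x : psi (tau x) = 0.
  apply: (gspan_min (P := fun x => psi (tau x) = 0) _ _ k0 (e0_gen D x)).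
    by split=> [|a y z ey ez]; rewrite ?linear0 // !linearP ey ez scaler0 addr0.
  by move=> g y ey; rewrite !rep_homJ ey linear0.
have [|psi1 psi1E] := @quot_factor _ _ _ _ (image_subrep tau) psi.
  by move=> _ /asboolP[x ->].
exists psi1; apply: (irreducible_hom_surj (x := qhom _ (e0 r)) irr).
by rewrite psi1E.
Qed.

Lemma supersingular_elim pi : supersingular iota p f pi -> exists r T
    (tau : rep_hom (XS r) (XS r)) (psi : rep_hom (XS r) pi),
  [/\ hecke_like D T, tau_like D T tau, psi (e0 r) != 0 & psi (tau (e0 r)) = 0].
Proof.
move=> [[[x x0] _] [r [T [tau [/(hecke_likeP D) HT /(is_tauP D) Htau [phi surj]]]]]].
exists r, T, tau, (comp_hom phi (qhom _)); split=> //.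
  apply: contra_neq x0 => e; have [y ey] := surj x; rewrite -ey.
  have [z ez] := qhom_surj y; rewrite -ez.
  apply: (gspan_min (P := fun z => phi (qhom (image_subrep tau) z) = 0) _ _ e (e0_gen D z)).
    by split=> [|a s t es et]; rewrite ?linear0 // !linearP es et scaler0 addr0.
  by move=> g s es; rewrite !rep_homJ es linear0.
have -> : (comp_hom phi (qhom (image_subrep tau))) (tau (e0 r)) = phi (qhom (image_subrep tau) (tau (e0 r))) by [].
have /qhom_eq0 -> : tau (e0 r) \in image_subrep tau by apply/asboolP; exists (e0 r).
by rewrite linear0.
Qed.

Lemma At_e0_neq0 r : At D (XS r) (e0 r) != 0.
Proof.
have [ct ctE] := ct_ex iota r; apply/eqP => e.
have [H1 H2 H3 H4] : [/\ forall g x h, ct h (rep_act (XS r) g x) = ct (h * g)%g x,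
    forall y, sigma_S iota r 1%g y = y, forall g, inK g -> ct g (e0 r) = sigma_S iota r g (xr C r) &
    forall g, ~~ inK g -> ct g (e0 r) = 0].
  split; [by move=> g x h; rewrite !ctE cv_act | exact: sigma_S1 | | ].
    by move=> g gK; rewrite ctE e0_in.
  by move=> g gK; rewrite ctE e0_out.
have e' : iter 1 (At D (XS r)) (e0 r) = 0 := e.
have := iter_At_value D H1 H2 H3 H4 1 (-1); rewrite e' linear0 => /esym/eqP.
exact/negP/xr_neq0.
Qed.

(** An injective map would make the compact induction irreducible, and the nonzero tau would then be
    surjective, against [tau_neq_e0]. *)
Lemma hom_not_injective pi r (phi : rep_hom (XS r) pi) : irreducible pi -> total r <> 0%N ->
  phi (e0 r) != 0 -> exists2 x, x != 0 & phi x = 0.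
Proof.
move=> irr E0 n0; apply: contrapT => H.
have inj : injective phi.
  move=> x y exy; apply/eqP; rewrite -subr_eq0; apply/negPn/negP => d0; apply: H.
  by exists (x - y); rewrite // linearB exy subrr.
have irrX := irreducible_iso (rep_iso_sym (bij_iso inj (irreducible_hom_surj irr n0))) irr.
have [T HT] := hecke_like_ex D r; have [tau Htau] := tau_ex HT.
have t0 : tau (e0 r) != 0.
  have E0' : total r != 0%N by apply/eqP.
  rewrite (tau_e0 HT Htau) expr0n (negPf E0') scale0r addr0; exact: At_e0_neq0.
have [x ex] := irreducibleP irrX (image_subsp tau) (fun g y => @image_inv _ _ _ _ tau g y)
  (ex_intro _ _ erefl) t0 (e0 r).
exact: (tau_neq_e0 HT Htau ex).
Qed.

Lemma csum_rho E : E != 0%N -> csum D (fun a => rho (- a) ^+ E) = \sum_(i < q) rho (lam i) ^+ E.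
Proof.
move=> E0; rewrite [RHS](bigD1 (lam_zero D)) //= lam0 (rho0 iota) expr0n (negPf E0) add0r.
pose Q x : C^o := rho x ^+ E.
apply: (@big_lam_reindex0 _ _ _ _ _ D _ _ _ (fun x => - x) Q).
- by move=> x; exact: unitON.
- by move=> x y _ _; have -> : - x - - y = y - x; [ring | rewrite vgeBC].
by move=> x y ux uy xy; rewrite /Q (rho_congr D _ _ xy) ?unitO_vge.
Qed.

Section WeightCase.
Variables (pi : rep C (SL2 F)) (irr : irreducible pi).
Variables (r : 'I_f -> 'I_p) (phi : rep_hom (XS r) pi).
Hypotheses (E0 : total r <> 0%N) (n0 : phi (e0 r) != 0).
Local Notation E := (total r).
Local Notation v := (phi (e0 r)).
Local Notation A := (At D pi).
Local Notation kappa := (\sum_(i < q) rho (lam i) ^+ E).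

Local Notation M := (@I1chi F C pi (fun a => rho a ^+ E)).
Let sM : subsp M := I1chi_subsp pi _.

Lemma weight_vector : M v.
Proof. exact: hom_I1chi (e0_I1chi D r). Qed.

Lemma weight_S0 : S0 D pi v = kappa *: v.
Proof. by rewrite -hom_S0 S0_e0 linearZ_LR. Qed.

Lemma S1S1_weight x : M x -> S1 D pi (S1 D pi x) = kappa *: S1 D pi x.
Proof.
move=> Mx; rewrite (S1S1 D Mx) -csum_rho; last exact/eqP.
congr (_ *: _); rewrite -[RHS]csum_inv.
  by apply: eq_bigr => i _; rewrite invrN.
by move=> a b ua ub ab; rewrite (rho_congr D (x := - a) (y := - b)) ?unitO_vge ?unitON // -opprD vgeN // vgeBC.
Qed.

Lemma S0S0_weight x : M x -> S0 D pi (S0 D pi (S1 D pi x)) = kappa *: S0 D pi (S1 D pi x).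
Proof.
move=> Mx; have [I1 c1] := S1_I1chi D Mx; rewrite (S0S0 D I1 c1) -csum_rho; last exact/eqP.
congr (_ *: _); rewrite -[RHS]csum_inv.
  by apply: eq_bigr => i _; rewrite invrN.
by move=> a b ua ub ab; rewrite (rho_congr D (x := - a) (y := - b)) ?unitO_vge ?unitON // -opprD vgeN // vgeBC.
Qed.

Lemma peval_weight P : M (peval A P v) /\ S0 D pi (peval A P v) = kappa *: peval A P v.
Proof.
have sG : subsp (fun x => M x /\ S0 D pi x = kappa *: x).
  split; first by split; [exact: sM.1 | rewrite linear0 scaler0].
  move=> a x y [Mx ex] [My ey]; split; first exact: sM.2.
  by rewrite linearP ex ey scalerDr !scalerA mulrC.
apply: (Good_peval sG) (conj weight_vector weight_S0) => x [Mx ex]; split; first exact: At_I1chi.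
exact: S0S0_weight.
Qed.

(** S0 acts by kappa on every P(A) v, so applying it to P(A) v + S1 Q(A) v = 0 gives the polynomial
    kappa P + X Q. The rest treats the case where this polynomial is zero. *)
Lemma annihilating_poly : exists2 R : {poly C}, R != 0 & peval A R v = 0.
Proof.
have [x x0 ex] := hom_not_injective irr E0 n0.
have [P [Q [PQ rel]]] := kernel_relation D x0 ex.
have [MP SP] := peval_weight P; have [MQ SQ] := peval_weight Q.
have rel0 : kappa *: peval A P v + A (peval A Q v) = 0.
  by rewrite -SP -[A _]/(S0 D pi (S1 D pi _)) -linearD rel linear0.
have rel1 : peval A (kappa *: P + Q * 'X) v = 0 by rewrite pevalP pevalMX peval_comm.
have [R1|R1] := eqVneq (kappa *: P + Q * 'X) 0; last by exists (kappa *: P + Q * 'X).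
have [Q0|Q0] := eqVneq Q 0.
  exists P; first by move: PQ; rewrite Q0 eqxx andbT.
  by move: rel; rewrite Q0 peval0 linear0 addr0.
have k0 : kappa != 0.
  apply: contraNneq Q0 => k0; move: R1; rewrite k0 scale0r add0r => /eqP.
  by rewrite mulf_eq0 polyX_eq0 orbF.
have k1 : kappa = -1.
  by move: k0; rewrite (sum_rho_pow D); case: ifP => // _; rewrite eqxx.
have PE : P = Q * 'X.
  by move/eqP: R1; rewrite k1 scaleN1r addrC subr_eq0 => /eqP.
(* Here kappa = -1 and P = X Q. Applying S0 S1 to the relation, with S1 S1 = - S1, gives A (A - 1)
   Q(A) v = 0. *)
exists (Q * ('X - 1%:P) * 'X); first by rewrite !mulf_neq0 ?polyX_eq0 ?polyXsubC_eq0.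
have := congr1 (fun y => S0 D pi (S1 D pi y)) rel.
rewrite linearD (S1S1_weight MQ) k1 scaleN1r PE pevalMX !linearD !linear0 !linearN.
rewrite pevalMX pevalMXsubC scale1r pevallB => <-.
by rewrite !peval_comm.
Qed.

Lemma classify_weight :
  [\/ principal_series pi, rep_iso pi (special_series F C) | supersingular iota p f pi].
Proof.
have [R R0 eR] := annihilating_poly; have [s eRs] := closed_field_poly_normal R.
have eR' : peval A (\prod_(z <- s) ('X - z%:P)) v = 0.
  move: eR; rewrite eRs pevalZ => /eqP; rewrite scaler_eq0 lead_coef_eq0 (negPf R0) /=.
  by move/eqP.
have [[c [y [c0 My y0 ey]]]|[n en]] := eigenvector_or_nilpotent sM
    (fun x Mx => At_I1chi D Mx) weight_vector eR'.
  by have [|] := eigen_classify irr y0 c0 My ey; [exact: Or31 | exact: Or32].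
apply: Or33; have [m em mmin] := ex_minnP (ex_intro (fun n => iter n A v == 0) n (introT eqP en)).
have [k ek] : exists k : nat, m = k.+1 by case: m em {mmin} => [|k _]; [rewrite (negPf n0) | exists k].
have [T HT] := hecke_like_ex D r; have [tau Htau] := tau_ex HT.
have tau0 : tau (e0 r) = At D (XS r) (e0 r).
  have E0' : total r != 0%N by apply/eqP.
  by rewrite (tau_e0 HT Htau) expr0n (negPf E0') scale0r addr0.
(* Composing [phi] with tau k times moves the image of [e0] to the last nonzero A^k v. *)
have [psi psiE] : exists psi : rep_hom (XS r) pi, psi (e0 r) = iter k A v.
  elim: k {ek} => [|k [psi psiE]]; first by exists phi.
  by exists (comp_hom psi tau); rewrite /= tau0 hom_At psiE.
apply: (supersingular_intro HT Htau irr (psi := psi)).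
  by rewrite psiE; apply/negP => /mmin; rewrite ek ltnn.
by rewrite tau0 hom_At psiE -iterS -ek; exact/eqP.
Qed.

End WeightCase.

Lemma weight_total t : (t < q)%N -> exists r : 'I_f -> 'I_p, total r = t.
Proof. exact: digit_sum_ex. Qed.

Section KFixed.
Variables (pi : rep C (SL2 F)).
Implicit Types (v z : pi).

Lemma K_fixed_I1chi v : (forall k, inK k -> rep_act pi k v = v) -> I1chi (fun=> 1) v.
Proof.
move=> vK; split=> [g gI|a ua]; first by apply: vK; exact: I1_inK.
by rewrite scale1r vK //; exact: inK_h.
Qed.

Lemma K_fixed_S0 v : (forall k, inK k -> rep_act pi k v = v) -> S0 D pi v = 0.
Proof.
move=> vK; rewrite S0E -[RHS](sum_lam_const D v); apply: eq_bigr => i _; apply: vK.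
by apply: inKM; [exact/inK_u/(lam_int D) | exact: inK_w].
Qed.

Lemma frobenius_K_fixed v : (forall k, inK k -> rep_act pi k v = v) ->
  exists r (phi : rep_hom (XS r) pi), total r = 0%N /\ phi (e0 r) = v.
Proof.
move=> vK; have [r rE] : exists r : 'I_f -> 'I_p, total r = 0%N.
  by apply: weight_total; rewrite ltnW // (q_gt1 D).
have [|phi phiP] := @frobenius_xr _ _ _ _ _ D r pi v; last by exists r, phi.
move=> s sK es; have cs : \sum_(c <- s) c.1 = 0.
  have : (\sum_(c <- s) c.1) *: xr C r = 0.
    rewrite -[RHS]es scaler_suml big_seq [RHS]big_seq; apply: eq_bigr => c cs.
    by rewrite (xr_K0 D rE) //; move/allP: sK => /(_ c cs).
  by move=> /eqP; rewrite scaler_eq0 (negPf (xr_neq0 C r)) orbF => /eqP.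
transitivity ((\sum_(c <- s) c.1) *: v); last by rewrite cs scale0r.
rewrite scaler_suml big_seq [RHS]big_seq; apply: eq_bigr => c cs'.
by rewrite vK //; move/allP: sK => /(_ c cs').
Qed.

(* [None] is the point at infinity of the projective line over the residue field. *)
Definition line_vec z (P : option 'I_q) : pi :=
  if P is Some i then rep_act pi (u (lam i) * w)%g z else z.

(** The pair at which a form is evaluated to test a point: the (q-1)-st power in [line_point] is 0
    at that point and 1 at all others. *)
Definition line_form (P : option 'I_q) : C * C := if P is Some i then (1, - rho (lam i)) else (0, 1).

Lemma line_point z k : I1chi (fun=> 1) z -> inK k -> exists P, rep_act pi k z = line_vec z P /\
  forall Q, (rho (ea k) * (line_form Q).1 + rho (ec k) * (line_form Q).2) ^+ q.-1 = (P != Q)%:R.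
Proof.
move=> Iz kK; have /and4P[ka kb kc kd] := kK.
have q1 : (0 < q.-1)%N by rewrite -subn1 subn_gt0 (q_gt1 D).
have [uc|c1] := unitO_or kc; last first.
  have Iz' : I1chi (fun a => rho a ^+ 0) z by apply: I1chi_ext Iz => a _; rewrite expr0.
  have ua : unitO (ea k).
    rewrite unitOE ka; apply/negP => a1; have := ead_bc k => e.
    have : vge 1 (1 : F) by rewrite -e; apply: vgeB; [exact: vgeMr | exact: vgeMl].
    by rewrite vgeE ?oner_eq0 // valuation1.
  exists None; split; first by rewrite (Iwahori_V0 Iz') // expr0 scale1r.
  move=> Q; rewrite (rho_small D c1) mul0r addr0; case: Q => [j|] /=.
    by rewrite mulr1 (rho_unit_order D ua).
  by rewrite mulr0 expr0n gtn_eqF.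
have c0 := unitO_neq0 uc; have cV := unitO_vgeV uc.
have ac0 : vge 0 (ea k / ec k) by exact: vgeMl.
have [i ai] := lam_cov D ac0; exists (Some i); split.
  rewrite {1}(bruhat_uwu c0) rep_actM Iz.1; last by apply/I1_u/vgeMl.
  have uh : unitO (- (ec k)^-1) by exact/unitON/unitOV.
  have h0 := unitO_neq0 uh; rewrite -[(_ * w)%g]mulgA h_w // mulgA rep_actM Iz.2 ?unitOV // scale1r.
  have -> : (u (ea k / ec k) * w = u (lam i) * w * l (- (ea k / ec k - lam i)))%g.
    by rewrite -mulgA w_l mulgA -uD opprK addrC subrK.
  by rewrite rep_actM [rep_act pi (l _) z]Iz.1 //; apply/I1_l/vgeN.
have ra : rho (ea k) = rho (ec k) * rho (lam i).
  rewrite -(rho_congr D ac0 (lam_int D i) ai) -(rhoM iota) //.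
  by congr rho; fld.
move=> [j|] /=; last by rewrite mulr0 mulr1 add0r (rho_unit_order D uc).
rewrite mulr1 ra mulrN -mulrBr; have [->|ij] := eqVneq i j.
  by rewrite subrr mulr0 expr0n gtn_eqF //= eqxx.
have -> : rho (lam i) - rho (lam j) = rho (lam i - lam j).
  by rewrite (rhoD iota) ?vgeN ?(lam_int D) // (rhoN iota) // (lam_int D).
rewrite exprMn (rho_unit_order D uc) mul1r (rho_unit_order D).
  by rewrite (_ : (Some i != Some j) = true) //; apply: contra ij => /eqP [->].
rewrite unitOE; apply/andP; split; first by apply: vgeB; exact: (lam_int D).
by apply: contra ij => /lam_inj ->.
Qed.

(** Evaluated at the pair of Q, a relation between translates of [xr] says that the coefficients at
    Q add up to the total sum S. All points thus carry the same sum, and the sum of the translates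
    of [z] over the projective line is z + S0 z = 0. *)
Lemma frobenius_steinberg z : I1chi (fun=> 1) z -> S0 D pi z = - z ->
  exists r (phi : rep_hom (XS r) pi), total r = q.-1 /\ phi (e0 r) = z.
Proof.
move=> Iz Sz; have [r rE] : exists r : 'I_f -> 'I_p, total r = q.-1.
  by apply: weight_total; rewrite ltn_predL ltnW // (q_gt1 D).
have [|phi phiP] := @frobenius_xr _ _ _ _ _ D r pi z; last by exists r, phi.
have point k : exists P, inK k -> rep_act pi k z = line_vec z P /\
    forall Q, (rho (ea k) * (line_form Q).1 + rho (ec k) * (line_form Q).2) ^+ q.-1 = (P != Q)%:R.
  have [kK|nK] := boolP (inK k); last by exists None => kK; case/negP: nK.
  by have [P PP] := line_point Iz kK; exists P.
have [pt ptP] := choice point; move=> s sK es.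
pose S : C := \sum_(c <- s) c.1.
have SQ Q : \sum_(c <- s) (if pt c.2 == Q then c.1 else 0) = S.
  apply/eqP; rewrite eq_sym -subr_eq0 -sumrB; apply/eqP.
  transitivity (ev (line_form Q).1 (line_form Q).2 (\sum_(c <- s) c.1 *: sigma_S iota r c.2 (xr C r)) : C);
    last by rewrite es linear0.
  rewrite (linear_sum_scale (L := ev (line_form Q).1 (line_form Q).2) (a := fun g => sigma_S iota r g (xr C r))
    (b := fun g => ((pt g != Q)%:R : C^o)) _ sK).
    by apply: eq_bigr => c _; case: eqP => _; rewrite /= ?subrr ?subr0 ?scaler0 ?[_ *: 1]mulr1.
  move=> g gK; apply: etrans (ev_sigma_S D _ _ _ gK) _.
  by rewrite ev_xr rE (ptP g gK).2.
transitivity (\sum_(c <- s) \sum_Q (if pt c.2 == Q then c.1 else 0) *: line_vec z Q).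
  rewrite big_seq [RHS]big_seq; apply: eq_bigr => c cs.
  have cK : inK c.2 by move/allP: sK => /(_ c cs).
  rewrite (bigD1 (pt c.2)) //= eqxx big1 ?addr0 => [|Q nQ]; first by rewrite (ptP _ cK).1.
  by rewrite eq_sym (negPf nQ) scale0r.
rewrite exchange_big /=; under eq_bigr => Q _ do rewrite -scaler_suml SQ.
by rewrite -scaler_sumr sum_option /= -S0E Sz subrr scaler0.
Qed.

(** If S1 v = 0 the whole group fixes [v]. If S0 S1 v = 0 then S1 v is fixed by K and killed by A +
    1 + S1, because S1 S1 = - S1. Otherwise z = S0 S1 v satisfies S0 z = - z and receives a map from
    the weight of total q-1. *)
Lemma classify_K_fixed v : irreducible pi -> v != 0 -> (forall k, inK k -> rep_act pi k v = v) ->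
  in_family iota p f TrivialFamily pi \/
  [\/ principal_series pi, rep_iso pi (special_series F C) | supersingular iota p f pi].
Proof.
move=> irr v0 vK; have Iv := K_fixed_I1chi vK; have S0v := K_fixed_S0 vK.
have [S1v|S1v] := eqVneq (S1 D pi v) 0.
  by left; apply: (trivial_of_fixed irr v0); exact: (G_fixed (D := D) Iv S0v S1v).
right; have Ix : I1chi (fun=> 1) (S1 D pi v) := S1_I1chi D Iv.
have csum1 : csum D (fun=> 1) = -1 :> C.
  rewrite /csum sumr_const (@eq_card _ _ (predC1 (lam_zero D))) // cardC1 card_ord.
  by apply/eqP; rewrite -addr_eq0 natr1 prednK ?(q_eq0 D) // ltnW // (q_gt1 D).
have [Av|Av] := eqVneq (S0 D pi (S1 D pi v)) 0.
  have xK := K_fixed Ix Av; have [r [phi [r0 ephi]]] := frobenius_K_fixed xK.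
  have [T HT] := hecke_like_ex D r; have [tau Htau] := tau_ex HT.
  apply: Or33; apply: (supersingular_intro HT Htau irr (psi := phi)); first by rewrite ephi.
  rewrite (tau_e0 HT Htau) r0 expr0 scale1r !linearD hom_At hom_S1 ephi.
  have -> : S1 D pi (S1 D pi v) = - S1 D pi v by rewrite (S1S1 D Iv) csum1 scaleN1r.
  by rewrite addrN addr0 -[At D pi _]/(S0 D pi (S1 D pi _)) (S1S1 D Iv) csum1 scaleN1r linearN Av oppr0.
have Iz : I1chi (fun=> 1) (S0 D pi (S1 D pi v)) := S0_I1chi D Ix.
have Sz : S0 D pi (S0 D pi (S1 D pi v)) = - S0 D pi (S1 D pi v).
  by rewrite (S0S0 D Ix.1 Ix.2) csum1 scaleN1r.
have [r [phi [rE ephi]]] := frobenius_steinberg Iz Sz.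
apply: (classify_weight irr (phi := phi)); last by rewrite ephi.
by apply/eqP; rewrite rE -lt0n -subn1 subn_gt0 (q_gt1 D).
Qed.

End KFixed.

Lemma classification pi : smooth pi -> irreducible pi -> exists c, in_family iota p f c pi.
Proof.
move=> sm irr; have [[r0 [phi [E0 n0]]]|[v v0 vK]] := weight_hom_or_K_fixed D sm irr.1.
  have [H|H|H] := classify_weight irr E0 n0.
  - by exists PrincipalFamily.
  - by exists SpecialFamily.
  - by exists SupersingularFamily.
have [H|[H|H|H]] := classify_K_fixed irr v0 vK.
- by exists TrivialFamily.
- by exists PrincipalFamily.
- by exists SpecialFamily.
- by exists SupersingularFamily.
Qed.

End Classification.

(** * The four families *)

Section CentralCharacter.
Variables (F : completeValuedFieldType) (C : closedFieldType) (pi : rep C (SL2 F)).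

Lemma centre_pm1 (s : SL2 F) : centre s -> s = 1%g \/ s = hh (-1 : F).
Proof.
move=> /centre_SL2[b0 c0 ad /eqP]; have N1 : (-1 : F) != 0 by rewrite oppr_eq0 oner_eq0.
rewrite sqrf_eq1 => /orP[] /eqP a1; [left | right]; apply: sl2P; rewrite ?hE // ?b0 ?c0 -?ad ?a1 ?eM //.
by rewrite invrN invr1.
Qed.

(** The nontrivial central element is an involution s. If some s x differs from x, then s x - x is a
    nonzero vector of the (-1)-eigenspace, which is stable because s is central. *)
Lemma irreducible_centre s : irreducible pi -> centre s -> exists c, forall x : pi, rep_act pi s x = c *: x.
Proof.
move=> irr cs; have [e|es] := centre_pm1 cs.
  by exists 1 => x; rewrite e rep_act1 scale1r.
have ss x : rep_act pi s (rep_act pi s x) = x.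
  rewrite -rep_actM es -hM ?oppr_eq0 ?oner_eq0 // mulrNN mulr1 h1 rep_act1 //.
have [H|/existsNP[x xn]] := pselect (forall x, rep_act pi s x = x).
  by exists 1 => x; rewrite H scale1r.
exists (-1) => y; pose P y := rep_act pi s y = -1 *: y.
have sP : subsp P.
  split=> [|a z z' ez ez']; first by rewrite /P linear0 scaler0.
  by rewrite /P linearP ez ez' scalerDr !scalerA mulrC.
have iP g z : P z -> P (rep_act pi g z).
  by move=> ez; rewrite /P -rep_actM (cs g) rep_actM ez linearZ.
apply: (irreducibleP irr sP iP (x := rep_act pi s x - x)).
  by rewrite /P linearB ss scaleN1r opprB.
by rewrite subr_eq0; apply/eqP.
Qed.

Lemma irreducible_central_character : irreducible pi -> has_central_character pi.
Proof.
move=> irr; have [[x x0] _] := irr.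
have ex s : exists c, centre s -> forall x : pi, rep_act pi s x = c *: x.
  have [cs|ncs] := pselect (centre s); last by exists 0.
  by have [c H] := irreducible_centre irr cs; exists c.
have [chi chiP] := choice ex; exists chi; split=> [z cz|z t cz ct|z y cz]; last exact: chiP.
  apply: contraTneq x0 => e; have := rep_act_eq0 z x.
  by rewrite (chiP z cz) e scale0r eqxx => <-.
have czt : centre (z * t)%g.
  by move=> g; apply: commute_sym; apply: commuteM; apply: commute_sym; [exact: cz | exact: ct].
apply/eqP; rewrite -subr_eq0; have := chiP _ czt x; rewrite rep_actM (chiP z cz) (chiP t ct) scalerA => e.
have : (chi (z * t)%g - chi z * chi t) *: x = 0 by rewrite scalerBl -e subrr.
by move/eqP; rewrite scaler_eq0 (negPf x0) orbF.
Qed.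

End CentralCharacter.

Section Families.
Variables (p f : nat) (F : completeValuedFieldType) (C : closedFieldType).
Variables (iota : {rmorphism residue_field F -> C}) (D : resdata p f iota).
Local Notation om := (uniformizer : F).
Local Notation rho := (@rho F C iota).
Local Notation q := (p ^ f)%N.
Local Notation lam := (lam D).
Local Notation XS := (cInd_S iota).
Local Notation e0 := (e0 D).
Local Notation Tr := (trivial_rep C (SL2 F)).
Local Notation Sp := (special_series F C).
Implicit Types (pi : rep C (SL2 F)) (c : rep_family).

Lemma trivial_irreducible : irreducible Tr.
Proof.
apply: irreducible_intro; first by exists (1 : C^o); exact: oner_neq0.
move=> P sP _ x Px x0 y.
have -> : y = ((y : C) / (x : C)) *: x by rewrite [_ *: _]divfK.
exact: (subspZ sP).
Qed.

Lemma trivial_smooth : smooth Tr.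
Proof. by apply/smoothP => x; exists 1. Qed.

Lemma in_family_iso c pi pi' : rep_iso pi pi' -> in_family iota p f c pi' -> in_family iota p f c pi.
Proof.
case: c => /= [iso|iso|iso|iso]; try exact: rep_iso_trans iso.
  by move=> [eta [sm irr iso']]; exists eta; split=> //; exact: rep_iso_trans iso iso'.
move=> [irr [r [T [tau [HT Htau [phi surj]]]]]].
split; first exact: irreducible_iso (rep_iso_sym iso) irr.
have [psi [psi' psiK psi'K]] := rep_iso_sym iso.
exists r, T, tau; split=> //; exists (comp_hom psi phi) => y.
by have [x ex] := surj (psi' y); exists x; rewrite /= ex psi'K.
Qed.

Lemma in_family_smooth_irreducible c pi : in_family iota p f c pi -> smooth pi /\ irreducible pi.
Proof.
case: c => [iso|[eta [sm irr iso]]|iso|ss].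
- split; first exact: smooth_iso (rep_iso_sym iso) trivial_smooth.
  exact: irreducible_iso (rep_iso_sym iso) trivial_irreducible.
- split; first exact: smooth_iso (rep_iso_sym iso) (@Ind_smooth _ _ _ _ _ D eta).
  exact: irreducible_iso (rep_iso_sym iso) irr.
- split; first exact: smooth_iso (rep_iso_sym iso) (Sp_smooth D).
  exact: irreducible_iso (rep_iso_sym iso) (Sp_irreducible D).
have irr := ss.1; split=> //; have [r [T [tau [psi [_ _ n0 _]]]]] := supersingular_elim D ss.
exact: smooth_hom (irreducible_hom_surj irr n0) (@XS_smooth _ _ _ _ _ D r).
Qed.

(** * No representation lies in two families *)

Section Disjointness.

(** The vector is the image of [e0]; the alternative translates the vanishing of tau e0 into
    relations that can be tested on the explicit S0 and S1 of the other families. *)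
Lemma supersingular_vector pi : supersingular iota p f pi -> exists (v : pi) E,
  [/\ v != 0, I1chi (fun a => rho a ^+ E) v &
   [/\ E <> 0%N, At D pi v = 0 & S0 D pi v = (\sum_(i < q) rho (lam i) ^+ E) *: v] \/
   (forall k, inK k -> rep_act pi k v = v) /\ At D pi v + (v + S1 D pi v) = 0].
Proof.
move=> /(supersingular_elim D)[r [T [tau [psi [HT Htau n0]]]]].
rewrite (tau_e0 HT Htau) => e; exists (psi (e0 r)), (total r); split=> //.
  exact: hom_I1chi (e0_I1chi D r).
have [E0|E0] := eqVneq (total r) 0%N.
  right; split.
    by move=> k kK; rewrite -rep_homJ brS_K // (xr_K0 D).
  by move: e; rewrite E0 expr0 scale1r linearD [psi (_ + S1 _ _ _)]linearD hom_At hom_S1.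
left; split; first exact/eqP.
  by move: e; rewrite expr0n (negPf E0) scale0r addr0 hom_At.
by rewrite -hom_S0 S0_e0 linearZ_LR.
Qed.

Lemma chi_trivial_dvd (V : lmodType C) (v : V) E : v != 0 ->
  (forall a, unitO a -> rho a ^+ E *: v = v) -> (q.-1 %| E)%N.
Proof.
move=> v0 H; have [g ug gP] := exists_prim_unit D; rewrite (prim_order_dvd gP).
have : (rho g ^+ E - 1) *: v = 0 by rewrite scalerBl H // scale1r subrr.
by move=> /eqP; rewrite scaler_eq0 (negPf v0) orbF subr_eq0.
Qed.

Lemma kappa_full E : E <> 0%N -> (q.-1 %| E)%N -> \sum_(i < q) rho (lam i) ^+ E = -1.
Proof. by move=> /eqP E0 dE; rewrite (sum_rho_pow D) lt0n E0 dE. Qed.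

Lemma oneN_neq0 : (-1 : C) != 0.
Proof. by rewrite oppr_eq0 oner_eq0. Qed.

(** S0, S1 and A vanish on the trivial representation. If E <> 0, the torus acts trivially, so q-1
    divides E and S0 would act by -1; if E = 0, the relation reads v = 0. *)
Lemma trivial_not_supersingular : ~ supersingular iota p f Tr.
Proof.
move=> /supersingular_vector[v [E [v0 Iv H]]].
have vK k : inK k -> rep_act Tr k v = v by [].
have S0v := K_fixed_S0 D vK.
have S1v : S1 D Tr v = 0 by exact: S0v.
have Av : At D Tr v = 0 by rewrite -[LHS]/(S0 D Tr (S1 D Tr v)) S1v linear0.
case: H => [[E0 _]|[_]]; last by rewrite Av S1v addr0 add0r => /eqP; exact/negP.
have dE : (q.-1 %| E)%N.
  by apply: (chi_trivial_dvd v0) => a ua; rewrite -Iv.2.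
rewrite S0v kappa_full // => /esym/eqP; rewrite scaler_eq0 (negPf v0) orbF.
exact/negP/oneN_neq0.
Qed.

Lemma special_not_supersingular : ~ supersingular iota p f Sp.
Proof.
move=> /supersingular_vector[v [E [v0 Iv H]]].
have [c ec] := Sp_I1f D Iv.1.
have S0v : S0 D Sp v = - v by rewrite ec linearZ_LR Sp_S0 scalerN.
have S1v : S1 D Sp v = - v by rewrite ec linearZ_LR Sp_S1 scalerN.
case: H => [[_ + _]|[vK _]].
  rewrite -[At D Sp v]/(S0 D Sp (S1 D Sp v)) S1v linearN S0v opprK => /eqP; exact/negP.
by move: S0v; rewrite (K_fixed_S0 D vK) => /esym/eqP; rewrite oppr_eq0; exact/negP.
Qed.

(** All relations are read in the coordinates v(1) and v(w). In the first case both coordinates are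
    forced to vanish. In the second they agree by invariance under [w], which yields eta(-1) = 1 and
    kap = -1, then eta(varpi)^-1 v(1) = 0. *)
Lemma Ind_not_supersingular eta : smooth_character eta -> ~ supersingular iota p f (Ind_B eta).
Proof.
move=> sm /supersingular_vector[v [E [v0 Iv H]]].
have ivE (e e' : Ind_B eta) g : e = e' -> iv e g = iv e' g by move=> ->.
have eN := eta_neq0 sm (x := -1); have eo := eta_neq0 sm (om_neq0 F).
have N1 : eta (-1) != 0 by apply: eN; rewrite oppr_eq0 oner_eq0.
set al := iv v 1%g; set be := iv v w; set kp := kap D eta.
have S0v := S0_Ind D sm Iv.1; have S1v := S1_Ind D sm Iv.1.
rewrite -/al -/be -/kp in S0v S1v; set c := (eta (-1) / eta om * be + kp * al) in S1v.
have Av : At D (Ind_B eta) v = (c * eta (-1)) *: fw D sm.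
  rewrite -[LHS]/(S0 D (Ind_B eta) (S1 D (Ind_B eta) v)) S1v linearZ_LR (S0_Ind D sm (f1_I1f D sm)).
  by rewrite f1_1 f1_w mulr0 addr0 mulr1 scalerA.
have v_eq0 : al = 0 -> be = 0 -> False.
  by move=> a0 b0; move: v0; rewrite (I1f_Ind D sm Iv.1) -/al -/be a0 b0 !scale0r addr0 eqxx.
case: H => [[E0 Av0 Sv]|[vK eqv]].
  have c0 : c = 0.
    have := ivE _ _ w Av0; rewrite Av Ind_scaleE Ind_zeroE fw_w mulr1 => /eqP.
    by rewrite mulf_eq0 (negPf N1) orbF => /eqP.
  have := ivE _ _ 1%g Sv; rewrite S0v !Ind_scaleE fw_1 mulr0 -/al => ka.
  have := ivE _ _ w Sv; rewrite S0v !Ind_scaleE fw_w mulr1 -/be => kb.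
  have [tr|ntr] := pselect (forall x, unitO x -> eta x = 1).
    have a0 : al = 0.
      apply: contrapT => /eqP a0; have dE : (q.-1 %| E)%N.
        apply: (@chi_trivial_dvd C^o al) => // a ua.
        have := ivE _ _ 1%g (Iv.2 a ua); rewrite Ind_scaleE -/al => e; apply: (etrans (esym e)).
        rewrite Ind_actE mul1g -[hh a]mulg1 Ind_equiv ?hE ?unitO_neq0 //.
        by rewrite tr // mul1r.
      move: ka; rewrite kappa_full // => /esym/eqP; rewrite mulf_eq0 (negPf a0) orbF.
      exact/negP/oneN_neq0.
    apply: (v_eq0 a0); move: c0; rewrite /c a0 mulr0 addr0 => /eqP.
    by rewrite !mulf_eq0 invr_eq0 (negPf N1) (negPf eo) => /eqP.
  have k0 : kp = 0.
    apply: kap_nontrivial => //; apply: contrapT => H; apply: ntr => x ux.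
    by apply: contrapT => /eqP ex; apply: H; exists x.
  have b0 : be = 0.
    move: c0; rewrite /c k0 mul0r addr0 => /eqP.
    by rewrite !mulf_eq0 invr_eq0 (negPf N1) (negPf eo) => /eqP.
  apply: (v_eq0 _ b0); move: kb; rewrite b0 !mulr0 addr0 => /eqP.
  by rewrite mulf_eq0 (negPf N1) => /eqP.
have ab : be = al by have := ivE _ _ 1%g (vK w (inK_w F)); rewrite Ind_actE mul1g.
have := ivE _ _ 1%g eqv; have := ivE _ _ w eqv.
rewrite Av S1v !Ind_addE !Ind_scaleE !Ind_zeroE fw_1 fw_w f1_1 f1_w -/al -/be ab.
rewrite !(mulr0, mulr1, addr0, add0r) => e1 e2.
have := ivE _ _ w (K_fixed_S0 D vK); rewrite S0v Ind_scaleE Ind_zeroE fw_w mulr1 ab => e3.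
have a0 : al != 0 by apply/eqP => a0; apply: v_eq0; rewrite ?ab.
have ce : c = - al by apply/eqP; rewrite -addr_eq0 addrC e2.
have eN1 : eta (-1) = 1.
  apply/eqP; rewrite -subr_eq0; have : al * (1 - eta (-1)) = 0 by rewrite mulrBr mulr1 -e1 ce; ring.
  by move=> /eqP; rewrite mulf_eq0 (negPf a0) /= -oppr_eq0 opprB.
have k1 : kp = -1.
  apply/eqP; rewrite -addr_eq0 addrC; move: e3; rewrite eN1 -mulrDl => /eqP.
  by rewrite mulf_eq0 (negPf a0) orbF.
have : (eta om)^-1 * al = 0.
  have := ce; rewrite /c ab eN1 k1 div1r mulN1r => /eqP; rewrite -subr_eq0 opprK subrK.
  by move/eqP.
by move=> /eqP; rewrite mulf_eq0 invr_eq0 (negPf eo) (negPf a0).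
Qed.

Lemma trivial_not_special : ~ rep_iso Tr Sp.
Proof.
move=> [phi [psi phiK psiK]]; have n0 := fw_nonconst D.
have vK k : inK k -> rep_act Tr k (psi (sp F C (fw D (one_smooth F C)))) = psi (sp F C (fw D (one_smooth F C))) by [].
have := hom_S0 D phi (psi (sp F C (fw D (one_smooth F C)))); rewrite (K_fixed_S0 D vK) linear0 psiK Sp_S0 => /esym/eqP.
by rewrite oppr_eq0; exact/negP.
Qed.

(* The invariants of the pro-p Iwahori subgroup in [Ind_B eta] are not a line. *)
Lemma Ind_not_iso_line eta pi (x : pi) : smooth_character eta ->
  (forall y, I1f y -> exists a : C, y = a *: x) -> ~ rep_iso (Ind_B eta) pi.
Proof.
move=> sm line [phi [psi phiK psiK]].
have [e [Ie ne]] := Ind_not_1dim D sm (psi x).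
have [|a ea] := line (phi e); first by move=> g gI; rewrite -rep_homJ Ie.
move/eqP: (ne a); apply; apply: (can_inj phiK).
by rewrite linearZ_LR ea psiK.
Qed.

Lemma principal_not_trivial eta : smooth_character eta -> ~ rep_iso (Ind_B eta) Tr.
Proof.
move=> sm; apply: (Ind_not_iso_line (x := (1 : C^o) : Tr) sm) => y _; exists y.
by rewrite [_ *: _]mulr1.
Qed.

Lemma principal_not_special eta : smooth_character eta -> ~ rep_iso (Ind_B eta) Sp.
Proof. by move=> sm; apply: (Ind_not_iso_line sm) => y; exact: (Sp_I1f D). Qed.

Lemma in_family_uniq c c' pi : in_family iota p f c pi -> in_family iota p f c' pi -> c = c'.
Proof.
have sym c1 c2 : in_family iota p f c1 pi -> in_family iota p f c2 pi ->
    match c1, c2 with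
    | TrivialFamily, PrincipalFamily | TrivialFamily, SpecialFamily | PrincipalFamily, SpecialFamily
    | TrivialFamily, SupersingularFamily | PrincipalFamily, SupersingularFamily
    | SpecialFamily, SupersingularFamily => False | _, _ => True end.
  case: c1; case: c2 => //=.
  - move=> iso [eta [sm _ iso']].
    exact: (principal_not_trivial sm (rep_iso_trans (rep_iso_sym iso') iso)).
  - by move=> iso iso'; exact: trivial_not_special (rep_iso_trans (rep_iso_sym iso) iso').
  - move=> iso ss; apply: trivial_not_supersingular.
    exact: (in_family_iso (c := SupersingularFamily) (rep_iso_sym iso) ss).
  - move=> [eta [sm _ iso']] iso.
    exact: (principal_not_special sm (rep_iso_trans (rep_iso_sym iso') iso)).
  - move=> [eta [sm _ iso']] ss; apply: (Ind_not_supersingular sm).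
    exact: (in_family_iso (c := SupersingularFamily) (rep_iso_sym iso') ss).
  move=> iso ss; apply: special_not_supersingular.
  exact: (in_family_iso (c := SupersingularFamily) (rep_iso_sym iso) ss).
by case: c; case: c' => // H H'; [have := sym _ _ H H'|have := sym _ _ H H'|have := sym _ _ H H'
  |have := sym _ _ H' H|have := sym _ _ H H'|have := sym _ _ H H'|have := sym _ _ H' H
  |have := sym _ _ H' H|have := sym _ _ H H'|have := sym _ _ H' H|have := sym _ _ H' H|have := sym _ _ H' H].
Qed.

End Disjointness.

Lemma supersingular_exists : exists pi, supersingular iota p f pi.
Proof.
have q0 : (0 < q)%N by rewrite ltnW // (q_gt1 D).
have [r _] := @weight_total p f 0 q0.
have [T HT] := hecke_like_ex D r; have [tau Htau] := tau_ex HT.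
pose good (W : set (XS r)) := [/\ subsp W, forall g x, W x -> W (rep_act (XS r) g x),
  forall x, W (tau x) & ~ W (e0 r)].
pose P := [set W : set (XS r) | W = set0 \/ good W].
have [|W [PW Wmax]] := @Zorn_bigcup _ P.
  move=> Ws WsP tot; have [[W0 [WW0 [x0 W0x0]]]|none] := pselect (exists W0, Ws W0 /\ exists x0, W0 x0); last first.
    left; rewrite -subset0 => x [W WW Wx]; apply: none.
    by exists W; split=> //; exists x.
  have goodW W x : Ws W -> W x -> good W.
    by move=> WW Wx; have [e|//] := WsP _ WW; rewrite e in Wx.
  have [sW0 _ tW0 _] := goodW _ _ WW0 W0x0.
  right; split.
  - split=> [|a x y [W1 W1W W1x] [W2 W2W W2y]]; first by exists W0 => //; exact: sW0.1.
    have [s1 _ _ _] := goodW _ _ W1W W1x; have [s2 _ _ _] := goodW _ _ W2W W2y.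
    have [sub|sub] := tot _ _ W1W W2W; [exists W2 | exists W1] => //.
      by apply: s2.2 => //; exact: sub.
    by apply: s1.2 => //; exact: sub.
  - move=> g x [W1 W1W W1x]; exists W1 => //.
    by have [_ i1 _ _] := goodW _ _ W1W W1x; exact: i1.
  - by move=> x; exists W0.
  move=> [W1 W1W W1e]; have [_ _ _ n1] := goodW _ _ W1W W1e; exact: n1.
have gim : good [set y | exists x, tau x = y].
  split=> [|g _ [x <-]|x|[x ex]].
  - exact: image_subsp.
  - exact: image_inv (ex_intro _ x erefl).
  - by exists x.
  exact: (tau_neq_e0 HT Htau ex).
have [sW iW tW nW] : good W.
  (* A maximal element is not the empty set: the image of tau is a good subspace, by
     [tau_neq_e0]. *)
  case: PW => // W0; exfalso; apply: (Wmax [set y | exists x, tau x = y]); last by right.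
  rewrite W0; split=> [|sub]; first exact: sub0set.
  by have [sg _ _ _] := gim; exact: (sub 0 sg.1).
have irr : irreducible (quot_rep (prop_subrep sW iW)).
  apply: irreducible_intro.
    exists (qhom (prop_subrep sW iW) (e0 r)); apply/eqP => /qhom_eq0/prop_subrepP; exact: nW.
  move=> Q sQ iQ y Qy y0 z.
  pose B := [set x | Q (qhom (prop_subrep sW iW) x)].
  have sB : subsp B := preimage_subsp (qhom (prop_subrep sW iW)) sQ.
  have iB g x : B x -> B (rep_act (XS r) g x) by move=> Bx; rewrite -[B _]/(Q (qhom _ (rep_act _ g x))) rep_homJ; exact: iQ.
  have WB x : W x -> B x.
    move=> Wx; rewrite /B /=; have /qhom_eq0 -> : x \in prop_subrep sW iW by exact/prop_subrepP.
    exact: sQ.1.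
  have Be : B (e0 r).
    apply: contrapT => nB; apply: (Wmax B); last by right; split=> // x; exact/WB/tW.
    split=> // sub; have [x ex] := qhom_surj y.
    move/eqP: y0; apply; rewrite -ex; apply/qhom_eq0/prop_subrepP/sub.
    by rewrite /B /= ex.
  have [x <-] := qhom_surj z; exact: (gspan_min sB iB Be (e0_gen D x)).
exists (quot_rep (prop_subrep sW iW)).
apply: (supersingular_intro HT Htau irr (psi := qhom (prop_subrep sW iW))).
  by apply/eqP => /qhom_eq0/prop_subrepP; exact: nW.
by apply/qhom_eq0/prop_subrepP; exact: tW.
Qed.

Lemma family_nonempty c : exists pi, in_family iota p f c pi.
Proof.
case: c.
- by exists Tr; exact: rep_iso_refl.
(* An algebraically closed field contains some mu other than 0 and 1; the unramified character with
   value mu^-1 at the uniformizer is then nontrivial. *)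
- have p0 : 'X * ('X - 1%:P) != 0 :> {poly C} by rewrite mulf_neq0 ?polyX_eq0 ?polyXsubC_eq0.
  have [mu] := closed_nonrootP _ p0; rewrite rootM rootX root_XsubC negb_or => /andP[mu0 mu1].
  have sm := eta_of_smooth D 0 mu0; pose eta := eta_of iota 0 mu.
  exists (Ind_B eta), eta; split=> //; last exact: rep_iso_refl.
  apply: (Ind_irreducible D sm); exists om; first exact: om_neq0.
  rewrite /eta /eta_of expr0 mul1r valuation_uniformizer expr1z.
  by apply: contra mu1; rewrite invr_eq1.
- by exists Sp; exact: rep_iso_refl.
exact: supersingular_exists.
Qed.

End Families.

Theorem mainTheorem1 (p f : nat) (F : completeValuedFieldType)
    (C : closedFieldType) (iota : {rmorphism residue_field F -> C})
    (p_prime : prime p)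
    (card_residue_field : ([set: residue_field F] #= `I_(p ^ f))%card)
    (C_closure : is_Fp_closure p C)
    (iota_inj : injective iota)
    (charF_neq2 : 2%N \notin [pchar F]) :
  [/\ forall (c : rep_family) (pi : rep C (SL2 F)), in_family iota p f c pi ->
        [/\ smooth pi, irreducible pi & has_central_character pi],
      forall c : rep_family, exists pi : rep C (SL2 F), in_family iota p f c pi
    & forall pi : rep C (SL2 F),
        [/\ smooth pi, irreducible pi & has_central_character pi] ->
        exists! c : rep_family, in_family iota p f c pi] /\
  (forall (c c' : rep_family) (pi pi' : rep C (SL2 F)), c <> c' ->
     in_family iota p f c pi -> in_family iota p f c' pi' -> ~ rep_iso pi pi').
Proof.
have [D _] := exists_resdata p_prime card_residue_field C_closure iota_inj.
split; last first.
  move=> c c' pi pi' cc' pic pic' iso; apply: cc'.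
  exact: (in_family_uniq D pic (in_family_iso iso pic')).
split; first last.
- move=> pi [sm irr _]; have [c pic] := classification D sm irr.
  by exists c; split=> // c'; exact: in_family_uniq.
- exact: family_nonempty.
move=> c pi pic; have [sm irr] := in_family_smooth_irreducible D pic.
by split=> //; exact: irreducible_central_character.
Qed.
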